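(* For a graded Lie algebra $(\widetilde{\mathfrak l},H_0)$ over $F$, $\widetilde{\mathfrak l}=V^-\oplus\mathfrak g\oplus V^+$, put $G=\{g\in\mathrm{Aut}_0(\widetilde{\mathfrak l}): g.H_0=H_0\}$. (1) Let $\widetilde{\mathfrak l}=\mathfrak{sl}_2(D)$, where $D$ is a central division algebra over $F$ of degree $\delta$ (so $\dim_F D=\delta^2$), graded by $H_0=\begin{pmatrix} 1 & 0 \\ 0 & -1 \end{pmatrix}$. Then $G$ is the group of automorphisms of $\mathfrak{sl}_2(D)$ of the form $$\begin{pmatrix} a & x \\ y & b \end{pmatrix}\longmapsto\begin{pmatrix} u & 0 \\ 0 & v \end{pmatrix}\begin{pmatrix} a & x \\ y & b \end{pmatrix}\begin{pmatrix} u^{-1} & 0 \\ 0 & v^{-1} \end{pmatrix},\qquad u,v\in D^*,$$ where $a,b,x,y\in D$, $\operatorname{tr}_{D/F}(a+b)=0$. Hence the action of $G$ on $V^+\simeq D$ is identified with the action of $D^*\times D^*$ on $D$ given by $(u,v).x=uxv^{-1}$, the group $G$ being isomorphic to $(D^*\times D^* )/\{(\lambda,\lambda):\lambda\in F^*\}$. There are two $G$-orbits in $V^+$: $\{0\}$ and $D^*$; and the fundamental relative invariant is the reduced norm $\nu_{D/F}$, which has degree $\delta$. (2) Let $\widetilde{\mathfrak l}=\mathfrak o(q,5)$, where $q$ is a non-degenerate quadratic form on $F^5$ which is the orthogonal sum of a hyperbolic plane and an anisotropic form $Q$ of dimension $3$, graded as described in the context. Then $G$ can be identified with $SO(Q)\times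 F^*$ acting on $V^+\simeq F^3$ by the natural action. The fundamental relative invariant is $Q$. There are four $G$-orbits in $V^+$: $\{0\}$ and three open orbits $\mathcal O_i=\{x\in F^3: Q(x)\in u_i\}$ $(i=1,2,3)$, where $u_1,u_2,u_3$ are the three classes in $F^*/F^{*2}$ distinct from the class of $-d(Q)$, $d(Q)$ being the discriminant of $Q$.
   Context: $F$ is a finite extension of $\mathbb Q_p$ whose residue field has characteristic $\ne2$; $\overline F$ is an algebraic closure. ''Graded'' means that $V^-,\mathfrak g,V^+$ are the eigenspaces of $\operatorname{ad}H_0$ on $\widetilde{\mathfrak l}$ for the eigenvalues $-2,0,2$ and that $\widetilde{\mathfrak l}=V^-\oplus\mathfrak g\oplus V^+$. $\mathrm{Aut}_0(\widetilde{\mathfrak l})$ is the group of automorphisms of $\widetilde{\mathfrak l}$ whose extension to $\widetilde{\mathfrak l}\otimes_F\overline F$ is elementary (a finite product of $e^{\operatorname{ad}x}$, $\operatorname{ad}x$ nilpotent). In (1): $\mathfrak{sl}_2(D)=\{\begin{pmatrix} a & x \\ y & b \end{pmatrix}: a,b,x,y\in D,\ \operatorname{tr}_{D/F}(a+b)=0\}$, $\operatorname{tr}_{D/F}$ the reduced trace; $V^+=\{\begin{pmatrix} 0 & x \\ 0 & 0 \end{pmatrix}:x\in D\}\simeq D$. In (2): writing $F^5=Fe\oplus F^3\oplus Ff$ with $Fe\oplus Ff$ the hyperbolic plane ($e,f$ isotropic) and $q|_{F^3}=Q$, the element $H_0\in\mathfrak o(q,5)$ acts on $F^5$ by $2$ on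 $Fe$, $0$ on $F^3$, $-2$ on $Ff$; then $V^+\simeq F^3$. The fundamental relative invariant is the (unique up to scalar) absolutely irreducible polynomial on $V^+$ with $P(g.X)=\chi(g)P(X)$ for some rational character $\chi$ of $G$. (These two families are the graded algebras $\widetilde{\mathfrak g}^{-\lambda_0}\oplus[\widetilde{\mathfrak g}^{-\lambda_0},\widetilde{\mathfrak g}^{\lambda_0}]\oplus\widetilde{\mathfrak g}^{\lambda_0}$, graded by $H_{\lambda_0}$, of split rank one.) *)

(* Defs.v *)
From HB Require Import structures.
From mathcomp Require Import all_boot all_order all_algebra all_field.
From mathcomp Require Import mpoly.
From mathcomp Require Import boolp classical_sets cardinality reals.

Set Implicit Arguments.
Unset Strict Implicit.
Unset Printing Implicit Defensive.

Import Order.TTheory GRing.Theory Num.Theory.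
Import passmx.
Local Open Scope ring_scope.
Local Open Scope classical_set_scope.

Record nonarch_abs (R : realType) (K : fieldType) (v : K -> R) : Prop :=
  NonarchAbs {
    nonarch_ge0 : forall x, 0 <= v x;
    nonarch_eq0 : forall x, v x = 0 <-> x = 0;
    nonarchM : forall x y, v (x * y) = v x * v y;
    nonarchD : forall x y, v (x + y) <= Num.max (v x) (v y) }.

Definition abs_complete (R : realType) (K : fieldType) (v : K -> R) : Prop :=
  forall u : nat -> K,
    (forall eps : R, 0 < eps -> exists N : nat, forall m n : nat,
       (N <= m)%N -> (N <= n)%N -> v (u m - u n) < eps) ->
    exists l : K, forall eps : R, 0 < eps -> exists N : nat, forall n : nat,
       (N <= n)%N -> v (u n - l) < eps.

(* (K, v) is the completion of the rationals for the p-adic absolute value;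
   by multiplicativity [padic_nat] fixes v on all rationals. *)
Record is_padic_numbers (R : realType) (p : nat) (K : fieldType) (v : K -> R) :
    Prop := IsPadicNumbers {
  padic_prime : prime p;
  padic_abs : nonarch_abs v;
  padic_nat : forall n : nat, (0 < n)%N -> v n%:R = p%:R ^- logn p n;
  padic_dense : forall (x : K) (eps : R), 0 < eps ->
    exists r : rat, v (x - ratr r) < eps;
  padic_complete : abs_complete v }.

(* The characteristic of the residue field {v <= 1} / {v < 1}, as a collective
   predicate in the style of [pchar _]: a prime l is 0 in the residue field iff
   v l < 1. *)
Definition residue_pchar (R : realType) (K : fieldType) (v : K -> R) : nat_pred :=
  [pred l : nat | prime l & v l%:R < 1].

Definition abs_open (R : realType) (K : fieldType) (v : K -> R) (n : nat)
    (A : set 'cV[K]_n) : Prop :=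
  forall x, A x -> exists2 eps : R, 0 < eps &
    forall y : 'cV[K]_n, (forall i, v (y i 0 - x i 0) < eps) -> A y.

HB.mixin Record Vector_isLie (F : fieldType) (L : Type) of Vector F L := {
  lie : L -> L -> L;
  lie_linearl : forall (a : F) (x x' y : L),
    lie (a *: x + x') y = a *: lie x y + lie x' y;
  lie_linearr : forall (a : F) (x y y' : L),
    lie x (a *: y + y') = a *: lie x y + lie x y';
  liexx : forall x : L, lie x x = 0;
  lie_jacobi : forall x y z : L,
    lie x (lie y z) + lie y (lie z x) + lie z (lie x y) = 0
}.

#[short(type="lieType")]
HB.structure Definition Lie (F : fieldType) :=
  { L of Vector_isLie F L & Vector F L }.

Section LieTheory.
Variables (F : fieldType) (L : lieType F).
Implicit Types x y : L.

Lemma lie0l y : lie 0 y = 0 :> L.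
Proof.
have := lie_linearl 1 0 0 y; rewrite !scale1r addr0 => e.
by rewrite -[LHS](addrK (lie 0 y)) -e subrr.
Qed.
Lemma lie0r x : lie x 0 = 0 :> L.
Proof.
have := lie_linearr 1 x 0 0; rewrite !scale1r addr0 => e.
by rewrite -[LHS](addrK (lie x 0)) -e subrr.
Qed.
Lemma lieDl x x' y : lie (x + x') y = lie x y + lie x' y.
Proof. by have := lie_linearl 1 x x' y; rewrite !scale1r. Qed.
Lemma lieDr x y y' : lie x (y + y') = lie x y + lie x y'.
Proof. by have := lie_linearr 1 x y y'; rewrite !scale1r. Qed.
Lemma lieC x y : lie x y = - lie y x.
Proof.
have := liexx (x + y); rewrite lieDl !lieDr !liexx add0r addr0.
by move/eqP; rewrite addr_eq0 => /eqP.
Qed.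

Definition ad x : 'End(L) := linfun (lie x).

Definition is_lie_aut (g : 'End(L)) : Prop :=
  bijective g /\ forall x y, g (lie x y) = lie (g x) (g y).

(* Exponential of ad x truncated at k; it is e^{ad x} when (ad x)^k = 0. *)
Definition exp_ad (k : nat) x : 'End(L) :=
  linfun (fun y : L => \sum_(i < k) (i`!%:R : F)^-1 *: iter i (lie x) y).

Inductive elementary : 'End(L) -> Prop :=
| elementary_id : elementary \1%VF
| elementary_exp k x g : (forall y, iter k (lie x) y = 0) ->
    elementary g -> elementary (exp_ad k x \o g)%VF.

End LieTheory.

Record liesub (F : fieldType) (A : falgType F) := LieSub {
  liesub_vs :> {vspace A};
  liesub_closed : forall x y, x \in liesub_vs -> y \in liesub_vs ->
    x * y - y * x \in liesub_vs }.

Section LieSub.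
Variables (F : fieldType) (A : falgType F) (U : liesub A).

Definition comm_lie (x y : subvs_of U) : subvs_of U :=
  Subvs (liesub_closed (subvsP x) (subvsP y)).

Lemma comm_lie_linearl (a : F) x x' y :
  comm_lie (a *: x + x') y = a *: comm_lie x y + comm_lie x' y.
Proof.
apply: val_inj => /=.
rewrite mulrDl mulrDr -scalerAl -scalerAr scalerBr !opprD.
by rewrite -!addrA; congr (_ + _); rewrite addrCA.
Qed.
Lemma comm_lie_linearr (a : F) x y y' :
  comm_lie x (a *: y + y') = a *: comm_lie x y + comm_lie x y'.
Proof.
apply: val_inj => /=.
rewrite mulrDl mulrDr -scalerAl -scalerAr scalerBr !opprD.
by rewrite -!addrA; congr (_ + _); rewrite addrCA.
Qed.
Lemma comm_liexx x : comm_lie x x = 0.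
Proof. by apply: val_inj; rewrite /= subrr. Qed.
Lemma comm_lie_jacobi x y z :
  comm_lie x (comm_lie y z) + comm_lie y (comm_lie z x)
    + comm_lie z (comm_lie x y) = 0.
Proof.
apply: val_inj => /=.
move: (vsval x) (vsval y) (vsval z) => {}x {}y {}z.
rewrite !mulrBr !mulrBl !mulrA !opprB.
set a := x * y * z; set b := x * z * y; set c := y * z * x.
set d := z * y * x; set e := y * x * z; set g := z * x * y.
rewrite (AC (((2*2)*(2*2))*(2*2))
  ((((1*12)*(2*7))*((3*10)*(4*5)))*((6*11)*(8*9)))) /=.
by rewrite !(subrr, addNr) !addr0.
Qed.
HB.instance Definition _ :=
  Vector_isLie.Build F (subvs_of U) comm_lie_linearl comm_lie_linearr
    comm_liexx comm_lie_jacobi.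
End LieSub.

(* L (x)_F K, in coordinates with respect to the basis (e_i (x) 1), where
   (e_i) = vbasis {:L}.  The bracket depends on iota, hence the argument. *)
Definition lie_ext (F K : fieldType) (iota : {rmorphism F -> K})
  (L : lieType F) : Type := 'rV[K]_(\dim {:L}).

Section ScalarExtension.
Variables (F K : fieldType) (iota : {rmorphism F -> K}) (L : lieType F).
Let n := \dim {:L}.
Let e : n.-tuple L := vbasis {:L}.

Local Notation lie_ext := (lie_ext iota L).
HB.instance Definition _ := Vector.copy lie_ext 'rV[K]_n.

Definition to_ext (x : L) : lie_ext := map_mx iota (rVof e x).

Definition ext_bracket (u v : lie_ext) : lie_ext :=
  \sum_(i < n) \sum_(j < n) (u 0 i * v 0 j) *: to_ext (lie e`_i e`_j).

Lemma ext_linearl (a : K) (u u' v : lie_ext) :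
  ext_bracket (a *: u + u') v = a *: ext_bracket u v + ext_bracket u' v.
Proof.
rewrite /ext_bracket scaler_sumr -big_split; apply: eq_bigr => i _ /=.
rewrite scaler_sumr -big_split; apply: eq_bigr => j _ /=.
by rewrite !mxE mulrDl scalerDl scalerA mulrA.
Qed.
Lemma ext_linearr (a : K) (u v v' : lie_ext) :
  ext_bracket u (a *: v + v') = a *: ext_bracket u v + ext_bracket u v'.
Proof.
rewrite /ext_bracket scaler_sumr -big_split; apply: eq_bigr => i _ /=.
rewrite scaler_sumr -big_split; apply: eq_bigr => j _ /=.
by rewrite !mxE mulrDr scalerDl scalerA mulrCA.
Qed.

Lemma to_extD x y : to_ext (x + y) = to_ext x + to_ext y.
Proof. by rewrite /to_ext linearD /= map_mxD. Qed.
Lemma to_extZ a x : to_ext (a *: x) = iota a *: to_ext x.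
Proof. by rewrite /to_ext linearZ /= map_mxZ. Qed.
Lemma to_ext0 : to_ext 0 = 0.
Proof. by rewrite /to_ext linear0 map_mx0. Qed.
Lemma to_ext_sum (I : Type) (r : seq I) (P : pred I) (f : I -> L) :
  to_ext (\sum_(i <- r | P i) f i) = \sum_(i <- r | P i) to_ext (f i).
Proof. exact: (big_morph _ to_extD to_ext0). Qed.

Lemma ext_bracket_to_ext x y :
  ext_bracket (to_ext x) (to_ext y) = to_ext (lie x y).
Proof.
have ex z : z = \sum_(i < n) rVof e z 0 i *: e`_i.
  by rewrite -[LHS](rVofK (vbasisP _)).
have suml (f : 'I_n -> L) z : lie (\sum_i f i) z = \sum_i lie (f i) z.
  by apply: (big_morph (lie^~ z) (fun a b => lieDl a b z) (lie0l z)).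
have sumr (f : 'I_n -> L) z : lie z (\sum_i f i) = \sum_i lie z (f i).
  by apply: (big_morph (lie z) (lieDr z) (lie0r z)).
have Zl (a : F) u v : lie (a *: u) v = a *: lie u v :> L.
  by rewrite -[a *: u]addr0 lie_linearl lie0l addr0.
have Zr (a : F) u v : lie u (a *: v) = a *: lie u v :> L.
  by rewrite -[a *: v]addr0 lie_linearr lie0r addr0.
rewrite [in RHS](ex x) suml to_ext_sum; apply: eq_bigr => i _.
rewrite [in RHS](ex y) sumr to_ext_sum; apply: eq_bigr => j _.
by rewrite Zl Zr !to_extZ scalerA /to_ext !mxE.
Qed.

Lemma ext_bracketxx u : ext_bracket u u = 0.
Proof.
rewrite /ext_bracket pair_big /= (bigID (fun ij : 'I_n * 'I_n => (ij.1 < ij.2)%N)) /=.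
rewrite [X in _ + X](bigID (fun ij : 'I_n * 'I_n => ij.1 == ij.2)) /= [X in _ + (X + _)]big1;
  last by move=> [i j] /= /andP[_ /eqP ->]; rewrite liexx to_ext0 scaler0.
pose swp (ij : 'I_n * 'I_n) := (ij.2, ij.1).
have swpK : involutive swp by case.
rewrite add0r [X in _ + X](reindex_inj (inv_inj swpK)) /=.
apply/eqP; rewrite addr_eq0 -sumrN; apply/eqP.
apply: eq_big => [[i j] | [i j] _] /=; first by rewrite -leqNgt ltn_neqAle andbC eq_sym.
rewrite lieC -scaleN1r to_extZ rmorphN1 scaleN1r mulrC.
by rewrite scalerN.
Qed.

Lemma ext_ind (P : lie_ext -> Prop) :
  P 0 -> (forall a u v, P u -> P v -> P (a *: u + v)) ->
  (forall x, P (to_ext x)) -> forall u, P u.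
Proof.
move=> P0 PD Pe u; rewrite [u]row_sum_delta.
elim/big_ind: _ => // [v w Pv Pw | i _]; first by rewrite -[v]scale1r; apply: PD.
rewrite -[_ *: _]addr0; apply: PD => //.
suff -> : delta_mx 0 i = to_ext e`_i by [].
by rewrite /to_ext rVofE ?vbasisP // map_delta_mx.
Qed.

Lemma ext_jacobi u v w :
  ext_bracket u (ext_bracket v w) + ext_bracket v (ext_bracket w u)
    + ext_bracket w (ext_bracket u v) = 0.
Proof.
have z0l y : ext_bracket 0 y = 0.
  by apply: big1 => i _; apply: big1 => j _; rewrite mxE mul0r scale0r.
have z0r y : ext_bracket y 0 = 0.
  by apply: big1 => i _; apply: big1 => j _; rewrite mxE mulr0 scale0r.
have comb (a : K) (x1 x2 y1 y2 z1 z2 : lie_ext) :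
    x1 + y1 + z1 = 0 -> x2 + y2 + z2 = 0 ->
    (a *: x1 + x2) + (a *: y1 + y2) + (a *: z1 + z2) = 0.
  move=> e1 e2; rewrite (addrACA (a *: x1)) (addrACA (_ + a *: y1)).
  rewrite -!scalerDr e1 e2.
  by rewrite scaler0 addr0.
elim/ext_ind: u => [|a u u' IHu IHu'|x].
- by rewrite !(z0l, z0r) !addr0.
- by rewrite !(ext_linearl, ext_linearr); apply: comb.
elim/ext_ind: v => [|a v v' IHv IHv'|y].
- by rewrite !(z0l, z0r) !addr0.
- by rewrite !(ext_linearl, ext_linearr); apply: comb.
elim/ext_ind: w => [|a w w' IHw IHw'|z].
- by rewrite !(z0l, z0r) !addr0.
- by rewrite !(ext_linearl, ext_linearr); apply: comb.
by rewrite !ext_bracket_to_ext -!to_extD lie_jacobi to_ext0.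
Qed.

HB.instance Definition _ := Vector_isLie.Build K lie_ext ext_linearl ext_linearr
  ext_bracketxx ext_jacobi.

Definition lfun_ext (g : 'End(L)) : 'End(lie_ext) :=
  linfun (fun u : lie_ext =>
    (u : 'rV[K]_n) *m map_mx iota (mxof e e g) : lie_ext).

End ScalarExtension.

Section GradedLie.
Variables (F : fieldType) (K : fieldType) (iota : {rmorphism F -> K}).
Variables (L : lieType F) (H0 : L).

Definition grade (a : F) : {vspace L} := leigenspace (ad H0) a.

Definition graded : Prop :=
  directv (grade (- 2%:R) + grade 0 + grade 2%:R) /\
  (grade (- 2%:R) + grade 0 + grade 2%:R)%VS = fullv.

Definition Aut0 : set 'End(L) :=
  [set g | is_lie_aut g /\ elementary (lfun_ext iota g)].

Definition grG : set 'End(L) := [set g | Aut0 g /\ g H0 = H0].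

Definition lie_orbit (G : set 'End(L)) (X : L) : set L :=
  [set g X | g in G].

Definition lie_orbits (G : set 'End(L)) (V : {vspace L}) : set (set L) :=
  [set lie_orbit G X | X in [set X | X \in V]].

(* chi is a regular function of g: a polynomial in the matrix entries of g
   divided by a power of det g. *)
Definition rational_character (G : set 'End(L)) (chi : 'End(L) -> F) : Prop :=
  let mx (g : 'End(L)) := mxof (vbasis {:L}) (vbasis {:L}) g in
  [/\ forall g, G g -> chi g != 0,
      forall g h, G g -> G h -> chi (g \o h)%VF = chi g * chi h &
      exists (p : {mpoly F[\dim {:L} * \dim {:L}]}) (k : nat),
        forall g, G g -> chi g = p.@[fun i => mxvec (mx g) 0 i] / \det (mx g) ^+ k].

(* A polynomial on V is an {mpoly F[\dim V]} in the coordinates of vbasis V. *)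
Definition vpeval (V : {vspace L}) (P : {mpoly F[\dim V]}) (X : L) : F :=
  P.@[fun i => coord (vbasis V) i X].

Definition relative_invariant (G : set 'End(L)) (V : {vspace L})
    (P : {mpoly F[\dim V]}) : Prop :=
  exists2 chi, rational_character G chi &
    forall g X, G g -> X \in V -> vpeval P (g X) = chi g * vpeval P X.

Definition irreducible_elt (A : idomainType) (a : A) : Prop :=
  [/\ a != 0, a \isn't a GRing.unit &
      forall b c, a = b * c -> (b \is a GRing.unit) \/ (c \is a GRing.unit)].

(* With K an algebraic closure of F. *)
Definition abs_irreducible_invariant (P : {mpoly F[\dim (grade 2%:R)]}) : Prop :=
  irreducible_elt (map_mpoly iota P) /\ relative_invariant grG P.

Definition fundamental_invariant (P : {mpoly F[\dim (grade 2%:R)]}) : Prop :=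
  abs_irreducible_invariant P /\
  forall P', abs_irreducible_invariant P' -> exists2 c : F, c != 0 & P' = c *: P.

End GradedLie.

Section SubspaceOf.
Variables (F : fieldType) (V : vectType F) (P : {pred V}).

Lemma ex_vspace_of : submod_closed P -> exists U : {vspace V}, U =i P.
Proof.
move=> [P0 PD].
pose ok n := `[< exists U : {vspace V}, \dim U = n /\ {subset U <= P} >].
have ok0 : exists n, ok n.
  exists 0%N; apply/asboolP; exists 0%VS; split; first exact: dimv0.
  by move=> x; rewrite memv0 => /eqP ->.
have okub n : ok n -> (n <= \dim {:V})%N.
  by move=> /asboolP[U [<- _]]; apply/dimvS/subvf.
case: (ex_maxnP ok0 okub) => n /asboolP[U [dU sU]] nmax.
exists U => x; apply/idP/idP => [/sU //|Px].
apply: contraT => nUx.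
have /nmax : ok (\dim (U + <[x]>)%VS).
  apply/asboolP; exists (U + <[x]>)%VS; split => // y.
  case/memv_addP => u Uu [w /vlineP[k ->] ->].
  by rewrite addrC; exact: (PD k x u Px (sU _ Uu)).
rewrite -dU => le; case/negP: nUx.
have /eqP -> : U == (U + <[x]>)%VS by rewrite eqEdim addvSl.
by rewrite (subvP (addvSr _ _)) // memv_line.
Qed.

Definition vspace_of (PP : submod_closed P) : {vspace V} :=
  sval (cid (ex_vspace_of PP)).

Lemma mem_vspace_of (PP : submod_closed P) : vspace_of PP =i P.
Proof. exact: svalP (cid (ex_vspace_of PP)). Qed.

End SubspaceOf.

(* 'M[D]_2 is canonically a left D-module; mat2 D is the same ring as an algebra
   over the base field F. *)
Section Mat2.
Variables (F : fieldType) (D : falgType F).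

Definition mat2 : Type := 'M[D]_2.
HB.instance Definition _ := GRing.NzRing.on mat2.

Definition mat2_scale (c : F) (X : mat2) : mat2 := \matrix_(i, j) (c *: X i j).

Fact mat2_scaleA a b X : mat2_scale a (mat2_scale b X) = mat2_scale (a * b) X.
Proof. by apply/matrixP => i j; rewrite !mxE scalerA. Qed.
Fact mat2_scale1 : left_id 1 mat2_scale.
Proof. by move=> X; apply/matrixP => i j; rewrite !mxE scale1r. Qed.
Fact mat2_scaleDr : right_distributive mat2_scale +%R.
Proof. by move=> a X Y; apply/matrixP => i j; rewrite !mxE scalerDr. Qed.
Fact mat2_scaleDl X : {morph mat2_scale^~ X : a b / a + b}.
Proof. by move=> a b; apply/matrixP => i j; rewrite !mxE scalerDl. Qed.
HB.instance Definition _ := GRing.Zmodule_isLmodule.Build F mat2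
  mat2_scaleA mat2_scale1 mat2_scaleDr mat2_scaleDl.

Fact mat2_scaleAl (a : F) (X Y : mat2) : a *: (X * Y) = (a *: X) * Y.
Proof.
apply/matrixP => i j; rewrite !mxE scaler_sumr.
by apply: eq_bigr => k _; rewrite !mxE scalerAl.
Qed.
HB.instance Definition _ := GRing.Lmodule_isLalgebra.Build F mat2 mat2_scaleAl.

Fact mat2_scaleAr (a : F) (X Y : mat2) : a *: (X * Y) = X * (a *: Y).
Proof.
apply/matrixP => i j; rewrite !mxE scaler_sumr.
by apply: eq_bigr => k _; rewrite !mxE scalerAr.
Qed.
HB.instance Definition _ := GRing.Lalgebra_isAlgebra.Build F mat2 mat2_scaleAr.

Definition mx22 (a x y b : D) : mat2 :=
  \matrix_(i < 2, j < 2)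
    if i == 0 then (if j == 0 then a else x) else (if j == 0 then y else b).

Fact mat2_vect_iso : Vector.axiom (\dim {:((D * D) * (D * D))%type}) mat2.
Proof.
pose T : vectType F := ((D * D) * (D * D))%type.
have bT : basis_of {:T} (vbasis {:T}) := vbasisP _.
have ord2 (i : 'I_2) : i = 0 \/ i = 1.
  by case: i => [[|[|//]] ?]; [left | right]; apply: val_inj.
pose f (X : mat2) : T := ((X 0 0, X 0 1), (X 1 0, X 1 1)).
exists (fun X => rVof (vbasis {:T}) (f X)).
  by move=> c X Y; rewrite -linearP; congr (rVof _ _); rewrite /f !mxE.
pose h (t : T) := mx22 t.1.1 t.1.2 t.2.1 t.2.2.
exists (fun r => h (vecof (vbasis {:T}) r)) => [X | r].
  rewrite rVofK //; apply/matrixP => i j; rewrite mxE.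
  by case: (ord2 i) (ord2 j) => -> [] ->.
rewrite -[RHS](vecofK bT); congr (rVof _ _).
by case: (vecof _ r) => [[a b] [c d]]; rewrite /f /h !mxE.
Qed.
HB.instance Definition _ := Lmodule_hasFinDim.Build F mat2 mat2_vect_iso.
HB.instance Definition _ := Algebra_isFalgebra.Build F mat2.

End Mat2.

(* A splitting of D over K: an iota-semilinear ring morphism D -> M_delta(K).
   For D central simple of dimension delta^2 over F it extends to an
   isomorphism of D (x)_F K onto M_delta(K). *)
Record splitting (F K : fieldType) (iota : {rmorphism F -> K}) (D : falgType F)
    (delta : nat) := Splitting {
  split_mor :> {rmorphism D -> 'M[K]_delta};
  split_scalar : forall c : F, split_mor c%:A = (iota c)%:M }.

Section Sl2.
Variables (F K : fieldType) (iota : {rmorphism F -> K}) (D : falgType F).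
Variables (delta : nat) (phi : splitting iota D delta).

(* Reduced trace and norm, as elements of K; their values lie in iota F. *)
Definition redtr (x : D) : K := \tr (phi x).
Definition rednorm (x : D) : K := \det (phi x).

Lemma redtrD x y : redtr (x + y) = redtr x + redtr y.
Proof. by rewrite /redtr rmorphD mxtraceD. Qed.
Lemma redtrZ c x : redtr (c *: x) = iota c * redtr x.
Proof.
by rewrite /redtr -mulr_algl rmorphM /= split_scalar -mxtraceZ -mul_scalar_mx.
Qed.
Lemma redtr0 : redtr 0 = 0.
Proof. by rewrite /redtr rmorph0 mxtrace0. Qed.
Lemma redtrN x : redtr (- x) = - redtr x.
Proof. by rewrite /redtr rmorphN raddfN. Qed.
Lemma redtrC x y : redtr (x * y) = redtr (y * x).
Proof. by rewrite /redtr !rmorphM /= mxtrace_mulC. Qed.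

Definition sl2_pred : {pred mat2 D} := [pred X : mat2 D | redtr (X 0 0 + X 1 1) == 0].

Lemma sl2_submod : submod_closed sl2_pred.
Proof.
split=> [|c X Y]; rewrite !inE ?mxE ?addr0 ?redtr0 // => /eqP eX /eqP eY.
rewrite addrACA -scalerDr redtrD redtrZ.
by rewrite eX eY mulr0 addr0.
Qed.

Lemma sl2_closed X Y : X \in vspace_of sl2_submod -> Y \in vspace_of sl2_submod ->
  X * Y - Y * X \in vspace_of sl2_submod.
Proof.
rewrite !mem_vspace_of !inE => _ _; rewrite !mxE.
have e1 : lift ord0 ord0 = 1 :> 'I_2 by apply: val_inj.
rewrite !(big_ord_recl, big_ord0) /= !addr0 e1.
rewrite !(redtrD, redtrN) (redtrC (X 0 0)) (redtrC (X 0 1)) (redtrC (X 1 0)).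
rewrite (redtrC (X 1 1)); apply/eqP.
have aux (a b c d : K) : a + b - (a + c) + (c + d - (b + d)) = 0.
  rewrite !opprD (AC ((2*2)*(2*2)) (((1*3)*(2*7))*((4*5)*(6*8)))) /=.
  by rewrite !(subrr, addNr) !addr0.
exact: aux.
Qed.

Definition sl2 : liesub (mat2 D) := LieSub sl2_closed.

Lemma mem_sl2 (X : mat2 D) : (X \in sl2) = (redtr (X 0 0 + X 1 1) == 0).
Proof. exact: mem_vspace_of. Qed.

Lemma sl2_upper_subproof (x : D) : mx22 0 x 0 0 \in sl2.
Proof. by rewrite mem_sl2 !mxE /= addr0 redtr0. Qed.
Definition sl2_upper (x : D) : subvs_of sl2 := Subvs (sl2_upper_subproof x).

Lemma sl2_H_subproof : mx22 1 0 0 (- 1) \in sl2.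
Proof. by rewrite mem_sl2 !mxE /= subrr redtr0. Qed.
Definition sl2_H : subvs_of sl2 := Subvs sl2_H_subproof.

End Sl2.

Section Orthogonal.
Variable F : fieldType.

(* The quadratic form with symmetric Gram matrix B; its discriminant is \det B
   up to squares.  In characteristic <> 2 every quadratic form arises so. *)
Definition qform (n : nat) (B : 'M[F]_n) (x : 'cV[F]_n) : F :=
  (x^T *m B *m x) 0 0.

Definition anisotropic (n : nat) (B : 'M[F]_n) : Prop :=
  forall x : 'cV[F]_n, x != 0 -> qform B x != 0.

Definition SO (n : nat) (B : 'M[F]_n) : set 'M[F]_n :=
  [set g | g^T *m B *m g = B /\ \det g = 1].

Definition oq_pred (n : nat) (B : 'M[F]_n.+1) : {pred 'M[F]_n.+1} :=
  [pred A | A^T *m B + B *m A == 0].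

Lemma oq_submod n (B : 'M[F]_n.+1) : submod_closed (oq_pred B).
Proof.
split=> [|c X Y]; rewrite !inE; first by rewrite trmx0 mul0mx mulmx0 addr0.
move=> /eqP eX /eqP eY.
rewrite linearP /= mulmxDl mulmxDr addrACA eY -scalemxAl -scalemxAr -scalerDr eX.
by rewrite scaler0 addr0.
Qed.

Lemma oq_closed n (B : 'M[F]_n.+1) X Y :
  X \in vspace_of (oq_submod B) -> Y \in vspace_of (oq_submod B) ->
  X * Y - Y * X \in vspace_of (oq_submod B).
Proof.
rewrite !mem_vspace_of !inE !addr_eq0 => /eqP eX /eqP eY.
have h (U W : 'M[F]_n.+1) : U^T *m B = - (B *m U) -> W^T *m B = - (B *m W) ->
    (U *m W)^T *m B = B *m (W *m U).
  by move=> eU eW; rewrite trmx_mul -mulmxA eU mulmxN (mulmxA W^T) eW mulNmx opprK mulmxA.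
rewrite -!mulmxE linearB /= mulmxBl mulmxBr (h _ _ eX eY) (h _ _ eY eX).
by rewrite opprB.
Qed.

Definition oq (n : nat) (B : 'M[F]_n.+1) : liesub 'M[F]_n.+1 :=
  LieSub (@oq_closed n B).

Lemma mem_oq n (B X : 'M[F]_n.+1) : (X \in oq B) = (X^T *m B + B *m X == 0).
Proof. exact: mem_vspace_of. Qed.

Definition sqclass (a : F) : set F := [set a * t ^+ 2 | t in [set t | t != 0]].
Definition sqclasses : set (set F) := [set sqclass a | a in [set a | a != 0]].

End Orthogonal.

(* Main.v *)
(* Over the algebraic closure K, ad-nilpotency of x forces the defining matrix of x
   to be nilpotent (up to a scalar for sl_2(D)), so an elementary automorphism is
   conjugation by a matrix P: in GL_(2 delta)(K) for sl_2(D), in O(q)(K) for o(q, 5).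
   If it fixes H_0, then P is block diagonal; comparing with its action on V^+,
   which is defined over F, makes P rational up to a scalar (by Skolem-Noether for
   sl_2(D), and by the values of la^2 and la^3 for o(q, 5), la being the scale of P).
   Conversely every P with det P = 1 is a product of transvections, hence of
   exponentials; and by Cartan-Dieudonne a scaled rotation is the product of two
   Weyl elements exp(up x) exp(down x') exp(up x), once the vectors are rescaled by
   a square root in K.
   Invariants: the relation f(g x) f(y) = f(g y) f(x) extends by Zariski density
   from the F-points of G to a polynomial family over K (left multiplications, resp.
   x |-> 2 b(a, x) a - q(a) x); a multiplicative polynomial on matrices is a power
   of det, and the quadratic family forces f to be a power of q.  That the reduced
   norm has coefficients in F is seen from a power of it being the determinant of
   left multiplication in D.  The orbits of o(q, 5) are the values of an anisotropic
   ternary form, which by Hensel's lemma and counting residues are all square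
   classes but that of -det. *)

Require Import Defs.
From HB Require Import structures.
From mathcomp Require Import all_boot all_order all_algebra all_field.
From mathcomp Require Import mpoly ring lra zify.
From mathcomp Require Import boolp classical_sets cardinality reals.
Set Implicit Arguments.
Unset Strict Implicit.
Unset Printing Implicit Defensive.
Import Order.TTheory GRing.Theory Num.Theory.
Local Open Scope ring_scope.
Local Open Scope classical_set_scope.
Local Open Scope card_scope.

(** * Polynomial functions *)

(** [Aut0] is a condition over the closed field K only, while [G] acts on an algebra over F. Both
    algebras are therefore represented by matrices over K, faithfully after extension of scalars,
    and automorphisms are compared through relations [P *m rho X = rho (g X) *m P]. Such a relation
    needs no inverse and leaves the scale of P free, which is exactly the ambiguity that the descent
    to F has to remove; in odd dimension this includes the sign, hence SO and not O. The character
    of an invariant is known on the F-points of G only. The exchange relation is used because the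
    character drops out of it, so that what remains is polynomial in every variable. In
    characteristic 0 the points with positive integer coordinates are dense enough to carry it to K,
    and there a polynomial without zeros on a line is constant; no Zariski topology is set up.
    Completeness, a uniformizer and a finite residue field are not given with F: all three are
    produced from its finite dimension over Q_p. *)

Section PolynomialFunctions.
Variable K : fieldType.

Lemma mpoly_closed_ind n (P : {mpoly K[n]} -> Prop) :
  (forall c, P c%:MP) -> (forall i, P 'X_i) ->
  (forall p q, P p -> P q -> P (p + q)) ->
  (forall p q, P p -> P q -> P (p * q)) -> forall p, P p.
Proof.
move=> PC PX PD PM p; rewrite [p]mpolyE.
elim/big_ind: _ => [||m _]; [by rewrite -(mpolyC0 n K); apply: PC|exact: PD|].
rewrite -mul_mpolyC; apply: (PM _ _ (PC _)).
rewrite mpolyXE_id; elim/big_ind: _ => [||i _]; first by rewrite -mpolyC1; apply: PC.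
  exact: PM.
elim: (m i) => [|k IH]; first by rewrite expr0 -mpolyC1; apply: PC.
by rewrite exprS; apply: PM.
Qed.

(** Polynomial functions without coordinates: the algebra generated by the linear forms. Linear
    substitution and restriction to a line become plain inductions, and no basis of the matrix
    spaces has to be chosen. *)
Inductive polyfun (V : lmodType K) : (V -> K) -> Prop :=
| polyfun_const c : polyfun (fun=> c)
| polyfun_lin f : (forall a x y, f (a *: x + y) = a * f x + f y) -> polyfun f
| polyfun_add f g : polyfun f -> polyfun g -> polyfun (fun x => f x + g x)
| polyfun_mul f g : polyfun f -> polyfun g -> polyfun (fun x => f x * g x).

Lemma eq_polyfun (V : lmodType K) (f g : V -> K) : f =1 g -> polyfun f -> polyfun g.
Proof. by move/funext => ->. Qed.

Lemma polyfun_comp (U V : lmodType K) (h : U -> V) (f : V -> K) :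
  (forall l : V -> K, (forall a x y, l (a *: x + y) = a * l x + l y) ->
     polyfun (fun u => l (h u))) ->
  polyfun f -> polyfun (fun u => f (h u)).
Proof.
move=> hP; elim=> [c|l lP|f1 f2 _ IH1 _ IH2|f1 f2 _ IH1 _ IH2].
- exact: polyfun_const.
- exact: hP.
- exact: polyfun_add.
- exact: polyfun_mul.
Qed.

Lemma polyfun_comp_lin (U V : lmodType K) (h : U -> V) (f : V -> K) :
  linear h -> polyfun f -> polyfun (fun u => f (h u)).
Proof.
move=> hP; apply: polyfun_comp => l lP; apply: polyfun_lin => a x y.
by rewrite hP lP.
Qed.

Lemma polyfun_sum (V : lmodType K) (I : Type) (r : seq I) (P : pred I) (F : I -> V -> K) :
  (forall i, polyfun (F i)) -> polyfun (fun x => \sum_(i <- r | P i) F i x).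
Proof.
move=> FP; elim: r => [|i r IH].
  by apply: eq_polyfun (polyfun_const _ 0) => x; rewrite big_nil.
case Pi: (P i).
  by apply: eq_polyfun (polyfun_add (FP i) IH) => x; rewrite big_cons Pi.
by apply: eq_polyfun IH => x; rewrite big_cons Pi.
Qed.

Lemma polyfun_prod (V : lmodType K) (I : Type) (r : seq I) (P : pred I) (F : I -> V -> K) :
  (forall i, polyfun (F i)) -> polyfun (fun x => \prod_(i <- r | P i) F i x).
Proof.
move=> FP; elim: r => [|i r IH].
  by apply: eq_polyfun (polyfun_const _ 1) => x; rewrite big_nil.
case Pi: (P i).
  by apply: eq_polyfun (polyfun_mul (FP i) IH) => x; rewrite big_cons Pi.
by apply: eq_polyfun IH => x; rewrite big_cons Pi.
Qed.

Lemma polyfun_exp (V : lmodType K) (f : V -> K) k :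
  polyfun f -> polyfun (fun x => f x ^+ k).
Proof.
move=> fP; elim: k => [|k IH].
  by apply: eq_polyfun (polyfun_const _ 1) => x; rewrite expr0.
by apply: eq_polyfun (polyfun_mul fP IH) => x; rewrite exprS.
Qed.

Lemma polyfun_sub (V : lmodType K) (f g : V -> K) :
  polyfun f -> polyfun g -> polyfun (fun x => f x - g x).
Proof.
move=> fP gP; apply: eq_polyfun (polyfun_add fP (polyfun_mul (polyfun_const _ (-1)) gP)) => x.
by rewrite mulN1r.
Qed.

Lemma polyfun_det (V : lmodType K) n (A : V -> 'M[K]_n) :
  (forall i j, polyfun (fun x => A x i j)) -> polyfun (fun x => \det (A x)).
Proof.
move=> AP; apply: polyfun_sum => s; apply: polyfun_mul; first exact: polyfun_const.
exact: polyfun_prod.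
Qed.

Lemma polyfun_meval (V : lmodType K) n (v : V -> 'I_n -> K) (p : {mpoly K[n]}) :
  (forall i, polyfun (fun x => v x i)) -> polyfun (fun x => p.@[v x]).
Proof.
move=> vP; elim/mpoly_closed_ind: p => [c|i|p q Pp Pq|p q Pp Pq].
- by apply: eq_polyfun (polyfun_const _ c) => x; rewrite mevalC.
- by apply: eq_polyfun (vP i) => x; rewrite mevalXU.
- by apply: eq_polyfun (polyfun_add Pp Pq) => x; rewrite mevalD.
- by apply: eq_polyfun (polyfun_mul Pp Pq) => x; rewrite mevalM.
Qed.

Lemma polyfun_line (V : lmodType K) (f : V -> K) (a b : V) : polyfun f ->
  exists q : {poly K}, forall s, f (a + s *: b) = q.[s].
Proof.
elim=> [c|l lP|f1 f2 _ [q1 e1] _ [q2 e2]|f1 f2 _ [q1 e1] _ [q2 e2]].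
- by exists c%:P => s; rewrite hornerC.
- exists ((l a)%:P + l b *: 'X) => s.
  by rewrite addrC lP !hornerE mulrC addrC.
- by exists (q1 + q2) => s; rewrite hornerD e1 e2.
- by exists (q1 * q2) => s; rewrite hornerM e1 e2.
Qed.

Section CharZero.
Hypothesis K0 : [pchar K] =i pred0.

Lemma natf_inj m n : m%:R = n%:R :> K -> m = n.
Proof.
have natf0 : forall k, k%:R = 0 :> K -> k = 0%N.
  by move=> k /eqP; have /pcharf0P -> := K0; move/eqP.
wlog le : m n / (m <= n)%N.
  by move=> H; case: (leqP m n) => [/H //|/ltnW /H W e]; rewrite W.
move/eqP; rewrite eq_sym -subr_eq0 -natrB // => /eqP /natf0 /eqP.
by rewrite subn_eq0 => le'; apply/eqP; rewrite eqn_leq le.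
Qed.

(** In characteristic 0 the points 1, 2, 3, ... are distinct, too many roots for a non-zero
    polynomial. Zero is left out so that vectors with such coordinates stay non-zero, as required of
    the F-points where invariance is applied. *)
Lemma poly_nat_eq0 (q : {poly K}) : (forall k : nat, q.[k.+1%:R] = 0) -> q = 0.
Proof.
move=> q0; apply/eqP; apply: contraT => nz.
have := @max_poly_roots _ q [seq k.+1%:R | k <- iota 0 (size q)] nz.
rewrite size_map size_iota ltnn => H; apply: H.
  by apply/allP => _ /mapP[k _ ->]; apply/rootP/q0.
by rewrite map_inj_uniq ?iota_uniq // => i j /natf_inj [].
Qed.

Lemma poly_fun_eq0 (q : {poly K}) : (forall s, q.[s] = 0) -> q = 0.
Proof. by move=> q0; apply: poly_nat_eq0 => k; apply: q0. Qed.

(** The coordinates are freed one at a time: with the first [j] arbitrary and the others positive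
    integers, the dependence on coordinate [j] is a one-variable polynomial that vanishes at all
    positive integers. *)
Lemma polyfun_dense (V : lmodType K) n (b : 'I_n -> V) (f : V -> K) :
  (forall x, exists t : 'I_n -> K, x = \sum_i t i *: b i) -> polyfun f ->
  (forall k : 'I_n -> nat, f (\sum_i (k i).+1%:R *: b i) = 0) -> forall x, f x = 0.
Proof.
move=> bP fP f0.
suff H j (t : 'I_n -> K) (k : 'I_n -> nat) :
    (j <= n)%N -> f (\sum_(i < n) (if (i < j)%N then t i else (k i).+1%:R) *: b i) = 0.
  move=> x; have [t ->] := bP x; rewrite -(H n t (fun=> 0%N)) //.
  by congr f; apply: eq_bigr => i _; rewrite ltn_ord.
elim: j t k => [|j IH] t k lt.
  by rewrite -(f0 k); congr f; apply: eq_bigr => i _.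
pose i0 := Ordinal lt.
pose g s := \sum_(i < n) (if i == i0 then s else if (i < j)%N then t i else (k i).+1%:R) *: b i.
have gE s : g s = g 0 + s *: b i0.
  rewrite /g (bigD1 i0) //= eqxx [in RHS](bigD1 i0) //= eqxx scale0r add0r addrC.
  by congr (_ + _); apply: eq_bigr => i /negPf ->.
have [q qE] := polyfun_line (g 0) (b i0) fP.
suff q0 : q = 0.
  have -> : \sum_(i < n) (if (i < j.+1)%N then t i else (k i).+1%:R) *: b i = g (t i0).
    apply: eq_bigr => i _; congr (_ *: _); case: eqP => [-> | /eqP ne]; first by rewrite /= ltnSn.
    by rewrite ltnS leq_eqVlt; have /negPf -> : (i != j :> nat).
  by rewrite gE qE q0 horner0.
apply: poly_nat_eq0 => l; rewrite -qE -gE.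
rewrite -(IH t (fun i => if i == i0 then l else k i)) ?(ltnW lt) //.
congr f; apply: eq_bigr => i _; congr (_ *: _).
by case: (eqVneq i i0) => [-> /=|ne]; rewrite ?ltnn.
Qed.

(** If [f] does not vanish at [a], its polynomial on the line from [a] to any [b] is non-zero, so
    that of [g] is zero; [b] is the parameter 1. *)
Lemma polyfun_domain (V : lmodType K) (f g : V -> K) : polyfun f -> polyfun g ->
  (forall x, f x * g x = 0) -> (forall x, f x = 0) \/ (forall x, g x = 0).
Proof.
move=> fP gP fg0; have [|/existsNP[a fa]] := pselect (forall x, f x = 0); first by left.
right=> b.
have [p pE] := polyfun_line a (b - a) fP; have [q qE] := polyfun_line a (b - a) gP.
have /eqP : p * q = 0 by apply: poly_fun_eq0 => s; rewrite hornerM -pE -qE.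
rewrite mulf_eq0 => /orP[/eqP e|/eqP e].
  by case: fa; have := pE 0; rewrite scale0r addr0 e horner0.
by have := qE 1; rewrite scale1r addrC subrK e horner0.
Qed.

Lemma meval_at0 n (p : {mpoly K[n]}) : p.@[fun=> 0] = p@_0%MM.
Proof.
rewrite mevalE [in RHS](mpolyE p) raddf_sum /=; apply: eq_bigr => m _.
rewrite mcoeffZ mcoeffX; congr (_ * _); case: eqVneq => [->|nz].
  by rewrite big1 // => i _; rewrite mnm0E expr0.
have [i mi] : exists i, (m i != 0)%N.
  apply/existsP; apply: contraR nz; rewrite negb_exists => /forallP m0.
  by apply/eqP/mnmP => i; rewrite mnm0E; apply/eqP; have := m0 i; rewrite negbK.
by rewrite (bigD1 i) //= expr0n (negPf mi) mul0r.
Qed.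

(** The partial derivative is the derivative at 0 of the restriction to a coordinate line, and that
    restriction is the zero polynomial. *)
Lemma meval_deriv0 n (p : {mpoly K[n]}) i : (forall v, p.@[v] = 0) ->
  forall v, (p^`M(i)).@[v] = 0.
Proof.
move=> p0 v.
suff [q qE dq] : exists2 q : {poly K},
    (forall s, p.@[fun j => v j + s * (j == i)%:R] = q.[s]) & (q^`()).[0] = (p^`M(i)).@[v].
  by rewrite -dq (@poly_fun_eq0 q) ?deriv0 ?horner0 // => s; rewrite -qE p0.
have v0 : (fun j => v j + 0 * (j == i)%:R) =1 v by move=> j; rewrite mul0r addr0.
elim/mpoly_closed_ind: {p0} p => [c|j|p q [p' pE dp] [q' qE dq]|p q [p' pE dp] [q' qE dq]].
- exists c%:P => [s|]; first by rewrite mevalC hornerC.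
  by rewrite derivC mderivC meval0 horner0.
- exists ((v j)%:P + (j == i)%:R *: 'X) => [s|].
    by rewrite mevalXU !hornerE [s * _]mulrC.
  rewrite derivD derivC derivZ derivX mderivX mevalZ mnm1E add0r hornerZ hornerC mulr1.
  case: (eqVneq j i) => [->|]; last by rewrite mul0r.
  have -> : (U_(i) - U_(i) = 0)%MM by apply/mnmP => k; rewrite mnmBE mnm0E subnn.
  by rewrite mpolyX0 meval1 mulr1.
- exists (p' + q') => [s|]; first by rewrite mevalD hornerD pE qE.
  by rewrite derivD mderivD mevalD hornerD dp dq.
- exists (p' * q') => [s|]; first by rewrite mevalM hornerM pE qE.
  rewrite derivM mderivM mevalD !mevalM hornerD !hornerM dp dq -pE -qE.
  by rewrite !(meval_eq _ v0).
Qed.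

(** Taylor coefficients: up to a positive integer factor, the coefficient of [m] is a coefficient of
    lower degree in a partial derivative, which again vanishes everywhere. *)
Lemma mpoly_fun_eq0 n (p : {mpoly K[n]}) : (forall v, p.@[v] = 0) -> p = 0.
Proof.
move=> p0; apply/mpolyP => m; rewrite mcoeff0.
elim: (mdeg m) {-2}m (erefl (mdeg m)) p p0 => {m} [|d IH] m dm p p0.
  move/eqP: dm; rewrite mdeg_eq0 => /eqP ->.
  by rewrite -meval_at0.
have [i mi] : exists i, (m i != 0)%N.
  apply/existsP; apply: contraT; rewrite negb_exists => /forallP m0.
  suff m00 : m = 0%MM by rewrite m00 mdeg0 in dm.
  by apply/mnmP => i; rewrite mnm0E; apply/eqP; have := m0 i; rewrite negbK.
have mE : m = (m - U_(i) + U_(i))%MM by rewrite submK // lep1mP.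
have d' : mdeg (m - U_(i))%MM = d.
  by move: dm; rewrite {1}mE mdegD mdeg1 addn1 => -[].
have := IH _ d' _ (meval_deriv0 i p0).
rewrite mcoeff_mderiv -?mE => /eqP; rewrite -mulr_natr mulf_eq0 => /orP[/eqP //|].
by have /pcharf0P -> := K0.
Qed.

End CharZero.
End PolynomialFunctions.

(** * Transvections and Gaussian elimination *)

Section Transvections.
Variable K : fieldType.

Inductive transvection_gen n : 'M[K]_n -> Prop :=
| transvection_gen1 : transvection_gen 1%:M
| transvection_genS i j t A : i != j -> transvection_gen A ->
    transvection_gen ((1%:M + t *: delta_mx i j) *m A).

Lemma transvection_genM n (A B : 'M[K]_n) :
  transvection_gen A -> transvection_gen B -> transvection_gen (A *m B).
Proof.
elim=> [|i j t {}A ne _ IH] gB; first by rewrite mul1mx.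
by rewrite -mulmxA; apply: transvection_genS => //; apply: IH.
Qed.

Lemma transvection_gen_delta n (i j : 'I_n) t :
  i != j -> transvection_gen (1%:M + t *: delta_mx i j).
Proof.
by move=> ne; rewrite -[_ + _]mulmx1; apply: transvection_genS ne (transvection_gen1 _).
Qed.

Lemma mul_transvection n (i j : 'I_n) t (A : 'M[K]_n) k l :
  ((1%:M + t *: delta_mx i j) *m A) k l = A k l + t * (k == i)%:R * A j l.
Proof.
rewrite mulmxDl mul1mx mxE -scalemxAl mxE -mulrA; congr (_ + _ * _).
rewrite mxE (bigD1 j) //= mxE eqxx andbT big1 ?addr0 // => j' /negPf ne.
by rewrite mxE ne andbF mul0r.
Qed.

Lemma transvection_unit n (i j : 'I_n) t :
  i != j -> (1%:M + t *: delta_mx i j : 'M[K]_n) \in unitmx.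
Proof.
move=> ne; have [] // := @mulmx1_unit _ _ (1%:M + t *: delta_mx i j) (1%:M + (- t) *: delta_mx i j).
apply/matrixP => k l; rewrite mul_transvection !mxE (negPf (_ : j != i)) 1?eq_sym //=.
rewrite mulr0 addr0 [l == j]eq_sym; case: (k == i); last by rewrite !mulr0 mul0r !addr0.
by rewrite mulr1 mulNr subrK.
Qed.

Lemma transvection_gen_unit n (A : 'M[K]_n) : transvection_gen A -> A \in unitmx.
Proof.
elim=> [|i j t {}A ne _ IH]; first exact: unitmx1.
by rewrite unitmx_mul transvection_unit.
Qed.

Lemma transvection_gen_lower n (c : 'cV[K]_n) :
  transvection_gen (block_mx 1%:M 0 c 1%:M : 'M_(1 + n)).
Proof.
rewrite [c]matrix_sum_delta.
elim/big_ind: _ => [|x y gx gy|i _].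
- by rewrite -scalar_mx_block; apply: transvection_gen1.
- have -> : block_mx 1%:M 0 (x + y) 1%:M = block_mx 1%:M 0 x 1%:M *m block_mx 1%:M 0 y 1%:M :> 'M[K]_(1 + n).
    by rewrite mulmx_block !(mulmx1, mul1mx, mul0mx, mulmx0, addr0, add0r).
  exact: transvection_genM.
rewrite big_ord1.
have -> : block_mx 1%:M 0 (c i 0 *: delta_mx i 0) 1%:M =
    1%:M + c i 0 *: delta_mx (rshift 1 i) (lshift n 0) :> 'M[K]_(1 + n).
  rewrite -[delta_mx (rshift _ _) _]submxK.
  have -> : (1%:M : 'M[K]_(1 + n)) = block_mx 1%:M 0 0 1%:M by rewrite -scalar_mx_block.
  rewrite scale_block_mx add_block_mx; congr block_mx; apply/matrixP => k l; rewrite !mxE;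
    by rewrite ?(eq_lrshift, eq_rlshift, eq_lshift, eq_rshift, mulr0, andbF, addr0, add0r).
by apply: transvection_gen_delta; rewrite eq_rlshift.
Qed.

Lemma transvection_gen_upper n (r : 'rV[K]_n) :
  transvection_gen (block_mx 1%:M r 0 1%:M : 'M_(1 + n)).
Proof.
rewrite [r]matrix_sum_delta big_ord1.
elim/big_ind: _ => [|x y gx gy|i _].
- by rewrite -scalar_mx_block; apply: transvection_gen1.
- have -> : block_mx 1%:M (x + y) 0 1%:M = block_mx 1%:M x 0 1%:M *m block_mx 1%:M y 0 1%:M :> 'M[K]_(1 + n).
    by rewrite mulmx_block !(mulmx1, mul1mx, mul0mx, mulmx0, addr0, add0r) addrC.
  exact: transvection_genM.
have -> : block_mx 1%:M (r 0 i *: delta_mx 0 i) 0 1%:M =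
    1%:M + r 0 i *: delta_mx (lshift n 0) (rshift 1 i) :> 'M[K]_(1 + n).
  rewrite -[delta_mx (lshift _ _) _]submxK.
  have -> : (1%:M : 'M[K]_(1 + n)) = block_mx 1%:M 0 0 1%:M by rewrite -scalar_mx_block.
  rewrite scale_block_mx add_block_mx; congr block_mx; apply/matrixP => k l; rewrite !mxE;
    by rewrite ?(eq_lrshift, eq_rlshift, eq_lshift, eq_rshift, mulr0, andbF, addr0, add0r).
by apply: transvection_gen_delta; rewrite eq_lrshift.
Qed.

Lemma transvection_gen_block n (A : 'M[K]_n) : transvection_gen A ->
  transvection_gen (block_mx 1%:M 0 0 A : 'M_(1 + n)).
Proof.
elim=> [|i j t {}A ne _ IH]; first by rewrite -scalar_mx_block; apply: transvection_gen1.
have -> : block_mx 1%:M 0 0 ((1%:M + t *: delta_mx i j) *m A) =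
   (1%:M + t *: delta_mx (rshift 1 i) (rshift 1 j)) *m block_mx 1%:M 0 0 A :> 'M[K]_(1 + n).
  have -> : 1%:M + t *: delta_mx (rshift 1 i) (rshift 1 j) =
      block_mx 1%:M 0 0 (1%:M + t *: delta_mx i j) :> 'M[K]_(1 + n).
    rewrite -[delta_mx (rshift _ _) _]submxK.
    have -> : (1%:M : 'M[K]_(1 + n)) = block_mx 1%:M 0 0 1%:M by rewrite -scalar_mx_block.
    rewrite scale_block_mx add_block_mx; congr block_mx; apply/matrixP => k l; rewrite !mxE;
      by rewrite ?(eq_lrshift, eq_rlshift, eq_lshift, eq_rshift, mulr0, andbF, addr0, add0r).
  by rewrite mulmx_block !(mulmx1, mul1mx, mul0mx, mulmx0, addr0, add0r).
by apply: transvection_genS => //; rewrite eq_rshift.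
Qed.

(** The normal form of an invertible matrix under transvections: only its determinant survives, in
    the last diagonal entry. *)
Definition corner_mx n (d : K) : 'M[K]_n.+1 :=
  diag_mx (\row_j (if j == ord_max then d else 1)).

Lemma det_corner n d : \det (corner_mx n d) = d.
Proof.
rewrite det_diag (bigD1 ord_max) //= mxE eqxx big1 ?mulr1 // => i /negPf ne.
by rewrite mxE ne.
Qed.

Lemma corner_block n d :
  corner_mx n.+1 d = block_mx 1%:M 0 0 (corner_mx n d) :> 'M_(1 + n.+1).
Proof.
rewrite -[corner_mx n.+1 d](@submxK _ 1 n.+1 1 n.+1); congr block_mx; apply/matrixP => i j.
- by rewrite !ord1 !mxE -!val_eqE.
- by rewrite !ord1 !mxE -!val_eqE.
- by rewrite !ord1 !mxE -!val_eqE.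
- by rewrite !mxE -!val_eqE /= !add1n !eqSS.
Qed.

Lemma pivot_transvection n (A : 'M[K]_(1 + n.+1)) : A \in unitmx ->
  exists2 T, transvection_gen T & (T *m A) 0 0 = 1.
Proof.
move=> uA.
have main (B : 'M[K]_(1 + n.+1)) i : i != 0 -> B i 0 != 0 ->
    exists2 T, transvection_gen T & (T *m B) 0 0 = 1.
  move=> i0 Bi; exists (1%:M + ((1 - B 0 0) / B i 0) *: delta_mx 0 i).
    by apply: transvection_gen_delta; rewrite eq_sym.
  by rewrite mul_transvection eqxx mulr1 divfK // addrC subrK.
have [i Ai] : exists i, A i 0 != 0.
  apply/existsP; apply: contraLR uA; rewrite negb_exists => /forallP A0.
  rewrite unitmxE (expand_det_col _ 0) big1 ?unitr0 // => i _.
  by have := A0 i; rewrite negbK => /eqP ->; rewrite mul0r.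
have [i0|/main/(_ Ai)//] := eqVneq i 0; subst i.
have [A1|A1] := eqVneq (A 1 0) 0; last exact: (main _ 1).
(* The corner is here the only entry of the column known to be non-zero; adding row 0 to row 1
   creates a second one below it. *)
pose T1 : 'M[K]_(1 + n.+1) := 1%:M + 1 *: delta_mx 1 0.
have [||T gT TE] := main (T1 *m A) 1; rewrite ?mul_transvection ?A1 ?eqxx ?mulr1 ?mul1r ?add0r //.
exists (T *m T1); last by rewrite -mulmxA.
by apply: transvection_genM gT _; apply: transvection_gen_delta.
Qed.

(** Elimination by induction on the size. The last entry [d] stays unknown during the induction and
    is identified with the determinant at the end, since transvections have determinant 1. *)
Lemma transvection_reduction n (A : 'M[K]_n.+1) : A \in unitmx ->
  exists2 T, transvection_gen T & T *m A = corner_mx n (\det A).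
Proof.
suff H : A \in unitmx -> exists T d, transvection_gen T /\ T *m A = corner_mx n d.
  move=> /H[T [d [gT TA]]]; exists T; first exact: gT.
  suff -> : \det A = d by [].
  have := congr1 determinant TA; rewrite det_mulmx det_corner => <-.
  suff -> : \det T = 1 by rewrite mul1r.
  elim: gT => [|i j t {TA}A' ne _ IH]; first exact: det1.
  rewrite det_mulmx IH mulr1.
  have [lt|ge] := ltnP j i.
    rewrite det_trig ?big1 // => [k _|]; first rewrite !mxE.
      by rewrite eqxx; case: eqP => [->|_]; rewrite ?(negPf ne) mulr0 addr0.
    apply/is_trig_mxP => k l kl; rewrite !mxE -!val_eqE (ltn_eqF kl) add0r /=.
    case: (eqVneq (k : nat) i) => [ki|]; rewrite ?mulr0 //=.
    case: (eqVneq (l : nat) j) => [lj|]; rewrite ?mulr0 //=.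
    by move: kl; rewrite ki lj ltnNge ltnW.
  rewrite -det_tr det_trig ?big1 // => [k _|]; first rewrite !mxE.
    by rewrite eqxx; case: eqP => [->|_]; rewrite ?(negPf ne) mulr0 addr0.
  apply/is_trig_mxP => k l kl; rewrite !mxE -!val_eqE (gtn_eqF kl) add0r /=.
  case: (eqVneq (l : nat) i) => [ki|]; rewrite ?mulr0 //=.
  case: (eqVneq (k : nat) j) => [lj|]; rewrite ?mulr0 //=.
  by move: kl; rewrite ki lj ltnNge ge.
elim: n A => [|n IH] A uA.
  exists 1%:M, (A 0 0); split; first exact: transvection_gen1.
  by apply/matrixP => i j; rewrite !ord1 mul1mx !mxE eqxx.
have [T1 gT1 T1A] := pivot_transvection uA.
have : T1 *m A \in unitmx by rewrite unitmx_mul uA transvection_gen_unit.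
move=> uB; suff [T [d [gT TB]]] : exists T d, transvection_gen T /\ T *m (T1 *m A) = corner_mx n.+1 d.
  by exists (T *m T1), d; split; [exact: transvection_genM | rewrite -mulmxA].
move: (T1 *m A : 'M_(1 + n.+1)) T1A uB => {T1 gT1 A uA} B B1 uB.
have Bul : ulsubmx (B : 'M_(1 + n.+1)) = 1%:M.
  by apply/matrixP => i j; rewrite !ord1 !mxE -B1; congr (B _ _); apply: val_inj.
have := @submxK _ 1 n.+1 1 n.+1 B; rewrite Bul.
move: (ursubmx _) (dlsubmx _) (drsubmx _) => r c A' BE'.
pose C := block_mx 1%:M 0 (- c) 1%:M : 'M_(1 + n.+1).
have CB : C *m B = block_mx 1%:M r 0 (A' - c *m r).
  by rewrite -BE' /C mulmx_block !(mulmx1, mul1mx, mul0mx, mulmx0, addr0, add0r) addNr mulNmx addrC.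
have uA' : A' - c *m r \in unitmx.
  have : C *m B \in unitmx by rewrite unitmx_mul uB transvection_gen_unit //; apply: transvection_gen_lower.
  by rewrite CB unitmxE det_ublock det1 mul1r.
have [T' [d [gT' T'A]]] := IH _ uA'.
have uD : corner_mx n d \in unitmx by rewrite -T'A unitmx_mul uA' transvection_gen_unit.
(* Once [T'] has turned the lower block into a corner matrix, the row [r] is cleared by the inverse
   of that matrix. *)
pose T2 : 'M_(1 + n.+1) := block_mx 1%:M (- (r *m invmx (corner_mx n d))) 0 1%:M.
pose T3 : 'M_(1 + n.+1) := block_mx 1%:M 0 0 T'.
have E : T2 *m (T3 *m (C *m B)) = block_mx 1%:M 0 0 (corner_mx n d).
  rewrite CB mulmx_block !(mulmx1, mul1mx, mul0mx, mulmx0, addr0, add0r) T'A mulmx_block.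
  by rewrite !(mulmx1, mul1mx, mul0mx, mulmx0, addr0, add0r) mulNmx mulmxKV // subrr.
exists (T2 *m (T3 *m C)), d; split.
  apply: transvection_genM; first exact: transvection_gen_upper.
  apply: transvection_genM; first exact: transvection_gen_block.
  exact: transvection_gen_lower.
by rewrite -!mulmxA corner_block; exact: E.
Qed.

Lemma transvection_gen_inv n (A : 'M[K]_n) : transvection_gen A -> transvection_gen (invmx A).
Proof.
elim=> [|i j t {}A ne gA IH]; first by rewrite invmx1; apply: transvection_gen1.
have -> : invmx ((1%:M + t *: delta_mx i j) *m A) = invmx A *m (1%:M + (- t) *: delta_mx i j).
  have uA := transvection_gen_unit gA; have uE := transvection_unit t ne.
  apply: (can_inj (mulKmx (_ : (1%:M + t *: delta_mx i j) *m A \in unitmx))).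
    by rewrite unitmx_mul uE.
  rewrite mulmxV ?unitmx_mul ?uE // mulmxA -(mulmxA _ A) mulmxV // mulmx1.
  apply/matrixP => k l; rewrite mul_transvection !mxE (negPf (_ : j != i)) 1?eq_sym //=.
  rewrite mulr0 addr0 [l == j]eq_sym; case: (k == i); last by rewrite !mulr0 mul0r !addr0.
  by rewrite mulr1 mulNr subrK.
by apply: transvection_genM IH _; apply: transvection_gen_delta.
Qed.

Lemma transvection_gen_det1 n (A : 'M[K]_n) : \det A = 1 -> transvection_gen A.
Proof.
case: n A => [|n] A dA; first by have -> : A = 1%:M; [apply/matrixP => -[] | apply: transvection_gen1].
have uA : A \in unitmx by rewrite unitmxE dA unitr1.
have [T gT TA] := transvection_reduction uA.
have E : T *m A = 1%:M.
  by rewrite TA dA; apply/matrixP => i j; rewrite !mxE; case: (i == ord_max).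
rewrite -[A]mul1mx -(mulVmx (transvection_gen_unit gT)) -mulmxA E mulmx1.
exact: transvection_gen_inv.
Qed.

End Transvections.

(** * Polynomials without zeros over a closed field *)

Section NonvanishingPolynomials.
Variable K : closedFieldType.
Hypothesis K0 : [pchar K] =i pred0.

Lemma poly_no_root (q : {poly K}) : (forall s, q.[s] != 0) -> forall s t, q.[s] = q.[t].
Proof.
move=> q0 s t; have [sz|] := boolP (size q == 1%N).
  by case/size_poly1P: sz => c _ ->; rewrite !hornerC.
by move/closed_rootP => [x /rootP qx]; move: (q0 x); rewrite qx eqxx.
Qed.

(** Factors X are split off until the value at 0 is non-zero; what is left has no root at all and is
    constant. *)
Lemma poly_root0 (q : {poly K}) : (forall s, s != 0 -> q.[s] != 0) ->
  exists k, forall s, q.[s] = q.[1] * s ^+ k.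
Proof.
elim: (size q) {-2}q (leqnn (size q)) => {q} [|m IH] q szq q0.
  move: szq; rewrite leqn0 size_poly_eq0 => /eqP qE.
  by move: (q0 1 (oner_neq0 _)); rewrite qE horner0 eqxx.
have [q00|q00] := eqVneq q.[0] 0; last first.
  exists 0%N => s; rewrite expr0 mulr1; apply: poly_no_root => t.
  by have [->|/q0] := eqVneq t 0.
have /factor_theorem[q' qE] : root q 0 by apply/rootP.
rewrite subr0 in qE.
have nz : q != 0 by apply: contraTneq (q0 1 (oner_neq0 _)) => ->; rewrite horner0 eqxx.
have nz' : q' != 0 by apply: contraNneq nz => e; rewrite qE e mul0r.
have [||k kE] := IH q'.
- by move: szq; rewrite qE size_mulX.
- by move=> s /q0; rewrite qE hornerMX mulf_eq0 => /norP[].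
by exists k.+1 => s; rewrite qE !hornerMX mulr1 kE -mulrA -exprSr.
Qed.

(** Along 1 + s E_ij the value is a polynomial in s without root, hence constant, so [f] sees an
    invertible matrix only through its corner form. On the line of corner matrices the only possible
    zero is d = 0, which leaves a monomial in the determinant. *)
Lemma polyfun_unitmx n (f : 'M[K]_n -> K) : (0 < n)%N -> polyfun f ->
  (forall A, A \in unitmx -> f A != 0) -> exists k, forall A, f A = f 1%:M * \det A ^+ k.
Proof.
case: n f => // n f _ fP fU.
have fT T A : transvection_gen T -> A \in unitmx -> f (T *m A) = f A.
  elim=> [|i j t {}T ne gT IH] uA; first by rewrite mul1mx.
  rewrite -IH //.
  have [q qE] := polyfun_line (T *m A) (delta_mx i j *m (T *m A)) fP.
  have e s : (1%:M + s *: delta_mx i j) *m T *m A = T *m A + s *: (delta_mx i j *m (T *m A)).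
    by rewrite -mulmxA mulmxDl mul1mx -scalemxAl.
  rewrite e qE -[in RHS](addr0 (T *m A)) -(scale0r (delta_mx i j *m (T *m A))) qE.
  apply: poly_no_root => s; rewrite -qE -e; apply: fU.
  by rewrite !unitmx_mul uA transvection_unit // transvection_gen_unit.
have fD A : A \in unitmx -> f A = f (corner_mx n (\det A)).
  by move=> uA; have [T gT <-] := transvection_reduction uA; rewrite fT.
have cE (d : K) : corner_mx n d = corner_mx n 0 + d *: diag_mx (\row_j (j == ord_max)%:R).
  apply/matrixP => i j; rewrite !mxE; case: (i == ord_max); case: (i == j);
  by rewrite /= ?mulr0n ?mulr0 ?addr0 ?mulr1n ?mulr1 ?add0r.
have c1 : corner_mx n (1 : K) = 1%:M.
  by apply/matrixP => i j; rewrite !mxE; case: (i == ord_max).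
have [q qE] := polyfun_line (corner_mx n 0) (diag_mx (\row_j (j == ord_max)%:R)) fP.
have [s s0|k kE] := @poly_root0 q.
  by rewrite -qE -cE; apply: fU; rewrite unitmxE det_corner unitfE.
exists k => A.
have fU' B : B \in unitmx -> f B = f 1%:M * \det B ^+ k.
  by move=> uB; rewrite fD // cE qE kE -qE -cE c1.
have detP : polyfun (fun B : 'M[K]_n.+1 => \det B).
  by apply: polyfun_det => i j; apply: polyfun_lin => a x y; rewrite !mxE.
(* The identity is known on invertible matrices. Multiplied by the determinant it holds everywhere,
   and [polyfun_domain] cancels that factor. *)
have gP : polyfun (fun B => f B - f 1%:M * \det B ^+ k).
  by apply: polyfun_sub fP (polyfun_mul (polyfun_const _ _) (polyfun_exp _ _)).
have [|H|H] := polyfun_domain K0 gP detP.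
- move=> B; have [uB|] := boolP (B \in unitmx); first by rewrite fU' // subrr mul0r.
  by rewrite unitmxE unitfE negbK => /eqP ->; rewrite mulr0.
- by apply/eqP; rewrite -subr_eq0 H.
- by have := H 1%:M; rewrite det1 => /eqP; rewrite oner_eq0.
Qed.

End NonvanishingPolynomials.

(** * Central division algebras *)

Section CentralDivisionAlgebra.
Variables (F : fieldType) (D : falgType F).
Hypothesis Dunit : forall x : D, x != 0 -> x \is a GRing.unit.
Hypothesis Dcent : ('Z({:D}) = 1)%VS.
Local Notation n := (\dim {:D}).
Local Notation e := (vbasis {:D}).

Lemma central_scalar (x : D) : (forall y, x * y = y * x) -> exists c : F, x = c%:A.
Proof.
move=> xC; have : x \in 'Z({:D})%VS by rewrite memv_cap memvf; apply/centvP => y _; apply: xC.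
by rewrite Dcent => /vlineP.
Qed.

Lemma basis_eq0 (c : 'I_n -> F) : \sum_i c i *: e`_i = 0 -> forall i, c i = 0.
Proof. by move=> c0; have /freeP := basis_free (vbasisP {:D}); apply. Qed.

(** The shortest-relation argument, as an induction on the support. With one coefficient normalised
    to 1, the commutators of the coefficients with [y] satisfy a shorter relation and vanish; so all
    coefficients are central, hence in F, against the independence of the basis. *)
Lemma multiplication_free (a : 'I_n -> D) :
  (forall x, \sum_i a i * x * e`_i = 0) -> forall i, a i = 0.
Proof.
elim: {a}_.+1 {-2}a (ltnSn #|[pred i | a i != 0]|) => // m IH a.
rewrite ltnS => am a0 i0; apply: contraTeq isT => ai0 /=.
pose b i := (a i0)^-1 * a i.
have b0 x : \sum_i b i * x * e`_i = 0.
  rewrite -[RHS](mulr0 (a i0)^-1) -[in RHS](a0 x) mulr_sumr.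
  by apply: eq_bigr => i _; rewrite !mulrA.
have bi0 : b i0 = 1 by rewrite /b mulVr // Dunit.
have bC y i : b i * y = y * b i.
  apply/eqP; rewrite eq_sym -subr_eq0; apply/eqP; move: i.
  apply: (IH (fun i => y * b i - b i * y)) => [|x]; last first.
    transitivity (y * (\sum_i b i * x * e`_i) - \sum_i b i * (y * x) * e`_i).
      rewrite mulr_sumr -sumrB; apply: eq_bigr => i _.
      by rewrite !mulrBl !mulrA.
    by rewrite !b0 mulr0 subrr.
  apply: leq_trans am; apply: proper_card; apply/properP; split.
    apply/fintype.subsetP => i; rewrite !inE; apply: contraNneq => ai.
    by rewrite /b ai mulr0 mulr0 mul0r subrr.
  by exists i0; rewrite !inE // bi0 mulr1 mul1r subrr eqxx.
have bF i : exists c : F, b i = c%:A by apply: central_scalar => y; rewrite bC.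
have [c cE] := fin_all_exists bF.
have /basis_eq0/(_ i0) ci0 : \sum_i c i *: e`_i = 0.
  rewrite -[RHS](b0 1); apply: eq_bigr => i _.
  by rewrite mulr1 cE mulr_algl.
by move: bi0; rewrite cE ci0 scale0r => /esym/eqP; rewrite oner_eq0.
Qed.

(** A dimension count: the tuples [a] form a space of dimension n^2 that embeds into ['End(D)], of
    the same dimension. This is the isomorphism of D (x) D^op with End_F(D). *)
Lemma multiplication_span (T : 'End(D)) :
  exists a : 'I_n -> D, forall x, T x = \sum_i a i * x * e`_i.
Proof.
pose W : vectType F := {ffun 'I_n -> D}.
pose mulf (a : {ffun 'I_n -> D}) (x : D) : D := \sum_(i < n) a i * x * e`_i.
have mlin a : linear (mulf a).
  move=> c x y; rewrite scaler_sumr -big_split; apply: eq_bigr => i _ /=.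
  by rewrite mulrDr mulrDl -scalerAr -scalerAl.
pose mul (a : {ffun 'I_n -> D}) : {linear D -> D} := HB.pack (mulf a)
  (GRing.isLinear.Build _ _ _ _ _ (mlin a)).
pose th (a : {ffun 'I_n -> D}) : 'End(D) := linfun (mul a).
have thE a x : th a x = \sum_(i < n) a i * x * e`_i by rewrite lfunE.
have thlin : linear (th : W -> 'End(D)).
  move=> c a b; apply/lfunP => x; rewrite !lfunE /= !lfunE /= !thE.
  rewrite scaler_sumr -big_split; apply: eq_bigr => i _ /=.
  by rewrite !ffunE !mulrDl -!scalerAl.
pose Th : {linear W -> 'End(D)} := HB.pack (th : W -> 'End(D)) (GRing.isLinear.Build _ _ _ _ _ thlin).
have inj : lker (linfun Th) == 0%VS.
  rewrite -subv0; apply/subvP => a; rewrite memv_ker lfunE /= => /eqP a0.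
  rewrite memv0; apply/eqP/ffunP => i; rewrite ffunE.
  by apply: multiplication_free => x; rewrite -thE a0 lfunE.
have : T \in limg (linfun Th).
  suff -> : limg (linfun Th) = fullv by rewrite memvf.
  apply/eqP; rewrite eqEdim subvf limg_dim_eq; last by rewrite (eqP inj) capv0.
  by rewrite !dimvf /dim /= card_ord dimvf.
by case/memv_imgP => a _ ->; exists a => x; rewrite lfunE /= thE.
Qed.

(** Write g(x) as the sum of the a_i x e_i. Multiplicativity and freeness give g(x) a_i = a_i x for
    every i, so any non-zero coefficient serves as [w]. *)
Lemma skolem_noether (g : 'End(D)) :
  (forall x y, g (x * y) = g x * g y) -> g 1 = 1 ->
  exists2 w : D, w != 0 & forall x, g x * w = w * x.
Proof.
move=> gM g1; have [a aE] := multiplication_span g.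
have [i ai] : exists i, a i != 0.
  apply/existsP; apply: contraT; rewrite negb_exists => /forallP a0.
  have := aE 1; rewrite g1 big1 => [/eqP|i _]; first by rewrite oner_eq0.
  by move/negPn/eqP: (a0 i) => ->; rewrite !mul0r.
exists (a i) => // x; apply/eqP; rewrite -subr_eq0; apply/eqP; move: i {ai}.
apply: (multiplication_free (a := fun i => g x * a i - a i * x)) => y.
transitivity (g x * (\sum_i a i * y * e`_i) - \sum_i a i * (x * y) * e`_i).
  by rewrite mulr_sumr -sumrB; apply: eq_bigr => i _; rewrite !mulrBl !mulrA.
by rewrite -!aE gM subrr.
Qed.

Section Splitting.
Variables (K : fieldType) (iota : {rmorphism F -> K}) (delta : nat).
Variable phi : splitting iota D delta.
Hypothesis Ddim : n = (delta ^ 2)%N.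

Lemma degree_gt0 : (0 < delta)%N.
Proof.
suff : (0 < delta ^ 2)%N by rewrite expn_gt0 orbF.
rewrite -Ddim lt0n dimv_eq0; apply: contraTneq (oner_neq0 D) => D0.
by rewrite negbK -memv0 -D0 memvf.
Qed.

Lemma splitZ (c : F) (x : D) : phi (c *: x) = iota c *: phi x.
Proof. by rewrite -mulr_algl rmorphM split_scalar -mul_scalar_mx. Qed.

Lemma split_inj : injective phi.
Proof.
move=> x y /eqP; rewrite -subr_eq0 -rmorphB => /eqP xy0; apply/eqP; rewrite -subr_eq0.
apply: contraT => /Dunit u; have := degree_gt0.
have : phi ((x - y)^-1 * (x - y)) = 1 by rewrite mulVr // rmorph1.
rewrite rmorphM /= xy0 mulr0 => /matrixP E d0.
by have := E (Ordinal d0) (Ordinal d0); rewrite !mxE eqxx => /esym/eqP; rewrite oner_eq0.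
Qed.

(** A form on D, followed by the inclusion of the scalars, is a combination of two-sided
    multiplications. These make sense after [phi], so the form may be applied to a relation with
    coefficients in K: D (x) K embeds into the matrices. *)
Lemma splitting_free (I : finType) (k : I -> K) (x : I -> D) :
  \sum_i k i *: phi (x i) = 0 ->
  forall l : D -> F, scalar l -> \sum_i k i * iota (l (x i)) = 0.
Proof.
move=> k0 l lP.
have Tlin : linear (fun y : D => (l y)%:A : D).
  by move=> c y z; rewrite lP scalerDl scalerA.
pose T : {linear D -> D} := HB.pack (fun y : D => (l y)%:A : D)
  (GRing.isLinear.Build _ _ _ _ _ Tlin).
have [a aE] := multiplication_span (linfun T).
have TE y : (l y)%:A = \sum_i a i * y * e`_i :> D by rewrite -aE lfunE.
have : (\sum_i k i * iota (l (x i)))%:M = 0 :> 'M[K]_delta.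
  transitivity (\sum_j phi (a j) * (\sum_i k i *: phi (x i)) * phi e`_j).
    rewrite raddf_sum /=.
    transitivity (\sum_i k i *: phi (\sum_j a j * x i * e`_j)).
      apply: eq_bigr => i _; rewrite -TE split_scalar.
      by rewrite scale_scalar_mx.
    transitivity (\sum_i \sum_(j < n) k i *: phi (a j * x i * e`_j)).
      by apply: eq_bigr => i _; rewrite -scaler_sumr -(rmorph_sum phi).
    rewrite exchange_big; apply: eq_bigr => j _ /=.
    rewrite mulr_sumr mulr_suml; apply: eq_bigr => i _.
    by rewrite !rmorphM /= -!mulmxE -scalemxAr -scalemxAl.
  by rewrite big1 // => j _; rewrite k0 mulr0 mul0r.
move/matrixP/(_ (Ordinal degree_gt0) (Ordinal degree_gt0)).
by rewrite !mxE eqxx mulr1n.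
Qed.

Definition split_mx : 'M[K]_(n, delta * delta) := \matrix_i mxvec (phi e`_i).

Lemma split_mx_rank : \rank split_mx = n.
Proof.
apply/eqP; rewrite -/(row_free _); apply/row_freeP.
apply/row_freeP/inj_row_free => v v0; apply/rowP => i; rewrite mxE.
have v0' : \sum_j v 0 j *: phi e`_j = 0.
  apply: (can_inj mxvecK); rewrite linear0 -v0 mulmx_sum_row linear_sum.
  by apply: eq_bigr => j _; rewrite linearZ rowK.
have sc : scalar (coord e i) by move=> c x y; rewrite linearP.
rewrite -[RHS](splitting_free v0' sc) (bigD1 i) //= coord_free ?(basis_free (vbasisP _)) //.
rewrite eqxx rmorph1 mulr1 big1 ?addr0 // => j /negPf ji.
by rewrite coord_free ?(basis_free (vbasisP _)) // ji rmorph0 mulr0.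
Qed.

(** Coordinates in the K-basis of the matrices formed by the images of the basis of D. The
    pseudo-inverse is used because [split_mx] is square only through the equality [Ddim]. *)
Definition split_coord (A : 'M[K]_delta) (i : 'I_n) : K := (mxvec A *m pinvmx split_mx) 0 i.

Lemma split_coordP c A B i :
  split_coord (c *: A + B) i = c * split_coord A i + split_coord B i.
Proof. by rewrite /split_coord linearP mulmxDl -scalemxAl !mxE. Qed.

Lemma split_coordK A : \sum_i split_coord A i *: phi e`_i = A.
Proof.
apply: (can_inj mxvecK); rewrite linear_sum -[RHS](mulmxKpV (B := split_mx)); last first.
  suff : row_full split_mx by move/submx_full; apply.
  by rewrite /row_full split_mx_rank Ddim mulnn.
by rewrite mulmx_sum_row; apply: eq_bigr => i _; rewrite linearZ rowK.
Qed.

Lemma split_coord_phi (x : D) i : split_coord (phi x) i = iota (coord e i x).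
Proof.
have sc : scalar (coord e i) by move=> c y z; rewrite linearP.
(* The relation expresses [phi x] in the basis: index 0 carries [x] with coefficient -1, the others
   carry the basis. *)
pose k (j : 'I_n.+1) := if unlift ord0 j is Some j then split_coord (phi x) j else -1.
pose y (j : 'I_n.+1) := if unlift ord0 j is Some j then e`_j else x.
have k0 : \sum_j k j *: phi (y j) = 0.
  rewrite big_ord_recl /k /y unlift_none scaleN1r; under eq_bigr do rewrite liftK.
  by rewrite split_coordK addNr.
have := splitting_free k0 sc; rewrite big_ord_recl /k /y unlift_none mulN1r addrC.
under eq_bigr do rewrite liftK.
move/eqP; rewrite subr_eq0 => /eqP <-.
rewrite (bigD1 i) //= coord_free ?(basis_free (vbasisP _)) // eqxx rmorph1 mulr1.
rewrite big1 ?addr0 // => j /negPf ji.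
by rewrite coord_free ?(basis_free (vbasisP _)) // ji rmorph0 mulr0.
Qed.

(** The K-linear extension of a form on D to the matrices, which are D (x) K. *)
Definition ext_form (l : D -> F) (A : 'M[K]_delta) : K :=
  \sum_i split_coord A i * iota (l e`_i).

Lemma ext_formP l c A B : ext_form l (c *: A + B) = c * ext_form l A + ext_form l B.
Proof.
rewrite /ext_form mulr_sumr -big_split; apply: eq_bigr => i _ /=.
by rewrite split_coordP mulrDl mulrA.
Qed.

Lemma ext_form_phi l x : scalar l -> ext_form l (phi x) = iota (l x).
Proof.
move=> lP; pose l' : {linear D -> F^o} := HB.pack l (GRing.isLinear.Build F D F^o _ l lP).
rewrite {2}(coord_basis (vbasisP {:D}) (memvf x)) -[l]/(l' : D -> F) linear_sum rmorph_sum.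
by apply: eq_bigr => i _; rewrite split_coord_phi linearZ rmorphM.
Qed.

End Splitting.
End CentralDivisionAlgebra.

(** * Exponentials and elementary automorphisms *)

Section MatrixExponential.
Variables (K : fieldType) (N : nat).
Hypothesis K0 : [pchar K] =i pred0.
Implicit Types X Y Z : 'M[K]_N.

Local Notation expt i Z := ((i`!%:R : K)^-1 *: Z ^+ i).

Definition expmx m Z : 'M[K]_N := \sum_(i < m) expt i Z.

Lemma natS_neq0 i : i.+1%:R != 0 :> K.
Proof. by have /pcharf0P -> := K0. Qed.

Lemma factS_inv i : (i.+1%:R : K) * (i.+1`!%:R)^-1 = (i`!%:R)^-1.
Proof.
by rewrite factS natrM invfM mulrA mulfV ?natS_neq0 // mul1r.
Qed.

(** The hypothesis is the differential equation a' = Z a - a Y for the series a(t) with coefficients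
    [a i]; its solution satisfies exp(tZ) a(0) = a(t) exp(tY), and the conclusion is the coefficient
    of t^n. *)
Lemma expt_intertwine Z Y (a : nat -> 'M[K]_N) :
  (forall i, Z *m a i = i.+1%:R *: a i.+1 + a i *m Y) ->
  forall n, expt n Z *m a 0%N = \sum_(i < n.+1) a i *m expt (n - i) Y.
Proof.
move=> aS; elim=> [|n IH].
  by rewrite big_ord1 !expr0 fact0 invr1 !scale1r mulmx1 mul1mx.
apply: (scalerI (natS_neq0 n)); rewrite scalemxAl scalerA factS_inv exprS -mulmxE scalemxAr -mulmxA IH.
rewrite mulmx_sumr.
transitivity (\sum_(i < n.+1) i.+1%:R *: (a i.+1 *m expt (n - i) Y)
   + \sum_(i < n.+1) (n.+1 - i)%:R *: (a i *m expt (n.+1 - i) Y)).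
  rewrite -big_split; apply: eq_bigr => i _ /=.
  rewrite mulmxA aS mulmxDl -scalemxAl; congr (_ + _).
  rewrite (subSn (_ : i <= n)%N) -1?ltnS // exprS -mulmxE -!scalemxAr scalerA factS_inv.
  by rewrite mulmxA.
rewrite scaler_sumr [in RHS](eq_bigr (fun i : 'I_n.+2 => i%:R *: (a i *m expt (n.+1 - i) Y) +
  (n.+1 - i)%:R *: (a i *m expt (n.+1 - i) Y))); last first.
  by move=> i _; rewrite -scalerDl -natrD subnKC // -ltnS.
rewrite big_split /=; congr (_ + _).
  by rewrite [RHS]big_ord_recl /= scale0r add0r; apply: eq_bigr => i _; rewrite subSS.
by rewrite [RHS]big_ord_recr /= subnn scale0r addr0.
Qed.

Lemma triangular_sum (A : nmodType) M (G : nat -> nat -> A) :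
  \sum_(n < M) \sum_(i < n.+1) G i (n - i)%N = \sum_(i < M) \sum_(j < M - i) G i j.
Proof.
elim: M => [|M IH]; first by rewrite !big_ord0.
rewrite big_ord_recr IH [RHS]big_ord_recr /= subSnn big_ord1.
rewrite [X in _ + X]big_ord_recr /= subnn addrA; congr (_ + _).
rewrite -big_split; apply: eq_bigr => i _ /=.
by rewrite subSn ?big_ord_recr // ltnW.
Qed.

Lemma expmx_stable m m' Z : Z ^+ m = 0 -> (m <= m')%N -> expmx m' Z = expmx m Z.
Proof.
move=> Z0 /subnK <-; rewrite addnC /expmx big_split_ord /= [X in _ + X]big1 ?addr0 //.
by move=> i _; rewrite exprD Z0 mul0r scaler0.
Qed.

Lemma expmx_intertwine m k Z Y (a : nat -> 'M[K]_N) :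
  Z ^+ m = 0 -> Y ^+ m = 0 -> (forall i, (k <= i)%N -> a i = 0) ->
  (forall i, Z *m a i = i.+1%:R *: a i.+1 + a i *m Y) ->
  expmx m Z *m a 0%N = (\sum_(i < k) a i) *m expmx m Y.
Proof.
move=> Z0 Y0 ak aS.
(* With [k + m] terms the triangular sum contains every product of some [a i], [i < k], with a power
   of [Y] below [m]. *)
rewrite -(expmx_stable Z0 (leq_addl k m)) /expmx mulmx_suml.
under eq_bigr do rewrite (expt_intertwine aS).
rewrite (triangular_sum _ (fun i j => a i *m expt j Y)) big_split_ord /=.
rewrite [X in _ + X]big1 ?addr0 => [|i _]; last first.
  by rewrite big1 // => j _; rewrite ak ?mul0mx // leq_addr.
rewrite mulmx_suml; apply: eq_bigr => i _.
rewrite -mulmx_sumr -/(expmx _ Y) (expmx_stable Y0) // -addnBAC ?leq_addl //.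
exact: ltnW.
Qed.
End MatrixExponential.

Section ExpConjugation.
Variables (K : fieldType) (N : nat).
Hypothesis K0 : [pchar K] =i pred0.
Implicit Types X Y Z : 'M[K]_N.

Definition mxad X Y : 'M[K]_N := X *m Y - Y *m X.

Lemma mxadP X c Y1 Y2 : mxad X (c *: Y1 + Y2) = c *: mxad X Y1 + mxad X Y2.
Proof.
rewrite /mxad mulmxDr mulmxDl -scalemxAr -scalemxAl scalerBr.
by rewrite opprD addrACA.
Qed.

Lemma mxad0 X : mxad X 0 = 0.
Proof. by rewrite /mxad mulmx0 mul0mx subrr. Qed.

Lemma iter_mxad0 X i : iter i (mxad X) 0 = 0.
Proof. by elim: i => //= i ->; rewrite mxad0. Qed.

(** The series is that of exp(tZ) Y exp(-tZ), with coefficients (ad Z)^i Y / i!, which solves the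
    equation with Z on both sides. *)
Lemma expmx_conj m k Z Y : Z ^+ m = 0 -> iter k (mxad Z) Y = 0 ->
  expmx m Z *m Y = (\sum_(i < k) (i`!%:R)^-1 *: iter i (mxad Z) Y) *m expmx m Z.
Proof.
move=> Z0 adZ0; have := @expmx_intertwine K N K0 m k Z Z (fun i => (i`!%:R)^-1 *: iter i (mxad Z) Y).
rewrite /= fact0 invr1 scale1r; apply=> // [i ki|i].
  by rewrite -(subnK ki) iterD adZ0 iter_mxad0 scaler0.
by rewrite scalerA factS_inv // -scalemxAr -scalemxAl -scalerDr subrK.
Qed.

Lemma expmx0 m : expmx m.+1 (0 : 'M[K]_N) = 1%:M.
Proof.
rewrite /expmx big_ord_recl big1 ?addr0 => [|i _]; first by rewrite fact0 invr1 scale1r.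
by rewrite exprS mul0r scaler0.
Qed.

Lemma expmxN m Z : Z ^+ m.+1 = 0 -> expmx m.+1 (- Z) *m expmx m.+1 Z = 1%:M.
Proof.
move=> Z0; have NZ0 i : (m.+1 <= i)%N -> (- Z) ^+ i = 0.
  by move=> le; rewrite -(subnK le) exprD [X in _ * X]exprNn Z0 !mulr0.
have := @expmx_intertwine K N K0 m.+1 m.+1 0 Z (fun i => (i`!%:R)^-1 *: (- Z) ^+ i).
rewrite /= expr0 fact0 invr1 scale1r => <- //.
- by rewrite expmx0 mulmx1.
- by rewrite exprS mul0r.
- by move=> i /NZ0 ->; rewrite scaler0.
move=> i; rewrite mul0mx scalerA factS_inv // -scalemxAl -scalerDr exprSr -mulmxE.
by rewrite mulmxN addNr scaler0.
Qed.

Lemma expmx_unit m Z : Z ^+ m.+1 = 0 -> expmx m.+1 Z \in unitmx.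
Proof. by move/expmxN/mulmx1_unit => []. Qed.

Lemma iter_mxad_rank1 X (c : K) (y : 'cV[K]_N) (v : 'rV[K]_N) i : v *m X = c *: v ->
  iter i (mxad X) (y *m v) = ((X - c%:M) ^+ i *m y) *m v.
Proof.
move=> vX; elim: i => [|i IH] /=; first by rewrite expr0 mul1mx.
rewrite IH /mxad -!mulmxA vX exprS -mulmxE -!mulmxA mulmxBl mul_scalar_mx.
by rewrite -!scalemxAr.
Qed.

End ExpConjugation.

Lemma eigenrow (K : closedFieldType) N (X : 'M[K]_N) : (0 < N)%N ->
  exists c (v : 'rV[K]_N), v *m X = c *: v /\ v != 0.
Proof.
move=> N0; have [|c] := closed_rootP (char_poly X) _.
  by rewrite size_char_poly; case: N N0 {X}.
by rewrite -eigenvalue_root_char => /eigenvalueP[v vX v0]; exists c, v.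
Qed.

Lemma mul_col_row_eq0 (K : fieldType) N (A : 'M[K]_N) (v : 'rV[K]_N) : v != 0 ->
  (forall y : 'cV[K]_N, (A *m y) *m v = 0) -> A = 0.
Proof.
move=> /rV0Pn[j vj] A0; apply/matrixP => i k.
have /matrixP/(_ i j)/eqP := A0 (delta_mx k 0).
by rewrite -colE !mxE big_ord1 !mxE mulf_eq0 (negPf vj) orbF => /eqP.
Qed.

(** For a left eigenvector [v] of eigenvalue [c], ad X sends the rank-one matrix y v to ((X - c) y)
    v, so its nilpotency passes to X - c. *)
Lemma mxad_nilpotent (K : closedFieldType) N (X : 'M[K]_N) k : (0 < N)%N ->
  (forall Y, iter k (mxad X) Y = 0) -> exists c, (X - c%:M) ^+ k = 0.
Proof.
move=> N0 X0; have [c [v [vX v0]]] := eigenrow X N0.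
by exists c; apply: (mul_col_row_eq0 v0) => y; rewrite -(iter_mxad_rank1 y k vX).
Qed.

(** * Matrix realisations of a Lie algebra and of its scalar extension *)

Section LieRealization.
Import passmx.
Variables (F K : fieldType) (iota : {rmorphism F -> K}) (L : lieType F).
Hypothesis K0 : [pchar K] =i pred0.
Variables (N : nat) (rho : L -> 'M[K]_N).
Local Notation n := (\dim {:L}).
Local Notation e := (vbasis {:L}).
Local Notation LK := (lie_ext iota L).
Hypothesis rhoP : forall a x y, rho (a *: x + y) = iota a *: rho x + rho y.
Hypothesis rho_lie : forall x y, rho (lie x y) = mxad (rho x) (rho y).
Hypothesis rho_free : forall k : 'I_n -> K, \sum_i k i *: rho e`_i = 0 -> forall i, k i = 0.

Definition rho_ext (u : LK) : 'M[K]_N := \sum_i (u : 'rV_n) 0 i *: rho e`_i.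

Lemma rho_extP a u v : rho_ext (a *: u + v) = a *: rho_ext u + rho_ext v.
Proof.
rewrite /rho_ext scaler_sumr -big_split; apply: eq_bigr => i _ /=.
by rewrite !mxE scalerDl scalerA.
Qed.

Lemma rho_ext0 : rho_ext 0 = 0.
Proof. by rewrite /rho_ext big1 // => i _; rewrite mxE scale0r. Qed.

Lemma rho_extD u v : rho_ext (u + v) = rho_ext u + rho_ext v.
Proof. by rewrite -[u]scale1r rho_extP !scale1r. Qed.

Lemma rho_extZ a u : rho_ext (a *: u) = a *: rho_ext u.
Proof. by rewrite -[a *: u]addr0 rho_extP rho_ext0 addr0. Qed.

Lemma rho_ext_inj : injective rho_ext.
Proof.
move=> u v uv; apply/rowP => i; apply/eqP; rewrite -subr_eq0; apply/eqP.
move: i; apply: (rho_free (k := fun i => (u : 'rV_n) 0 i - (v : 'rV_n) 0 i)).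
transitivity (rho_ext u - rho_ext v); last by rewrite uv subrr.
by rewrite /rho_ext -sumrB; apply: eq_bigr => i _; rewrite scalerBl.
Qed.

Lemma rho0 : rho 0 = 0.
Proof. by have := rhoP (-1) 0 0; rewrite scaler0 addr0 rmorphN1 scaleN1r addNr. Qed.

Lemma rho_ext_to_ext x : rho_ext (to_ext iota x) = rho x.
Proof.
rewrite [in RHS](coord_vbasis (memvf x)).
rewrite (big_morph rho (fun a b => _ : rho (a + b) = rho a + rho b) rho0); last first.
  by move=> a b; rewrite -[a]scale1r rhoP rmorph1 !scale1r.
apply: eq_bigr => i _; rewrite /to_ext !mxE.
by rewrite -[in RHS](addr0 (_ *: _)) rhoP rho0 addr0.
Qed.

Lemma rho_ext_lie u v : rho_ext (lie u v) = mxad (rho_ext u) (rho_ext v).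
Proof.
have adl X : mxad 0 X = 0 by rewrite /mxad mul0mx mulmx0 subrr.
have adDl c X Y Z : mxad (c *: X + Y) Z = c *: mxad X Z + mxad Y Z.
  by rewrite /mxad mulmxDl mulmxDr -scalemxAr -scalemxAl scalerBr opprD addrACA.
elim/ext_ind: u => [|a u u' IHu IHu'|x].
- by rewrite lie0l rho_ext0 adl.
- by rewrite lie_linearl !rho_extP adDl IHu IHu'.
elim/ext_ind: v => [|a v v' IHv IHv'|y].
- by rewrite lie0r rho_ext0 mxad0.
- by rewrite lie_linearr !rho_extP mxadP IHv IHv'.
by rewrite [lie _ _]ext_bracket_to_ext !rho_ext_to_ext rho_lie.
Qed.

Lemma iter_rho_ext_lie u v i : rho_ext (iter i (lie u) v) = iter i (mxad (rho_ext u)) (rho_ext v).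
Proof. by elim: i => //= i IH; rewrite rho_ext_lie IH. Qed.

Lemma exp_adE (L' : lieType K) k (x y : L') :
  exp_ad k x y = \sum_(i < k) (i`!%:R)^-1 *: iter i (lie x) y.
Proof.
have lin : linear (fun y : L' => \sum_(i < k) (i`!%:R : K)^-1 *: iter i (lie x) y).
  move=> c {}y z; rewrite scaler_sumr -big_split; apply: eq_bigr => i _ /=.
  have -> : iter i (lie x) (c *: y + z) = c *: iter i (lie x) y + iter i (lie x) z.
    by elim: (i : nat) => //= j ->; rewrite lie_linearr.
  by rewrite scalerDr !scalerA mulrC.
pose f : {linear L' -> L'} := HB.pack (fun y : L' => \sum_(i < k) (i`!%:R : K)^-1 *: iter i (lie x) y)
  (GRing.isLinear.Build _ _ _ _ _ lin).
by rewrite /exp_ad -[LHS]/(linfun f y) lfunE.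
Qed.

(** Subtracting the scalar [c] does not change ad and makes the matrix nilpotent, so that its
    exponential is a finite sum. *)
Lemma rho_ext_exp_ad m k c (x : LK) u : (rho_ext x - c%:M) ^+ m = 0 ->
  (forall y, iter k (lie x) y = 0) ->
  expmx m (rho_ext x - c%:M) *m rho_ext u =
  rho_ext (exp_ad k x u) *m expmx m (rho_ext x - c%:M).
Proof.
move=> Z0 x0; have adE : mxad (rho_ext x - c%:M) =1 mxad (rho_ext x).
  by move=> Y; rewrite /mxad mulmxBl mulmxBr scalar_mxC opprB addrA subrK.
have it i Y : iter i (mxad (rho_ext x - c%:M)) Y = iter i (mxad (rho_ext x)) Y.
  exact: eq_iter.
rewrite (@expmx_conj _ _ K0 m k) // ?it -?iter_rho_ext_lie ?x0 ?rho_ext0 //.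
rewrite exp_adE (big_morph _ rho_extD rho_ext0); congr (_ *m _).
by apply: eq_bigr => i _; rewrite rho_extZ iter_rho_ext_lie it.
Qed.

Lemma lfun_ext_to_ext (g : 'End(L)) x : lfun_ext iota g (to_ext iota x) = to_ext iota (g x).
Proof.
have lin : linear (fun u : LK => (u : 'rV[K]_n) *m map_mx iota (mxof e e g) : LK).
  by move=> c u v; rewrite mulmxDl -scalemxAl.
pose f : {linear LK -> LK} := HB.pack (fun u : LK => (u : 'rV[K]_n) *m map_mx iota (mxof e e g) : LK)
  (GRing.isLinear.Build _ _ _ _ _ lin).
rewrite /lfun_ext -[LHS]/(linfun f (to_ext iota x)) lfunE /= /to_ext.
by rewrite -map_mxM -rVof_app // vbasisP.
Qed.

Lemma rho_ext_lfun_ext (g : 'End(L)) P Q :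
  (forall x, P *m rho x = rho (g x) *m Q) ->
  forall u, P *m rho_ext u = rho_ext (lfun_ext iota g u) *m Q.
Proof.
move=> gP; elim/ext_ind => [|a u v IHu IHv|x].
- by rewrite linear0 rho_ext0 mulmx0 mul0mx.
- by rewrite linearP !rho_extP mulmxDr mulmxDl -scalemxAl -scalemxAr IHu IHv.
- by rewrite lfun_ext_to_ext !rho_ext_to_ext.
Qed.

Lemma lfun_ext_rho (g : 'End(L)) P Q :
  (forall u, P *m rho_ext u = rho_ext (lfun_ext iota g u) *m Q) ->
  forall x, P *m rho x = rho (g x) *m Q.
Proof. by move=> gP x; rewrite -!rho_ext_to_ext gP lfun_ext_to_ext. Qed.

(** The matrices that induce elementary automorphisms of the extended algebra by conjugation.
    Without inverses in the relation, products and non-zero multiples are immediate. *)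
Definition elementary_conj (P : 'M[K]_N) : Prop :=
  exists2 g : 'End(LK), elementary g & forall u, P *m rho_ext u = rho_ext (g u) *m P.

Lemma elementary_comp (L' : lieType K) (g h : 'End(L')) :
  elementary g -> elementary h -> elementary (g \o h)%VF.
Proof.
elim=> [|k x {}g x0 _ IH] eh; first by rewrite comp_lfun1l.
by rewrite -comp_lfunA; apply: elementary_exp => //; apply: IH.
Qed.

Lemma elementary_conjM P Q :
  elementary_conj P -> elementary_conj Q -> elementary_conj (P *m Q).
Proof.
move=> [g eg gP] [h eh hQ]; exists (g \o h)%VF; first exact: elementary_comp.
by move=> u; rewrite lfunE /= mulmxA -gP -!mulmxA hQ.
Qed.

Lemma elementary_conjZ c P : c != 0 -> elementary_conj P -> elementary_conj (c *: P).
Proof. by move=> c0 [g eg gP]; exists g => // u; rewrite -scalemxAl gP scalemxAr. Qed.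

Lemma elementary_conj1 : elementary_conj 1%:M.
Proof.
by exists \1%VF; [exact: elementary_id | move=> u; rewrite lfunE /= mulmx1 mul1mx].
Qed.

Lemma elementary_conj_exp m (x : LK) : rho_ext x ^+ m = 0 -> elementary_conj (expmx m (rho_ext x)).
Proof.
move=> Z0; set Z := rho_ext x in Z0 *.
(* Strengthened for the induction: each ad Z puts one more factor Z on the left or on the right, and
   of 2m factors one side receives at least m. *)
have ad0 Y i a b : (m + m <= a + b + i)%N -> Z ^+ a *m iter i (mxad Z) Y *m Z ^+ b = 0.
  elim: i a b => [|i IH] a b le /=.
    have [le'|le'] := leqP m a.
      by rewrite -(subnK le') exprD Z0 mulr0 !mul0mx.
    have le2 : (m <= b)%N by lia.
    by rewrite -(subnKC le2) exprD Z0 mul0r mulmx0.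
  rewrite {1}/mxad mulmxBr mulmxBl.
  have := IH a.+1 b; rewrite exprSr -mulmxE !mulmxA => ->; last lia.
  by have := IH a b.+1; rewrite exprS -mulmxE !mulmxA => ->; [rewrite subrr | lia].
have x0 y : iter (m + m) (lie x) y = 0.
  apply: rho_ext_inj; rewrite iter_rho_ext_lie rho_ext0.
  by have := ad0 (rho_ext y) (m + m)%N 0%N 0%N (leqnn _); rewrite mul1mx mulmx1.
exists (exp_ad (m + m) x \o \1)%VF; first exact: elementary_exp x0 (elementary_id _).
move=> u; rewrite comp_lfun1r; have := @rho_ext_exp_ad m (m + m) 0 x u.
by rewrite raddf0 subr0; apply.
Qed.

Lemma elementary_conj_ext (g : 'End(L)) P : P \in unitmx ->
  (forall x, P *m rho x = rho (g x) *m P) ->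
  elementary_conj P -> elementary (lfun_ext iota g).
Proof.
move=> uP gP [h eh hP]; suff -> : lfun_ext iota g = h by [].
apply/lfunP => u; apply: rho_ext_inj.
by rewrite -[LHS](mulmxK uP) -[RHS](mulmxK uP) -hP -(rho_ext_lfun_ext gP).
Qed.

End LieRealization.

(** * Quadratic forms over local fields *)

Section NonarchAbs.
Variables (R : realType) (K : fieldType) (v : K -> R).
Hypothesis vP : nonarch_abs v.

Lemma nonarch0 : v 0 = 0.
Proof. exact/(nonarch_eq0 vP). Qed.

Lemma nonarch_neq0 x : (v x != 0) = (x != 0).
Proof. by congr negb; apply/eqP/eqP => /(nonarch_eq0 vP). Qed.

Lemma nonarch_gt0 x : (0 < v x) = (x != 0).
Proof. by rewrite lt_neqAle eq_sym nonarch_neq0 (nonarch_ge0 vP) andbT. Qed.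

Lemma nonarch1 : v 1 = 1.
Proof.
apply: (mulfI (_ : v 1 != 0)); first by rewrite nonarch_neq0 oner_neq0.
by rewrite -(nonarchM vP) !mulr1.
Qed.

Lemma nonarchX x k : v (x ^+ k) = v x ^+ k.
Proof. by elim: k => [|k IH]; rewrite ?expr0 ?nonarch1 // !exprS (nonarchM vP) IH. Qed.

Lemma nonarchN x : v (- x) = v x.
Proof.
apply/eqP; rewrite -(eqrXn2 (n := 2)) ?(nonarch_ge0 vP) //.
by rewrite -!nonarchX sqrrN.
Qed.

Lemma nonarchV x : v x^-1 = (v x)^-1.
Proof.
have [->|x0] := eqVneq x 0; first by rewrite invr0 nonarch0 invr0.
apply: (mulfI (_ : v x != 0)); first by rewrite nonarch_neq0.
by rewrite -(nonarchM vP) !mulfV ?nonarch_neq0 // nonarch1.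
Qed.

Lemma nonarchBC x y : v (x - y) = v (y - x).
Proof. by rewrite -nonarchN opprB. Qed.

Lemma nonarchD_lt x y r : v x < r -> v y < r -> v (x + y) < r.
Proof. by move=> xr yr; apply: le_lt_trans (nonarchD vP _ _) _; rewrite gt_max xr. Qed.

Lemma nonarchB_lt x y r : v x < r -> v y < r -> v (x - y) < r.
Proof. by rewrite -(nonarchN y); apply: nonarchD_lt. Qed.

Lemma nonarchD_le x y r : v x <= r -> v y <= r -> v (x + y) <= r.
Proof. by move=> xr yr; apply: le_trans (nonarchD vP _ _) _; rewrite ge_max xr. Qed.

Lemma nonarchB_le x y r : v x <= r -> v y <= r -> v (x - y) <= r.
Proof. by rewrite -(nonarchN y); apply: nonarchD_le. Qed.

Lemma nonarch_tri x y z r : v (x - y) < r -> v (y - z) < r -> v (x - z) < r.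
Proof. by move=> xy yz; rewrite -(subrK y x) -addrA; apply: nonarchD_lt. Qed.

Lemma nonarch_eq x y : v (x - y) < v y -> v x = v y.
Proof.
move=> xy; apply/eqP; rewrite eq_le; apply/andP; split.
  by rewrite -[x](subrK y) nonarchD_le // ltW.
rewrite leNgt; apply/negP => lt.
have : v (x - (x - y)) < v y by apply: nonarchB_lt.
by rewrite opprB addrCA subrr addr0 ltxx.
Qed.

Lemma nonarch_sum_lt (I : Type) (r : seq I) (P : pred I) (F : I -> K) e : 0 < e ->
  (forall i, P i -> v (F i) < e) -> v (\sum_(i <- r | P i) F i) < e.
Proof.
move=> e0 Fe; elim/big_ind: _ => [||//]; first by rewrite nonarch0.
by move=> x y; apply: nonarchD_lt.
Qed.

Lemma nonarch_nat k : v k%:R <= 1.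
Proof.
elim: k => [|k IH]; first by rewrite nonarch0 ler01.
by rewrite -natr1 nonarchD_le // nonarch1.
Qed.

(** In an ultrametric sum a term of largest value cannot be cancelled when no other term has the
    same value. *)
Lemma nonarch_sum_distinct (I : finType) (t : I -> K) :
  (forall i j, t i != 0 -> t j != 0 -> v (t i) = v (t j) -> i = j) ->
  \sum_i t i = 0 -> forall i, t i = 0.
Proof.
move=> tinj t0 i0; pose m := [arg max_(i > i0) v (t i)]%O.
have mP j : v (t j) <= v (t m) by rewrite /m; case: arg_maxP => // i _; apply.
have [tm|tm] := eqVneq (t m) 0.
  apply/eqP; rewrite -[_ == 0]negbK -nonarch_neq0 negbK eq_le (nonarch_ge0 vP) andbT.
  by rewrite -nonarch0 -tm.
move: t0; rewrite (bigD1 m) //= => /eqP; rewrite addr_eq0 => /eqP tmE.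
have : v (t m) < v (t m); last by rewrite ltxx.
rewrite {1}tmE nonarchN nonarch_sum_lt ?nonarch_gt0 // => j jm.
have [->|tj] := eqVneq (t j) 0; first by rewrite nonarch0 nonarch_gt0.
by rewrite lt_neqAle mP andbT; apply: contraNneq jm => /tinj ->.
Qed.

Definition cauchy_seq (u : nat -> K) := forall eps : R, 0 < eps ->
  exists N : nat, forall m n : nat, (N <= m)%N -> (N <= n)%N -> v (u m - u n) < eps.

Definition converges_to (u : nat -> K) l := forall eps : R, 0 < eps ->
  exists N : nat, forall n : nat, (N <= n)%N -> v (u n - l) < eps.

Lemma limit_unique u l l' : converges_to u l -> converges_to u l' -> l = l'.
Proof.
move=> ul ul'; apply/eqP; rewrite -subr_eq0 -[_ == 0]negbK -nonarch_gt0; apply/negP => gt0.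
have [N1 H1] := ul _ gt0; have [N2 H2] := ul' _ gt0.
have : v (l - l') < v (l - l'); last by rewrite ltxx.
apply: (@nonarch_tri _ (u (maxn N1 N2))); first by rewrite nonarchBC H1 // leq_maxl.
by rewrite H2 // leq_maxr.
Qed.

Lemma converges_cauchy u l : converges_to u l -> cauchy_seq u.
Proof.
move=> ul e e0; have [N H] := ul e e0; exists N => m n Nm Nn.
by apply: (@nonarch_tri _ l); [exact: H | rewrite nonarchBC H].
Qed.

(** Bernoulli's inequality for 1/r = 1 + h and the archimedean property. *)
Lemma exprn_small (r e : R) : 0 <= r < 1 -> 0 < e -> exists k : nat, r ^+ k < e.
Proof.
move=> /andP[r0 r1] e0; have [->|rn0] := eqVneq r 0; first by exists 1%N; rewrite expr1.
have {rn0}r0 : 0 < r by rewrite lt_neqAle eq_sym rn0.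
pose h := r^-1 - 1; have h0 : 0 < h by rewrite subr_gt0 invf_gt1.
have bern k : 1 + h *+ k <= (1 + h) ^+ k.
  elim: k => [|k IH]; first by rewrite mulr0n addr0 expr0.
  rewrite exprS mulrS; have : 0 <= h * (h *+ k) by rewrite mulr_ge0 ?mulrn_wge0 // ltW.
  have : (1 + h) * (1 + h *+ k) <= (1 + h) * (1 + h) ^+ k by rewrite ler_pM2l // addr_gt0.
  by move: (_ ^+ k) (h *+ k) => a b; nra.
pose k := (Num.truncn (e^-1 / h)).+1.
have kP : e^-1 < h *+ k.
  by rewrite -mulr_natl -ltr_pdivrMr // truncnS_gt.
exists k; rewrite -[r]invrK exprVn -[e]invrK ltf_pV2 ?posrE ?exprn_gt0 ?invr_gt0 //.
apply: lt_le_trans kP _; apply: le_trans (_ : 1 + h *+ k <= _); first by rewrite lerDr.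
by have := bern k; rewrite /h subrKC.
Qed.

Hypothesis vcomplete : abs_complete v.
Hypothesis v2 : v 2%:R = 1.

(* The root is 1 + z where z is the fixed point of the contraction z |-> (y - z^2)/2. *)
Lemma hensel_sqrt y : v y < 1 -> exists z, (1 + z) ^+ 2 = 1 + y.
Proof.
move=> y1; have two0 : 2%:R != 0 :> K by rewrite -nonarch_neq0 v2 oner_neq0.
pose f z : K := (y - z ^+ 2) / 2%:R; pose u k := iter k f 0.
have vf z : v (f z) = v (y - z ^+ 2) by rewrite (nonarchM vP) nonarchV v2 invr1 mulr1.
have uy k : v (u k) <= v y.
  elim: k => [|k IH]; first by rewrite nonarch0 (nonarch_ge0 vP).
  rewrite /u iterS vf nonarchB_le // nonarchX expr2.
  apply: le_trans (_ : v y * v y <= _); last by rewrite ler_piMr ?(nonarch_ge0 vP) // ltW.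
  by rewrite ler_pM ?(nonarch_ge0 vP).
have fB z w : v (f z - f w) = v (z - w) * v (z + w).
  rewrite -mulrBl (nonarchM vP) nonarchV v2 invr1 mulr1 -(nonarchM vP) -nonarchN.
  by congr v; ring.
have step k : v (u k.+1 - u k) <= v y ^+ k.+1.
  elim: k => [|k IH]; first by rewrite expr1 nonarchB_le.
  rewrite {1}/u iterS [u k.+1]iterS fB exprSr.
  by rewrite ler_pM ?(nonarch_ge0 vP) // nonarchD_le //; [apply: (uy k.+1) | apply: uy].
have far k j : v (u (k + j)%N - u k) <= v y ^+ k.
  elim: j => [|j IH]; first by rewrite addn0 subrr nonarch0 exprn_ge0 ?(nonarch_ge0 vP).
  rewrite addnS -(subrK (u (k + j)%N) (u (k + j).+1)) -addrA nonarchD_le //.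
  apply: le_trans (step _) _.
  by rewrite -addnS exprD ler_piMr ?exprn_ge0 ?exprn_ile1 ?(nonarch_ge0 vP) // ltW.
have far2 k m : (k <= m)%N -> v (u m - u k) <= v y ^+ k by move=> /subnKC <-.
have [z zP] : exists z, converges_to u z.
  apply: vcomplete => e e0; have vy : 0 <= v y < 1 by rewrite (nonarch_ge0 vP).
  have [k ke] := exprn_small vy e0.
  exists k => m n km kn; apply: (@nonarch_tri _ (u k)).
    by apply: le_lt_trans ke; apply: far2.
  by rewrite nonarchBC; apply: le_lt_trans ke; apply: far2.
exists z; have fz : f z = z.
  apply/eqP; rewrite -subr_eq0 -[_ == 0]negbK -nonarch_gt0; apply/negP => gt0.
  have [N H] := zP _ gt0.
  have zy : v z <= 1.
    have [N' H'] := zP 1 ltr01; rewrite -(subKr (u N') z) nonarchB_le //; first by rewrite (le_trans (uy _)) // ltW.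
    by rewrite ltW // H'.
  have : v (f z - z) < v (f z - z); last by rewrite ltxx.
  apply: (@nonarch_tri _ (u N.+1)); last exact/H/leqnSn.
  rewrite [u _]iterS fB nonarchBC; apply: le_lt_trans (H N (leqnn N)).
  rewrite ler_piMr ?(nonarch_ge0 vP) // nonarchD_le //.
  by rewrite (le_trans (uy _)) // ltW.
have {}fz : y - z ^+ 2 = z * 2%:R by rewrite -[in RHS]fz /f divfK.
by rewrite -[y in RHS](subrK (z ^+ 2)) fz; ring.
Qed.

End NonarchAbs.

(** * Finite extensions of the p-adic numbers *)

Section LocalField.
Variables (R : realType) (p : nat) (Qp : fieldType) (absp : Qp -> R).
Hypothesis HQp : is_padic_numbers p absp.
Variables (F : fieldExtType Qp) (v : F -> R).
Hypothesis vP : nonarch_abs v.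
Hypothesis vQp : forall c : Qp, v c%:A = absp c.
Local Notation apP := (padic_abs HQp).

Lemma absZ (c : Qp) (x : F) : v (c *: x) = absp c * v x.
Proof. by rewrite -mulr_algl (nonarchM vP) vQp. Qed.

Lemma p_gt1 : 1 < p%:R :> R.
Proof. by rewrite ltr1n prime_gt1 // (padic_prime HQp). Qed.

Lemma absp_p : absp p%:R = p%:R^-1.
Proof.
have pp := padic_prime HQp.
by rewrite (padic_nat HQp) ?prime_gt0 // logn_prime // eqxx expr1.
Qed.

Lemma v_nat n : v n%:R = absp n%:R.
Proof. by rewrite -vQp scaler_nat. Qed.

Lemma pchar_local : [pchar F] =i pred0.
Proof.
apply/pcharf0P => n; apply/idP/idP => [|/eqP -> //]; apply: contraLR; rewrite -lt0n => n0.
rewrite -(nonarch_neq0 vP) v_nat (padic_nat HQp) // invr_neq0 // expf_neq0 //.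
by rewrite pnatr_eq0 -lt0n prime_gt0 // (padic_prime HQp).
Qed.

(** The point is that the coordinates along [e] form a Cauchy sequence. Otherwise differences of
    [u], divided by differences of coordinates bounded away from 0, exhibit -e as a limit of
    elements of the complete space [W], hence as one of its elements. *)
Lemma complete_add_line (W : {vspace F}) (e : F) :
  (forall u, (forall n, u n \in W) -> cauchy_seq v u -> exists2 l, l \in W & converges_to v u l) ->
  forall u, (forall n, u n \in (<[e]> + W)%VS) -> cauchy_seq v u ->
  exists2 l, l \in (<[e]> + W)%VS & converges_to v u l.
Proof.
move=> Wc u uP uc; have [eW|eW] := boolP (e \in W).
  have sub : (<[e]> + W <= W)%VS by rewrite subv_add subvv andbT -memvE.
  have [n|l lW ul] := Wc u _ uc; first exact: subvP (uP n).
  by exists l => //; apply: subvP (addvSr _ _) _ lW.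
have /choice[cw cwP] n : exists c : Qp * F, c.2 \in W /\ u n = c.1 *: e + c.2.
  by have /memv_addP[_ /vlineP[c ->] [w wW E]] := uP n; exists (c, w).
pose c n := (cw n).1; pose w n := (cw n).2.
have wW n : w n \in W by have [] := cwP n.
have uE n : u n = c n *: e + w n by have [] := cwP n.
have [l lc] : exists l, converges_to absp c l.
  apply: (padic_complete HQp) => eps eps0; apply: contrapT => /forallNP ncauchy.
  have /choice[mn mnP] N : exists mn : nat * nat,
      [/\ (N <= mn.1)%N, (N <= mn.2)%N & eps <= absp (c mn.1 - c mn.2)].
    have := ncauchy N => /existsNP[m /existsNP[n /not_implyP[Nm /not_implyP[Nn /negP]]]].
    by rewrite -leNgt => le; exists (m, n).
  pose d N := c (mn N).1 - c (mn N).2.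
  have d0 N : d N != 0.
    rewrite -(nonarch_neq0 apP) gt_eqF // (lt_le_trans eps0) //.
    by have [] := mnP N.
  pose w' N := (d N)^-1 *: (w (mn N).1 - w (mn N).2).
  have w'E N : w' N - - e = (d N)^-1 *: (u (mn N).1 - u (mn N).2).
    rewrite !uE /w' [in RHS]opprD addrACA -scalerBl [in RHS]scalerDr scalerA.
    by rewrite -/(d N) (mulVf (d0 N)) scale1r opprK [RHS]addrC.
  have w'e : converges_to v w' (- e).
    move=> r r0; have [N NP] := uc (eps * r) (mulr_gt0 eps0 r0).
    exists N => n Nn; rewrite w'E absZ (nonarchV apP).
    have [nm nn le] := mnP n.
    rewrite ltr_pdivrMl; last by rewrite (nonarch_gt0 apP).
    apply: lt_le_trans (NP _ _ (leq_trans Nn nm) (leq_trans Nn nn)) _.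
    by rewrite ler_pM2r.
  have [n|l lW w'l] := Wc w' _ (converges_cauchy vP w'e).
    by rewrite /w' memvZ // memvB.
  case/negP: eW; rewrite -(opprK e) memvN.
  by rewrite (limit_unique vP w'e w'l).
have ce : converges_to v (fun n => c n *: e) (l *: e).
  move=> r r0; have [->|e0] := eqVneq e 0.
    by exists 0%N => n _; rewrite !scaler0 subrr (nonarch0 vP).
  have ve : 0 < v e by rewrite (nonarch_gt0 vP).
  have [N NP] := lc (r / v e) (divr_gt0 r0 ve); exists N => n Nn.
  by rewrite -scalerBl absZ -ltr_pdivlMr // NP.
have wc : cauchy_seq v w.
  move=> r r0; have [N NP] := uc r r0; have [M MP] := converges_cauchy vP ce r0.
  exists (maxn N M) => m n; rewrite !geq_max => /andP[Nm Mm] /andP[Nn Mn].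
  have wE k : w k = u k - c k *: e by rewrite uE addrC addKr.
  have -> : w m - w n = (u m - u n) - (c m *: e - c n *: e) by rewrite !wE; ring.
  by rewrite (nonarchB_lt vP) ?NP // MP.
have [l' l'W wl'] := Wc w wW wc.
exists (l *: e + l').
  by apply/memv_addP; exists (l *: e); [apply/vlineP; exists l | exists l'].
move=> r r0; have [N NP] := ce r r0; have [M MP] := wl' r r0.
exists (maxn N M) => n; rewrite geq_max => /andP[Nn Mn].
by rewrite uE opprD addrACA (nonarchD_lt vP) ?NP ?MP.
Qed.

Lemma complete_finite_extension : abs_complete v.
Proof.
suff H (s : seq F) : forall u, (forall n, u n \in <<s>>%VS) -> cauchy_seq v u ->
    exists2 l, l \in <<s>>%VS & converges_to v u l.
  move=> u uc; have [|l _ ul] := H (vbasis {:F}) u _ uc; last by exists l.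
  by move=> n; rewrite (span_basis (vbasisP _)) memvf.
elim: s => [|e s IH] u.
  rewrite span_nil => uP _; exists 0; rewrite ?mem0v // => r r0; exists 0%N => n _.
  by have := uP n; rewrite memv0 => /eqP ->; rewrite subrr (nonarch0 vP).
by rewrite span_cons; apply: complete_add_line.
Qed.

Lemma linear_dependence N (x : 'I_N -> F) : (\dim {:F} < N)%N ->
  exists2 c : 'I_N -> Qp, \sum_i c i *: x i = 0 & exists i, c i != 0.
Proof.
move=> dimN; apply: contrapT => H; set X := [tuple x i | i < N].
suff : free X.
  rewrite /free size_tuple => /eqP dN.
  by move: dimN; rewrite -dN ltnNge dimvS // subvf.
apply/freeP => c c0 i; apply: contrapT => /eqP ci; apply: H; exists c; last by exists i.
by rewrite -[RHS]c0; apply: eq_bigr => j _; rewrite -tnth_nth tnth_mktuple.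
Qed.

Lemma absp_int (z : int) : z != 0 -> absp z%:~R = p%:R ^- logn p `|z|%N.
Proof.
move=> z0; rewrite -(padic_nat HQp) ?absz_gt0 //.
by case: z z0 => n _ //; rewrite NegzE mulrNz (nonarchN apP) abszN.
Qed.

Lemma rat_value (r : rat) : ratr r = (numq r)%:~R / (denq r)%:~R :> Qp.
Proof. by []. Qed.

(** By density some rational has the same absolute value; [a] and [b] are the exponents of p in its
    numerator and denominator, which keeps the statement in natural powers. *)
Lemma absp_value c : c != 0 -> exists a b : nat, absp c * p%:R ^+ a = p%:R ^+ b.
Proof.
move=> c0; have c0' : 0 < absp c by rewrite (nonarch_gt0 apP).
have [r rP] := padic_dense HQp c c0'.
have rE : absp (ratr r) = absp c by apply: (nonarch_eq apP); rewrite (nonarchBC apP).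
have p0 : p%:R != 0 :> R by rewrite gt_eqF // (lt_trans ltr01 p_gt1).
have r0 : numq r != 0.
  apply: contraTneq c0' => n0; rewrite -rE rat_value n0 mul0r (nonarch0 apP).
  by rewrite ltxx.
exists (logn p `|numq r|%N), (logn p `|denq r|%N).
rewrite -rE rat_value (nonarchM apP) (nonarchV apP) !absp_int ?denq_eq0 // invrK.
by rewrite mulrAC mulVf ?mul1r // expf_neq0.
Qed.

(** [c] is approximated by a fraction whose denominator is prime to p. A Bezout coefficient inverts
    that denominator modulo p, and [j] is the residue of its product with the numerator. *)
Lemma absp_residue c : absp c <= 1 -> exists2 j : nat, (j < p)%N & absp (c - j%:R) < 1.
Proof.
move=> c1; have [r rP] := padic_dense HQp c ltr01.
have pp := padic_prime HQp.
have r1 : absp (ratr r) <= 1.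
  by rewrite -(subKr c (ratr r)) (nonarchB_le apP) // ltW.
have Ediv (z : int) : (p %| `|z|)%N -> absp z%:~R < 1.
  have [->|z0] := eqVneq z 0; first by rewrite (nonarch0 apP) ltr01.
  move=> pz; rewrite absp_int // invf_lt1 ?exprn_egt1 ?p_gt1 ?exprn_gt0 ?ltr0n ?prime_gt0 //.
  by rewrite -lt0n logn_gt0 mem_primes pp absz_gt0 z0 pz.
have Endiv (z : int) : ~~ (p %| `|z|)%N -> absp z%:~R = 1.
  move=> pz; have z0 : z != 0 by apply: contraNneq pz => ->; rewrite absz0 dvdn0.
  by rewrite absp_int // (_ : logn p _ = 0%N) ?expr0 ?invr1 //; apply/eqP; rewrite lognE pp absz_gt0 z0 (negPf pz).
have dp : ~~ (p %| `|denq r|)%N.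
  apply/negP => pd; have np : ~~ (p %| `|numq r|)%N.
    apply/negP => pn; have := coprime_num_den r; rewrite /coprime => /eqP g1.
    by have := dvdn_gcd p `|numq r| `|denq r|; rewrite g1 pn pd dvdn1 => /eqP p1; rewrite p1 in pp.
  move: r1; rewrite rat_value (nonarchM apP) (nonarchV apP) (Endiv _ np) mul1r leNgt.
  by rewrite invf_gt1 ?Ediv // (nonarch_gt0 apP) -(nonarch_neq0 apP) absp_int ?denq_eq0 // invr_neq0 // expf_neq0 // gt_eqF // (lt_trans ltr01 p_gt1).
have [[a b] ab] : exists ab : int * int, ab.1 * denq r + ab.2 * p%:Z = 1.
  have : coprimez (denq r) p%:Z by rewrite coprimezE coprime_sym absz_nat prime_coprime.
  by case/coprimezP => -[a b] /= E; exists (a, b).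
pose m := (a * numq r)%Z; pose j := `|(m %% p%:Z)%Z|%N.
have p0 : p%:Z != 0 by rewrite -lt0n prime_gt0.
have jE : j%:Z = (m %% p%:Z)%Z by rewrite /j gez0_abs // modz_ge0.
exists j; first by rewrite -ltz_nat jE ltz_pmod // ltz_nat prime_gt0.
rewrite (_ : c - _ = (c - ratr r) + (ratr r - j%:R)); last by rewrite addrA subrK.
rewrite (nonarchD_lt apP) //.
have d0 : absp (denq r)%:~R = 1 by apply: Endiv.
have dn0 : (denq r)%:~R != 0 :> Qp by rewrite -(nonarch_neq0 apP) d0 oner_neq0.
rewrite -[X in X < 1]mulr1 -{1}d0 -(nonarchM apP) mulrBl rat_value divfK //.
have -> : (numq r)%:~R - j%:R * (denq r)%:~R = (numq r - j%:Z * denq r)%:~R :> Qp.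
  by rewrite intrB intrM.
apply: Ediv; rewrite jE; change (p%:Z %| numq r - (m %% p)%Z * denq r)%Z.
have -> : numq r - (m %% p)%Z * denq r = p%:Z * (b * numq r + (m %/ p)%Z * denq r).
  rewrite mulrDr -{1}[numq r]mul1r -ab /= [(m %/ p)%Z * _]mulrC.
  have := divz_eq m p; rewrite {1}/m => E.
  have -> : (m %% p)%Z = a * numq r - (m %/ p)%Z * p by rewrite E [_ + (_ %% _)%Z]addrC addrK.
  by ring.
exact: dvdz_mulr.
Qed.

End LocalField.

(** * Valuations modulo 2 *)

Section Uniformizer.
Variables (R : realType) (K : fieldType) (v : K -> R).
Hypothesis vP : nonarch_abs v.
Variable pi : K.
Hypotheses (pi0 : pi != 0) (pi1 : v pi < 1) (pimax : forall x, v x < 1 -> v x <= v pi).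

(** [k] is the last exponent with |x| <= |pi|^k; the maximality of |pi| below 1 then forces the
    quotient to have absolute value 1. *)
Lemma valuation_decomp :
  forall x, x != 0 -> v x <= 1 -> exists k u, v u = 1 /\ x = pi ^+ k * u.
Proof.
move=> x x0 x1.
have vpi : 0 <= v pi < 1 by rewrite (nonarch_ge0 vP).
have vx : 0 < v x by rewrite (nonarch_gt0 vP).
have exk : exists k, v pi ^+ k < v x by apply: exprn_small.
case: (ex_minnP exk) => -[|k] kx kmin; first by move: kx; rewrite expr0 ltNge x1.
have xk : v x <= v pi ^+ k by rewrite leNgt; apply/negP => /kmin; rewrite ltnn.
have pik : pi ^+ k != 0 by rewrite expf_neq0.
have vpik : 0 < v pi ^+ k by rewrite -(nonarchX vP) (nonarch_gt0 vP).
exists k, (x / pi ^+ k); split; last by rewrite mulrCA divff ?mulr1.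
have vu : v (x / pi ^+ k) = v x / v pi ^+ k by rewrite (nonarchM vP) (nonarchV vP) (nonarchX vP).
apply/eqP; rewrite eq_le {1}vu ler_pdivrMr // mul1r xk /= leNgt.
apply/negP => /pimax; rewrite vu ler_pdivrMr // -exprS leNgt.
by rewrite kx.
Qed.

Lemma sq_decomp :
  forall x, x != 0 -> exists t u (b : bool), [/\ t != 0, v u = 1 & x = t ^+ 2 * (pi ^+ b * u)].
Proof.
have H x : x != 0 -> v x <= 1 -> exists t u (b : bool), [/\ t != 0, v u = 1 & x = t ^+ 2 * (pi ^+ b * u)].
  move=> x0 x1; have [k [u [u1 ->]]] := valuation_decomp x0 x1.
  exists (pi ^+ k./2), u, (odd k); split=> //; first by rewrite expf_neq0.
  by rewrite -{1}(odd_double_half k) mulrA -exprM muln2 -exprD addnC.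
move=> x x0; have [x1|/ltW x1] := leP (v x) 1; first exact: H.
have [||t [u [b [t0 u1 E]]]] := H x^-1; first by rewrite invr_eq0.
  by rewrite (nonarchV vP) invf_le1 // (nonarch_gt0 vP).
exists (x * t), u, b; split; rewrite ?mulf_neq0 //.
by rewrite exprMn -mulrA -E expr2 mulfK.
Qed.

(** Here |t|^2 would be |pi|, hence |pi| < |t| < 1, against the maximality of |pi|. *)
Lemma odd_not_square :
  forall u t, v u = 1 -> pi * u <> t ^+ 2.
Proof.
move=> u t u1 E.
have vt : v pi = v t ^+ 2 by rewrite -(nonarchX vP) -E (nonarchM vP) u1 mulr1.
have t1 : v t < 1.
  by rewrite ltNge; apply/negP => /(exprn_ege1 2); rewrite -vt leNgt pi1.
have t0 : 0 < v t.
  by rewrite lt_neqAle eq_sym (nonarch_ge0 vP) andbT -sqrf_eq0 -vt (nonarch_neq0 vP) pi0.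
by have := pimax t1; rewrite vt expr2 ler_pMr // leNgt t1.
Qed.

End Uniformizer.

Section LocalFieldStructure.
Variables (R : realType) (p : nat) (Qp : fieldType) (absp : Qp -> R).
Hypothesis HQp : is_padic_numbers p absp.
Variables (F : fieldExtType Qp) (v : F -> R).
Hypothesis vP : nonarch_abs v.
Hypothesis vQp : forall c : Qp, v c%:A = absp c.
Local Notation apP := (padic_abs HQp).

Lemma p_gt0 : 0 < p%:R :> R.
Proof. exact: lt_trans ltr01 (p_gt1 HQp). Qed.

(* Elements whose absolute values are distinct modulo |Qp^*| are linearly
   independent over Qp, so only finitely many values lie between 1/p and 1. *)
Lemma uniformizer_exists :
  exists pi : F, [/\ pi != 0, v pi < 1 & forall x, v x < 1 -> v x <= v pi].
Proof.
apply: contrapT => H.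
have /choice[f fP] y : exists z : F, y != 0 -> v y < 1 -> v y < v z < 1.
  have [->|y0] := eqVneq y 0; first by exists 0.
  have [y1|y1] := boolP (v y < 1); last by exists 0.
  apply: contrapT => nz; apply: H; exists y; split=> // z z1.
  by rewrite leNgt; apply/negP => yz; apply: nz; exists z; rewrite yz z1.
(* Starting at |p| = 1/p, the values increase strictly and stay below 1, so no two of them differ by
   a power of p. *)
pose X k := iter k f p%:R.
have vp : v p%:R = p%:R^-1 by rewrite (v_nat vQp) (absp_p HQp).
have X0 k : X k != 0 /\ v (X k) < 1.
  elim: k => [|k [IH0 IH1]] /=.
    by rewrite -(nonarch_neq0 vP) vp invr_neq0 ?gt_eqF ?p_gt0 // invf_lt1 ?(p_gt1 HQp) ?p_gt0.
  have /andP[lt lt1] := fP _ IH0 IH1; split=> //.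
  by rewrite -(nonarch_gt0 vP) (le_lt_trans _ lt) // (nonarch_ge0 vP).
have XS k : v (X k) < v (X k.+1) by have [h0 h1] := X0 k; case/andP: (fP _ h0 h1).
have Xlt i j : (i < j)%N -> v (X i) < v (X j).
  elim: j => // j IH; rewrite ltnS leq_eqVlt => /orP[/eqP ->|/IH lt]; first exact: XS.
  exact: lt_trans lt (XS j).
have Xp k : 1 <= p%:R * v (X k).
  rewrite -ler_pdivrMl ?p_gt0 // mulr1; case: k => [|k]; first by rewrite /X /= vp.
  by apply/ltW; rewrite -vp; apply: (Xlt 0%N).
have Xneq A B i j : p%:R ^+ A * v (X i) = p%:R ^+ B * v (X j) -> ~~ (A < B)%N.
  move=> E; apply/negP => AB; have : v (X i) = p%:R ^+ (B - A) * v (X j).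
    apply: (mulfI (_ : p%:R ^+ A != 0)); first by rewrite expf_neq0 // gt_eqF // p_gt0.
    by rewrite E mulrA -exprD subnKC // ltnW.
  have [_ lt1] := X0 i; move: lt1 => /[swap] ->.
  rewrite (_ : (B - A = (B - A).-1.+1)%N); last by rewrite prednK // subn_gt0.
  rewrite exprSr -mulrA ltNge => /negP[]; rewrite -[X in X <= _]mulr1 ler_pM ?Xp //.
  by rewrite exprn_ege1 // ltW // (p_gt1 HQp).
have [c c0 [i ci]] := linear_dependence (fun i : 'I_(\dim {:F}).+1 => X i) (ltnSn _).
suff /(_ i)/eqP : forall i, c i *: X i = 0.
  by rewrite scaler_eq0 (negPf ci); have [/negPf ->] := X0 i.
apply: (nonarch_sum_distinct vP) c0 => {ci} {}i j.
rewrite !scaler_eq0 !negb_or => /andP[ci _] /andP[cj _].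
rewrite !(absZ vP vQp) => E; apply: val_inj => /=.
have [a [b ab]] := absp_value HQp ci; have [a' [b' ab']] := absp_value HQp cj.
have E' : p%:R ^+ (b + a') * v (X i) = p%:R ^+ (b' + a) * v (X j).
  rewrite !exprD -ab -ab'; move: E; set Pa := _ ^+ a; set Pa' := _ ^+ a'.
  by move=> E; transitivity ((absp (c i) * v (X i)) * (Pa * Pa')); [|rewrite E]; ring.
have eAB : (b + a' = b' + a)%N.
  apply/eqP; rewrite eqn_leq leqNgt (Xneq _ _ _ _ (esym E')) leqNgt.
  exact: Xneq E'.
have {E'} E' : v (X i) = v (X j).
  by move: E'; rewrite eAB => /(mulfI _); apply; rewrite expf_neq0 // gt_eqF // p_gt0.
by have [lt|lt|//] := ltngtP i j; have := Xlt _ _ lt; rewrite E' ltxx.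
Qed.

(** A family of integers that is independent modulo the maximal ideal has at most as many members as
    the degree. For a largest one, the combinations with digits below p meet every residue class;
    [cls] picks one close to [y], and is [None] if there is none. *)
Lemma residue_classes : exists (J : finType) (cls : F -> J),
  forall x y, v x <= 1 -> v y <= 1 -> (cls x == cls y) = (v (x - y) < 1).
Proof.
pose P r := `[< exists x : 'I_r -> F, (forall i, v (x i) <= 1) /\
  forall a : 'I_r -> Qp, (forall i, absp (a i) <= 1) -> v (\sum_i a i *: x i) < 1 ->
    forall i, absp (a i) < 1 >].
have P0 : exists r, P r by exists 0%N; apply/asboolP; exists (fun=> 0); split=> [[]|a _ _ []].
have Pmax r : P r -> (r <= \dim {:F})%N.
  move=> /asboolP[x [x1 xP]]; rewrite leqNgt; apply/negP => lt.
  have [c c0 [i0 ci0]] := linear_dependence x lt.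
  (* Divided by its largest coefficient, a dependence relation has integral coefficients, one of
     them equal to 1. *)
  pose m := [arg max_(i > i0) absp (c i)]%O.
  have mP j : absp (c j) <= absp (c m) by rewrite /m; case: arg_maxP => // i _; apply.
  have cm : 0 < absp (c m) by apply: lt_le_trans (mP i0); rewrite (nonarch_gt0 apP).
  have /xP/(_ _ m) : forall i, absp ((c m)^-1 * c i) <= 1.
    by move=> i; rewrite (nonarchM apP) (nonarchV apP) mulrC ler_pdivrMr // mul1r.
  rewrite mulVf ?(nonarch1 apP) ?ltxx; last by rewrite -(nonarch_gt0 apP).
  have -> : \sum_i ((c m)^-1 * c i) *: x i = 0.
    transitivity ((c m)^-1 *: \sum_i c i *: x i); last by rewrite c0 scaler0.
    by rewrite scaler_sumr; apply: eq_bigr => i _; rewrite scalerA.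
  by rewrite (nonarch0 vP) ltr01 => /(_ isT).
case: (ex_maxnP P0 Pmax) => r /asboolP[x [x1 xP]] rmax.
pose J : finType := {ffun 'I_r -> 'I_p}.
pose s (j : J) : F := \sum_i (nat_of_ord (j i))%:R *: x i.
have cover y : v y <= 1 -> exists j, v (y - s j) < 1.
  (* An integer [y] away from all the combinations could be adjoined to the family: a relation in
     which [y] has a unit coefficient would make it congruent to one of them. *)
  move=> y1; apply: contrapT => nope; suff /rmax : P r.+1 by rewrite ltnn.
  pose x' (i : 'I_r.+1) := if unlift ord0 i is Some j then x j else y.
  have x'S i : x' (lift ord0 i) = x i by rewrite /x' liftK.
  have x'0 : x' ord0 = y by rewrite /x' unlift_none.
  apply/asboolP; exists x'; split=> [i|a a1 sa i]; first by rewrite /x'; case: unlift.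
  apply: contrapT => /negP ai; apply: nope.
  move: sa; rewrite big_ord_recl x'0; under eq_bigr do rewrite x'S; move=> sa.
  have a0 : absp (a ord0) = 1.
    apply/eqP; rewrite eq_le a1 leNgt; apply/negP => lt.
    case/negP: ai; case: (unliftP ord0 i) => [j ->|-> //].
    apply: (xP (fun j => a (lift ord0 j))) => [k|]; first exact: a1.
    rewrite -[X in v X](addKr (a ord0 *: y)) addrC (nonarchB_lt vP) //.
    rewrite (absZ vP vQp); apply: le_lt_trans lt; rewrite ler_piMr //.
    exact: (nonarch_ge0 apP).
  have an0 : a ord0 != 0 by rewrite -(nonarch_neq0 apP) a0 oner_neq0.
  pose b j := - (a ord0)^-1 * a (lift ord0 j).
  have yb : v (y - \sum_j b j *: x j) < 1.
    rewrite -[v _]mul1r -{1}a0 -(absZ vP vQp) scalerBr.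
    suff -> : a ord0 *: (\sum_j b j *: x j) = - (\sum_j a (lift ord0 j) *: x j) by rewrite opprK.
    rewrite scaler_sumr -sumrN; apply: eq_bigr => j _.
    by rewrite scalerA /b mulrA mulrN mulfV // mulN1r scaleNr.
  have b1 j : absp (b j) <= 1.
    by rewrite (nonarchM apP) (nonarchN apP) (nonarchV apP) a0 invr1 mul1r a1.
  have /choice[d dP] j : exists d : 'I_p, absp (b j - d%:R) < 1.
    by have [k kp kP] := absp_residue HQp (b1 j); exists (Ordinal kp).
  exists [ffun j => d j]; apply: (nonarch_tri vP yb).
  rewrite /s -sumrB (nonarch_sum_lt vP) ?ltr01 // => j _.
  rewrite ffunE -scalerBl (absZ vP vQp); apply: le_lt_trans (dP j).
  by rewrite ler_piMr // (nonarch_ge0 apP).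
pose cls y : option J := [pick j | v (y - s j) < 1].
exists (option J), cls => y z y1 z1.
apply/eqP/idP => [|yz].
  rewrite /cls; case: pickP => [j yj|y0]; last by have [j] := cover y y1; rewrite y0.
  case: pickP => // k zk [jk]; apply: (nonarch_tri vP yj).
  by rewrite (nonarchBC vP) jk.
apply: eq_pick => j /=; apply/idP/idP => H; apply: (nonarch_tri vP _ H) => //.
by rewrite (nonarchBC vP).
Qed.

End LocalFieldStructure.

(** * Squares in the residue field and their lifts *)

Section ResidueSquares.
Variables (R : realType) (K : fieldType) (v : K -> R).
Hypothesis vP : nonarch_abs v.
Hypothesis vcomplete : abs_complete v.
Hypothesis v2 : v 2%:R = 1.
Variables (J : finType) (cls : K -> J).
Hypothesis clsP : forall x y, v x <= 1 -> v y <= 1 -> (cls x == cls y) = (v (x - y) < 1).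

Definition residue_set : {set J} := [set j | `[< exists2 x, v x <= 1 & cls x = j >]].

Lemma mem_residue_set x : v x <= 1 -> cls x \in residue_set.
Proof. by move=> x1; rewrite inE; apply/asboolP; exists x. Qed.

Lemma residue_repr : exists s : J -> K,
  forall j, j \in residue_set -> v (s j) <= 1 /\ cls (s j) = j.
Proof.
have /choice[s sP] j : exists x, j \in residue_set -> v x <= 1 /\ cls x = j.
  have [|_] := boolP (j \in residue_set); last by exists 0.
  by rewrite inE => /asboolP[x x1 xj]; exists x.
by exists s.
Qed.

Lemma square_unit_le x y : v x <= 1 -> v y <= 1 -> v (x * y) <= 1.
Proof. by move=> x1 y1; rewrite (nonarchM vP) mulr_ile1 ?(nonarch_ge0 vP). Qed.

(* x |-> c + a x^2 is at most two-to-one on the residue field, and one-to-one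
   over c. *)
Lemma card_quadratic_values (s : J -> K) a c :
  (forall j, j \in residue_set -> v (s j) <= 1 /\ cls (s j) = j) ->
  v a = 1 -> v c <= 1 ->
  (#|residue_set| < (#|((fun j => cls (c + a * s j ^+ 2)) @: residue_set)|).*2)%N.
Proof.
move=> sP a1 c1; set C := residue_set; pose h j := cls (c + a * s j ^+ 2).
have O_sq j : j \in C -> v (c + a * s j ^+ 2) <= 1.
  move=> /sP[s1 _]; by rewrite (nonarchD_le vP) // square_unit_le ?a1 // expr2 square_unit_le.
have hE i j : i \in C -> j \in C -> h i = h j -> j = i \/ j = cls (- s i).
  move=> iC jC /eqP; have [si1 si] := sP _ iC; have [sj1 sj] := sP _ jC.
  rewrite clsP ?O_sq //.
  have -> : c + a * s i ^+ 2 - (c + a * s j ^+ 2) = a * ((s j - s i) * (- s i - s j)) by ring.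
  rewrite !(nonarchM vP) a1 mul1r => lt.
  have [lt1|ge1] := ltP (v (s j - s i)) 1.
    by left; apply/eqP; rewrite -si -sj clsP.
  right; apply/eqP; rewrite -sj clsP ?(nonarchN vP) // (nonarchBC vP).
  by apply: le_lt_trans lt; rewrite ler_peMl ?(nonarch_ge0 vP).
have O0 : v 0 <= 1 by rewrite (nonarch0 vP) ler01.
pose z := cls 0; have zC : z \in C by apply: mem_residue_set.
have [sz1 sz] := sP _ zC.
have Nsz : cls (- s z) = z.
  apply/eqP; rewrite clsP ?(nonarchN vP) //.
  by rewrite -(nonarchN vP) opprB add0r opprK -[s z]subr0 -clsP // sz.
have fib k : (\sum_(i in C | h i == k) 1 <= 2)%N.
  rewrite sum1_card; case: (pickP [pred i in C | h i == k]) => [i /=|none]; last by rewrite eq_card0.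
  case/andP=> iC /eqP hi.
  apply: leq_trans (_ : #|[set i; cls (- s i)]%SET| <= _)%N; last by rewrite cards2; case: eqP.
  apply/subset_leq_card/fintype.subsetP => j; rewrite unfold_in /= => /andP[jC /eqP hj].
  by rewrite !inE; case: (hE i j) => // [|->|->]; rewrite ?hi ?eqxx ?orbT.
have fibz : (\sum_(i in C | h i == h z) 1 <= 1)%N.
  rewrite sum1_card -(cards1 z); apply/subset_leq_card/fintype.subsetP => j.
  rewrite unfold_in /= => /andP[jC /eqP hj]; rewrite inE.
  by case: (hE z j) => // ->; rewrite ?Nsz.
rewrite -sum1_card (partition_big_imset h) /= -/h.
rewrite (bigD1 (h z)) ?imset_f //=.
have S2 : (\sum_(k in h @: C | k != h z) \sum_(i in C | h i == k) 1 <= (#|(h @: C) :\ h z|).*2)%N.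
  rewrite -muln2 -sum_nat_const (eq_bigl (fun k => k \in (h @: C) :\ h z)); last first.
    by move=> k; rewrite !inE andbC.
  by apply: leq_sum.
by have := cardsD1 (h z) (h @: C); rewrite imset_f //; lia.
Qed.

(** Pigeonhole: the classes of a x^2 and those of c - b y^2 each fill more than half of the residue
    field, so they meet. *)
Lemma form_mod_represents a b c : v a = 1 -> v b = 1 -> v c <= 1 ->
  exists x y, [/\ v x <= 1, v y <= 1 & v (a * x ^+ 2 + b * y ^+ 2 - c) < 1].
Proof.
move=> a1 b1 c1; have [s sP] := residue_repr.
have O0 : v 0 <= 1 by rewrite (nonarch0 vP) ler01.
have := @card_quadratic_values s (- b) c sP _ c1; rewrite (nonarchN vP) => /(_ b1).
have := card_quadratic_values sP a1 O0.
set A := (_ @: _)%SET => hA; set B := (_ @: _)%SET => hB.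
have O_sq a' c' j : v a' = 1 -> v c' <= 1 -> j \in residue_set -> v (c' + a' * s j ^+ 2) <= 1.
  move=> a'1 c'1 /sP[s1 _]; by rewrite (nonarchD_le vP) // square_unit_le ?a'1 // expr2 square_unit_le.
have sub : A :|: B \subset residue_set.
  apply/fintype.subsetP => k; rewrite finset.in_setU.
  case/orP=> /imsetP[j jC ->]; apply: mem_residue_set.
    exact: O_sq.
  by apply: O_sq; rewrite ?(nonarchN vP).
have [k] : exists k, k \in A :&: B.
  apply/finset.set0Pn; rewrite -card_gt0; have := cardsUI A B; have := subset_leq_card sub; lia.
rewrite finset.in_setI => /andP[/imsetP[i iC ->] /imsetP[j jC] /eqP].
rewrite clsP ?O_sq ?(nonarchN vP) // => lt.
exists (s i), (s j); split; [by have [] := sP _ iC|by have [] := sP _ jC|].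
by move: lt; rewrite add0r opprD mulNr opprK addrA addrAC.
Qed.

Lemma square_of_residue u x : v u = 1 -> v (u - x ^+ 2) < 1 -> exists t, u = t ^+ 2.
Proof.
move=> u1 lt; have vx : v (x ^+ 2) = 1.
  by rewrite -u1; apply: (nonarch_eq vP); rewrite u1 (nonarchBC vP).
have x0 : x ^+ 2 != 0 by rewrite -(nonarch_neq0 vP) vx oner_neq0.
have [|z zE] := hensel_sqrt vP vcomplete v2 (y := (u - x ^+ 2) / x ^+ 2).
  by rewrite (nonarchM vP) (nonarchV vP) vx invr1 mulr1.
exists (x * (1 + z)); rewrite exprMn zE mulrDr mulr1 mulrCA divff // mulr1.
by rewrite addrC subrK.
Qed.

(** Since [c] is a unit, one of the variables of a solution modulo the maximal ideal is a unit; it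
    is corrected by a square root, the other one being kept. *)
Lemma unit_form_represents a b c : v a = 1 -> v b = 1 -> v c = 1 ->
  exists x y, a * x ^+ 2 + b * y ^+ 2 = c.
Proof.
have main a' b' c' x y : v a' = 1 -> v b' = 1 -> v c' = 1 -> v x = 1 -> v y <= 1 ->
    v (a' * x ^+ 2 + b' * y ^+ 2 - c') < 1 -> exists x y, a' * x ^+ 2 + b' * y ^+ 2 = c'.
  move=> a1 b1 c1 x1 y1 lt; have a0 : a' != 0 by rewrite -(nonarch_neq0 vP) a1 oner_neq0.
  have lt' : v ((c' - b' * y ^+ 2) / a' - x ^+ 2) < 1.
    rewrite -[v _]mul1r -{1}a1 -(nonarchM vP) mulrBr mulrCA divff // mulr1 (nonarchBC vP).
    by rewrite opprB addrA.
  have [|t tE] := square_of_residue _ lt'.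
    have vx : v (x ^+ 2) = 1 by rewrite (nonarchX vP) x1 expr1n.
    by rewrite -vx; apply: (nonarch_eq vP); rewrite vx.
  by exists t, y; rewrite -tE mulrCA divff // mulr1 subrK.
move=> a1 b1 c1; have [|x [y [x1 y1 lt]]] := form_mod_represents a1 b1 (c := c); first by rewrite c1.
have [vx|vx] := ltP (v x) 1; last by apply: (main a b c x y) => //; apply/eqP; rewrite eq_le x1.
have [vy|vy] := ltP (v y) 1; last first.
  have [y' [x' E]] : exists y x, b * y ^+ 2 + a * x ^+ 2 = c.
    apply: (main b a c y x) => //; first by apply/eqP; rewrite eq_le y1.
    by rewrite [b * _ + _]addrC.
  by exists x', y'; rewrite addrC.
have sq_lt w d : v w < 1 -> v d = 1 -> v (d * w ^+ 2) < 1.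
  by move=> w1 d1; rewrite (nonarchM vP) d1 mul1r (nonarchX vP) exprn_ilt1 ?(nonarch_ge0 vP).
have : v c < 1; last by rewrite c1 ltxx.
by rewrite -(subKr (a * x ^+ 2 + b * y ^+ 2) c) (nonarchB_lt vP) // (nonarchD_lt vP) // sq_lt.
Qed.

(** If all units were squares, squaring would map the finite residue field onto itself, hence
    injectively; but 1 and -1 have the same square and differ, as |2| = 1. *)
Lemma nonsquare_unit_exists : exists2 u, v u = 1 & forall t, u <> t ^+ 2.
Proof.
apply: contrapT => H; have [s sP] := residue_repr.
have O0 : v 0 <= 1 by rewrite (nonarch0 vP) ler01.
have O1 : v 1 <= 1 by rewrite (nonarch1 vP).
have ON1 : v (-1) <= 1 by rewrite (nonarchN vP).
pose h j := cls (s j ^+ 2).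
have O_sq j : j \in residue_set -> v (s j ^+ 2) <= 1.
  by move=> /sP[s1 _]; rewrite expr2 square_unit_le.
have sub : residue_set \subset h @: residue_set.
  apply/fintype.subsetP => k; rewrite inE => /asboolP[x x1 <-].
  have [t tE] : exists t, v (x - t ^+ 2) < 1 /\ v t <= 1.
    have [lt|ge] := ltP (v x) 1; first by exists 0; rewrite expr0n subr0.
    apply: contrapT => nt; apply: H; exists x; first by apply/eqP; rewrite eq_le x1.
    move=> t xt; apply: nt; exists t; rewrite xt subrr (nonarch0 vP) ltr01.
    by split=> //; rewrite -(expr_le1 (n := 2)) ?(nonarch_ge0 vP) // -(nonarchX vP) -xt.
  have [tx t1] := tE; have tC := mem_residue_set t1.
  apply/imsetP; exists (cls t) => //; apply/eqP; have [st1 st] := sP _ tC.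
  rewrite /h clsP ?O_sq //; apply: (nonarch_tri vP tx).
  rewrite subr_sqr (nonarchM vP); move/eqP: st; rewrite clsP // (nonarchBC vP) => lt.
  by apply: le_lt_trans lt; rewrite ler_piMr ?(nonarch_ge0 vP) // (nonarchD_le vP).
have /imset_injP hinj : #|h @: residue_set| == #|residue_set|.
  by rewrite eqn_leq leq_imset_card subset_leq_card.
have [s1 sc1] := sP _ (mem_residue_set O1); have [sN1 scN1] := sP _ (mem_residue_set ON1).
have /eqP : cls 1 = cls (-1).
  apply: hinj; rewrite ?mem_residue_set //; apply/eqP.
  rewrite /h clsP ?O_sq ?mem_residue_set // subr_sqr (nonarchM vP) mulrC.
  apply: le_lt_trans (_ : v (s (cls 1) + s (cls (-1))) < 1).
    by rewrite ler_piMr ?(nonarch_ge0 vP) // (nonarchB_le vP).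
  rewrite -[s (cls 1) + _](addrK 1) -addrA addrACA [_ - 1]addrC.
  move/eqP: sc1; rewrite clsP // => lt1; move/eqP: scN1; rewrite clsP // opprK => ltN1.
  by rewrite addrACA (nonarchD_lt vP) // addrC.
by rewrite clsP // opprK -[1 + 1]/(2%:R : K) v2 ltxx.
Qed.

(** Otherwise the classes of u x^2, x^2 and w x^2 meet pairwise in 0 only. Each kind fills more than
    half of the residue field, so the first two exhaust it and leave nothing but 0 to the third. *)
Lemma nonsquare_unit_mul u w : v u = 1 -> v w = 1 ->
  (forall t, u <> t ^+ 2) -> (forall t, w <> t ^+ 2) -> exists t, u * w = t ^+ 2.
Proof.
move=> u1 w1 uN wN; apply: contrapT => uwN; have [s sP] := residue_repr.
have O0 : v 0 <= 1 by rewrite (nonarch0 vP) ler01.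
have O1 : v 1 <= 1 by rewrite (nonarch1 vP).
have Cz := mem_residue_set O0; have C1 := mem_residue_set O1.
pose A a : {set J} := ((fun j => cls (0 + a * s j ^+ 2)) @: residue_set)%SET.
have O_sq a j : v a = 1 -> j \in residue_set -> v (a * s j ^+ 2) <= 1.
  by move=> a1 /sP[s1 _]; rewrite square_unit_le ?a1 // expr2 square_unit_le.
have AC a : v a = 1 -> A a \subset residue_set.
  by move=> a1; apply/fintype.subsetP => _ /imsetP[j jC ->]; rewrite mem_residue_set // add0r O_sq.
have cardA a : v a = 1 -> (#|residue_set| < (#|A a|).*2)%N.
  by move=> a1; apply: card_quadratic_values.
have AI a b : v a = 1 -> v b = 1 -> (forall t, a / b <> t ^+ 2) -> A a :&: A b \subset [set cls 0]%SET.
  move=> a1 b1 abN; apply/fintype.subsetP => k; rewrite finset.in_setI inE.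
  case/andP=> /imsetP[i iC ->] /imsetP[j jC] /eqP; rewrite !add0r clsP ?O_sq // => lt.
  rewrite clsP ?O_sq // subr0 ltNge; apply/negP => ge.
  have [si1 _] := sP _ iC; have [sj1 _] := sP _ jC.
  have b0 : b != 0 by rewrite -(nonarch_neq0 vP) b1 oner_neq0.
  have vi : v (s i ^+ 2) = 1.
    by apply/eqP; rewrite eq_le expr2 square_unit_le //=; rewrite (nonarchM vP) a1 mul1r expr2 in ge.
  have i0 : s i ^+ 2 != 0 by rewrite -(nonarch_neq0 vP) vi oner_neq0.
  have [||t tE] := @square_of_residue (a / b) (s j / s i); last exact: abN tE.
    by rewrite (nonarchM vP) (nonarchV vP) a1 b1 divr1.
  have E : (a / b - (s j / s i) ^+ 2) * (b * s i ^+ 2) = a * s i ^+ 2 - b * s j ^+ 2.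
    have i0' : s i != 0 by move: i0; rewrite expf_eq0.
    by field; rewrite i0' b0.
  by rewrite -[v _]mulr1 -{1}vi -[X in _ * X]mul1r -{1}b1 -!(nonarchM vP) E.
have v1 : v 1 = 1 by apply: nonarch1.
have card1 a b : v a = 1 -> v b = 1 -> (forall t, a / b <> t ^+ 2) -> (#|A a :&: A b| <= 1)%N.
  by move=> a1 b1 /(AI a b a1 b1)/subset_leq_card; rewrite cards1.
have u0 : u != 0 by rewrite -(nonarch_neq0 vP) u1 oner_neq0.
have w0 : w != 0 by rewrite -(nonarch_neq0 vP) w1 oner_neq0.
have I1 : (#|A u :&: A 1%R| <= 1)%N by apply: card1 => // t; rewrite divr1; apply: uN.
have I2 : (#|(A u :|: A 1%R) :&: A w| <= 1)%N.
  rewrite finset.setIUl -(cards1 (cls 0)); apply: subset_leq_card; rewrite finset.subUset.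
  apply/andP; split; apply: AI => // t tE.
    by apply: uwN; exists (t * w); rewrite exprMn -tE expr2 mulrA divfK.
  by apply: (wN t^-1); rewrite exprVn -tE mul1r invrK.
have q2 : (1 < #|residue_set|)%N.
  have <- : #|[set cls 0; cls 1]%SET| = 2%N.
    by rewrite cards2 clsP // (nonarchBC vP) subr0 v1 ltxx.
  apply/subset_leq_card/fintype.subsetP => j; rewrite finset.in_set2.
  by case/orP=> /eqP ->.
have sub : A u :|: A 1 :|: A w \subset residue_set by rewrite !finset.subUset !AC.
have := subset_leq_card sub; have := cardsUI (A u :|: A 1) (A w); have := cardsUI (A u) (A 1).
have := cardA _ u1; have := cardA _ w1; have := cardA _ v1; lia.
Qed.

End ResidueSquares.

Section SquareClasses.
Variable K : fieldType.

Definition sq_equiv (x y : K) : Prop := exists2 t : K, t != 0 & x = y * t ^+ 2.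

Lemma sq_equiv_refl x : sq_equiv x x.
Proof. by exists 1; rewrite ?oner_neq0 // expr1n mulr1. Qed.

Lemma sq_equiv_sym x y : sq_equiv x y -> sq_equiv y x.
Proof.
move=> [t t0 ->]; exists t^-1; rewrite ?invr_eq0 // exprVn mulfK //.
by rewrite expf_neq0.
Qed.

Lemma sq_equiv_trans y x z : sq_equiv x y -> sq_equiv y z -> sq_equiv x z.
Proof.
move=> [t t0 ->] [s s0 ->]; exists (s * t); rewrite ?mulf_neq0 //.
by ring.
Qed.

Lemma sq_equivM a x y : sq_equiv x y -> sq_equiv (a * x) (a * y).
Proof. by move=> [t t0 ->]; exists t => //; rewrite mulrA. Qed.

Lemma sq_equiv_cancel a x y : a != 0 -> sq_equiv (a * x) (a * y) -> sq_equiv x y.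
Proof. by move=> a0 [t t0]; rewrite -mulrA => /(mulfI a0) ->; exists t. Qed.

Lemma sq_equiv1 x t : x != 0 -> x = t ^+ 2 -> sq_equiv x 1.
Proof. by move=> x0 xt; exists t; rewrite ?mul1r //; apply: contraNneq x0 => t0; rewrite xt t0 expr0n. Qed.

Lemma sqclassE (a b : K) : sqclass a b <-> sq_equiv b a.
Proof. by split=> [[t t0 <-]|[t t0 ->]]; exists t. Qed.

Lemma eq_sqclass (a b : K) : sq_equiv a b <-> sqclass a = sqclass b.
Proof.
split=> [ab|E]; last by apply/sqclassE; rewrite -E; apply/sqclassE/sq_equiv_refl.
rewrite predeqE => x; rewrite !sqclassE; split=> H; first exact: sq_equiv_trans H ab.
exact: sq_equiv_trans H (sq_equiv_sym ab).
Qed.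

Definition represents_by (a b c d : K) : Prop :=
  exists x y z, a * x ^+ 2 + b * y ^+ 2 + c * z ^+ 2 = d.

Definition diag_anisotropic (a b c : K) : Prop :=
  forall x y z, a * x ^+ 2 + b * y ^+ 2 + c * z ^+ 2 = 0 -> [/\ x = 0, y = 0 & z = 0].

End SquareClasses.

(** * Square classes and diagonal ternary forms over a local field *)

Section LocalSquareClasses.
Variables (R : realType) (K : fieldType) (v : K -> R).
Hypothesis vP : nonarch_abs v.
Hypothesis vcomplete : abs_complete v.
Hypothesis v2 : v 2%:R = 1.
Variables (J : finType) (cls : K -> J).
Hypothesis clsP : forall x y, v x <= 1 -> v y <= 1 -> (cls x == cls y) = (v (x - y) < 1).
Variable pi : K.
Hypotheses (pi0 : pi != 0) (pi1 : v pi < 1) (pimax : forall x, v x < 1 -> v x <= v pi).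

Lemma unit_neq0 u : v u = 1 -> u != 0.
Proof. by move=> u1; rewrite -(nonarch_neq0 vP) u1 oner_neq0. Qed.

(** [eps] is a non-square unit. The parity of the valuation separates the classes with [pi] from
    those without; two non-square units differ by a square. *)
Lemma local_square_classes : exists eps,
  [/\ eps != 0, ~ sq_equiv eps 1, ~ sq_equiv pi 1, ~ sq_equiv (eps * pi) 1 &
   forall x, x != 0 -> [\/ sq_equiv x 1, sq_equiv x eps, sq_equiv x pi | sq_equiv x (eps * pi)]].
Proof.
have [eps e1 eN] := nonsquare_unit_exists vP v2 clsP.
have e0 := unit_neq0 e1.
have sq1 (x : K) : sq_equiv x 1 -> exists t, x = t ^+ 2 by move=> [t _ ->]; exists t; rewrite mul1r.
exists eps; split=> //.
- by move/sq1 => [t]; apply: eN.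
- move/sq1 => [t tE]; case: (@odd_not_square _ _ _ vP _ pi0 pi1 pimax 1 t (nonarch1 vP)).
  by rewrite mulr1.
- move/sq1 => [t tE]; case: (@odd_not_square _ _ _ vP _ pi0 pi1 pimax eps t e1).
  by rewrite mulrC.
have unit_class u : v u = 1 -> sq_equiv u 1 \/ sq_equiv u eps.
  move=> u1; have u0 := unit_neq0 u1.
  have [[t tE]|uN] := pselect (exists t, u = t ^+ 2); first by left; apply: sq_equiv1 tE.
  right; have [|t tE] := nonsquare_unit_mul vP vcomplete v2 clsP u1 e1 _ eN.
    by move=> t tE; apply: uN; exists t.
  exists (t / eps); last by rewrite expr_div_n -tE; field.
  rewrite mulf_neq0 ?invr_eq0 //; apply: contraNneq (mulf_neq0 u0 e0) => t0.
  by rewrite tE t0 expr0n.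
move=> x x0; have [t [u [b [t0 u1 ->]]]] := sq_decomp vP pi0 pi1 pimax x0.
have tt y : sq_equiv (t ^+ 2 * y) y by exists t => //; rewrite mulrC.
case: b; rewrite ?expr1 ?expr0 ?mul1r.
  have [H|H] := unit_class _ u1; [constructor 3|constructor 4]; apply: sq_equiv_trans (tt _) _.
    by rewrite -[X in sq_equiv _ X]mulr1; apply: sq_equivM.
  by rewrite [eps * _]mulrC; apply: sq_equivM.
have [H|H] := unit_class _ u1; [constructor 1|constructor 2]; exact: sq_equiv_trans (tt _) _.
Qed.

(** As a x^2 + b y^2 takes all unit values, a third coefficient that is a unit would make the form
    isotropic. So it is pi c, and -ab is not a square. Only values d = pi u t^2 need the third
    variable: it suffices when c u is a square, and otherwise -a b c u is a square, which puts d in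
    the excluded class. *)
Lemma unit_ternary_represents a b c (k : bool) d :
  v a = 1 -> v b = 1 -> v c = 1 -> diag_anisotropic a b (pi ^+ k * c) -> d != 0 ->
  ~ sq_equiv d (- (a * b * (pi ^+ k * c))) -> represents_by a b (pi ^+ k * c) d.
Proof.
move=> a1 b1 c1; have [a0 b0 c0] := And3 (unit_neq0 a1) (unit_neq0 b1) (unit_neq0 c1).
case: k => [|an]; last first.
  have Nc1 : v (- c) = 1 by rewrite (nonarchN vP).
  have [x [y E]] := unit_form_represents vP vcomplete v2 clsP a1 b1 Nc1.
  have [|_ _ /eqP] := an x y 1; first by rewrite E expr0 expr1n mul1r mulr1 addNr.
  by rewrite oner_eq0.
rewrite expr1 => an d0 dN.
have abN t : - (a * b) <> t ^+ 2.
  move=> tE; have [|_ a00 _] := an t a 0; last by rewrite a00 eqxx in a0.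
  by rewrite -tE; ring.
have [t [u [k [t0 u1 dE]]]] := sq_decomp vP pi0 pi1 pimax d0.
have u0 := unit_neq0 u1.
case: k dE; rewrite ?expr1 ?expr0 ?mul1r => dE; last first.
  have [x [y E]] := unit_form_represents vP vcomplete v2 clsP a1 b1 u1.
  by exists (t * x), (t * y), 0; rewrite dE -E; ring.
have [[r rE]|cuN] := pselect (exists r, c * u = r ^+ 2).
  exists 0, 0, (t * r / c); rewrite dE expr_div_n exprMn -rE; field.
  by [].
have vab : v (- (a * b)) = 1 by rewrite (nonarchN vP) (nonarchM vP) a1 b1 mulr1.
have vcu : v (c * u) = 1 by rewrite (nonarchM vP) c1 u1 mulr1.
have [|r rE] := nonsquare_unit_mul vP vcomplete v2 clsP vab vcu abN.
  by move=> r rE; apply: cuN; exists r.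
case: dN; exists (t * r / (a * b * c)).
  rewrite !mulf_neq0 ?invr_eq0 ?mulf_neq0 //.
  apply: contraNneq (mulf_neq0 (unit_neq0 vab) (unit_neq0 vcu)) => r0.
  by rewrite rE r0 expr0n.
rewrite dE expr_div_n exprMn -rE; field.
by rewrite a0 b0 c0.
Qed.

Lemma scaled_ternary_represents s a b c (k : bool) ta tb tc d :
  s != 0 -> v a = 1 -> v b = 1 -> v c = 1 -> ta != 0 -> tb != 0 -> tc != 0 ->
  diag_anisotropic (s * a * ta ^+ 2) (s * b * tb ^+ 2) (s * (pi ^+ k * c) * tc ^+ 2) ->
  d != 0 ->
  ~ sq_equiv d (- (s * a * ta ^+ 2 * (s * b * tb ^+ 2) * (s * (pi ^+ k * c) * tc ^+ 2))) ->
  represents_by (s * a * ta ^+ 2) (s * b * tb ^+ 2) (s * (pi ^+ k * c) * tc ^+ 2) d.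
Proof.
move=> s0 a1 b1 c1 ta0 tb0 tc0; set g := pi ^+ k * c => an d0 dN.
have [x [y [z E]]] : represents_by a b g (d / s).
  apply: unit_ternary_represents => //; last first.
  - move=> [t t0 tE]; apply: dN; exists (t / (s * ta * tb * tc)).
      by rewrite mulf_neq0 ?invr_eq0 ?mulf_neq0.
    rewrite -[d](divfK s0) tE -/g; field.
    by rewrite ta0 tb0 tc0 s0.
  - by rewrite mulf_neq0 ?invr_eq0.
  move=> x y z E; have [|x0 y0 z0] := an (x / ta) (y / tb) (z / tc).
    rewrite -[RHS](mulr0 s) -[in RHS]E -/g; field.
    by rewrite ta0 tb0 tc0.
  have div0 (w t : K) : t != 0 -> w / t = 0 -> w = 0.
    by move=> t0 /eqP; rewrite mulf_eq0 invr_eq0 (negPf t0) orbF => /eqP.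
  by split; [exact: div0 x0|exact: div0 y0|exact: div0 z0].
exists (x / ta), (y / tb), (z / tc); rewrite -[d](divfK s0) -E -/g; field.
by rewrite ta0 tb0 tc0.
Qed.

Lemma represents_by_perm (a b c d : K) : represents_by a b c d -> represents_by b c a d.
Proof. by move=> [x [y [z <-]]]; exists y, z, x; ring. Qed.

(** Two of the three valuations have the same parity; a cyclic permutation puts them first and their
    common power of [pi] is factored out. *)
Lemma ternary_represents (a b c d : K) : a != 0 -> b != 0 -> c != 0 ->
  diag_anisotropic a b c -> d != 0 -> ~ sq_equiv d (- (a * b * c)) -> represents_by a b c d.
Proof.
have main a' b' c' d' ta tb tc (i k : bool) ua ub uc :
   ta != 0 -> tb != 0 -> tc != 0 -> v ua = 1 -> v ub = 1 -> v uc = 1 ->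
   a' = ta ^+ 2 * (pi ^+ i * ua) -> b' = tb ^+ 2 * (pi ^+ i * ub) -> c' = tc ^+ 2 * (pi ^+ k * uc) ->
   diag_anisotropic a' b' c' -> d' != 0 -> ~ sq_equiv d' (- (a' * b' * c')) -> represents_by a' b' c' d'.
  move=> ta0 tb0 tc0 ua1 ub1 uc1 aE bE cE.
  (* After division by pi^i the third parity is i xor k; for i = 1 and k = 0 a factor pi^2 is
     absorbed by [tc']. *)
  have [tc' tc0' {}cE] : exists2 tc', tc' != 0 & c' = pi ^+ i * (pi ^+ (i (+) k) * uc) * tc' ^+ 2.
    case: i k {aE bE} cE => -[] /= ->; rewrite ?expr0 ?expr1 ?mul1r.
    - by exists tc => //; rewrite mulrC.
    - by exists (tc / pi); rewrite ?mulf_neq0 ?invr_eq0 //; field.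
    - by exists tc => //; rewrite mulrC.
    - by exists tc => //; rewrite mulrC.
  have {}aE : a' = pi ^+ i * ua * ta ^+ 2 by rewrite aE mulrC.
  have {}bE : b' = pi ^+ i * ub * tb ^+ 2 by rewrite bE mulrC.
  rewrite aE bE cE; apply: scaled_ternary_represents => //.
  by rewrite expf_neq0.
move=> a0 b0 c0 an d0 dN.
have [ta [ua [i [ta0 ua1 aE]]]] := sq_decomp vP pi0 pi1 pimax a0.
have [tb [ub [j [tb0 ub1 bE]]]] := sq_decomp vP pi0 pi1 pimax b0.
have [tc [uc [k [tc0 uc1 cE]]]] := sq_decomp vP pi0 pi1 pimax c0.
have [ij|ij] := eqVneq i j.
  by subst j; apply: main aE bE cE an d0 dN.
have [jk|jk] := eqVneq j k.
  subst k; apply/represents_by_perm/represents_by_perm.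
  apply: (main b c a d) bE cE aE _ d0 _ => //.
    by move=> x y z E; have [|? ? ?] := an z x y; rewrite // -E; ring.
  by rewrite (_ : b * c * a = a * b * c) //; ring.
have ki : k = i by case: i j k ij jk {aE bE cE} => -[] [].
subst k; apply: represents_by_perm.
apply: (main c a b d) cE aE bE _ d0 _ => //.
  by move=> x y z E; have [|? ? ?] := an y z x; rewrite // -E; ring.
by rewrite (_ : c * a * b = a * b * c) //; ring.
Qed.

End LocalSquareClasses.

(** * Graded Lie algebras and relative invariants *)

Section GradedLieAlgebra.
Import passmx.
Variables (F K : fieldType) (iota : {rmorphism F -> K}) (L : lieType F) (H0 : L).
Hypothesis F0 : [pchar F] =i pred0.

Lemma lieZr (c : F) (x y : L) : lie x (c *: y) = c *: lie x y.
Proof. by rewrite -[c *: y]addr0 lie_linearr lie0r addr0. Qed.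

Lemma adE (x y : L) : ad x y = lie x y.
Proof.
pose f : {linear L -> L} := HB.pack (lie x)
  (GRing.isLinear.Build _ _ _ _ _ (fun c : F => lie_linearr c x)).
by rewrite /ad -[LHS]/(linfun f y) lfunE.
Qed.

Lemma mem_grade a X : (X \in grade H0 a) = (lie H0 X == a *: X).
Proof.
rewrite /grade /leigenspace memv_ker add_lfunE opp_lfunE scale_lfunE id_lfunE adE.
by rewrite subr_eq0.
Qed.

Lemma gradedP : (forall X, exists X1 X2 X3,
    [/\ X = X1 + X2 + X3, lie H0 X1 = - 2%:R *: X1, lie H0 X2 = 0 & lie H0 X3 = 2%:R *: X3]) ->
  graded H0.
Proof.
move=> dec; have two0 : 2%:R != 0 :> F by have /pcharf0P -> := F0.
have eigen0 a b (X : L) : a != b -> a *: X = b *: X -> X = 0.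
  move=> ab /eqP; rewrite -subr_eq0 -scalerBl scaler_eq0 subr_eq0 (negPf ab).
  by move/eqP.
split.
  rewrite !directv_addE !directv_trivial /= -!subv0; apply/andP; split; apply/subvP => X.
    rewrite memv_cap !mem_grade memv0 => /andP[/eqP -> /eqP E].
    by apply/eqP/(eigen0 _ _ _ _ E); rewrite oppr_eq0.
  rewrite memv_cap memv0 => /andP[/memv_addP[A A1 [B B1 ->]]].
  move: A1 B1; rewrite !mem_grade => /eqP hA /eqP hB /eqP.
  rewrite lieDr hA hB scale0r addr0 => E.
  have E2 : - 2%:R *: (- 2%:R *: A) = 2%:R *: (- 2%:R *: A).
    by have := congr1 (lie H0) E; rewrite !lieZr lieDr hA hB scale0r addr0.
  have ne : - 2%:R != 2%:R :> F.
    rewrite -subr_eq0 -opprD oppr_eq0 -natrD.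
    by have /pcharf0P -> := F0.
  have A0 : A = 0.
    have /eqP := eigen0 _ _ _ ne E2.
    by rewrite scaler_eq0 oppr_eq0 (negPf two0) => /eqP.
  move/eqP: E; rewrite A0 add0r scaler0 eq_sym scaler_eq0 (negPf two0).
  by move=> /eqP ->.
apply/eqP; rewrite eqEsubv subvf; apply/subvP => X _.
have [A [B [C [-> hA hB hC]]]] := dec X.
by rewrite !memv_add // mem_grade ?hA ?hB ?hC ?scale0r.
Qed.

Lemma grG_grade g a X : grG iota H0 g -> X \in grade H0 a -> g X \in grade H0 a.
Proof.
move=> [[[_ gM] _] gH]; rewrite !mem_grade => /eqP E.
by rewrite -{1}gH -gM E linearZ.
Qed.

Section Evaluation.
Variable V : {vspace L}.

Lemma vpeval_polynomial (P : {mpoly F[\dim V]}) (X : L) :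
  exists p : {mpoly F[\dim {:L} * \dim {:L}]}, forall g : 'End(L),
    vpeval P (g X) = p.@[fun i => mxvec (mxof (vbasis {:L}) (vbasis {:L}) g) 0 i].
Proof.
set e := vbasis {:L}; pose N := \dim {:L}.
pose lq := [tuple \sum_(k < N) \sum_(l < N)
  (rVof e X 0 k * coord (vbasis V) i e`_l) *: 'X_(mxvec_index k l) : {mpoly F[N * N]} | i < \dim V].
exists (P \mPo lq) => g; rewrite comp_mpoly_meval; apply: meval_eq => i.
rewrite tnth_mktuple (raddf_sum (meval _)).
under eq_bigr do rewrite (raddf_sum (meval _)).
rewrite -[g X](rVofK (vbasisP {:L})) (@rVof_app _ _ _ e e (vbasisP _)) /vecof linear_sum /=.
rewrite exchange_big; apply: eq_bigr => l _ /=.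
rewrite linearZ /= mxE mulr_suml; apply: eq_bigr => k _.
by rewrite mevalZ mevalXU mxvecE; ring.
Qed.

(** The character is P(g X0) / P(X0) at a point where P does not vanish; it is a polynomial in the
    entries of [g], so the exponent of the determinant can be 0. *)
Lemma relative_invariantP (G : set 'End(L)) (P : {mpoly F[\dim V]}) (X0 : L) :
  X0 \in V -> vpeval P X0 != 0 -> (forall g X, G g -> X \in V -> g X \in V) ->
  (forall g, G g -> exists2 c, c != 0 & forall X, X \in V -> vpeval P (g X) = c * vpeval P X) ->
  relative_invariant G P.
Proof.
move=> X0V PX0 GV GP; pose chi (g : 'End(L)) := vpeval P (g X0) / vpeval P X0.
have chiE g X : G g -> X \in V -> vpeval P (g X) = chi g * vpeval P X.
  by move=> Gg XV; have [c c0 cE] := GP _ Gg; rewrite /chi !cE // mulfK.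
exists chi => //; split.
- by move=> g Gg; have [c c0 cE] := GP _ Gg; rewrite /chi cE // mulfK.
- move=> g h Gg Gh; rewrite {1}/chi lfunE /= chiE //; last exact: GV.
  by rewrite [vpeval P (h X0)]chiE // mulrA mulfK.
have [p pE] := vpeval_polynomial P X0.
exists ((vpeval P X0)^-1 *: p), 0%N => g _.
by rewrite expr0 divr1 mevalZ -pE mulrC.
Qed.

End Evaluation.
End GradedLieAlgebra.

(** * Irreducibility, degrees and rationality of polynomials *)

Section IrreduciblePolynomials.
Variables (K : fieldType) (n : nat).

Lemma mpolyC_unit (c : K) : c != 0 -> (c%:MP : {mpoly K[n]}) \is a GRing.unit.
Proof.
move=> c0; apply/unitrP; exists (c^-1)%:MP.
by rewrite -!mpolyCM mulVf // mulfV // mpolyC1.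
Qed.

Lemma irreducible_power (p : {mpoly K[n]}) (c : K) k :
  p \isn't a GRing.unit -> irreducible_elt (c *: p ^+ k) -> k = 1%N.
Proof.
move=> pN [nz nu irr].
have c0 : c != 0 by apply: contraNneq nz => ->; rewrite scale0r.
case: k nz nu irr => [|[|k]] // nz nu irr.
  by case/negP: nu; rewrite expr0 -mul_mpolyC mulr1 mpolyC_unit.
have E : c *: p ^+ k.+2 = (c *: p) * p ^+ k.+1 by rewrite exprS scalerAl.
have [|u] := irr _ _ E.
  by rewrite -mul_mpolyC unitrM (negPf pN) andbF.
by move: u; rewrite unitrX_pos // (negPf pN).
Qed.

Lemma meval0_nonunit (p : {mpoly K[n]}) v : p.@[v] = 0 -> p \isn't a GRing.unit.
Proof.
move=> pv; apply/negP => /unitrP[q [qp _]].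
by have /eqP := congr1 (meval v) qp; rewrite mevalM pv mulr0 meval1 eq_sym oner_eq0.
Qed.

(** The scalar c = 2 is enough: a monomial of degree k is multiplied by 2^k, and distinct powers of
    2 stay distinct in characteristic 0. *)
Lemma homogeneous_msize (K0 : [pchar K] =i pred0) (p : {mpoly K[n]}) d : p != 0 ->
  (forall c t, p.@[fun i => c * t i] = c ^+ d * p.@[t]) -> msize p = d.+1.
Proof.
move=> p0 ph; have supp m : m \in msupp p -> mdeg m = d.
  pose q := \sum_(m <- msupp p) (p@_m * 2%:R ^+ mdeg m) *: 'X_[m] - 2%:R ^+ d *: p : {mpoly K[n]}.
  have q0 : q = 0.
    apply: (mpoly_fun_eq0 K0) => t; rewrite mevalB mevalZ -ph (raddf_sum (meval t)) mevalE.
    apply/eqP; rewrite subr_eq0; apply/eqP; apply: eq_bigr => m' _.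
    rewrite /= mevalZ mevalX -mulrA; congr (_ * _).
    under [RHS]eq_bigr do rewrite exprMn.
    by rewrite big_split /= prodrXr mdegE.
  move=> mp; have := congr1 (mcoeff m) q0.
  rewrite mcoeffB mcoeffZ mcoeff0 (raddf_sum (mcoeff m)) (bigD1_seq m) ?msupp_uniq //=.
  rewrite mcoeffZ mcoeffX eqxx mulr1 big1 ?addr0 => [|m' m'm]; last first.
    by rewrite mcoeffZ mcoeffX (negPf m'm) mulr0.
  rewrite mulrC -mulrBl => /eqP; rewrite mulf_eq0 -[p@_m == 0]negbK -mcoeff_msupp mp orbF.
  rewrite subr_eq0 -!natrX => /eqP /(natf_inj K0) /eqP.
  by rewrite eqn_exp2l // => /eqP.
rewrite msizeE; have [m mp] : exists m, m \in msupp p.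
  case: (msupp p) (msupp_eq0 p) => [|m s _]; last by exists m; rewrite inE eqxx.
  by rewrite eqxx => /esym/eqP p00; rewrite p00 eqxx in p0.
apply/eqP; rewrite eqn_leq; apply/andP; split.
  by apply/bigmax_leqP_seq => m' m'p _; rewrite supp.
by rewrite -(supp _ mp); apply: (leq_bigmax_seq (F := fun m => (mdeg m).+1)).
Qed.

End IrreduciblePolynomials.

Section PowerRoots.
Variables (F K : fieldType) (iota : {rmorphism F -> K}) (n : nat).
Lemma map_mpoly_inj : injective (map_mpoly iota : {mpoly F[n]} -> {mpoly K[n]}).
Proof.
move=> p q pq; apply/mpolyP => m; apply: (fmorph_inj iota).
by rewrite -!mcoeff_map_mpoly pq.
Qed.

Hypothesis K0 : [pchar K] =i pred0.

Lemma mcoeffM_lowest (r s : {mpoly K[n]}) d m :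
  (forall m', (mdeg m' < d)%N -> r@_m' = 0) -> mdeg m = d -> (r * s)@_m = r@_m * s@_0.
Proof.
move=> r0 dm; rewrite mcoeffM.
have lt1 : (mdeg m < (mdeg m).+1)%N by [].
have lt0 : (mdeg (0%MM : 'X_{1..n}) < (mdeg m).+1)%N by rewrite mdeg0.
rewrite (bigD1 (BMultinom lt1, BMultinom lt0)) /=; last by rewrite addm0.
rewrite big1 ?addr0 // => -[m1 m2] /= /andP[/eqP mE ne].
have [lt|ge] := ltnP (mdeg m1) d; first by rewrite r0 // mul0r.
case/eqP: ne; have m20 : (m2 : 'X_{1..n}) = 0%MM.
  by apply/eqP; rewrite -mdeg_eq0; have := congr1 mdeg mE; rewrite mdegD; lia.
have m1E : (m1 : 'X_{1..n}) = m by have := mE; rewrite m20 addm0 => /esym.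
by congr (_, _); apply: val_inj.
Qed.

(* By induction on the degree d: if A is defined over F and agrees with p in
   degree < d, then in degree d the polynomial p^k - A^k is k (p - A). *)
Lemma power_root_rational (p : {mpoly K[n]}) (q : {mpoly F[n]}) k :
  (0 < k)%N -> p@_0 = 1 -> p ^+ k = map_mpoly iota q -> exists p0, p = map_mpoly iota p0.
Proof.
move=> k0 p1 pk.
suff H d m : mdeg m = d -> exists c, p@_m = iota c.
  have /choice[c cE] m : exists c, p@_m = iota c by apply: H (erefl _).
  exists (\sum_(m <- msupp p) c m *: 'X_[m]); rewrite [LHS]mpolyE raddf_sum.
  by apply: eq_bigr => m _; rewrite /= map_mpolyZ map_mpolyX cE.
elim/ltn_ind: d m => -[_ m /eqP|d IH m dm].
  by rewrite mdeg_eq0 => /eqP ->; exists 1; rewrite p1 rmorph1.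
have /choice[c cE] m' : exists c, (mdeg m' < d.+1)%N -> p@_m' = iota c.
  have [lt|_] := ltnP (mdeg m') d.+1; last by exists 0.
  by have [c cE] := IH _ lt m' (erefl _); exists c.
pose A := \sum_(m' <- msupp p | (mdeg m' < d.+1)%N) c m' *: 'X_[m'].
have AE : map_mpoly iota A = \sum_(m' <- msupp p | (mdeg m' < d.+1)%N) p@_m' *: 'X_[m'].
  rewrite raddf_sum; apply: eq_bigr => m' lt.
  by rewrite /= map_mpolyZ map_mpolyX cE.
have pA m' : (mdeg m' < d.+1)%N -> (p - map_mpoly iota A)@_m' = 0.
  move=> lt; have -> : p - map_mpoly iota A =
      \sum_(m'' <- msupp p | ~~ (mdeg m'' < d.+1)%N) p@_m'' *: 'X_[m''].
    by rewrite {1}[p]mpolyE (bigID (fun m'' => (mdeg m'' < d.+1)%N)) /= -AE addrC addrK.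
  rewrite raddf_sum big1 //= => m'' ge; rewrite mcoeffZ mcoeffX.
  by case: eqP ge => [->|_]; rewrite ?lt ?mulr0.
have A1 : (map_mpoly iota A)@_0 = 1.
  by apply/eqP; rewrite -p1 eq_sym -subr_eq0 -mcoeffB pA // mdeg0.
have := congr1 (mcoeff m) (subrXX p (map_mpoly iota A) k).
rewrite (mcoeffM_lowest _ pA dm) pk -rmorphXn -rmorphB mcoeff_map_mpoly.
have -> : (\sum_(i < k) p ^+ (k.-1 - i) * map_mpoly iota A ^+ i)@_0 = k%:R.
  rewrite -meval_at0 raddf_sum -[k in RHS]card_ord -sum1_card natr_sum.
  apply: eq_bigr => i _; rewrite /= mevalM !(rmorphXn (meval _)) /=.
  by rewrite !meval_at0 p1 A1 !expr1n mulr1.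
have k0' : k%:R != 0 :> K by have /pcharf0P -> := K0; rewrite -lt0n.
have k0F : iota k%:R = k%:R by rewrite rmorph_nat.
rewrite mcoeffB mcoeff_map_mpoly => E; exists ((q - A ^+ k)@_m / k%:R + A@_m).
by rewrite rmorphD fmorph_div k0F E mulfK // subrK.
Qed.

End PowerRoots.

(** * The graded algebra sl_2(D) *)

Section Sl2Algebra.
Variables (F : fieldType) (K : closedFieldType) (iota : {rmorphism F -> K}) (D : falgType F).
Variables (delta : nat) (phi : splitting iota D delta).
Hypothesis F0 : [pchar F] =i pred0.
Hypothesis K0 : [pchar K] =i pred0.
Hypothesis Dunit : forall x : D, x != 0 -> x \is a GRing.unit.
Hypothesis Dcent : ('Z({:D}) = 1)%VS.
Hypothesis Ddim : \dim {:D} = (delta ^ 2)%N.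

Local Notation L := (subvs_of (sl2 phi)).
Local Notation H0 := (sl2_H phi : L).
Local Notation G := (grG iota H0).
Local Notation up := (sl2_upper phi).
Local Notation LK := (lie_ext iota L).
Local Notation e := (vbasis {:D}).

Lemma ord2P (i : 'I_2) : i = 0 \/ i = 1.
Proof. by case: i => [[|[|//]] ?]; [left | right]; apply: val_inj. Qed.

Lemma mx22P (X Y : mat2 D) : X 0 0 = Y 0 0 -> X 0 1 = Y 0 1 -> X 1 0 = Y 1 0 -> X 1 1 = Y 1 1 ->
  X = Y.
Proof.
by move=> *; apply/matrixP => i j; case: (ord2P i) (ord2P j) => -> [] ->.
Qed.

Lemma mx22E (a x y b : D) : ((mx22 a x y b 0 0 = a) * (mx22 a x y b 0 1 = x) *
  (mx22 a x y b 1 0 = y) * (mx22 a x y b 1 1 = b))%type.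
Proof. by rewrite !mxE. Qed.

Lemma mat2M (X Y : mat2 D) i j : (X * Y) i j = X i 0 * Y 0 j + X i 1 * Y 1 j.
Proof.
rewrite mxE big_ord_recl big_ord1; congr (_ + X i _ * Y _ j); exact: val_inj.
Qed.

Lemma mat2Z c (X : mat2 D) i j : (c *: X) i j = c *: X i j.
Proof. by rewrite mxE. Qed.

Lemma mat2D (X Y : mat2 D) i j : (X + Y) i j = X i j + Y i j.
Proof. by rewrite mxE. Qed.

Lemma mat2B (X Y : mat2 D) i j : (X - Y) i j = X i j - Y i j.
Proof. by rewrite !mxE. Qed.

Lemma vsvalZ c (X : L) : vsval (c *: X) = c *: vsval X. Proof. exact: linearZ. Qed.
Lemma vsval_add (X Y : L) : vsval (X + Y) = vsval X + vsval Y. Proof. exact: linearD. Qed.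
Lemma vsval_lie (X Y : L) : vsval (lie X Y) = vsval X * vsval Y - vsval Y * vsval X.
Proof. by []. Qed.

Lemma diag_conj_subproof (u v : D) (X : L) : u \is a GRing.unit -> v \is a GRing.unit ->
  mx22 u 0 0 v * vsval X * mx22 u^-1 0 0 v^-1 \in sl2 phi.
Proof.
move=> uu uv; rewrite mem_sl2 !mat2M !mx22E !mul0r !mulr0 !addr0 !add0r.
rewrite redtrD redtrC mulrA mulVr // mul1r (redtrC _ (_ * _)) mulrA mulVr // mul1r -redtrD.
by have := subvsP X; rewrite mem_sl2.
Qed.

Definition diag_conj (w : D * D) : 'End(L) :=
  linfun (vsproj (sl2 phi) \o (fun X : L => mx22 w.1 0 0 w.2 * vsval X * mx22 w.1^-1 0 0 w.2^-1 : mat2 D)).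

Lemma diag_conjE u v (X : L) : u \is a GRing.unit -> v \is a GRing.unit ->
  vsval (diag_conj (u, v) X) = mx22 u 0 0 v * vsval X * mx22 u^-1 0 0 v^-1.
Proof.
move=> uu uv; pose h (X : L) : L := vsproj (sl2 phi) (mx22 u 0 0 v * vsval X * mx22 u^-1 0 0 v^-1 : mat2 D).
have lin : linear h.
  move=> c Y Z; rewrite /h vsval_add vsvalZ mulrDr mulrDl -scalerAr -scalerAl.
  by rewrite linearP.
pose f : {linear L -> L} := HB.pack h (GRing.isLinear.Build _ _ _ _ _ lin).
rewrite /diag_conj -[linfun _]/(linfun f) lfunE /= /h vsprojK //.
exact: diag_conj_subproof.
Qed.

Lemma mx22_diagM (u v u' v' : D) : mx22 u 0 0 v * mx22 u' 0 0 v' = mx22 (u * u') 0 0 (v * v').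
Proof.
by apply: mx22P; rewrite mat2M !mx22E !(mul0r, mulr0) ?(addr0, add0r).
Qed.

Lemma mx22_1 : mx22 1 0 0 1 = 1 :> mat2 D.
Proof. by apply: mx22P; rewrite !mxE. Qed.

Lemma diag_conjM u v u' v' : u \is a GRing.unit -> v \is a GRing.unit ->
  u' \is a GRing.unit -> v' \is a GRing.unit ->
  diag_conj (u * u', v * v') = (diag_conj (u, v) \o diag_conj (u', v'))%VF.
Proof.
move=> uu uv uu' uv'; apply/lfunP => X; apply: val_inj.
rewrite lfunE /= !diag_conjE ?unitrMl //.
by rewrite !invrM // -!mx22_diagM !mulrA.
Qed.

Lemma diag_conj1 : diag_conj (1, 1) = \1%VF.
Proof.
apply/lfunP => X; apply: val_inj; rewrite lfunE /= diag_conjE ?unitr1 //.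
by rewrite invr1 mx22_1 mul1r mulr1.
Qed.

Lemma diag_conj_upper u v x : u \is a GRing.unit -> v \is a GRing.unit ->
  diag_conj (u, v) (up x) = up (u * x * v^-1).
Proof.
move=> uu uv; apply: val_inj; rewrite /= diag_conjE //=.
by apply: mx22P; rewrite !mat2M !mx22E !(mul0r, mulr0, addr0, add0r).
Qed.

Lemma diag_conj_lie_aut u v : u \is a GRing.unit -> v \is a GRing.unit ->
  is_lie_aut (diag_conj (u, v)).
Proof.
move=> uu uv; split.
  exists (diag_conj (u^-1, v^-1)) => X.
    by rewrite -comp_lfunE -diag_conjM ?unitrV // !mulVr // diag_conj1 lfunE.
  by rewrite -comp_lfunE -diag_conjM ?unitrV // !mulrV // diag_conj1 lfunE.
move=> X Y; apply: val_inj.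
change (vsval (diag_conj (u, v) (lie X Y)) = vsval (lie (diag_conj (u, v) X) (diag_conj (u, v) Y))).
rewrite vsval_lie !diag_conjE // vsval_lie.
have E : mx22 u^-1 0 0 v^-1 * mx22 u 0 0 v = 1 :> mat2 D.
  by rewrite mx22_diagM !mulVr // mx22_1.
have cancel (A B : mat2 D) : mx22 u 0 0 v * A * mx22 u^-1 0 0 v^-1 * (mx22 u 0 0 v * B * mx22 u^-1 0 0 v^-1)
    = mx22 u 0 0 v * (A * B) * mx22 u^-1 0 0 v^-1.
  by rewrite -!mulrA; congr (_ * (_ * _)); rewrite !mulrA E mul1r.
by rewrite mulrBr mulrBl !cancel.
Qed.

Lemma diag_conj_H u v : u \is a GRing.unit -> v \is a GRing.unit -> diag_conj (u, v) H0 = H0.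
Proof.
move=> uu uv; apply: val_inj; rewrite /= diag_conjE //= !mx22_diagM !mulr1.
by apply: mx22P; rewrite !mx22E // ?mulrV // mulrN1 mulNr mulrV.
Qed.

Definition block_rho (X : mat2 D) : 'M[K]_(delta + delta) :=
  block_mx (phi (X 0 0)) (phi (X 0 1)) (phi (X 1 0)) (phi (X 1 1)).

Definition sl2_rho (X : L) := block_rho (vsval X).

Lemma block_rhoM X Y : block_rho (X * Y) = block_rho X *m block_rho Y.
Proof.
by rewrite /block_rho mulmx_block !mat2M !rmorphD !rmorphM.
Qed.

Lemma block_rhoP a X Y : block_rho (a *: X + Y) = iota a *: block_rho X + block_rho Y.
Proof.
rewrite /block_rho scale_block_mx add_block_mx !mat2D !mat2Z.
by rewrite !rmorphD /= !splitZ.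
Qed.

Lemma block_rhoB X Y : block_rho (X - Y) = block_rho X - block_rho Y.
Proof. by rewrite addrC -scaleN1r block_rhoP rmorphN1 scaleN1r addrC. Qed.

Lemma block_rho_inj : injective block_rho.
Proof.
move=> X Y /eq_block_mx[e1 e2 e3 e4].
by apply: mx22P; apply: (split_inj Dunit (phi := phi) Ddim).
Qed.

Lemma sl2_rhoP a (X Y : L) : sl2_rho (a *: X + Y) = iota a *: sl2_rho X + sl2_rho Y.
Proof. by rewrite /sl2_rho vsval_add vsvalZ block_rhoP. Qed.

Lemma sl2_rho_lie (X Y : L) : sl2_rho (lie X Y) = mxad (sl2_rho X) (sl2_rho Y).
Proof. by rewrite /sl2_rho vsval_lie block_rhoB !block_rhoM. Qed.

(** A relation between block matrices amounts to four relations between values of [phi]. Through the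
    projection onto sl_2(D), the j-th coordinate is a sum of four forms on D, one for each entry,
    and each may be applied to its relation. *)
Lemma sl2_rho_free (k : 'I_(\dim {:L}) -> K) :
  \sum_i k i *: sl2_rho (vbasis {:L})`_i = 0 -> forall i, k i = 0.
Proof.
move=> k0 j; set b := vbasis {:L} in k0 *.
have comp (pq : 'I_2 * 'I_2) : \sum_i k i *: phi (vsval b`_i pq.1 pq.2) = 0.
  have blk (f : mat2 D -> 'M[K]_delta) (sub : 'M[K]_(delta + delta) -> 'M[K]_delta) :
      linear sub -> (forall X, sub (block_rho X) = f X) -> \sum_i k i *: f (vsval b`_i) = 0.
    move=> subL subE; pose g : {linear 'M[K]_(delta + delta) -> 'M[K]_delta} :=
      HB.pack sub (GRing.isLinear.Build _ _ _ _ _ subL).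
    rewrite -[RHS](linear0 g) -[in RHS]k0 linear_sum; apply: eq_bigr => i _.
    by rewrite linearZ /= -subE.
  case: pq => p q; case: (ord2P p) (ord2P q) => -> [] -> /=.
  - apply: (blk (fun X => phi (X 0 0)) ulsubmx) => [c X Y|X]; last by rewrite block_mxKul.
    by apply/matrixP => a c'; rewrite !mxE.
  - apply: (blk (fun X => phi (X 0 1)) ursubmx) => [c X Y|X]; last by rewrite block_mxKur.
    by apply/matrixP => a c'; rewrite !mxE.
  - apply: (blk (fun X => phi (X 1 0)) dlsubmx) => [c X Y|X]; last by rewrite block_mxKdl.
    by apply/matrixP => a c'; rewrite !mxE.
  - apply: (blk (fun X => phi (X 1 1)) drsubmx) => [c X Y|X]; last by rewrite block_mxKdr.
    by apply/matrixP => a c'; rewrite !mxE.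
pose unitm (pq : 'I_2 * 'I_2) (x : D) : mat2 D :=
  \matrix_(i, j) (if (i == pq.1) && (j == pq.2) then x else 0).
pose l pq x := coord b j (vsproj (sl2 phi) (unitm pq x)).
have lP pq : scalar (l pq).
  move=> c x y; rewrite /l -linearP -linearP; congr (coord b j (vsproj _ _)).
  by apply/matrixP => p q; rewrite !mxE; case: ifP => // _; rewrite scaler0 addr0.
have decomp (X : L) : \sum_pq l pq (vsval X pq.1 pq.2) = coord b j X.
  rewrite -linear_sum -linear_sum -[in RHS](vsvalK X); congr (coord b j (vsproj _ _)).
  apply/matrixP => p q; rewrite summxE (bigD1 (p, q)) //= mxE !eqxx big1 ?addr0 //.
  by move=> [p' q'] ne; rewrite mxE; case: andP => // -[/eqP pE /eqP qE]; rewrite pE qE eqxx in ne.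
have : \sum_i k i * iota (coord b j b`_i) = 0.
  under eq_bigr do rewrite -decomp rmorph_sum mulr_sumr.
  rewrite exchange_big big1 // => pq _ /=.
  exact: (splitting_free Dunit Dcent Ddim (comp pq) (lP pq)).
rewrite (bigD1 j) //= coord_free ?(basis_free (vbasisP _)) // eqxx rmorph1 mulr1.
rewrite big1 ?addr0 // => i /negPf ji.
by rewrite coord_free ?(basis_free (vbasisP _)) // ji rmorph0 mulr0.
Qed.

Local Notation rho_ext := (@rho_ext F K iota L (delta + delta) sl2_rho).

Definition in_sl2_ext (Y : 'M[K]_(delta + delta)) := exists u, rho_ext u = Y.

Lemma in_sl2_ext0 : in_sl2_ext 0.
Proof. by exists 0; rewrite rho_ext0. Qed.

Lemma in_sl2_extP c Y Z : in_sl2_ext Y -> in_sl2_ext Z -> in_sl2_ext (c *: Y + Z).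
Proof. by move=> [u <-] [w <-]; exists (c *: u + w); rewrite rho_extP. Qed.

Lemma in_sl2_extZ c Y : in_sl2_ext Y -> in_sl2_ext (c *: Y).
Proof. by move=> iY; rewrite -[_ *: _]addr0; apply: in_sl2_extP (in_sl2_ext0). Qed.

Lemma in_sl2_ext_sum (I : Type) (r : seq I) (f : I -> 'M[K]_(delta + delta)) :
  (forall i, in_sl2_ext (f i)) -> in_sl2_ext (\sum_(i <- r) f i).
Proof.
move=> fP; elim/big_ind: _ => //; first exact: in_sl2_ext0.
by move=> Y Z iY iZ; rewrite -[Y]scale1r; apply: in_sl2_extP.
Qed.

Lemma in_sl2_ext_mxad Y Z : in_sl2_ext Y -> in_sl2_ext Z -> in_sl2_ext (mxad Y Z).
Proof.
by move=> [u <-] [w <-]; exists (lie u w); rewrite (rho_ext_lie sl2_rhoP sl2_rho_lie).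
Qed.

Lemma sl2_lower_subproof (x : D) : mx22 0 0 x 0 \in sl2 phi.
Proof. by rewrite mem_sl2 !mx22E addr0 redtr0. Qed.

Lemma in_sl2_ext_upper (A : 'M[K]_delta) : in_sl2_ext (block_mx 0 A 0 0).
Proof.
have -> : block_mx 0 A 0 0 = \sum_i split_coord phi A i *: sl2_rho (up e`_i).
  rewrite -{1}[A](split_coordK Dunit Dcent phi Ddim).
  rewrite (big_morph (fun B => block_mx 0 B 0 0 : 'M_(delta + delta)) (id1 := 0) (op1 := +%R)).
  - by apply: eq_bigr => i _; rewrite /sl2_rho /block_rho !mx22E rmorph0 scale_block_mx !scaler0.
  - by move=> B C; rewrite add_block_mx !addr0.
  - exact: block_mx0.
by apply: in_sl2_ext_sum => i; apply: in_sl2_extZ; exists (to_ext iota (up e`_i)); rewrite rho_ext_to_ext //; apply: sl2_rhoP.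
Qed.

Lemma in_sl2_ext_lower (A : 'M[K]_delta) : in_sl2_ext (block_mx 0 0 A 0).
Proof.
pose low x : L := Subvs (sl2_lower_subproof x).
have -> : block_mx 0 0 A 0 = \sum_i split_coord phi A i *: sl2_rho (low e`_i).
  rewrite -{1}[A](split_coordK Dunit Dcent phi Ddim).
  rewrite (big_morph (fun B => block_mx 0 0 B 0 : 'M_(delta + delta)) (id1 := 0) (op1 := +%R)).
  - by apply: eq_bigr => i _; rewrite /sl2_rho /block_rho !mx22E rmorph0 scale_block_mx !scaler0.
  - by move=> B C; rewrite add_block_mx !addr0.
  - exact: block_mx0.
by apply: in_sl2_ext_sum => i; apply: in_sl2_extZ; exists (to_ext iota (low e`_i)); rewrite rho_ext_to_ext //; apply: sl2_rhoP.
Qed.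

(** The off-diagonal blocks are filled because D spans the matrices over K; matrix units inside a
    diagonal block are commutators of an upper and a lower one. *)
Lemma in_sl2_ext_delta i j : i != j -> in_sl2_ext (delta_mx i j).
Proof.
have ul (a b : 'I_delta) : in_sl2_ext (delta_mx (lshift delta a) (rshift delta b)).
  have -> : delta_mx (lshift delta a) (rshift delta b) = block_mx 0 (delta_mx a b) 0 0 :> 'M[K]_(delta + delta).
    rewrite -[LHS]submxK; congr block_mx; apply/matrixP => k l; rewrite !mxE;
      by rewrite ?(eq_lrshift, eq_rlshift, eq_lshift, eq_rshift, andbF).
  exact: in_sl2_ext_upper.
have lu (a b : 'I_delta) : in_sl2_ext (delta_mx (rshift delta a) (lshift delta b)).
  have -> : delta_mx (rshift delta a) (lshift delta b) = block_mx 0 0 (delta_mx a b) 0 :> 'M[K]_(delta + delta).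
    rewrite -[LHS]submxK; congr block_mx; apply/matrixP => k l; rewrite !mxE;
      by rewrite ?(eq_lrshift, eq_rlshift, eq_lshift, eq_rshift, andbF).
  exact: in_sl2_ext_lower.
have comm (a b c : 'I_(delta + delta)) : a != b ->
    in_sl2_ext (delta_mx a c) -> in_sl2_ext (delta_mx c b) -> in_sl2_ext (delta_mx a b).
  move=> ab hac hcb; have := in_sl2_ext_mxad hac hcb.
  by rewrite /mxad mul_delta_mx mul_delta_mx_0 1?eq_sym // subr0.
case: (split_ordP i) => a ->; case: (split_ordP j) => b -> ne.
- exact: comm ne (ul a b) (lu b b).
- exact: ul.
- exact: lu.
- exact: comm ne (lu a b) (ul b b).
Qed.

Local Notation elconj := (@elementary_conj F K iota L (delta + delta) sl2_rho).

Lemma elementary_conj_unitmx (P : 'M[K]_(delta + delta)) : P \in unitmx -> elconj P.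
Proof.
move=> uP; have dgt0 := degree_gt0 Ddim.
(* Division by a root of order 2 delta of the determinant does not change the conjugation and makes
   the determinant 1. *)
have [s /rootP sE] : exists s, root ('X^(delta + delta) - (\det P)%:P) s.
  by apply/closed_rootP; rewrite size_XnsubC ?addn_gt0 ?dgt0 // eqSS -lt0n addn_gt0 dgt0.
have {}sE : s ^+ (delta + delta) = \det P.
  by apply/eqP; move/eqP: sE; rewrite !hornerE subr_eq0.
have s0 : s != 0.
  apply: contraTneq uP => s0; rewrite unitmxE -sE s0 expr0n.
  by rewrite gtn_eqF ?unitr0 // addn_gt0 dgt0.
rewrite -[P](scalerKV s0); apply: elementary_conjZ => //.
have : \det (s^-1 *: P) = 1 by rewrite detZ exprVn sE mulVr // -unitmxE.
move/transvection_gen_det1; elim=> [|i j t A ne _ IH]; first exact: elementary_conj1.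
apply: elementary_conjM IH.
have [x xE] := in_sl2_extZ t (in_sl2_ext_delta ne).
have sq0 : (t *: delta_mx i j : 'M[K]_(delta + delta)) ^+ 2 = 0.
  by rewrite expr2 -mulmxE -scalemxAl -scalemxAr mul_delta_mx_0 1?eq_sym // !scaler0.
have -> : 1%:M + t *: delta_mx i j = expmx 2 (rho_ext x).
  by rewrite xE /expmx !big_ord_recl big_ord0 /= expr0 expr1 invr1 !scale1r addr0.
by apply: (elementary_conj_exp K0 sl2_rhoP sl2_rho_lie sl2_rho_free); rewrite xE.
Qed.

Lemma diag_conj_grG u v : u \is a GRing.unit -> v \is a GRing.unit -> G (diag_conj (u, v)).
Proof.
move=> uu uv; split; last exact: diag_conj_H.
split; first exact: diag_conj_lie_aut.
pose P := block_rho (mx22 u 0 0 v).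
have uP : P \in unitmx.
  have [] // := @mulmx1_unit _ _ P (block_rho (mx22 u^-1 0 0 v^-1)).
  rewrite -block_rhoM mx22_diagM !mulrV // mx22_1 /block_rho !mxE /=.
  by rewrite !rmorph1 !rmorph0 -scalar_mx_block.
apply: (elementary_conj_ext sl2_rhoP sl2_rho_free uP); last exact: elementary_conj_unitmx.
move=> X; rewrite /sl2_rho diag_conjE // !block_rhoM -!mulmxA /P -(block_rhoM (mx22 u^-1 0 0 _)).
rewrite mx22_diagM !mulVr //.
rewrite mx22_1 /block_rho !mxE /= !rmorph1 !rmorph0 -scalar_mx_block mulmx1.
by [].
Qed.

(** In characteristic 0, E_ii minus its trace part is an average of the E_ii - E_jj, which are
    commutators. Since scalars are invisible to ad, nilpotency of ad x on the image extends to all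
    matrices. *)
Lemma in_sl2_ext_mod_scalar (Y : 'M[K]_(delta + delta)) : exists c, in_sl2_ext (Y - c%:M).
Proof.
have dgt0 := degree_gt0 Ddim.
have N0 : (delta + delta)%:R != 0 :> K.
  by have /pcharf0P -> := K0; rewrite -lt0n addn_gt0 dgt0.
rewrite [Y]matrix_sum_delta.
elim/big_ind: _ => [|Y1 Y2 [c1 h1] [c2 h2]|i _].
- by exists 0; rewrite raddf0 subr0; apply: in_sl2_ext0.
- by exists (c1 + c2); rewrite raddfD opprD addrACA -[Y1 - _]scale1r; apply: in_sl2_extP.
elim/big_ind: _ => [|Y1 Y2 [c1 h1] [c2 h2]|j _].
- by exists 0; rewrite raddf0 subr0; apply: in_sl2_ext0.
- by exists (c1 + c2); rewrite raddfD opprD addrACA -[Y1 - _]scale1r; apply: in_sl2_extP.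
have [<-{j}|ne] := eqVneq i j; last first.
  by exists 0; rewrite raddf0 subr0; apply/in_sl2_extZ/in_sl2_ext_delta.
exists (Y i i / (delta + delta)%:R).
have -> : Y i i *: delta_mx i i - (Y i i / (delta + delta)%:R)%:M =
    (Y i i / (delta + delta)%:R) *: \sum_j (delta_mx i i - delta_mx j j).
  rewrite sumrB sumr_const card_ord scalerBr -scaler_nat scalerA divfK //.
  by rewrite -scalemx1 scalar_mx_sum_delta; under eq_bigr do rewrite scale1r.
apply/in_sl2_extZ/in_sl2_ext_sum => j.
have [<-|ne] := eqVneq i j; first by rewrite subrr; apply: in_sl2_ext0.
have := in_sl2_ext_mxad (in_sl2_ext_delta ne) (in_sl2_ext_delta (_ : j != i)).
by rewrite /mxad !mul_delta_mx; apply; rewrite eq_sym.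
Qed.

(* ad x nilpotent forces x to be a scalar plus a nilpotent matrix, so that
   exp (ad x) is a conjugation. *)
Lemma elementary_is_conj (g : 'End(LK)) : elementary g ->
  exists2 P, P \in unitmx & forall u, P *m rho_ext u = rho_ext (g u) *m P.
Proof.
elim=> [|k x {}g x0 _ [P uP PE]].
  by exists 1%:M; rewrite ?unitmx1 // => u; rewrite lfunE mul1mx mulmx1.
have dgt0 := degree_gt0 Ddim.
have [|Y|c Z0] := @mxad_nilpotent K _ (rho_ext x) k.+1; first by rewrite addn_gt0 dgt0.
  have [c [w wE]] := in_sl2_ext_mod_scalar Y.
  rewrite -[Y](subrK c%:M) -wE iterSr.
  have -> : mxad (rho_ext x) (rho_ext w + c%:M) = mxad (rho_ext x) (rho_ext w).
    by rewrite /mxad mulmxDr mulmxDl scalar_mxC opprD addrACA subrr addr0.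
  rewrite -iterSr -(iter_rho_ext_lie sl2_rhoP sl2_rho_lie) /= x0.
  by rewrite lie0r rho_ext0.
exists (expmx k.+1 (rho_ext x - c%:M) *m P).
  by rewrite unitmx_mul uP expmx_unit.
move=> u; rewrite -mulmxA PE mulmxA comp_lfunE.
have E := rho_ext_exp_ad K0 sl2_rhoP sl2_rho_lie (g u) Z0 x0.
by rewrite mulmxA; congr (_ *m _); exact: E.
Qed.

End Sl2Algebra.

(** * The group and its orbits for sl_2(D) *)

Section Sl2Group.
Variables (F : fieldType) (K : closedFieldType) (iota : {rmorphism F -> K}) (D : falgType F).
Variables (delta : nat) (phi : splitting iota D delta).
Hypothesis F0 : [pchar F] =i pred0.
Hypothesis K0 : [pchar K] =i pred0.
Hypothesis Dunit : forall x : D, x != 0 -> x \is a GRing.unit.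
Hypothesis Dcent : ('Z({:D}) = 1)%VS.
Hypothesis Ddim : \dim {:D} = (delta ^ 2)%N.

Local Notation L := (subvs_of (sl2 phi)).
Local Notation H0 := (sl2_H phi : L).
Local Notation G := (grG iota H0).
Local Notation up := (sl2_upper phi).
Local Notation rho := (@sl2_rho F K iota D delta phi).
Local Notation Psi := (@diag_conj F K iota D delta phi).

Lemma unit_neq0E (x : D) : (x \is a GRing.unit) = (x != 0).
Proof.
by apply/idP/idP => [|/Dunit //]; apply: contraTneq => ->; rewrite unitr0.
Qed.

Lemma two_neq0 : 2%:R != 0 :> F.
Proof. by have /pcharf0P -> := F0. Qed.

Lemma lie_HE (X : L) : vsval (lie H0 X) = mx22 0 (2%:R *: vsval X 0 1) (- 2%:R *: vsval X 1 0) 0.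
Proof.
rewrite vsval_lie /=; apply: mx22P; rewrite mat2B !mat2M !mx22E !(mul0r, mulr0, addr0, add0r).
- by rewrite mul1r mulr1 subrr.
- by rewrite mul1r mulrN1 opprK scaler_nat mulr2n.
- by rewrite mulN1r mulr1 scaleNr scaler_nat mulr2n opprD.
- by rewrite mulN1r mulrN1 subrr.
Qed.

Lemma sl2_grade2 (X : L) : X \in grade H0 2%:R <-> exists x, X = up x.
Proof.
rewrite mem_grade; split=> [/eqP E|[x ->]].
  have M i j : vsval (lie H0 X) i j = (2%:R *: vsval X) i j by rewrite E vsvalZ.
  have cancel (c : F) (d : D) : c != 0 -> c *: d = 0 -> d = 0.
    by move=> c0 /eqP; rewrite scaler_eq0 (negPf c0) => /eqP.
  exists (vsval X 0 1); apply: val_inj => /=; apply: mx22P; rewrite !mx22E //.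
  - by apply: (cancel _ _ two_neq0); have := M 0 0; rewrite lie_HE mx22E mat2Z.
  - have := M 1 0; rewrite lie_HE mx22E mat2Z => /eqP; rewrite -subr_eq0 -scalerBl.
    rewrite -opprD -natrD scaler_eq0 oppr_eq0.
    by have /pcharf0P -> := F0 => /eqP.
  - by apply: (cancel _ _ two_neq0); have := M 1 1; rewrite lie_HE mx22E mat2Z.
apply/eqP/val_inj; change (vsval (lie H0 (up x)) = vsval (2%:R *: up x)).
by rewrite lie_HE vsvalZ; apply: mx22P; rewrite mat2Z !mx22E ?scaler0.
Qed.

Lemma sl2_graded : graded H0.
Proof.
apply: gradedP => // X.
pose low x : L := Subvs (sl2_lower_subproof phi x).
have Xmem := subvsP X; rewrite mem_sl2 in Xmem.
have diagP : mx22 (vsval X 0 0) 0 0 (vsval X 1 1) \in sl2 phi by rewrite mem_sl2 !mx22E.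
exists (low (vsval X 1 0)), (Subvs diagP), (up (vsval X 0 1)); split.
- apply: val_inj; change (vsval X = vsval (low (vsval X 1 0) + Subvs diagP + up (vsval X 0 1))).
  by rewrite !vsval_add; apply: mx22P; rewrite !mat2D !mx22E !(addr0, add0r).
- apply: val_inj; change (vsval (lie H0 (low (vsval X 1 0))) = vsval (- 2%:R *: low (vsval X 1 0))).
  by rewrite lie_HE vsvalZ; apply: mx22P; rewrite mat2Z !mx22E ?scaler0.
- apply: val_inj; change (vsval (lie H0 (Subvs diagP)) = vsval (0 : L)).
  by rewrite lie_HE linear0; apply: mx22P; rewrite !mx22E ?mxE ?scaler0.
- apply: val_inj; change (vsval (lie H0 (up (vsval X 0 1))) = vsval (2%:R *: up (vsval X 0 1))).
  by rewrite lie_HE vsvalZ; apply: mx22P; rewrite mat2Z !mx22E ?scaler0.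
Qed.

Lemma sl2_rho_inj : injective rho.
Proof. by move=> X Y /(block_rho_inj Dunit Ddim) XY; apply: val_inj. Qed.

Lemma sl2_rho_upper x : rho (up x) = block_mx 0 (phi x) 0 0.
Proof. by rewrite /sl2_rho /block_rho !mx22E rmorph0. Qed.

Lemma up_lin : linear up.
Proof.
move=> c x y; apply: val_inj; change (vsval (up (c *: x + y)) = vsval (c *: up x + up y)).
by rewrite vsval_add vsvalZ; apply: mx22P; rewrite mat2D mat2Z !mx22E ?scaler0 ?addr0.
Qed.

Lemma up_inj : injective up.
Proof. by move=> x y /(congr1 (fun X : L => vsval X 0 1)); rewrite /= !mx22E. Qed.

Lemma commutes_with_H_block (P : 'M[K]_(delta + delta)) :
  P *m rho H0 = rho H0 *m P -> P = block_mx (ulsubmx P) 0 0 (drsubmx P).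
Proof.
rewrite /sl2_rho /block_rho !mx22E rmorph1 rmorph0 rmorphN1.
rewrite -[P]submxK; move: (ulsubmx P) (ursubmx P) (dlsubmx P) (drsubmx P) => A B C E.
rewrite !mulmx_block !(mulmxN, mulNmx, mulmx1, mul1mx, mul0mx, mulmx0, addr0, add0r).
have half m (Z : 'M[K]_(m, m)) : Z = - Z -> Z = 0.
  move/eqP; rewrite -addr_eq0 -mulr2n -scaler_nat scaler_eq0.
  by have /pcharf0P -> := K0 => /eqP.
case/eq_block_mx => _ /esym/half -> /half -> _.
by rewrite block_mxKul block_mxKdr.
Qed.

(** With P = diag(P1, P2), the action [al] on V^+ satisfies P1 phi(x) = phi(al x) P2. Normalised to
    [ga] by its value at 1, it becomes conjugation by P2, hence an algebra automorphism of D, inner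
    by some [w]. *)
Lemma grG_diag_conj (g : 'End(L)) : G g ->
  exists u v, [/\ u \is a GRing.unit, v \is a GRing.unit & Psi (u, v) = g].
Proof.
move=> Gg; have [[_ eg] gH] := Gg.
have [P uP /(lfun_ext_rho (@sl2_rhoP F K iota D delta phi)) PE] :=
  elementary_is_conj K0 Dunit Dcent Ddim eg.
have PH := PE H0; rewrite gH in PH.
have PB := commutes_with_H_block PH.
move: uP; rewrite PB unitmxE det_ublock unitrM -!unitmxE => /andP[uP1 uP2].
set P1 := ulsubmx P in PB uP1; set P2 := drsubmx P in PB uP2.
have upV x : up x \in grade H0 2%:R by apply/sl2_grade2; exists x.
have /choice[al alE] x : exists y, g (up x) = up y.
  by apply/sl2_grade2; apply: grG_grade Gg (upV x).
have alP x : P1 *m phi x = phi (al x) *m P2.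
  have := PE (up x); rewrite alE !sl2_rho_upper PB !mulmx_block.
  rewrite !(mulmx0, mul0mx, addr0, add0r) => /eq_block_mx[_ + _ _].
  by [].
have P1E : P1 = phi (al 1) *m P2 by rewrite -alP rmorph1 mulmx1.
have u0 : al 1 \is a GRing.unit.
  rewrite unit_neq0E; apply: contraTneq uP1 => a0.
  have unit0 n : (0 < n)%N -> (0 : 'M[K]_n) \notin unitmx.
    by case: n => // n _; rewrite unitmxE det0 unitr0.
  by rewrite P1E a0 rmorph0 mul0mx unit0 // (degree_gt0 Ddim).
pose ga x := (al 1)^-1 * al x.
have gaP x : P2 *m phi x = phi (ga x) *m P2.
  rewrite /ga rmorphM -mulmxE -mulmxA -alP P1E !mulmxA mulmxE -rmorphM mulVr // rmorph1.
  by rewrite mul1r.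
have cancelP2 A B : A *m P2 = B *m P2 -> A = B.
  by move/(congr1 (mulmx^~ (invmx P2))); rewrite !mulmxK.
have phi_inj := split_inj Dunit (phi := phi) Ddim.
have ga_lin : linear ga.
  move=> c x y; apply/phi_inj/cancelP2; rewrite -gaP !rmorphD /= !splitZ.
  by rewrite mulmxDr mulmxDl -scalemxAr -scalemxAl !gaP.
pose gal : {linear D -> D} := HB.pack ga (GRing.isLinear.Build _ _ _ _ _ ga_lin).
have [||w w0 wE] := @skolem_noether F D Dunit Dcent (linfun gal).
- move=> x y; rewrite !lfunE /=; apply/phi_inj/cancelP2.
  by rewrite -gaP (rmorphM phi x) (rmorphM phi (ga x)) -!mulmxE mulmxA gaP -mulmxA gaP mulmxA.
- by rewrite lfunE /= /ga mulVr.
have {}wE x : ga x * w = w * x by rewrite -wE lfunE.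
have uw := Dunit w0.
exists (al 1 * w), w; split; rewrite ?unitrMl //.
apply/lfunP => X; apply: sl2_rho_inj.
have phiw : phi w^-1 *m phi w = 1%:M by rewrite mulmxE -rmorphM mulVr // rmorph1.
have phiw' : phi w *m phi w^-1 = 1%:M by rewrite mulmxE -rmorphM mulrV // rmorph1.
(* The defect between P and diag(al(1) w, w). It commutes with phi(D), which is enough to remove it
   from the conjugation; that it is scalar need not be known. *)
pose Z := phi w^-1 *m P2.
have ZC x : Z *m phi x = phi x *m Z.
  rewrite /Z -mulmxA gaP !mulmxA; congr (_ *m _).
  by rewrite !mulmxE -!rmorphM; congr (phi _); rewrite -[ga x](mulrK uw) wE !mulrA mulVr // mul1r.
have ZB : P = block_rho phi (mx22 (al 1 * w) 0 0 w) *m block_mx Z 0 0 Z.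
  rewrite PB /block_rho !mx22E rmorph0 mulmx_block !(mulmx0, mul0mx, addr0, add0r).
  by rewrite /Z !mulmxA phiw' mul1mx rmorphM -mulmxE -(mulmxA (phi (al 1))) phiw' mulmx1 -P1E.
have uP : P \in unitmx by rewrite PB unitmxE det_ublock unitrM -!unitmxE uP1.
have ZX : block_mx Z 0 0 Z *m rho X = rho X *m block_mx Z 0 0 Z.
  by rewrite /sl2_rho /block_rho !mulmx_block !(mulmx0, mul0mx, addr0, add0r) !ZC.
rewrite -[LHS](mulmxK uP) -[RHS](mulmxK uP); congr (_ *m _); rewrite -PE ZB.
rewrite -[RHS]mulmxA ZX !mulmxA; congr (_ *m _).
rewrite /sl2_rho diag_conjE ?unitrMl // !block_rhoM -!mulmxA -(block_rhoM phi (mx22 (_ * _)^-1 _ _ _)) mx22_diagM !mulVr ?unitrMl //.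
by rewrite mx22_1 /block_rho !mxE /= !rmorph1 !rmorph0 -scalar_mx_block mulmx1.
Qed.

(** On V^+ the identity reads u x v^-1 = x: x = 1 gives u = v, and then u commutes with all of D. *)
Lemma diag_conj_id u v : u \is a GRing.unit -> v \is a GRing.unit ->
  (Psi (u, v) = \1%VF <-> exists lambda : F, [/\ lambda != 0, u = lambda%:A & v = lambda%:A]).
Proof.
move=> uu uv; split=> [E|[l [l0 -> ->]]]; last first.
  have ul : (l%:A : D) \is a GRing.unit by rewrite unit_neq0E scaler_eq0 (negPf l0) oner_eq0.
  apply/lfunP => X; apply: val_inj; rewrite /= diag_conjE // lfunE /=.
  have C (A : mat2 D) : mx22 l%:A 0 0 l%:A * A = A * mx22 l%:A 0 0 l%:A.
    apply: mx22P; rewrite !mat2M !mx22E !(mul0r, mulr0, addr0, add0r);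
    by rewrite mulr_algl mulr_algr.
  by rewrite C -mulrA mx22_diagM mulrV // mx22_1 mulr1.
have upE x : u * x * v^-1 = x.
  by apply: up_inj; rewrite -diag_conj_upper // E lfunE.
have uvE : u = v by have := upE 1; rewrite mulr1 => /(canRL (mulrVK uv)); rewrite mul1r.
have [l lE] : exists l : F, u = l%:A.
  by apply: (central_scalar Dcent) => x; rewrite -{2}(upE x) -uvE mulrVK.
exists l; rewrite -uvE -lE; split=> //; apply: contraTneq uu => l0.
by rewrite lE l0 scale0r unitr0.
Qed.

Lemma orbit_zero : lie_orbit G (up 0) = [set 0].
Proof.
have up0 : up 0 = 0 by have := up_lin (-1) 0 0; rewrite scaler0 addr0 scaleN1r addNr.
rewrite up0 predeqE => X; split=> [[g Gg <-]|->]; first by rewrite linear0.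
exists \1%VF; last by rewrite lfunE.
by rewrite -(diag_conj1 phi); apply: diag_conj_grG; rewrite ?unitr1.
Qed.

Lemma orbit_unit x : x \is a GRing.unit -> lie_orbit G (up x) = up @` [set u | u \is a GRing.unit].
Proof.
move=> ux; rewrite predeqE => X; split.
  move=> [g /grG_diag_conj[u [v [uu uv <-]]] <-].
  by exists (u * x * v^-1); rewrite ?diag_conj_upper //= !unitrMl ?unitrV.
move=> [y uy <-]; exists (Psi (y * x^-1, 1)).
  by apply: diag_conj_grG; rewrite ?unitr1 ?unitrMl ?unitrV.
by rewrite diag_conj_upper ?unitr1 ?unitrMl ?unitrV // mulrVK // invr1 mulr1.
Qed.

Lemma sl2_orbits : lie_orbits G (grade H0 2%:R) = [set [set 0]; up @` [set u | u \is a GRing.unit]].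
Proof.
rewrite predeqE => O; split=> [[X /sl2_grade2[x ->] <-]|].
  have [->|x0] := eqVneq x 0; first by left; rewrite orbit_zero.
  by right; rewrite orbit_unit // unit_neq0E.
case=> ->.
  by exists (up 0); [apply/sl2_grade2; exists 0 | rewrite orbit_zero].
by exists (up 1); [apply/sl2_grade2; exists 1 | rewrite orbit_unit // unitr1].
Qed.

Lemma sl2_orbits_neq : [set 0] <> up @` [set u | u \is a GRing.unit].
Proof.
have up0 : up 0 = 0 by have := up_lin (-1) 0 0; rewrite scaler0 addr0 scaleN1r addNr.
move=> E; have : [set 0 : L] 0 by [].
by rewrite E => -[x ux]; rewrite -up0 => /up_inj x0; move: ux; rewrite /= x0 unitr0.
Qed.

End Sl2Group.

(** * The reduced norm as fundamental invariant *)

Section Sl2Invariant.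
Variables (F : fieldType) (K : closedFieldType) (iota : {rmorphism F -> K}) (D : falgType F).
Variables (delta : nat) (phi : splitting iota D delta).
Hypothesis F0 : [pchar F] =i pred0.
Hypothesis K0 : [pchar K] =i pred0.
Hypothesis Dunit : forall x : D, x != 0 -> x \is a GRing.unit.
Hypothesis Dcent : ('Z({:D}) = 1)%VS.
Hypothesis Ddim : \dim {:D} = (delta ^ 2)%N.

Local Notation L := (subvs_of (sl2 phi)).
Local Notation H0 := (sl2_H phi : L).
Local Notation G := (grG iota H0).
Local Notation V := (grade H0 2%:R).
Local Notation n := (\dim V).
Local Notation up := (sl2_upper phi).
Local Notation Psi := (@diag_conj F K iota D delta phi).
Local Notation e := (vbasis {:D}).

Lemma delta_gt0 : (0 < delta)%N. Proof. exact: degree_gt0 Ddim. Qed.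

Lemma upV x : up x \in V. Proof. by apply/(sl2_grade2 F0); exists x. Qed.

Definition up_coord (i : 'I_n) (x : D) : F := coord (vbasis V) i (up x).
Definition up_basis (i : 'I_n) : D := vsval ((vbasis V)`_i : L) 0 1.

Lemma up_coord_scalar i : scalar (up_coord i).
Proof. by move=> c x y; rewrite /up_coord (up_lin phi) linearP. Qed.

Lemma up_basisE i : up (up_basis i) = (vbasis V)`_i.
Proof.
have : (vbasis V)`_i \in V by rewrite vbasis_mem // mem_nth // size_tuple.
by move/(sl2_grade2 F0) => [x xE]; rewrite /up_basis xE /= mx22E.
Qed.

Lemma up_coord_basis i j : up_coord i (up_basis j) = (j == i)%:R.
Proof. by rewrite /up_coord up_basisE coord_free // (basis_free (vbasisP _)). Qed.

Lemma up_basisK x : \sum_i up_coord i x *: up_basis i = x.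
Proof.
apply: (@up_inj F K iota D delta phi).
pose f : {linear D -> L} := HB.pack up (GRing.isLinear.Build _ _ _ _ _ (up_lin phi)).
rewrite -[LHS]/(f _) linear_sum [RHS](coord_vbasis (upV x)); apply: eq_bigr => i _.
by rewrite linearZ /= up_basisE.
Qed.

(** The element of D (x) K with coordinates [t] in the basis of V^+ transported to D;
    [generic_coord] is the inverse map. *)
Definition generic_mx (t : 'I_n -> K) : 'M[K]_delta := \sum_i t i *: phi (up_basis i).
Definition generic_coord (A : 'M[K]_delta) (i : 'I_n) : K := ext_form phi (up_coord i) A.

Lemma generic_coordK A : generic_mx (generic_coord A) = A.
Proof.
rewrite /generic_mx /generic_coord /ext_form.
under eq_bigr do rewrite scaler_suml.
rewrite exchange_big -[RHS](split_coordK Dunit Dcent phi Ddim); apply: eq_bigr => j _ /=.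
rewrite -{2}[e`_j]up_basisK rmorph_sum scaler_sumr; apply: eq_bigr => i _.
by rewrite /= splitZ scalerA.
Qed.

Lemma generic_coord_phi x i : generic_coord (phi x) i = iota (up_coord i x).
Proof. exact: (ext_form_phi Dunit Dcent phi Ddim x (up_coord_scalar i)). Qed.

Lemma generic_coordP i c A B :
  generic_coord (c *: A + B) i = c * generic_coord A i + generic_coord B i.
Proof. exact: ext_formP. Qed.

Lemma generic_mxK t i : generic_coord (generic_mx t) i = t i.
Proof.
have c0 : generic_coord 0 i = 0.
  by have := generic_coordP i (-1) 0 0; rewrite scaler0 addr0 mulN1r addNr.
have cD : {morph (fun A => generic_coord A i) : A B / A + B}.
  by move=> A B; rewrite -[A]scale1r generic_coordP mul1r scale1r.
rewrite (big_morph (fun A => generic_coord A i) cD c0) (bigD1 i) //= big1 ?addr0 => [|j ji].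
  by rewrite -[_ *: _]addr0 generic_coordP c0 addr0 generic_coord_phi up_coord_basis eqxx rmorph1 mulr1.
rewrite -[_ *: _]addr0 generic_coordP c0 addr0 generic_coord_phi up_coord_basis.
by rewrite (negPf ji) rmorph0 mulr0.
Qed.

Lemma generic_mx_phi x : generic_mx (fun i => iota (up_coord i x)) = phi x.
Proof.
rewrite -[RHS]generic_coordK; apply: eq_bigr => i _.
by rewrite generic_coord_phi.
Qed.

Definition mxfun (p : {mpoly K[n]}) (A : 'M[K]_delta) : K := p.@[generic_coord A].

Lemma mxfun_polyfun p : polyfun (mxfun p).
Proof.
by apply: polyfun_meval => i; apply: polyfun_lin => c A B; apply: generic_coordP.
Qed.

Lemma mxfun_generic p t : mxfun p (generic_mx t) = p.@[t].
Proof. by apply: meval_eq => i; apply: generic_mxK. Qed.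

Lemma mxfun_phi (p : {mpoly F[n]}) x : mxfun (map_mpoly iota p) (phi x) = iota (vpeval p (up x)).
Proof.
rewrite /mxfun /vpeval (meval_eq (v2 := iota \o (fun i => up_coord i x))); last first.
  by move=> i; rewrite generic_coord_phi.
elim/mpoly_closed_ind: p => [c|i|p q ep eq|p q ep eq].
- by rewrite map_mpolyC !mevalC.
- by rewrite map_mpolyX !mevalXU.
- by rewrite rmorphD !mevalD rmorphD ep eq.
- by rewrite rmorphM !mevalM rmorphM ep eq.
Qed.

Lemma mxfun_inj p q : (forall A, mxfun p A = mxfun q A) -> p = q.
Proof.
move=> pq; apply/eqP; rewrite -subr_eq0; apply/eqP/(mpoly_fun_eq0 K0) => t.
by rewrite mevalB -!mxfun_generic pq subrr.
Qed.

Definition generic_det : {mpoly K[n]} :=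
  \det (\matrix_(a < delta, b < delta) \sum_i (phi (up_basis i) a b) *: 'X_i).

Lemma meval_det (m : nat) (M : 'M[{mpoly K[n]}]_m) t :
  (\det M).@[t] = \det (map_mx (meval t) M).
Proof. by rewrite det_map_mx. Qed.

Lemma meval_generic_det t : generic_det.@[t] = \det (generic_mx t).
Proof.
rewrite meval_det; congr (\det _); apply/matrixP => a b; rewrite !mxE summxE.
rewrite (raddf_sum (meval t)); apply: eq_bigr => i _.
by rewrite /= mevalZ mevalXU mxE mulrC.
Qed.

Lemma mxfun_generic_det A : mxfun generic_det A = \det A.
Proof. by rewrite -{1}[A]generic_coordK mxfun_generic meval_generic_det generic_coordK. Qed.

Definition left_mult_mx (A : 'M[K]_delta) : 'M[K]_(\dim {:D}) :=
  \matrix_(i, j) split_coord phi (A *m phi e`_i) j.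

Lemma left_mult_mxP c A B : left_mult_mx (c *: A + B) = c *: left_mult_mx A + left_mult_mx B.
Proof.
by apply/matrixP => i j; rewrite !mxE mulmxDl -scalemxAl split_coordP.
Qed.

Lemma left_mult_mxE A B j :
  split_coord phi (A *m B) j = \sum_k split_coord phi B k * left_mult_mx A k j.
Proof.
have s0 : split_coord phi 0 j = 0.
  by have := split_coordP phi (-1) 0 0 j; rewrite scaler0 addr0 mulN1r addNr.
have sD : {morph (fun A => split_coord phi A j) : A B / A + B}.
  by move=> A' B'; rewrite -[A']scale1r split_coordP mul1r scale1r.
rewrite -{1}[B](split_coordK Dunit Dcent phi Ddim) mulmx_sumr.
rewrite (big_morph (fun A => split_coord phi A j) sD s0); apply: eq_bigr => k _.
by rewrite -scalemxAr -[_ *: _]addr0 split_coordP s0 addr0 mxE.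
Qed.

Lemma left_mult_mxM A B : left_mult_mx (A *m B) = left_mult_mx B *m left_mult_mx A.
Proof.
apply/matrixP => i j; rewrite !mxE -mulmxA (left_mult_mxE A (B *m phi e`_i) j).
by apply: eq_bigr => k _; rewrite [in RHS]mxE.
Qed.

Lemma left_mult_mx1 : left_mult_mx 1%:M = 1%:M.
Proof.
apply/matrixP => i j; rewrite !mxE mul1mx (split_coord_phi Dunit Dcent phi Ddim).
by rewrite coord_free ?(basis_free (vbasisP _)) // rmorph_nat.
Qed.

(** Left multiplication is (anti)multiplicative, so its determinant is a polynomial without zeros on
    invertible matrices. The exponent is positive because this determinant vanishes at 0. *)
Lemma det_left_mult : exists2 k, (0 < k)%N & forall A, \det (left_mult_mx A) = \det A ^+ k.
Proof.
pose f A := \det (left_mult_mx A).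
have fM A B : f (A *m B) = f A * f B by rewrite /f left_mult_mxM det_mulmx mulrC.
have f1 : f 1%:M = 1 by rewrite /f left_mult_mx1 det1.
have fP : polyfun f.
  apply: polyfun_det => i j; apply: polyfun_lin => c A B.
  by rewrite left_mult_mxP !mxE.
have [|k kE] := polyfun_unitmx K0 delta_gt0 fP.
  move=> A uA; apply: contraTneq (oner_neq0 K) => fA0.
  by rewrite negbK -f1 -(mulmxV uA) fM fA0 mul0r.
exists k; last by move=> A; rewrite -[LHS]/(f A) kE f1 mul1r.
rewrite lt0n; apply/eqP => k0; have := kE 0; rewrite k0 expr0 f1 mulr1 /f.
have -> : left_mult_mx 0 = 0.
  by have := left_mult_mxP (-1) 0 0; rewrite scaler0 addr0 scaleN1r addNr.
have : (0 < \dim {:D})%N by rewrite Ddim expn_gt0 delta_gt0.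
by case: (\dim _) => // m _; rewrite det0 => /esym/eqP; rewrite oner_eq0.
Qed.

(* det (1 + sum t_i d_i) has constant term 1, and one of its powers is the
   determinant of a left multiplication in D, hence has coefficients in F. *)
Lemma rational_generic_det : exists P : {mpoly F[n]}, map_mpoly iota P = generic_det.
Proof.
have [k k0 kE] := det_left_mult.
pose p1 : {mpoly K[n]} := \det (\matrix_(a < delta, b < delta)
  ((a == b)%:R%:MP + \sum_i (phi (up_basis i) a b) *: 'X_i)).
have p1E t : p1.@[t] = \det (1%:M + generic_mx t).
  rewrite meval_det; congr (\det _); apply/matrixP => a b; rewrite !mxE summxE mevalD mevalC.
  rewrite (raddf_sum (meval t)); congr (_ + _); apply: eq_bigr => i _.
  by rewrite /= mevalZ mevalXU mxE mulrC.
pose q1 : {mpoly F[n]} := \det (\matrix_(a < \dim {:D}, b < \dim {:D})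
  ((a == b)%:R%:MP + \sum_i (coord e b (up_basis i * e`_a)) *: 'X_i)).
have q1E t : (map_mpoly iota q1).@[t] = \det (left_mult_mx (1%:M + generic_mx t)).
  rewrite -det_map_mx meval_det; congr (\det _).
  have -> : left_mult_mx (1%:M + generic_mx t) = 1%:M + \sum_i t i *: left_mult_mx (phi (up_basis i)).
    have l0 : left_mult_mx 0 = 0.
      by have := left_mult_mxP (-1) 0 0; rewrite scaler0 addr0 scaleN1r addNr.
    have lD : {morph left_mult_mx : A B / A + B}.
      by move=> A B; rewrite -[A]scale1r left_mult_mxP !scale1r.
    rewrite lD left_mult_mx1 (big_morph _ lD l0); congr (_ + _); apply: eq_bigr => i _.
    by rewrite -[_ *: _]addr0 left_mult_mxP l0 addr0.
  apply/matrixP => a b; rewrite !mxE summxE rmorphD /= mevalD map_mpolyC mevalC /= rmorph_nat.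
  rewrite (raddf_sum (map_mpoly iota)) (raddf_sum (meval t)); congr (_ + _).
  apply: eq_bigr => i _; rewrite /= map_mpolyZ map_mpolyX mevalZ mevalXU !mxE mulrC.
  by rewrite mulmxE -rmorphM (split_coord_phi Dunit Dcent phi Ddim).
have p1k : p1 ^+ k = map_mpoly iota q1.
  apply/eqP; rewrite -subr_eq0; apply/eqP/(mpoly_fun_eq0 K0) => t.
  by rewrite mevalB (rmorphXn (meval t)) /= p1E q1E kE subrr.
have p10 : p1@_0%MM = 1.
  rewrite -meval_at0 p1E (_ : generic_mx _ = 0) ?addr0 ?det1 // /generic_mx.
  by rewrite big1 // => i _; rewrite scale0r.
have [P1 P1E] := power_root_rational K0 k0 p10 p1k.
(* Translation by the coordinates of 1 undoes the shift, whose purpose was the constant term 1 in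
   the extraction of the root. *)
pose lq := [tuple 'X_i - (up_coord i 1)%:MP : {mpoly F[n]} | i < n].
exists (P1 \mPo lq); apply/eqP; rewrite -subr_eq0; apply/eqP/(mpoly_fun_eq0 K0) => t.
have compE (p : {mpoly F[n]}) : (map_mpoly iota (p \mPo lq)).@[t] =
    (map_mpoly iota p).@[fun i => t i - iota (up_coord i 1)].
  elim/mpoly_closed_ind: p => [c|i|p q ep eq|p q ep eq].
  - by rewrite comp_mpolyC !map_mpolyC !mevalC.
  - rewrite comp_mpolyXU -tnth_nth tnth_mktuple rmorphB /= map_mpolyX map_mpolyC.
    by rewrite mevalB !mevalXU mevalC.
  - by rewrite comp_mpolyD !rmorphD /= ep eq.
  - by rewrite !rmorphM /= ep eq.
rewrite mevalB compE -P1E p1E meval_generic_det; apply/eqP; rewrite subr_eq0; apply/eqP; congr (\det _).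
have -> : generic_mx (fun i => t i - iota (up_coord i 1)) = generic_mx t - 1%:M.
  have -> : (1%:M : 'M[K]_delta) = generic_mx (fun i => iota (up_coord i 1)).
    by rewrite generic_mx_phi rmorph1.
  by rewrite /generic_mx -sumrB; apply: eq_bigr => i _; rewrite scalerBl.
by rewrite addrC subrK.
Qed.

Variable P : {mpoly F[n]}.
Hypothesis PE : map_mpoly iota P = generic_det.

Lemma vpeval_rednorm x : iota (vpeval P (up x)) = rednorm phi x.
Proof. by rewrite -mxfun_phi PE mxfun_generic_det. Qed.

Lemma generic_det0 : generic_det.@[fun=> 0] = 0.
Proof.
rewrite meval_generic_det (_ : generic_mx _ = 0).
  by have := delta_gt0; case: (delta) => // m _; rewrite det0.
by rewrite /generic_mx big1 // => i _; rewrite scale0r.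
Qed.

Lemma generic_det_nonunit : generic_det \isn't a GRing.unit.
Proof. exact: meval0_nonunit generic_det0. Qed.

Lemma vpeval_scale (c : F) (t : 'I_n -> F) : P.@[fun i => c * t i] = c ^+ delta * P.@[t].
Proof.
have PD x : iota P.@[fun i => up_coord i x] = \det (phi x).
  exact: vpeval_rednorm.
have tE (s : 'I_n -> F) : exists x, forall i, s i = up_coord i x.
  exists (\sum_j s j *: up_basis j) => i.
  have uD : {morph up_coord i : x y / x + y}.
    by move=> x y; rewrite -[x]scale1r (up_coord_scalar i) mul1r scale1r.
  have u0 : up_coord i 0 = 0.
    by have := up_coord_scalar i (-1) 0 0; rewrite scaler0 addr0 mulN1r addNr.
  rewrite (big_morph _ uD u0) (bigD1 i) //= big1 ?addr0 => [|j ji].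
    by rewrite -[_ *: _]addr0 up_coord_scalar u0 addr0 up_coord_basis eqxx mulr1.
  by rewrite -[_ *: _]addr0 up_coord_scalar u0 addr0 up_coord_basis (negPf ji) mulr0.
have [x xE] := tE t; apply: (fmorph_inj iota); rewrite rmorphM rmorphXn /=.
rewrite (meval_eq (v2 := fun i => up_coord i (c *: x))); last first.
  move=> i; rewrite xE -[c *: x]addr0 up_coord_scalar.
  have := up_coord_scalar i (-1) 0 0; rewrite scaler0 addr0 mulN1r addNr => ->.
  by rewrite addr0.
by rewrite (meval_eq _ xE) !PD splitZ detZ.
Qed.

Lemma generic_det_neq0 : generic_det != 0.
Proof.
apply: contraTneq (oner_neq0 K) => E; rewrite negbK -(@det1 K delta).
by rewrite -mxfun_generic_det E /mxfun meval0.
Qed.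

Lemma msize_rednorm : msize P = delta.+1.
Proof.
apply: (homogeneous_msize F0 _ vpeval_scale); apply: contraNneq generic_det_neq0 => P0.
by rewrite -PE P0 raddf0.
Qed.

(** Neither factor vanishes on invertible matrices, so each is a constant times a power of det. A
    matrix of determinant 2 shows that the exponents add up to 1, and the factor of exponent 0 is a
    constant. *)
Lemma generic_det_irreducible : irreducible_elt generic_det.
Proof.
split; [exact: generic_det_neq0 | exact: generic_det_nonunit |] => b c bc.
have fact A : mxfun b A * mxfun c A = \det A by rewrite -mxfun_generic_det bc /mxfun mevalM.
have nz A : A \in unitmx -> mxfun b A != 0 /\ mxfun c A != 0.
  by rewrite unitmxE unitfE -fact mulf_eq0 => /norP.
have [|k kE] := polyfun_unitmx K0 delta_gt0 (mxfun_polyfun b); first by move=> A /nz[].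
have [|l lE] := polyfun_unitmx K0 delta_gt0 (mxfun_polyfun c); first by move=> A /nz[].
have [b1 c1] := nz _ (unitmx1 _ _).
have bc1 : mxfun b 1%:M * mxfun c 1%:M = 1 by rewrite fact det1.
have kl (d : K) : d ^+ (k + l) = d.
  have [A dA] : exists A : 'M[K]_delta, \det A = d.
    have := delta_gt0; case: (delta) => // m _; exists (corner_mx m d).
    exact: det_corner.
  by rewrite -{2}dA -fact kE lE mulrACA bc1 mul1r -exprD dA.
have kl1 : (k + l = 1)%N.
  have := kl 2%:R; rewrite -natrX => /(natf_inj K0)/eqP.
  by rewrite -{2}(expn1 2) eqn_exp2l // => /eqP.
have const (q : {mpoly K[n]}) : mxfun q 1%:M != 0 -> (forall A, mxfun q A = mxfun q 1%:M * \det A ^+ 0) ->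
    q \is a GRing.unit.
  move=> q1 qE; rewrite (_ : q = (mxfun q 1%:M)%:MP) ?mpolyC_unit //.
  by apply: mxfun_inj => A; rewrite qE expr0 mulr1 /mxfun mevalC.
case: k l kE lE kl1 {kl} => [|[|k]] // [|l] // kE lE _; first by left; apply: const.
by right; apply: const.
Qed.

Lemma rednorm_relative_invariant : relative_invariant G P.
Proof.
have P1 : vpeval P (up 1) != 0.
  by rewrite -(fmorph_eq0 iota) vpeval_rednorm /rednorm rmorph1 det1 oner_eq0.
apply: (relative_invariantP (upV 1) P1) => [g X Gg XV|g Gg]; first exact: grG_grade Gg XV.
have [u [v [uu uv <-]]] := grG_diag_conj F0 K0 Dunit Dcent Ddim Gg.
have uvu : u * v^-1 \is a GRing.unit by rewrite unitrMl ?unitrV.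
have nz x : x \is a GRing.unit -> vpeval P (up x) != 0.
  move=> ux; rewrite -(fmorph_eq0 iota) vpeval_rednorm /rednorm.
  apply: contraTneq (oner_neq0 K) => d0; rewrite negbK -(@det1 K delta).
  have <- : phi x *m phi x^-1 = 1%:M by rewrite mulmxE -rmorphM mulrV // rmorph1.
  by rewrite det_mulmx d0 mul0r.
exists (vpeval P (up (u * v^-1))); first exact: nz.
move=> X /(sl2_grade2 F0)[x ->]; rewrite diag_conj_upper //.
apply: (fmorph_inj iota); rewrite rmorphM !vpeval_rednorm /rednorm.
by rewrite !rmorphM -!mulmxE !det_mulmx mulrAC.
Qed.

(** Left multiplications by units u of D give f(u x) f(1) = f(u) f(x), which extends to matrices
    over K in each variable in turn. So f(1) is non-zero, f has no zero on invertible matrices, and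
    irreducibility leaves only the first power of det. *)
Lemma abs_irreducible_invariant_unique P' : abs_irreducible_invariant iota P' ->
  exists2 c : F, c != 0 & P' = c *: P.
Proof.
move=> [irr [chi [chi0 _ _] chiE]]; have [nz _ _] := irr.
pose f := mxfun (map_mpoly iota P').
have fP : polyfun f := mxfun_polyfun _.
have fphi x : f (phi x) = iota (vpeval P' (up x)) by exact: mxfun_phi.
have f0 : ~ forall A, f A = 0.
  move=> f0; case/eqP: nz; apply: mxfun_inj => A; rewrite -[LHS]/(f A) f0.
  by rewrite /mxfun meval0.
have mulD u x : u != 0 -> f (phi u *m phi x) * f 1%:M = f (phi u) * f (phi x).
  move=> u0; have uu := Dunit u0.
  have Gu : G (Psi (u, 1)) by apply: diag_conj_grG; rewrite ?unitr1.
  have E y : f (phi (u * y)) = iota (chi (Psi (u, 1))) * f (phi y).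
    rewrite !fphi -rmorphM; congr (iota _); rewrite -chiE ?upV // diag_conj_upper ?unitr1 //.
    by rewrite invr1 mulr1.
  rewrite mulmxE -rmorphM E; have := E 1; rewrite mulr1 rmorph1 => ->.
  by rewrite -mulrA [f _ * f 1]mulrC mulrA.
have span A : exists t : 'I_(\dim {:D}) -> K, A = \sum_i t i *: phi e`_i.
  by exists (split_coord phi A); rewrite (split_coordK Dunit Dcent phi Ddim).
have natpt (k : 'I_(\dim {:D}) -> nat) :
    \sum_i (k i).+1%:R *: phi e`_i = phi (\sum_i (k i).+1%:R *: e`_i).
  by rewrite rmorph_sum; apply: eq_bigr => i _; rewrite /= splitZ rmorph_nat.
have fM A B : f (A *m B) * f 1%:M = f A * f B.
  apply/eqP; rewrite -subr_eq0; apply/eqP; move: A.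
  apply: (polyfun_dense K0 span) => [|k].
    apply: polyfun_sub; apply: polyfun_mul => //; try exact: polyfun_const.
    apply: (@polyfun_comp_lin K _ _ (fun X => X *m B) f _ fP) => c X Y.
    by rewrite mulmxDl -scalemxAl.
  rewrite natpt; set u := \sum_i _; move: B.
  have u0 : u != 0.
    apply: contraTneq (degree_gt0 Ddim) => u0.
    have d0 : (0 < \dim {:D})%N by rewrite Ddim expn_gt0 (degree_gt0 Ddim).
    have := basis_eq0 u0 (Ordinal d0).
    by move/eqP; have /pcharf0P -> := F0.
  apply: (polyfun_dense K0 span) => [|k'].
    apply: polyfun_sub; apply: polyfun_mul => //; try exact: polyfun_const.
    apply: (@polyfun_comp_lin K _ _ (mulmx (phi u)) f _ fP) => c X Y.
    by rewrite mulmxDr -scalemxAr.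
  by rewrite natpt mulD // subrr.
have f1 : f 1%:M != 0.
  apply/eqP => f1; apply: f0 => A; apply/eqP; rewrite -[_ == 0]orbb -mulf_eq0 -fM f1.
  by rewrite mulr0.
have [|k kE] := polyfun_unitmx K0 delta_gt0 fP.
  move=> A uA; have := fM A (invmx A); rewrite mulmxV // => E.
  by apply: contraNneq f1 => fA; move: E; rewrite fA mul0r => /eqP; rewrite mulf_eq0 orbb.
have PE' : map_mpoly iota P' = f 1%:M *: generic_det ^+ k.
  apply: mxfun_inj => A; rewrite -[LHS]/(f A) kE /mxfun mevalZ.
  by rewrite (rmorphXn (meval _)) /= -/(mxfun _ A) mxfun_generic_det.
have k1 : k = 1%N by apply: (irreducible_power (c := f 1%:M) generic_det_nonunit); rewrite -PE'.
have f1E : f 1%:M = iota (vpeval P' (up 1)) by rewrite -fphi rmorph1.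
exists (vpeval P' (up 1)); first by rewrite -(fmorph_eq0 iota) -f1E.
apply: (@map_mpoly_inj F K iota); rewrite PE' k1 expr1 f1E -PE.
by rewrite -[in RHS]mul_mpolyC rmorphM /= map_mpolyC mul_mpolyC.
Qed.

End Sl2Invariant.

(** * Split quadratic spaces of dimension five *)

Section SplitQuadraticSpace.
Variable E : fieldType.
Hypothesis E0 : [pchar E] =i pred0.
Variables (B : 'M[E]_5) (BQ : 'M[E]_3) (e f : 'cV[E]_5) (W : 'M[E]_(5, 3)) (c : E).

(** The field is a parameter and the pairing [c] of [e] with [f] is not normalised: the same
    computations serve over F and, after [map_split_quadratic], over K. *)
Record split_quadratic : Prop := SplitQuadratic {
  sq_sym : B^T = B;
  sq_unit : B \in unitmx;
  sq_basis : (row_mx e (row_mx W f) : 'M[E]_5) \in unitmx;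
  sq_c : c != 0;
  sq_ee : e^T *m B *m e = 0;
  sq_ff : f^T *m B *m f = 0;
  sq_ef : e^T *m B *m f = c%:M;
  sq_eW : e^T *m B *m W = 0;
  sq_fW : f^T *m B *m W = 0;
  sq_WW : W^T *m B *m W = BQ }.

Hypothesis H : split_quadratic.
Local Notation T := (row_mx e (row_mx W f) : 'M[E]_5).

Lemma sq_fe : f^T *m B *m e = c%:M.
Proof. by apply: trmx_inj; rewrite !trmx_mul trmxK (sq_sym H) mulmxA (sq_ef H) tr_scalar_mx. Qed.

Lemma sq_We : W^T *m B *m e = 0.
Proof. by apply: trmx_inj; rewrite !trmx_mul trmxK (sq_sym H) mulmxA (sq_eW H) trmx0. Qed.

Lemma sq_Wf : W^T *m B *m f = 0.
Proof. by apply: trmx_inj; rewrite !trmx_mul trmxK (sq_sym H) mulmxA (sq_fW H) trmx0. Qed.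

Lemma sq_BQ_sym : BQ^T = BQ.
Proof. by rewrite -(sq_WW H) !trmx_mul trmxK (sq_sym H) mulmxA. Qed.

Lemma mul_basis n (X : 'M[E]_(n, 5)) :
  X *m T = row_mx (X *m e) (row_mx (X *m W) (X *m f)).
Proof. exact: etrans (mul_mx_row X e (row_mx W f)) (congr1 (row_mx _) (mul_mx_row X W f)). Qed.

Lemma basis_mul n (a b : 'rV[E]_n) (v : 'M[E]_(3, n)) :
  T *m (col_mx a (col_mx v b) : 'M[E]_(5, n)) = e *m a + W *m v + f *m b.
Proof.
rewrite -addrA; exact: etrans (mul_row_col e (row_mx W f) a (col_mx v b))
  (congr1 (+%R _) (mul_row_col W f v b)).
Qed.

Lemma basis_act n (X Y : 'M[E]_(n, 5)) :
  X *m e = Y *m e -> X *m W = Y *m W -> X *m f = Y *m f -> X = Y.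
Proof.
move=> he hW hf; rewrite -[X](mulmxK (sq_basis H)) -[Y](mulmxK (sq_basis H)).
by congr (_ *m _); rewrite !mul_basis he hW hf.
Qed.

Lemma basis_coord n (u : 'M[E]_(5, n)) : exists (a b : 'rV[E]_n) (v : 'M[E]_(3, n)),
  u = e *m a + W *m v + f *m b.
Proof.
pose t : 'M[E]_(1 + (3 + 1), n) := invmx T *m u.
exists (usubmx t), (dsubmx (dsubmx t)), (usubmx (dsubmx t)).
rewrite -basis_mul -[LHS](mulKVmx (sq_basis H)) -/t; congr (_ *m _).
by rewrite -{1}[t]vsubmxK -{1}[dsubmx t]vsubmxK.
Qed.

Lemma basis_coord_inj n (a a' b b' : 'rV[E]_n) (v v' : 'M[E]_(3, n)) :
  e *m a + W *m v + f *m b = e *m a' + W *m v' + f *m b' -> [/\ a = a', v = v' & b = b'].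
Proof.
rewrite -!basis_mul => /(can_inj (mulKmx (sq_basis H))).
move=> E1; have [-> E2] := @eq_col_mx E 1 (3 + 1) n a (col_mx v b) a' (col_mx v' b') E1.
by have [-> ->] := @eq_col_mx E 3 1 n v b v' b' E2.
Qed.

Lemma W_inj n (v v' : 'M[E]_(3, n)) : W *m v = W *m v' -> v = v'.
Proof.
move=> vv; have [] // := @basis_coord_inj n 0 0 0 0 v v' _.
by rewrite !mulmx0 !addr0 !add0r.
Qed.

(** The skew endomorphism u |-> b(z, u) y - b(y, u) z attached to the bivector of y and z. *)
Definition wedge (y z : 'cV[E]_5) : 'M[E]_5 := (y *m z^T - z *m y^T) *m B.
(** The factor 1/c makes this map send [f] to W x; in the same way [down_mx x] sends [e] to W x. *)
Definition up_mx (x : 'cV[E]_3) : 'M[E]_5 := c^-1 *: wedge (W *m x) e.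
Definition down_mx (x : 'cV[E]_3) : 'M[E]_5 := c^-1 *: wedge (W *m x) f.

Lemma wedge_act n y z (u : 'M[E]_(5, n)) :
  wedge y z *m u = y *m (z^T *m B *m u) - z *m (y^T *m B *m u).
Proof. by rewrite /wedge !mulmxBl !mulmxA. Qed.

Lemma wedge_skew y z : (wedge y z)^T *m B + B *m wedge y z = 0.
Proof.
rewrite /wedge trmx_mul linearB /= !trmx_mul !trmxK (sq_sym H) -!mulmxA -mulmxDr -mulmxDl.
by rewrite addrC addrA subrK subrr mul0mx mulmx0.
Qed.

Lemma mulmx_scal1 n (u : 'M[E]_(n, 1)) a : u *m (a%:M : 'M[E]_1) = a *: u.
Proof. by rewrite mul_mx_scalar. Qed.

Lemma up_e x : up_mx x *m e = 0.
Proof.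
rewrite /up_mx -scalemxAl wedge_act (sq_ee H) mulmx0 trmx_mul -!mulmxA (mulmxA _ B).
by rewrite sq_We !mulmx0 subrr scaler0.
Qed.

Lemma up_f x : up_mx x *m f = W *m x.
Proof.
rewrite /up_mx -scalemxAl wedge_act (sq_ef H) mulmx_scal1 trmx_mul -!mulmxA (mulmxA _ B).
by rewrite sq_Wf !mulmx0 subr0 scalerA mulVf ?scale1r // (sq_c H).
Qed.

Lemma up_W x : up_mx x *m W = - (c^-1 *: (e *m (x^T *m BQ))).
Proof.
rewrite /up_mx -scalemxAl wedge_act (sq_eW H) mulmx0 trmx_mul -!mulmxA (mulmxA _ B).
by rewrite (sq_WW H) sub0r scalerN.
Qed.

Lemma down_f x : down_mx x *m f = 0.
Proof.
rewrite /down_mx -scalemxAl wedge_act (sq_ff H) mulmx0 trmx_mul -!mulmxA (mulmxA _ B).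
by rewrite sq_Wf !mulmx0 subrr scaler0.
Qed.

Lemma down_e x : down_mx x *m e = W *m x.
Proof.
rewrite /down_mx -scalemxAl wedge_act sq_fe mulmx_scal1 trmx_mul -!mulmxA (mulmxA _ B).
by rewrite sq_We !mulmx0 subr0 scalerA mulVf ?scale1r // (sq_c H).
Qed.

Lemma down_W x : down_mx x *m W = - (c^-1 *: (f *m (x^T *m BQ))).
Proof.
rewrite /down_mx -scalemxAl wedge_act (sq_fW H) mulmx0 trmx_mul -!mulmxA (mulmxA _ B).
by rewrite (sq_WW H) sub0r scalerN.
Qed.

(** The block diagonal matrix (a, g, b) in the basis e, W, f. *)
Definition levi_mx (a b : E) (g : 'M[E]_3) : 'M[E]_5 :=
  (row_mx (a *: e) (row_mx (W *m g) (b *: f)) : 'M[E]_5) *m invmx T.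

Lemma levi_basis a b g : levi_mx a b g *m T = row_mx (a *: e) (row_mx (W *m g) (b *: f)).
Proof. by rewrite /levi_mx mulmxKV // (sq_basis H). Qed.

Lemma levi_act a b g : [/\ levi_mx a b g *m e = a *: e, levi_mx a b g *m W = W *m g &
  levi_mx a b g *m f = b *: f].
Proof.
have := levi_basis a b g; rewrite mul_basis => E1.
have [-> E2] := @eq_row_mx E 5 1 (3 + 1) _ (row_mx _ _) _ (row_mx _ _) E1.
by have [-> ->] := @eq_row_mx E 5 3 1 _ _ _ _ E2.
Qed.

Lemma leviM a b g a' b' g' :
  levi_mx a b g *m levi_mx a' b' g' = levi_mx (a * a') (b * b') (g *m g').
Proof.
have [he hW hf] := levi_act a b g; have [he' hW' hf'] := levi_act a' b' g'.
have [he2 hW2 hf2] := levi_act (a * a') (b * b') (g *m g').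
apply: basis_act; rewrite -mulmxA ?he' ?hW' ?hf' ?he2 ?hW2 ?hf2.
- by rewrite -scalemxAr he scalerA mulrC.
- by rewrite mulmxA hW mulmxA.
- by rewrite -scalemxAr hf scalerA mulrC.
Qed.

Lemma levi1 : levi_mx 1 1 1%:M = 1%:M.
Proof.
have [he hW hf] := levi_act 1 1 1%:M.
by apply: basis_act; rewrite ?he ?hW ?hf mul1mx ?scale1r ?mulmx1.
Qed.

Lemma bilinear_basis (X Y : 'M[E]_5) :
  e^T *m X = e^T *m Y -> W^T *m X = W^T *m Y -> f^T *m X = f^T *m Y -> X = Y.
Proof.
move=> he hW hf; apply: trmx_inj; apply: basis_act;
by apply: trmx_inj; rewrite !trmx_mul !trmxK.
Qed.

Lemma isometry_basis (P : 'M[E]_5) a b g :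
  P *m e = a *: e -> P *m W = W *m g -> P *m f = b *: f ->
  P^T *m B *m P = B <-> a * b = 1 /\ g^T *m BQ *m g = BQ.
Proof.
move=> he hW hf.
have gram n m (u : 'M[E]_(5, n)) (u' : 'M[E]_(5, m)) :
  u^T *m (P^T *m B *m P) *m u' = (P *m u)^T *m B *m (P *m u').
  by rewrite trmx_mul !mulmxA.
split=> [PP|[ab gg]].
  split.
    have := gram _ _ e f; rewrite PP he hf (sq_ef H) [(_ *: _)^T]linearZ /= -!scalemxAl -scalemxAr scalerA (sq_ef H).
    move/matrixP/(_ 0 0); rewrite !mxE eqxx mulr1n => /eqP.
    by rewrite -{1}[c]mul1r (inj_eq (mulIf (sq_c H))) => /eqP.
  transitivity ((W *m g)^T *m B *m (W *m g)); first by rewrite -(sq_WW H) trmx_mul !mulmxA.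
  by rewrite -hW -gram PP (sq_WW H).
apply: bilinear_basis; apply: basis_act; rewrite gram ?he ?hW ?hf
  ?[(_ *: _)^T]linearZ ?trmx_mul /= -?scalemxAl -?scalemxAr ?scalerA.
- by rewrite (sq_ee H) scaler0.
- by rewrite !mulmxA (sq_eW H) mul0mx scaler0.
- by rewrite (sq_ef H) ab scale1r.
- by rewrite -!mulmxA (mulmxA _ B) sq_We mulmx0 scaler0.
- by rewrite (sq_WW H) -[RHS]gg -(sq_WW H) !mulmxA.
- by rewrite -!mulmxA (mulmxA _ B) sq_Wf mulmx0 scaler0.
- by rewrite sq_fe mulrC ab scale1r.
- by rewrite !mulmxA (sq_fW H) mul0mx scaler0.
- by rewrite (sq_ff H) scaler0.
Qed.

Lemma levi_isometry a b g : a * b = 1 -> g^T *m BQ *m g = BQ ->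
  (levi_mx a b g)^T *m B *m levi_mx a b g = B.
Proof.
have [he hW hf] := levi_act a b g => ab gg.
by apply/(isometry_basis he hW hf).
Qed.

Definition reflection (x : 'cV[E]_3) : 'M[E]_3 :=
  1%:M - (2%:R / qform BQ x) *: (x *m (x^T *m BQ)).

Definition exp_up x : 'M[E]_5 := expmx 3 (up_mx x).
Definition exp_down x : 'M[E]_5 := expmx 3 (down_mx x).

Lemma qformE (x : 'cV[E]_3) : x^T *m BQ *m x = (qform BQ x)%:M.
Proof. by rewrite [LHS]mx11_scalar. Qed.

Lemma exp3_act n (X : 'M[E]_5) (u : 'M[E]_(5, n)) :
  expmx 3 X *m u = u + X *m u + 2%:R^-1 *: (X *m (X *m u)).
Proof.
rewrite /expmx !big_ord_recl big_ord0 /= !mulmxDl mul0mx addr0 expr0 expr1.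
rewrite invr1 !scale1r mul1mx expr2 -scalemxAl -mulmxE mulmxA addrA.
by [].
Qed.

Lemma exp_up_e x : exp_up x *m e = e.
Proof. by rewrite /exp_up exp3_act up_e mulmx0 scaler0 !addr0. Qed.

Lemma exp_up_f x : exp_up x *m f = f + W *m x - (qform BQ x / (2%:R * c)) *: e.
Proof.
rewrite /exp_up exp3_act up_f mulmxA up_W mulNmx -scalemxAl -!mulmxA (mulmxA _ BQ) qformE.
rewrite mulmx_scal1 scalerN !scalerA; congr (_ + _); congr (- (_ *: _)).
by rewrite invfM mulrC mulrA.
Qed.

Lemma exp_up_W x : exp_up x *m W = W - c^-1 *: (e *m (x^T *m BQ)).
Proof.
rewrite /exp_up exp3_act up_W mulmxN -scalemxAr (mulmxA (up_mx x) e) up_e.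
by rewrite mul0mx scaler0 oppr0 scaler0 addr0.
Qed.

Lemma exp_down_f x : exp_down x *m f = f.
Proof. by rewrite /exp_down exp3_act down_f mulmx0 scaler0 !addr0. Qed.

Lemma exp_down_e x : exp_down x *m e = e + W *m x - (qform BQ x / (2%:R * c)) *: f.
Proof.
rewrite /exp_down exp3_act down_e mulmxA down_W mulNmx -scalemxAl -!mulmxA (mulmxA _ BQ) qformE.
rewrite mulmx_scal1 scalerN !scalerA; congr (_ + _); congr (- (_ *: _)).
by rewrite invfM mulrC mulrA.
Qed.

Lemma exp_down_W x : exp_down x *m W = W - c^-1 *: (f *m (x^T *m BQ)).
Proof.
rewrite /exp_down exp3_act down_W mulmxN -scalemxAr (mulmxA (down_mx x) f) down_f.
by rewrite mul0mx scaler0 oppr0 scaler0 addr0.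
Qed.

(* The Weyl element of the sl_2-triple through x: it exchanges the lines of e
   and f and acts as the reflection in x on the span of W. *)
Definition weyl_mx x : 'M[E]_5 :=
  exp_up x *m (exp_down ((2%:R * c / qform BQ x) *: x) *m exp_up x).

(** Three shears composed in the coordinates (a, v, b). The scale mu = 2c / q(x) of the middle one
    satisfies mu k = 1, where k = q(x) / 2c is the coefficient of the quadratic term of [exp_up x];
    this makes the old coordinates on e and f cancel out. *)
Lemma weyl_act x : qform BQ x != 0 ->
  [/\ weyl_mx x *m e = - (2%:R * c / qform BQ x) *: f, weyl_mx x *m W = W *m reflection x &
      weyl_mx x *m f = - (qform BQ x / (2%:R * c)) *: e].
Proof.
set q := qform BQ x => q0; set mu := 2%:R * c / q; have c0 := sq_c H.
have two0 : 2%:R != 0 :> E by have /pcharf0P -> := E0.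
have qmu : qform BQ (mu *: x) = mu ^+ 2 * q.
  by rewrite /qform [(_ *: _)^T]linearZ /= -!scalemxAl -scalemxAr scalerA mxE expr2.
have rx : (x^T *m BQ) *m x = q%:M by rewrite qformE.
pose k := q / (2%:R * c).
have h1 : mu ^+ 2 * k = mu by rewrite /mu /k; field; rewrite c0 q0 two0.
have h2 : mu * q = 2%:R * c by rewrite /mu; field; rewrite q0.
have h3 : mu * k = 1 by rewrite /mu /k; field; rewrite c0 q0 two0.
have h4 : c^-1 * q = 2%:R * k by rewrite /k; field; rewrite c0 two0.
have upE n (a b : 'rV[E]_n) (v : 'M[E]_(3, n)) : exp_up x *m (e *m a + W *m v + f *m b) =
    e *m (a - c^-1 *: (x^T *m BQ *m v) - k *: b) + W *m (v + x *m b) + f *m b.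
  rewrite !mulmxDr !mulmxA exp_up_e exp_up_W exp_up_f.
  rewrite !mulmxBl !mulmxDl ?mulmxN -!scalemxAl -!scalemxAr !mulmxA -/q -/k.
  by apply/matrixP => i j; rewrite !mxE; ring.
have downE n (a b : 'rV[E]_n) (v : 'M[E]_(3, n)) : exp_down (mu *: x) *m (e *m a + W *m v + f *m b) =
    e *m a + W *m (v + mu *: (x *m a)) + f *m (b - (c^-1 * mu) *: (x^T *m BQ *m v) - mu *: a).
  rewrite !mulmxDr !mulmxA exp_down_e exp_down_W exp_down_f qmu -mulrA h1.
  rewrite [(_ *: _)^T]linearZ /= !mulmxBl !mulmxDl ?mulmxN -!scalemxAl -!scalemxAr -?scalemxAl !mulmxA.
  rewrite scalerA; by apply/matrixP => i j; rewrite !mxE; ring.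
have main n (a b : 'rV[E]_n) (v : 'M[E]_(3, n)) : weyl_mx x *m (e *m a + W *m v + f *m b) =
    e *m (- (k *: b)) + W *m (reflection x *m v) + f *m (- (mu *: a)).
  rewrite /weyl_mx -!mulmxA upE downE upE; set r := x^T *m BQ.
  have rxE (a' : 'rV[E]_n) : r *m (x *m a') = q *: a' by rewrite mulmxA rx mul_scalar_mx.
  (* The coordinates after each shear are made opaque, which keeps the remaining identities
     small. *)
  set a1 := a - _ - _; have a1E : a1 = a - c^-1 *: (r *m v) - k *: b by [].
  clearbody a1; set b2 := b - _ - _.
  have b2D : b2 = b - (c^-1 * mu) *: (r *m (v + x *m b)) - mu *: a1 by [].
  clearbody b2; set v2 := v + _ + _; have v2E : v2 = v + x *m b + mu *: (x *m a1) by [].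
  clearbody v2.
  have r2 : r *m v2 = r *m v + q *: b + (mu * q) *: a1.
    by rewrite v2E !mulmxDr -scalemxAr !rxE scalerA.
  have b2E : b2 = - (mu *: a).
    rewrite b2D mulmxDr rxE a1E; move: (r *m v) => rho.
    apply/matrixP => i j; rewrite !mxE; move: (b i j) (a i j) (rho i j) => bb aa rr.
    transitivity (- (mu * aa) + bb * (1 - c^-1 * (mu * q) + mu * k)); first by ring.
    by rewrite h2 h3; field.
  congr (e *m _ + W *m _ + f *m _); last exact: b2E.
    rewrite r2 b2E a1E; move: (r *m v) => rho.
    apply/matrixP => i j; rewrite !mxE h2; move: (b i j) (a i j) (rho i j) => bb aa rr.
    transitivity ((aa - c^-1 * rr - k * bb) * (1 - c^-1 * (2%:R * c)) - c^-1 * rr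
      - (c^-1 * q) * bb + (mu * k) * aa); first by ring.
    by rewrite h3 h4; field.
  rewrite /reflection mulmxBl mul1mx -scalemxAl -!mulmxA (mulmxA _ BQ) -/q -/r.
  rewrite v2E b2E a1E; move: (r *m v) => rho.
  have h5 : mu * c^-1 = 2%:R / q by rewrite /mu; field; rewrite c0 q0.
  rewrite mulmxN !mulmxBr -!scalemxAr !scalerBr !scalerA h3 h5 scale1r.
  by apply/matrixP => i j; rewrite !mxE; ring.
split.
- have := main 1%N 1%:M 0 0; rewrite !mulmx0 !mulmx1 !addr0 scaler0 oppr0 mulmx0 !add0r => ->.
  by rewrite mulmxN -scalemxAr mulmx1 scaleNr.
- have := main 3 0 0 1%:M; rewrite !mulmx0 !mulmx1 !scaler0 oppr0 !mulmx0 !add0r !addr0 => ->.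
  by [].
- have := main 1%N 0 1%:M 0; rewrite !mulmx0 !mulmx1 !addr0 scaler0 oppr0 mulmx0 !add0r => ->.
  by rewrite addr0 mulmxN -scalemxAr mulmx1 scaleNr.
Qed.

(** Two exchanges restore the lines of e and f. The scale is the quotient q(x) / q(y), so over a
    closed field rescaling one vector reaches any non-zero scale without changing the
    reflections. *)
Lemma weyl_levi x y : qform BQ x != 0 -> qform BQ y != 0 ->
  weyl_mx x *m weyl_mx y =
  levi_mx (qform BQ x / qform BQ y) (qform BQ y / qform BQ x) (reflection x *m reflection y).
Proof.
move=> qx qy; have c0 := sq_c H; have two0 : 2%:R != 0 :> E by have /pcharf0P -> := E0.
have [he hW hf] := weyl_act qx; have [he' hW' hf'] := weyl_act qy.
have [he2 hW2 hf2] := levi_act (qform BQ x / qform BQ y) (qform BQ y / qform BQ x) (reflection x *m reflection y).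
move: (weyl_mx x) (weyl_mx y) he hW hf he' hW' hf' => P Q he hW hf he' hW' hf'.
apply: basis_act.
- rewrite -mulmxA he' he2 -scalemxAr hf scalerA; congr (_ *: _); field.
  by rewrite qy c0 two0.
- by rewrite -mulmxA hW' hW2 mulmxA hW mulmxA.
- rewrite -mulmxA hf' hf2 -scalemxAr he scalerA; congr (_ *: _); field.
  by rewrite qx c0 two0.
Qed.

Lemma up_cube x : up_mx x ^+ 3 = 0.
Proof.
rewrite exprS expr2 -!mulmxE; apply: basis_act; rewrite -!mulmxA ?up_e ?up_f ?mulmx0 ?mul0mx //.
  by rewrite up_W !mulmxN -scalemxAr (mulmxA (up_mx x) e) up_e mul0mx scaler0 mulmx0 oppr0.
have -> : up_mx x *m (W *m x) = e *m (- (c^-1 *: (x^T *m BQ *m x))).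
  by rewrite mulmxA up_W mulNmx -scalemxAl mulmxN -scalemxAr !mulmxA.
by rewrite mulmxA up_e mul0mx.
Qed.

Lemma down_cube x : down_mx x ^+ 3 = 0.
Proof.
rewrite exprS expr2 -!mulmxE; apply: basis_act; rewrite -!mulmxA ?down_e ?down_f ?mulmx0 ?mul0mx //.
  have -> : down_mx x *m (W *m x) = f *m (- (c^-1 *: (x^T *m BQ *m x))).
    by rewrite mulmxA down_W mulNmx -scalemxAl mulmxN -scalemxAr !mulmxA.
  by rewrite mulmxA down_f mul0mx.
by rewrite down_W !mulmxN -scalemxAr (mulmxA (down_mx x) f) down_f mul0mx scaler0 mulmx0 oppr0.
Qed.

End SplitQuadraticSpace.

(** * Ternary quadratic forms *)

Section Frames.
Variables (E : fieldType) (n : nat) (B : 'M[E]_n).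

Definition bil (x y : 'cV[E]_n) : E := (x^T *m B *m y) 0 0.

Lemma bilE x y : x^T *m B *m y = (bil x y)%:M.
Proof. by rewrite [LHS]mx11_scalar. Qed.

Lemma bilxx x : bil x x = qform B x.
Proof. by []. Qed.

Lemma bilPr x c y z : bil x (c *: y + z) = c * bil x y + bil x z.
Proof. by rewrite /bil mulmxDr -scalemxAr !mxE. Qed.

Lemma bilPl x c y z : bil (c *: y + z) x = c * bil y x + bil z x.
Proof. by rewrite /bil linearP /= !mulmxDl -!scalemxAl !mxE. Qed.

Lemma bilZr x c y : bil x (c *: y) = c * bil x y.
Proof. by rewrite /bil -scalemxAr mxE. Qed.

Lemma bilDr x y z : bil x (y + z) = bil x y + bil x z.
Proof. by rewrite -[y]scale1r bilPr mul1r scale1r. Qed.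

Lemma bilDl x y z : bil (y + z) x = bil y x + bil z x.
Proof. by rewrite -[y]scale1r bilPl mul1r scale1r. Qed.

Lemma bilZl x c y : bil (c *: y) x = c * bil y x.
Proof. by rewrite /bil linearZ /= -!scalemxAl mxE. Qed.

Lemma qformZ c x : qform B (c *: x) = c ^+ 2 * qform B x.
Proof. by rewrite -!bilxx bilZl bilZr mulrA. Qed.

Definition frame (v : 'I_n -> 'cV[E]_n) : 'M[E]_n := \matrix_(i, j) v j i 0.

Lemma mul_frame (P : 'M[E]_n) v : P *m frame v = frame (fun j => P *m v j).
Proof.
by apply/matrixP => i j; rewrite !mxE; apply: eq_bigr => k _; rewrite !mxE.
Qed.

Lemma frame_diag v (d : 'I_n -> E) :
  frame (fun j => d j *: v j) = frame v *m diag_mx (\row_j d j).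
Proof. by apply/matrixP => i j; rewrite mul_mx_diag !mxE mulrC. Qed.

Lemma frame_mul v (u : 'cV[E]_n) : frame v *m u = \sum_j u j 0 *: v j.
Proof.
apply/matrixP => i j; rewrite ord1 mxE summxE; apply: eq_bigr => k _.
by rewrite !mxE mulrC.
Qed.

Lemma eq_frame v w : v =1 w -> frame v = frame w.
Proof. by move=> vw; apply/matrixP => i j; rewrite !mxE vw. Qed.

Lemma frame_gram v : (frame v)^T *m B *m frame v = \matrix_(i, j) bil (v i) (v j).
Proof.
apply/matrixP => i j; rewrite !mxE /bil mxE; apply: eq_bigr => k _.
by rewrite !mxE; congr (_ * _); apply: eq_bigr => l _; rewrite !mxE.
Qed.

Definition orthogonal_frame (v : 'I_n -> 'cV[E]_n) :=
  (forall i, qform B (v i) != 0) /\ forall i j, i != j -> bil (v i) (v j) = 0.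

Lemma orthogonal_gram v : orthogonal_frame v ->
  (frame v)^T *m B *m frame v = diag_mx (\row_i qform B (v i)).
Proof.
move=> [_ ov]; rewrite frame_gram; apply/matrixP => i j; rewrite !mxE.
by case: eqVneq => [->|/ov]; rewrite ?mulr1n.
Qed.

Lemma orthogonal_det v : orthogonal_frame v ->
  \det (frame v) ^+ 2 * \det B = \prod_i qform B (v i).
Proof.
move/orthogonal_gram/(congr1 determinant); rewrite !det_mulmx det_tr det_diag => E1.
transitivity (\det (frame v) * \det B * \det (frame v)); first by ring.
by rewrite E1; apply: eq_bigr => i _; rewrite mxE.
Qed.

Lemma orthogonal_unit v : orthogonal_frame v -> frame v \in unitmx.
Proof.
move=> ov; have := orthogonal_det ov; have [q0 _] := ov.
rewrite unitmxE unitfE => E1; apply/eqP => d0; move/esym/eqP: E1.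
by rewrite d0 expr0n mul0r; apply/negP/prodf_neq0.
Qed.

Lemma frame_eigen v (P : 'M[E]_n) (d : 'I_n -> E) : frame v \in unitmx ->
  (forall i, P *m v i = d i *: v i) -> \det P = \prod_i d i.
Proof.
move=> uv Pv; have := mul_frame P v; rewrite (eq_frame Pv) frame_diag.
move/(congr1 determinant); rewrite !det_mulmx det_diag mulrC => /(mulfI _) ->.
  by apply: eq_bigr => i _; rewrite mxE.
by rewrite -unitfE -unitmxE.
Qed.

Lemma frame_eq v (P Q : 'M[E]_n) : frame v \in unitmx -> (forall i, P *m v i = Q *m v i) -> P = Q.
Proof.
move=> uv PQ; rewrite -[P](mulmxK uv) -[Q](mulmxK uv) !mul_frame.
by congr (_ *m _); apply: eq_frame.
Qed.

Lemma frame_coord v (u : 'cV[E]_n) : orthogonal_frame v ->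
  u = \sum_j (bil (v j) u / qform B (v j)) *: v j.
Proof.
move=> ov; have uv := orthogonal_unit ov; have [q0 oij] := ov.
pose t := invmx (frame v) *m u; have uE : u = \sum_j t j 0 *: v j.
  by rewrite -frame_mul /t mulKVmx.
rewrite {1}uE; apply: eq_bigr => j _; congr (_ *: _).
have b0 : bil (v j) 0 = 0 by rewrite /bil mulmx0 mxE.
rewrite uE (big_morph (bil (v j)) (bilDr (v j)) b0) (bigD1 j) //= big1 ?addr0 => [|i ij].
  by rewrite bilZr bilxx mulfK.
by rewrite bilZr oij 1?eq_sym // mulr0.
Qed.

Lemma qform_frame v (t : 'I_n -> E) : orthogonal_frame v ->
  qform B (\sum_j t j *: v j) = \sum_j qform B (v j) * t j ^+ 2.
Proof.
move=> [_ oij]; have b0 x : bil x 0 = 0 by rewrite /bil mulmx0 mxE.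
have b0' x : bil 0 x = 0 by rewrite /bil trmx0 mul0mx mul0mx mxE.
rewrite -bilxx (big_morph (bil _) (bilDr _) (b0 _)); apply: eq_bigr => j _.
rewrite bilZr (big_morph (bil^~ (v j)) (bilDl (v j)) (b0' _)) (bigD1 j) //= big1 ?addr0 => [|i ij].
  by rewrite bilZl bilxx; ring.
by rewrite bilZl oij // mulr0.
Qed.

End Frames.

Lemma kernel_vector (E : fieldType) m n (A : 'M[E]_(m, n)) : (m < n)%N ->
  exists2 u : 'cV[E]_n, u != 0 & A *m u = 0.
Proof.
move=> mn; have : kermx A^T != 0.
  rewrite kermx_eq0 /row_free; apply: contraTneq mn => rk.
  by rewrite -leqNgt -rk rank_leq_col.
case/rowV0Pn => w /sub_kermxP wA w0; exists w^T.
  by rewrite -(inj_eq trmx_inj) trmxK trmx0.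
by apply: trmx_inj; rewrite trmx_mul trmxK wA trmx0.
Qed.

Section TernaryForms.
Variables (E : fieldType) (B : 'M[E]_3).
Hypothesis E0 : [pchar E] =i pred0.
Hypothesis Bsym : B^T = B.
Hypothesis Ban : anisotropic B.
Local Notation b := (bil B).
Local Notation q := (qform B).
Local Notation s := (reflection B).

Lemma bilC x y : b x y = b y x.
Proof.
have <- : (x^T *m B *m y)^T 0 0 = b x y by rewrite mxE.
by rewrite !trmx_mul trmxK Bsym mulmxA.
Qed.

Lemma bil_delta (M : 'M[E]_3) i j : bil M (delta_mx i 0) (delta_mx j 0) = M i j.
Proof. by rewrite /bil trmx_delta -rowE -colE !mxE. Qed.

Lemma bil_isometry (g : 'M[E]_3) x y : g^T *m B *m g = B -> b (g *m x) (g *m y) = b x y.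
Proof. by move=> gB; rewrite -[in RHS]gB /bil trmx_mul !mulmxA. Qed.

Lemma isometry_bil (g : 'M[E]_3) : (forall x y, b (g *m x) (g *m y) = b x y) -> g^T *m B *m g = B.
Proof.
move=> gb; apply/matrixP => i j; rewrite -bil_delta -[RHS]bil_delta -gb.
by rewrite /bil trmx_mul !mulmxA.
Qed.

Lemma qform_eq0 x : (q x == 0) = (x == 0).
Proof.
apply/idP/eqP => [|->]; last by rewrite /qform trmx0 !mul0mx mxE.
by apply: contraTeq => /Ban.
Qed.

Lemma qformD x y : q (x + y) = q x + 2%:R * b x y + q y.
Proof. by rewrite -!bilxx bilDl !bilDr (bilC y x); ring. Qed.

Lemma reflectE x u : s x *m u = u - (2%:R / q x * b x u) *: x.
Proof.
rewrite /reflection mulmxBl mul1mx -scalemxAl -mulmxA bilE mul_mx_scalar scalerA.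
by [].
Qed.

Lemma reflect_fix x u : b x u = 0 -> s x *m u = u.
Proof. by move=> xu; rewrite reflectE xu mulr0 scale0r subr0. Qed.

Lemma reflect_self x : x != 0 -> s x *m x = - x.
Proof.
move=> x0; rewrite reflectE bilxx divfK; last by rewrite qform_eq0.
by rewrite scaler_nat mulr2n opprD addrA subrr sub0r.
Qed.

Lemma reflect_isometry x : x != 0 -> (s x)^T *m B *m s x = B.
Proof.
rewrite -qform_eq0 => x0; apply: isometry_bil => u w; rewrite !reflectE -!scaleNr.
rewrite ![_ + _ *: x]addrC bilPl !bilPr bilxx (bilC u x).
by field.
Qed.

Lemma reflectK x : x != 0 -> s x *m s x = 1%:M.
Proof.
rewrite -qform_eq0 => x0; have r : (x^T *m B) *m x = (q x)%:M by rewrite bilE.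
rewrite {2}/reflection mulmxBr mulmx1 -scalemxAr (mulmxA (s x) x) reflect_self -?qform_eq0 //.
rewrite /reflection mulNmx scalerN opprK.
by rewrite subrK.
Qed.

Lemma reflect_sub x y : q x = q y -> x != y -> s (x - y) *m x = y.
Proof.
move=> xy ne; have ne0 : q (x - y) != 0 by rewrite qform_eq0 subr_eq0.
rewrite reflectE; suff -> : 2%:R / q (x - y) * b (x - y) x = 1 by rewrite scale1r opprB addrC subrK.
have E1 : q (x - y) = 2%:R * b (x - y) x.
  rewrite -scaleN1r addrC bilPl bilxx -bilxx bilPl !bilPr !bilxx (bilC x y) xy.
  by ring.
by move: ne0; rewrite E1 => ne0; rewrite mulrAC mulfV.
Qed.

Lemma orthogonal_triple x y z : x != 0 -> y != 0 -> z != 0 -> b x y = 0 -> b x z = 0 ->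
  b y z = 0 -> orthogonal_frame B (fun i : 'I_3 => [:: x; y; z]`_i).
Proof.
move=> x0 y0 z0 xy xz yz; split; first by case=> -[|[|[|]]] //= _; rewrite qform_eq0.
by case=> -[|[|[|]]] //= ? [[|[|[|]]]] //= ? _; rewrite // bilC.
Qed.

Lemma orthogonal_extend x : x != 0 -> exists y z,
  [/\ y != 0, z != 0, b x y = 0, b x z = 0 & b y z = 0].
Proof.
move=> x0; have [//|y y0 xy] := @kernel_vector E 1 3 (x^T *m B).
have [//|z z0 E1] := @kernel_vector E (1 + 1) 3 (col_mx (x^T *m B) (y^T *m B)).
exists y, z; rewrite /bil xy mxE; split=> //; move/eqP: E1; rewrite mul_col_mx col_mx_eq0.
  by case/andP => /eqP -> _; rewrite mxE.
by case/andP => _ /eqP ->; rewrite mxE.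
Qed.

Lemma det_anisotropic : \det B != 0.
Proof.
have one0 : (const_mx 1 : 'cV[E]_3) != 0.
  by apply/eqP => /matrixP/(_ 0 0)/eqP; rewrite !mxE oner_eq0.
have [y [z [y0 z0 xy xz yz]]] := orthogonal_extend one0.
have ov := orthogonal_triple one0 y0 z0 xy xz yz.
apply: contraTneq (_ : \prod_i q ([:: const_mx 1; y; z]`_(i : 'I_3)) != 0) => [d0|].
  by rewrite -(orthogonal_det ov) d0 mulr0 eqxx.
by apply/prodf_neq0 => i _; case: ov => ->.
Qed.

Lemma det_reflection x : x != 0 -> \det (s x) = -1.
Proof.
move=> x0; have [y [z [y0 z0 xy xz yz]]] := orthogonal_extend x0.
have ov := orthogonal_triple x0 y0 z0 xy xz yz.
rewrite (frame_eigen (d := fun i : 'I_3 => [:: -1; 1; 1]`_i) (orthogonal_unit ov)).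
  by rewrite !big_ord_recl big_ord0 /= !mulr1.
by case=> -[|[|[|]]] //= ?; rewrite ?scaleN1r ?scale1r ?reflect_self ?reflect_fix.
Qed.

Lemma isometry_third x y z (g : 'M[E]_3) : orthogonal_frame B (fun i : 'I_3 => [:: x; y; z]`_i) ->
  g^T *m B *m g = B -> g *m x = x -> g *m y = y -> g *m z = \det g *: z.
Proof.
move=> ov gB gx gy; have [_ oij] := ov.
have xz : b x z = 0 by apply: (oij 0 2%:R).
have yz : b y z = 0 by apply: (oij 1 2%:R).
have [c gz] : exists c, g *m z = c *: z.
  exists (b z (g *m z) / q z); rewrite [LHS](frame_coord _ ov) !big_ord_recl big_ord0 /=.
  by rewrite -{1}gx bil_isometry // xz -{1}gy bil_isometry // yz !mul0r !scale0r !add0r addr0.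
rewrite (frame_eigen (d := fun i : 'I_3 => [:: 1; 1; c]`_i) (orthogonal_unit ov)).
  by rewrite !big_ord_recl big_ord0 /= !mul1r mulr1.
by case=> -[|[|[|]]] //= ?; rewrite ?scale1r.
Qed.

(** In g^T B (g - 1) = - (g - 1)^T B the dimension is odd, so determinants give det (g - 1) = - det
    (g - 1), and 1 is an eigenvalue. *)
Lemma isometry_axis (g : 'M[E]_3) : g^T *m B *m g = B -> \det g = 1 ->
  exists2 z : 'cV[E]_3, z != 0 & g *m z = z.
Proof.
move=> gB dg; have two0 : 2%:R != 0 :> E by have /pcharf0P -> := E0.
have : \det (g^T - 1) = 0.
  have E1 : g^T *m B *m (g - 1) = -1 *: ((g - 1)^T *m B).
    by rewrite scaleN1r mulmxBr gB linearB /= trmx1 mulmxBl mul1mx mulmx1 opprB.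
  have := congr1 determinant E1; rewrite detZ !det_mulmx !det_tr dg mul1r.
  have -> : g^T - 1 = (g - 1)^T by rewrite linearB /= trmx1.
  rewrite det_tr; move: det_anisotropic (\det (g - 1)) => B0 d E2.
  have /eqP : 2%:R * (\det B * d) = 0 by rewrite mulr_natl mulr2n {1}E2; ring.
  by rewrite !mulf_eq0 (negPf two0) (negPf B0) /= => /eqP.
move/eqP/det0P => [v v0 E1]; exists v^T; first by rewrite -(inj_eq trmx_inj) trmxK trmx0.
apply: trmx_inj; rewrite trmx_mul trmxK; apply/eqP; rewrite -subr_eq0 -{2}[v]mulmx1.
by rewrite -mulmxBr E1.
Qed.

(** Let z be an axis and z, x, y an orthogonal frame. If g moves x, the reflection in g x - x takes
    g x back to x and fixes z; composed with g it is an isometry of determinant -1 fixing z and x,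
    that is the reflection in y. *)
Lemma cartan_dieudonne3 (g : 'M[E]_3) : g^T *m B *m g = B -> \det g = 1 ->
  exists x y : 'cV[E]_3, [/\ x != 0, y != 0 & g = s x *m s y].
Proof.
move=> gB dg; have [z z0 gz] := isometry_axis gB dg.
have [x [y [x0 y0 zx zy xy]]] := orthogonal_extend z0.
have ov := orthogonal_triple z0 x0 y0 zx zy xy; have uv := orthogonal_unit ov.
have [gx|gx] := eqVneq (g *m x) x.
  exists x, x; split=> //; rewrite reflectK //; apply: (frame_eq uv) => -[[|[|[|]]] //= ?]; rewrite mul1mx //.
  by rewrite (isometry_third ov gB gz gx) dg scale1r.
have a0 : g *m x - x != 0 by rewrite subr_eq0.
exists (g *m x - x), y; split=> //; set a := g *m x - x.
have az : b a z = 0.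
  by rewrite /a -scaleN1r addrC bilPl -{2}gz bil_isometry // (bilC x z) zx mulr0 addr0.
have hz : (s a *m g) *m z = z by rewrite -mulmxA gz reflect_fix.
have hx : (s a *m g) *m x = x.
  by rewrite -mulmxA reflect_sub // -!bilxx bil_isometry.
have hB : (s a *m g)^T *m B *m (s a *m g) = B.
  by rewrite trmx_mul -!mulmxA (mulmxA (s a)^T) (mulmxA ((s a)^T *m B)) reflect_isometry // mulmxA.
suff <- : s a *m g = s y by rewrite mulmxA reflectK // mul1mx.
apply: (frame_eq uv) => -[[|[|[|]]] //= ?].
- by rewrite hz reflect_fix // bilC.
- by rewrite hx reflect_fix // bilC.
by rewrite (isometry_third ov hB hz hx) det_mulmx det_reflection // dg mulr1 scaleN1r reflect_self.
Qed.

(** Otherwise the orthogonal complement of x has discriminant minus a square, so it is a hyperbolic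
    plane: an isotropic vector is written down from an orthogonal basis y, z of it. *)
Lemma represented_value x : x != 0 -> ~ sq_equiv (q x) (- \det B).
Proof.
move=> x0 [t t0 qx]; have [y [z [y0 z0 xy xz yz]]] := orthogonal_extend x0.
have ov := orthogonal_triple x0 y0 z0 xy xz yz; have dE := orthogonal_det ov.
have qx0 : q x != 0 by rewrite qform_eq0.
have qy0 : q y != 0 by rewrite qform_eq0.
have qz0 : q z != 0 by rewrite qform_eq0.
have B0 := det_anisotropic.
move: dE; rewrite !big_ord_recl big_ord0 /= mulr1; set d := \det _ => dE.
have yzE : q y * q z = - (d / t) ^+ 2.
  apply: (mulfI qx0); rewrite -dE qx; field.
  by rewrite t0.
have /eqP : q (d / t *: y + q y *: z) = 0.
  rewrite qformD !qformZ bilZl bilZr yz !mulr0 addr0 expr2 -[q y ^+ 2 * _]/(q y ^+ 2 * q z).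
  by transitivity (q y * ((d / t) ^+ 2 + q y * q z)); [ring | rewrite yzE subrr mulr0].
rewrite qform_eq0 => /eqP /(congr1 (b z)); rewrite bilPr bilZr (bilC z y) yz mulr0 add0r bilxx.
have -> : b z 0 = 0 by rewrite /bil mulmx0 mxE.
by move/eqP; rewrite mulf_eq0 (negPf qy0) (negPf qz0).
Qed.

Lemma neg_reflection_SO a : a != 0 -> SO B (- s a).
Proof.
move=> a0; split.
  by rewrite -scaleN1r [(_ *: _)^T]linearZ /= -!scalemxAl -scalemxAr scalerA mulrNN mulr1 scale1r reflect_isometry.
by rewrite -scaleN1r detZ det_reflection // -signr_odd /= expr1 mulrNN mulr1.
Qed.

End TernaryForms.

Section LocalTernaryForms.
Variables (R : realType) (K : fieldType) (v : K -> R).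
Hypothesis K0 : [pchar K] =i pred0.
Hypothesis vP : nonarch_abs v.
Hypothesis vcomplete : abs_complete v.
Hypothesis v2 : v 2%:R = 1.
Variables (J : finType) (cls : K -> J).
Hypothesis clsP : forall x y, v x <= 1 -> v y <= 1 -> (cls x == cls y) = (v (x - y) < 1).
Variable pi : K.
Hypotheses (pi0 : pi != 0) (pi1 : v pi < 1) (pimax : forall x, v x < 1 -> v x <= v pi).
Variable B : 'M[K]_3.
Hypotheses (Bsym : B^T = B) (Ban : anisotropic B).

Lemma ternary_value d : d != 0 -> ~ sq_equiv d (- \det B) -> exists x, qform B x = d.
Proof.
move=> d0 dN; have one0 : (const_mx 1 : 'cV[K]_3) != 0.
  by apply/eqP => /matrixP/(_ 0 0)/eqP; rewrite !mxE oner_eq0.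
set o := const_mx 1 in one0.
have [y [z [y0 z0 xy xz yz]]] := orthogonal_extend B one0.
have ov := orthogonal_triple Bsym Ban one0 y0 z0 xy xz yz.
have qE a b c : qform B (\sum_(i < 3) [:: a; b; c]`_i *: [:: o; y; z]`_i) =
    qform B o * a ^+ 2 + qform B y * b ^+ 2 + qform B z * c ^+ 2.
  by rewrite (qform_frame _ ov) !big_ord_recl big_ord0 /= addr0 addrA.
have q0 x : x != 0 -> qform B x != 0 by rewrite qform_eq0.
have [||a [b [c E]]] := ternary_represents vP vcomplete v2 clsP pi0 pi1 pimax
  (q0 _ one0) (q0 _ y0) (q0 _ z0) _ d0.
- move=> a b c; rewrite -qE => /eqP; rewrite qform_eq0 // => /eqP E.
  have : frame (fun i : 'I_3 => [:: o; y; z]`_i) *m (\col_i [:: a; b; c]`_i) = 0.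
    by rewrite frame_mul; apply: etrans E; apply: eq_bigr => i _; rewrite mxE.
  move/(congr1 (mulmx (invmx (frame (fun i : 'I_3 => [:: o; y; z]`_i))))).
  rewrite mulmx0 mulKmx ?(orthogonal_unit ov) // => /colP E2.
  by have := E2 0; have := E2 1; have := E2 2%:R; rewrite !mxE.
- move=> H; apply: dN; apply: sq_equiv_trans H _; exists (\det (frame (fun i : 'I_3 => [:: o; y; z]`_i))).
    by rewrite -unitfE -unitmxE (orthogonal_unit ov).
  rewrite mulNr; congr (- _); rewrite [\det B * _]mulrC (orthogonal_det ov) !big_ord_recl big_ord0 /=.
  by rewrite mulr1 mulrA.
by exists (\sum_(i < 3) [:: a; b; c]`_i *: [:: o; y; z]`_i); rewrite qE.
Qed.

End LocalTernaryForms.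

(** * The graded algebra o(q, 5) *)

(** Independence is the row-freeness of a matrix over F, and the rank does not change in the larger
    field. *)
Lemma map_mx_free (F K : fieldType) (iota : {rmorphism F -> K}) m n p
    (M : 'I_p -> 'M[F]_(m, n)) (k : 'I_p -> K) :
  (forall c : 'I_p -> F, \sum_i c i *: M i = 0 -> forall i, c i = 0) ->
  \sum_i k i *: map_mx iota (M i) = 0 -> forall i, k i = 0.
Proof.
move=> Mfree k0; pose A : 'M[F]_(p, m * n) := \matrix_i mxvec (M i).
have Afree : row_free A.
  apply/inj_row_free => v vA; apply/rowP => i; rewrite mxE.
  apply: (Mfree (fun i => v 0 i)); apply: (can_inj mxvecK); rewrite linear0 -[RHS]vA.
  rewrite mulmx_sum_row linear_sum; apply: eq_bigr => j _.
  by rewrite rowK linearZ.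
move=> i; pose kv : 'rV[K]_p := \row_i k i.
suff : kv = 0 by move/rowP/(_ i); rewrite !mxE.
apply/eqP; rewrite -(mulmx_free_eq0 _ (_ : row_free (map_mx iota A))) ?row_free_map //.
apply/eqP; apply: (can_inj vec_mxK); rewrite linear0; apply: etrans k0.
rewrite mulmx_sum_row linear_sum; apply: eq_bigr => j _ /=.
by rewrite linearZ /= mxE; congr (_ *: _); rewrite -map_row rowK map_mxvec mxvecK.
Qed.

Lemma isometry_unitmx (E : fieldType) n (C P : 'M[E]_n) : C \in unitmx -> P^T *m C *m P = C -> P \in unitmx.
Proof.
by move=> uC PC; move: uC; rewrite -{1}PC unitmx_mul => /andP[].
Qed.

Section OrthogonalAlgebra.
Variables (F : fieldType) (K : closedFieldType) (iota : {rmorphism F -> K}).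
Hypothesis K0 : [pchar K] =i pred0.
Variable B : 'M[F]_5.
Hypotheses (Bsym : B^T = B) (uB : B \in unitmx).

Local Notation L := (subvs_of (oq B)).
Local Notation LK := (lie_ext iota L).
Local Notation BK := (map_mx iota B).

Definition oq_rho (X : L) : 'M[K]_5 := map_mx iota (vsval X).

Lemma oq_val_inj (X Y : L) : vsval X = vsval Y -> X = Y. Proof. exact: val_inj. Qed.
Lemma oq_valZ c (X : L) : vsval (c *: X) = c *: vsval X. Proof. exact: linearZ. Qed.
Lemma oq_valD (X Y : L) : vsval (X + Y) = vsval X + vsval Y. Proof. exact: linearD. Qed.
Lemma oq_val_lie (X Y : L) : vsval (lie X Y) = vsval X *m vsval Y - vsval Y *m vsval X.
Proof. by []. Qed.

Lemma oq_skew (X : L) : (vsval X)^T *m B + B *m vsval X = 0.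
Proof. by have := subvsP X; rewrite mem_oq => /eqP. Qed.

Lemma oq_rhoP a (X Y : L) : oq_rho (a *: X + Y) = iota a *: oq_rho X + oq_rho Y.
Proof. by rewrite /oq_rho oq_valD oq_valZ map_mxD map_mxZ. Qed.

Lemma oq_rho_lie (X Y : L) : oq_rho (lie X Y) = mxad (oq_rho X) (oq_rho Y).
Proof. by rewrite /oq_rho oq_val_lie map_mxB !map_mxM. Qed.

Lemma oq_rho_free (k : 'I_(\dim {:L}) -> K) :
  \sum_i k i *: oq_rho (vbasis {:L})`_i = 0 -> forall i, k i = 0.
Proof.
apply: map_mx_free => c c0; have /freeP := basis_free (vbasisP {:L}); apply.
apply: val_inj; change (vsval (\sum_i c i *: (vbasis {:L})`_i) = vsval (0 : L)).
by rewrite linear0 linear_sum -[RHS]c0; apply: eq_bigr => i _; rewrite linearZ.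
Qed.

Local Notation rho_ext := (@rho_ext F K iota L 5 oq_rho).

Lemma rho_ext_skew (u : LK) : (rho_ext u)^T *m BK + BK *m rho_ext u = 0.
Proof.
rewrite /rho_ext linear_sum mulmx_suml mulmx_sumr -big_split big1 // => i _ /=.
rewrite linearZ /= -scalemxAl -scalemxAr -scalerDr /oq_rho map_trmx -!map_mxM -map_mxD.
by rewrite oq_skew map_mx0 scaler0.
Qed.

Lemma in_oq_wedge (y z : 'cV[F]_5) : wedge B y z \in oq B.
Proof.
rewrite mem_oq /wedge trmx_mul linearB /= !trmx_mul !trmxK Bsym -!mulmxA -mulmxDr -mulmxDl.
by rewrite addrC addrA subrK subrr mul0mx mulmx0.
Qed.

(** By bilinearity only wedges of coordinate vectors matter, and these are defined over F. They
    supply both the test elements for ad-nilpotency and the exponentials that generate. *)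
Lemma rho_ext_wedge (y z : 'cV[K]_5) : exists u, rho_ext u = wedge BK y z.
Proof.
pose d i : 'cV[F]_5 := delta_mx i 0.
exists (\sum_i \sum_j (y i 0 * z j 0) *: to_ext iota (Subvs (in_oq_wedge (d i) (d j)) : L)).
have rD := @rho_extD F K iota L 5 oq_rho; have r0 := @rho_ext0 F K iota L 5 oq_rho.
rewrite (big_morph rho_ext rD r0); under eq_bigr do rewrite (big_morph rho_ext rD r0).
rewrite /wedge; transitivity ((\sum_i \sum_j (y i 0 * z j 0) *: (delta_mx i j - delta_mx j i)) *m BK).
  rewrite mulmx_suml; apply: eq_bigr => i _; rewrite mulmx_suml; apply: eq_bigr => j _.
  rewrite rho_extZ rho_ext_to_ext; last exact: oq_rhoP.
  rewrite /oq_rho /= /wedge map_mxM map_mxB !map_mxM !trmx_delta !map_delta_mx.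
  by rewrite !mul_delta_mx scalemxAl.
congr (_ *m _); apply/matrixP => a b; rewrite summxE !mxE !big_ord1 !mxE.
under eq_bigr do rewrite summxE.
transitivity (\sum_i \sum_j (y i 0 * z j 0) * ((a == i)%:R * (b == j)%:R) -
   \sum_i \sum_j (y i 0 * z j 0) * ((a == j)%:R * (b == i)%:R)).
  rewrite -sumrB; apply: eq_bigr => i _; rewrite -sumrB; apply: eq_bigr => j _.
  by rewrite !mxE -!natrM !mulnb mulrBr.
congr (_ - _).
  rewrite (bigD1 a) //= (bigD1 b) //= !eqxx !mulr1 !big1 ?addr0 // => [i ia|j jb].
    by rewrite big1 // => j _; rewrite eq_sym (negPf ia) mul0r mulr0.
  by rewrite [b == j]eq_sym (negPf jb) !mulr0.
rewrite (bigD1 b) //= (bigD1 a) //= !eqxx !mulr1 !big1 ?addr0 // => [|i ia|j jb].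
- by rewrite mulrC.
- by rewrite big1 // => j _; rewrite [b == i]eq_sym (negPf ia) !mulr0.
- by rewrite [a == j]eq_sym (negPf jb) mul0r mulr0.
Qed.

Lemma skew_wedge (Z : 'M[K]_5) y z : Z^T *m BK + BK *m Z = 0 ->
  mxad Z (wedge BK y z) = wedge BK (Z *m y) z + wedge BK y (Z *m z).
Proof.
move/eqP; rewrite addr_eq0 => /eqP ZB.
have E : BK *m Z = - (Z^T *m BK) by rewrite ZB opprK.
rewrite /mxad /wedge -[_ *m BK *m Z]mulmxA E mulmxN opprK !trmx_mul !mulmxA -!mulmxDl.
congr (_ *m _); rewrite mulmxBr mulmxBl !mulmxA.
move: (Z *m y *m z^T) (Z *m z *m y^T) (y *m z^T *m Z^T) (z *m y^T *m Z^T) => a b c d.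
by rewrite addrACA [RHS]addrACA [- b - d]addrC.
Qed.

(* In odd dimension a skew matrix Z has a kernel vector v, and
   ad Z (y /\ v) = Zy /\ v. *)
Lemma oq_ad_nilpotent (x : LK) k : (forall y, iter k (lie x) y = 0) -> rho_ext x ^+ k.+1 = 0.
Proof.
move=> x0; set Z := rho_ext x; have ZB := rho_ext_skew x; rewrite -/Z in ZB.
have two0 : 2%:R != 0 :> K by have /pcharf0P -> := K0.
have uBK : BK \in unitmx by rewrite map_unitmx.
have : \det Z == 0.
  have /(congr1 determinant) : Z^T *m BK = -1 *: (BK *m Z).
    by rewrite scaleN1r; apply/eqP; rewrite -addr_eq0 ZB.
  rewrite detZ !det_mulmx det_tr => E1.
  have : 2%:R * (\det BK * \det Z) == 0 by rewrite mulr_natl mulr2n {1}[\det BK * _]mulrC E1; apply/eqP; ring.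
  by rewrite !mulf_eq0 (negPf two0) /=; move: uBK; rewrite unitmxE unitfE => /negPf ->.
rewrite -det_tr => /det0P[w w0 wZ]; set v := w^T.
have v0 : v != 0 by rewrite /v -(inj_eq trmx_inj) trmxK trmx0.
have Zv : Z *m v = 0 by apply: trmx_inj; rewrite trmx_mul /v trmxK wZ trmx0.
have it y : iter k (mxad Z) (wedge BK y v) = wedge BK (Z ^+ k *m y) v.
  elim: (k) y => [|i IH] y; first by rewrite expr0 mul1mx.
  rewrite iterS IH skew_wedge // Zv /wedge trmx0 mulmx0 mul0mx subrr mul0mx addr0.
  by rewrite exprS -mulmxE !mulmxA.
apply/matrixP => i j; rewrite -[LHS](_ : (Z ^+ k.+1 *m delta_mx j 0 : 'cV_5) i 0 = _); last by rewrite -colE mxE.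
rewrite exprS -mulmxE -mulmxA; set a := _ *m delta_mx j 0.
have : wedge BK a v = 0.
  have [u uE] := rho_ext_wedge (delta_mx j 0) v.
  rewrite /a -it -uE -(iter_rho_ext_lie oq_rhoP oq_rho_lie) x0.
  by rewrite rho_ext0.
rewrite /wedge => /(congr1 (mulmx^~ (invmx BK))); rewrite mulmxK // mul0mx.
(* Since the wedge of [a] and [v] is 0, [a] is a multiple of [v], which Z kills: hence the exponent
   k + 1. *)
have [l vl] : exists l, v l 0 != 0 by case/cV0Pn: v0 => l; exists l.
move=> /matrixP av; clearbody a v; have aE : a = (a l 0 / v l 0) *: v.
  apply/matrixP => r c; rewrite ord1 mxE; have /eqP := av r l.
  rewrite !mxE !big_ord1 !mxE subr_eq0 => /eqP E.
  by rewrite mulrAC -[a l 0 * _]mulrC -E mulfK.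
by rewrite aE -scalemxAr Zv scaler0 !mxE.
Qed.

Lemma expmx_skew m (Z : 'M[K]_5) : Z^T *m BK + BK *m Z = 0 ->
  (expmx m Z)^T *m BK = BK *m expmx m (- Z).
Proof.
move/eqP; rewrite addr_eq0 => /eqP ZB; rewrite /expmx linear_sum mulmx_suml mulmx_sumr.
apply: eq_bigr => i _ /=; rewrite linearZ /= -scalemxAl -scalemxAr; congr (_ *: _).
elim: (i : nat) => [|j IH]; first by rewrite !expr0 trmx1 mul1mx mulmx1.
rewrite exprSr exprS -!mulmxE trmx_mul -mulmxA IH mulmxA ZB -mulmxN -mulmxA.
by [].
Qed.

Lemma expmx_isometry m (Z : 'M[K]_5) : Z^T *m BK + BK *m Z = 0 -> Z ^+ m.+1 = 0 ->
  (expmx m.+1 Z)^T *m BK *m expmx m.+1 Z = BK.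
Proof. by move=> ZB Z0; rewrite expmx_skew // -mulmxA expmxN // mulmx1. Qed.

Lemma elementary_is_isometry (g : 'End(LK)) : elementary g ->
  exists2 P, P^T *m BK *m P = BK & forall u, P *m rho_ext u = rho_ext (g u) *m P.
Proof.
elim=> [|k x {}g x0 _ [P PB PE]].
  by exists 1%:M; [rewrite trmx1 mul1mx mulmx1 | move=> u; rewrite lfunE mul1mx mulmx1].
have Z0 := oq_ad_nilpotent x0.
exists (expmx k.+1 (rho_ext x) *m P).
  rewrite trmx_mul -!mulmxA (mulmxA (expmx _ _)^T) (mulmxA (_ *m BK)).
  by rewrite expmx_isometry ?rho_ext_skew // mulmxA.
move=> u; rewrite -mulmxA PE mulmxA comp_lfunE.
have Z0' : (rho_ext x - 0%:M) ^+ k.+1 = 0 by rewrite raddf0 subr0.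
have E := rho_ext_exp_ad K0 oq_rhoP oq_rho_lie (g u) Z0' x0.
rewrite raddf0 subr0 in E.
by rewrite mulmxA; congr (_ *m _); exact: E.
Qed.

End OrthogonalAlgebra.

Section MapSplitQuadratic.
Variables (F K : fieldType) (iota : {rmorphism F -> K}).

Lemma map_split_quadratic (B : 'M[F]_5) BQ (e f : 'cV_5) (W : 'M_(5, 3)) c :
  split_quadratic B BQ e f W c ->
  split_quadratic (map_mx iota B) (map_mx iota BQ) (map_mx iota e) (map_mx iota f)
    (map_mx iota W) (iota c).
Proof.
move=> H; split; rewrite ?map_trmx -?map_mxM.
- by rewrite (sq_sym H).
- by rewrite map_unitmx (sq_unit H).
- have -> : (row_mx (map_mx iota e) (row_mx (map_mx iota W) (map_mx iota f)) : 'M[K]_5) =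
      map_mx iota (row_mx e (row_mx W f) : 'M[F]_5).
    apply: esym; apply: etrans (@map_row_mx _ _ iota 5 1 (3 + 1) e (row_mx W f)) _.
    by congr (row_mx _ _); apply: map_row_mx.
  by rewrite map_unitmx (sq_basis H).
- by rewrite fmorph_eq0 (sq_c H).
- by rewrite (sq_ee H) map_mx0.
- by rewrite (sq_ff H) map_mx0.
- by rewrite (sq_ef H) map_scalar_mx.
- by rewrite (sq_eW H) map_mx0.
- by rewrite (sq_fW H) map_mx0.
- by rewrite (sq_WW H).
Qed.

Lemma map_qform n (M : 'M[F]_n) (x : 'cV_n) :
  qform (map_mx iota M) (map_mx iota x) = iota (qform M x).
Proof. by rewrite /qform map_trmx -!map_mxM mxE. Qed.

Lemma map_reflection (BQ : 'M[F]_3) x :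
  map_mx iota (reflection BQ x) = reflection (map_mx iota BQ) (map_mx iota x).
Proof.
rewrite /reflection map_mxB map_mx1 map_mxZ !map_mxM -map_trmx.
by rewrite map_qform fmorph_div rmorph_nat.
Qed.

End MapSplitQuadratic.

(** * Eigenspaces of the grading element *)

Section SplitQuadraticGrading.
Variable E : fieldType.
Hypothesis E0 : [pchar E] =i pred0.
Variables (B : 'M[E]_5) (BQ : 'M[E]_3) (e f : 'cV[E]_5) (W : 'M[E]_(5, 3)) (c : E).
Hypothesis H : split_quadratic B BQ e f W c.
Local Notation up := (up_mx B e W c).
Local Notation down := (down_mx B f W c).
Local Notation levi := (levi_mx e f W).
Variable h : 'M[E]_5.
Hypotheses (he : h *m e = 2%:R *: e) (hW : h *m W = 0) (hf : h *m f = - 2%:R *: f).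

Lemma natE_neq0 k : k.+1%:R != 0 :> E.
Proof. by have /pcharf0P -> := E0. Qed.

Lemma reflectionZ a x : a != 0 -> reflection BQ (a *: x) = reflection BQ x.
Proof.
move=> a0; rewrite /reflection qformZ [(_ *: _)^T]linearZ /= -!scalemxAl -!scalemxAr !scalerA.
by rewrite invfM; move: (qform BQ x)^-1 => q'; congr (_ - _ *: _); field.
Qed.

Lemma h_coord n (a b : 'rV[E]_n) (v : 'M[E]_(3, n)) :
  h *m (e *m a + W *m v + f *m b) = e *m (2%:R *: a) + W *m 0 + f *m (- 2%:R *: b).
Proof.
rewrite !mulmxDr !mulmxA he hW hf mul0mx mulmx0 -!scalemxAl -!scalemxAr.
by [].
Qed.

Lemma scale_coord n k (a b : 'rV[E]_n) (v : 'M[E]_(3, n)) :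
  k *: (e *m a + W *m v + f *m b) = e *m (k *: a) + W *m (k *: v) + f *m (k *: b).
Proof. by rewrite !scalerDr !scalemxAr. Qed.

Lemma scale_eq0 n m (k l : E) (u : 'M[E]_(n, m)) : k != l -> k *: u = l *: u -> u = 0.
Proof.
move=> kl /eqP; rewrite -subr_eq0 -scalerBl scaler_eq0 subr_eq0 (negPf kl).
by move/eqP.
Qed.

Lemma two_ne k : 2%:R != - k%:R :> E.
Proof. by rewrite -subr_eq0 opprK -natrD natE_neq0. Qed.

Lemma h_eigen_e n (u : 'M[E]_(5, n)) : h *m u = 2%:R *: u -> exists a, u = e *m a.
Proof.
have [a [b [v ->]]] := basis_coord H u; rewrite h_coord scale_coord => /(basis_coord_inj H)[_ E1 E2].
exists a; rewrite (@scale_eq0 _ _ 0 2%:R v) ?(scale_eq0 _ (esym E2)) ?mulmx0 ?addr0 //.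
- exact: two_ne.
- by rewrite eq_sym natE_neq0.
- by rewrite scale0r.
Qed.

Lemma h_eigen_f n (u : 'M[E]_(5, n)) : h *m u = - 2%:R *: u -> exists b, u = f *m b.
Proof.
have [a [b [v ->]]] := basis_coord H u; rewrite h_coord scale_coord => /(basis_coord_inj H)[E1 E2 _].
exists b; rewrite (@scale_eq0 _ _ 0 (- 2%:R) v) ?(scale_eq0 _ E1) ?mulmx0 ?add0r //.
- exact: two_ne.
- by rewrite eq_sym oppr_eq0 natE_neq0.
- by rewrite scale0r.
Qed.

Lemma h_eigen_W n (u : 'M[E]_(5, n)) : h *m u = 0 -> exists v, u = W *m v.
Proof.
have [a [b [v ->]]] := basis_coord H u; rewrite h_coord => E1.
have [] := @basis_coord_inj _ _ _ _ _ _ _ H n (2%:R *: a) 0 (- 2%:R *: b) 0 0 0.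
  by rewrite E1 !mulmx0 !addr0.
move=> /eqP a0 _ /eqP b0; move: a0 b0; rewrite !scaler_eq0 oppr_eq0 (negPf (natE_neq0 1)) /=.
by move=> /eqP -> /eqP ->; exists v; rewrite !mulmx0 add0r addr0.
Qed.

Lemma h_eigen4 n (u : 'M[E]_(5, n)) : h *m u = 4%:R *: u -> u = 0.
Proof.
have [a [b [v ->]]] := basis_coord H u; rewrite h_coord scale_coord => /(basis_coord_inj H)[E1 E2 E3].
have -> : a = 0.
  by apply: scale_eq0 E1; rewrite eq_sym -subr_eq0 -natrB // natE_neq0.
have -> : b = 0.
  by apply: scale_eq0 E3; rewrite eq_sym -subr_eq0 opprK -natrD natE_neq0.
have -> : v = 0.
  by apply: (@scale_eq0 _ _ 0 4%:R); rewrite ?scale0r // eq_sym natE_neq0.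
by rewrite !mulmx0 !addr0.
Qed.

Lemma h_up x : mxad h (up x) = 2%:R *: up x.
Proof.
apply: (basis_act H); rewrite /mxad mulmxBl -!mulmxA -[RHS]scalemxAl ?he ?hW ?hf.
- by rewrite -scalemxAr (up_e H) scaler0 mulmx0 subrr.
- rewrite (up_W H) mulmx0 subr0 mulmxN -scalemxAr (mulmxA h) he -scalemxAl.
  by rewrite scalerN scalerA mulrC -scalerA.
- rewrite (up_f H) (mulmxA h) hW mul0mx sub0r -scalemxAr (up_f H) scaleNr opprK.
  by [].
Qed.

Lemma h_down x : mxad h (down x) = - 2%:R *: down x.
Proof.
apply: (basis_act H); rewrite /mxad mulmxBl -!mulmxA -[RHS]scalemxAl ?he ?hW ?hf.
- by rewrite (down_e H) (mulmxA h) hW mul0mx sub0r -scalemxAr (down_e H) scaleNr.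
- rewrite (down_W H) mulmx0 subr0 mulmxN -scalemxAr (mulmxA h) hf -scalemxAl.
  by rewrite scalerN scalerA mulrC -scalerA.
- by rewrite -scalemxAr (down_f H) scaler0 mulmx0 subrr.
Qed.

Lemma skew_bil n m (X : 'M[E]_5) (u : 'M[E]_(5, n)) (w : 'M[E]_(5, m)) :
  X^T *m B + B *m X = 0 -> u^T *m B *m (X *m w) = - ((X *m u)^T *m B *m w).
Proof.
move/eqP; rewrite addr_eq0 => /eqP XB.
by rewrite trmx_mul -!mulmxA (mulmxA X^T) XB !mulNmx mulmxN opprK !mulmxA.
Qed.

Lemma skew_self (X : 'M[E]_5) (u : 'cV[E]_5) : X^T *m B + B *m X = 0 -> u^T *m B *m (X *m u) = 0.
Proof.
move=> XB; have E1 := skew_bil u u XB.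
have E2 : (X *m u)^T *m B *m u = u^T *m B *m (X *m u).
  have tr (M : 'M[E]_1) : M^T = M by apply/matrixP => i j; rewrite mxE !ord1.
  by rewrite -[LHS]tr !trmx_mul !trmxK (sq_sym H) mulmxA.
apply: (@scale_eq0 _ _ 1 (-1)); first by rewrite -subr_eq0 opprK (natE_neq0 1).
by rewrite scale1r scaleN1r -{2}E2 -E1.
Qed.

Lemma skew_W (X : 'M[E]_5) a b : X^T *m B + B *m X = 0 ->
  X *m e = a *: e -> X *m f = b *: f -> exists s, X *m W = W *m s.
Proof.
move=> XB Xe Xf; have [r [t [s XW]]] := basis_coord H (X *m W).
have c0 := sq_c H.
have r0 : r = 0.
  have := skew_bil f W XB; rewrite Xf [(_ *: _)^T]linearZ /= -!scalemxAl (sq_fW H) scaler0 oppr0.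
  rewrite XW !mulmxDr !mulmxA (sq_fe H) (sq_fW H) (sq_ff H) !mul0mx !addr0 mul_scalar_mx.
  by move/eqP; rewrite scaler_eq0 (negPf c0) => /eqP.
have t0 : t = 0.
  have := skew_bil e W XB; rewrite Xe [(_ *: _)^T]linearZ /= -!scalemxAl (sq_eW H) scaler0 oppr0.
  rewrite XW !mulmxDr !mulmxA (sq_ee H) (sq_eW H) (sq_ef H) !mul0mx !add0r mul_scalar_mx.
  by move/eqP; rewrite scaler_eq0 (negPf c0) => /eqP.
by exists s; rewrite XW r0 t0 !mulmx0 add0r addr0.
Qed.

Lemma up_skew x : (up x)^T *m B + B *m up x = 0.
Proof.
by rewrite /up_mx [(_ *: _)^T]linearZ /= -scalemxAl -scalemxAr -scalerDr (wedge_skew H) scaler0.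
Qed.

Lemma down_skew x : (down x)^T *m B + B *m down x = 0.
Proof.
by rewrite /down_mx [(_ *: _)^T]linearZ /= -scalemxAl -scalemxAr -scalerDr (wedge_skew H) scaler0.
Qed.

Lemma skew_sub (X Y : 'M[E]_5) : X^T *m B + B *m X = 0 -> Y^T *m B + B *m Y = 0 ->
  (X - Y)^T *m B + B *m (X - Y) = 0.
Proof. by move=> XB YB; rewrite linearB /= mulmxBl mulmxBr addrACA XB -opprD YB subrr. Qed.

Lemma scal1 n (u : 'M[E]_(n, 1)) (a : 'M[E]_1) : u *m a = a 0 0 *: u.
Proof. by rewrite {1}[a]mx11_scalar mul_mx_scalar. Qed.

(** Skewness excludes a component of X e on f and of X f on e. Their components in W are removed by
    a [down] and an [up]; what remains preserves both lines and, again by skewness, W, so it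
    commutes with h. *)
Lemma skew_decomposition (X : 'M[E]_5) : X^T *m B + B *m X = 0 ->
  exists x y (Z : 'M[E]_5), [/\ X = down x + Z + up y, Z^T *m B + B *m Z = 0 & mxad h Z = 0].
Proof.
move=> XB; have [a [b [v Xe]]] := basis_coord H (X *m e).
have [a' [b' [v' Xf]]] := basis_coord H (X *m f).
have c0 := sq_c H.
have b0 : b = 0.
  have := skew_self e XB; rewrite Xe !mulmxDr !mulmxA (sq_ee H) (sq_eW H) (sq_ef H) !mul0mx !add0r mul_scalar_mx.
  by move/eqP; rewrite scaler_eq0 (negPf c0) => /eqP.
have a0 : a' = 0.
  have := skew_self f XB; rewrite Xf !mulmxDr !mulmxA (sq_fe H) (sq_fW H) (sq_ff H) !mul0mx !addr0 mul_scalar_mx.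
  by move/eqP; rewrite scaler_eq0 (negPf c0) => /eqP.
pose Z := X - down v - up v'.
have ZB : Z^T *m B + B *m Z = 0 by apply: skew_sub (up_skew _); apply: skew_sub (down_skew _).
have Ze : Z *m e = a 0 0 *: e.
  by rewrite /Z !mulmxBl Xe (up_e H) (down_e H) b0 mulmx0 addr0 subr0 addrK scal1.
have Zf : Z *m f = b' 0 0 *: f.
  by rewrite /Z !mulmxBl Xf (up_f H) (down_f H) a0 mulmx0 add0r subr0 addrC addKr scal1.
have [s ZW] := skew_W ZB Ze Zf.
exists v, v', Z; split=> //.
  by rewrite /Z [down v + _]addrC addrAC !subrK.
apply: (basis_act H); rewrite /mxad mulmxBl mul0mx -!mulmxA ?Ze ?ZW ?Zf ?he ?hW ?hf -?scalemxAr.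
- by rewrite he Ze scalerA mulrC -scalerA subrr.
- by rewrite mulmxA hW mul0mx mulmx0 subrr.
- by rewrite hf Zf scalerA mulrC -scalerA subrr.
Qed.

(** X raises eigenvalues of h by 2, so it kills e, as 4 is not an eigenvalue, and maps f into W.
    After subtraction of the matching [up], skewness keeps the image of W in W, where weight 2
    forces it to be 0. *)
Lemma skew_grade2 (X : 'M[E]_5) : X^T *m B + B *m X = 0 -> mxad h X = 2%:R *: X -> exists x, X = up x.
Proof.
move=> XB Xh; have hX n (u : 'M[E]_(5, n)) : h *m (X *m u) = X *m (h *m u) + 2%:R *: (X *m u).
  by rewrite scalemxAl -Xh /mxad mulmxBl !mulmxA addrC subrK.
have Xe : X *m e = 0.
  by apply: h_eigen4; rewrite hX he -scalemxAr -scalerDl -natrD.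
have [v Xf] : exists v, X *m f = W *m v.
  by apply: h_eigen_W; rewrite hX hf -scalemxAr -scalerDl addNr scale0r.
exists v; apply/eqP; rewrite -subr_eq0; apply/eqP; set Z := X - up v.
have ZB : Z^T *m B + B *m Z = 0 by apply: skew_sub (up_skew _).
have Ze : Z *m e = 0 *: e by rewrite /Z mulmxBl Xe (up_e H) subrr scale0r.
have Zf : Z *m f = 0 *: f by rewrite /Z mulmxBl Xf (up_f H) subrr scale0r.
have [s ZW] := skew_W ZB Ze Zf.
have Zh : mxad h Z = 2%:R *: Z.
  by rewrite /Z -scaleN1r addrC mxadP Xh h_up [in RHS]scalerDr scalerA mulrC -scalerA.
apply: (basis_act H); rewrite mul0mx ?Ze ?Zf ?scale0r //.
have : 2%:R *: (Z *m W) = 0.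
  by rewrite scalemxAl -Zh /mxad mulmxBl -!mulmxA hW ZW mulmxA hW mul0mx mulmx0 subrr.
by move/eqP; rewrite scaler_eq0 (negPf (natE_neq0 1)) => /eqP.
Qed.

Lemma levi_h a b g : levi a b g *m h = h *m levi a b g.
Proof.
have [] := levi_act H a b g; move: (levi a b g) => P le lW lf.
apply: (basis_act H); rewrite -!mulmxA ?he ?hW ?hf ?le ?lW ?lf -?scalemxAr ?le ?lf ?he ?hf.
- by rewrite scalerA mulrC -scalerA.
- by rewrite mulmx0 mulmxA hW mul0mx.
- by rewrite scalerA mulrC -scalerA.
Qed.

Lemma levi_up a g x : a != 0 -> g^T *m BQ *m g = BQ ->
  levi a a^-1 g *m up x = up (a *: (g *m x)) *m levi a a^-1 g.
Proof.
move=> a0 gB; have [] := levi_act H a a^-1 g; move: (levi a a^-1 g) => P le lW lf.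
apply: (basis_act H); rewrite -!mulmxA ?le ?lW ?lf -?scalemxAr ?(up_e H) ?(up_f H) ?mulmx0 ?scaler0 //.
- rewrite (up_W H) mulmxN -scalemxAr (mulmxA P) le -scalemxAl.
  rewrite (mulmxA (up _)) (up_W H) mulNmx -scalemxAl -mulmxA [(_ *: _)^T]linearZ /= trmx_mul -!scalemxAl.
  by rewrite -[in RHS](mulmxA (x^T *m g^T)) -(mulmxA x^T) (mulmxA g^T) gB -scalemxAr.
- by rewrite (mulmxA P) lW -scalemxAr scalerA mulVf // scale1r mulmxA.
Qed.

End SplitQuadraticGrading.

(** * Rotations and scalars acting on o(q, 5) *)

Section OrthogonalGroup.
Variables (F : fieldType) (K : closedFieldType) (iota : {rmorphism F -> K}).
Hypothesis F0 : [pchar F] =i pred0.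
Hypothesis K0 : [pchar K] =i pred0.
Variables (B : 'M[F]_5) (BQ : 'M[F]_3) (e f : 'cV[F]_5) (W : 'M[F]_(5, 3)) (c : F).
Hypothesis H : split_quadratic B BQ e f W c.
Hypothesis Ban : anisotropic BQ.

Local Notation L := (subvs_of (oq B)).
Local Notation up := (up_mx B e W c).
Local Notation levi := (levi_mx e f W).
Local Notation rho := (@oq_rho F K iota B).
Local Notation "M ^K" := (map_mx iota M) (at level 2, format "M ^K").
Let HK := map_split_quadratic iota H.
Let Bsym := sq_sym H.
Let uB := sq_unit H.
Let BQsym := sq_BQ_sym H.

Variable H0 : L.
Hypotheses (H0e : vsval H0 *m e = 2%:R *: e) (H0W : vsval H0 *m W = 0)
  (H0f : vsval H0 *m f = - 2%:R *: f).
Local Notation G := (grG iota H0).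
Local Notation V := (grade H0 2%:R).

Definition psi (x : 'cV[F]_3) : L := vsproj (oq B) (up x).

Lemma psi_val x : vsval (psi x) = up x.
Proof. by rewrite vsprojK // mem_oq (up_skew H). Qed.

Lemma up_linear : linear up.
Proof.
move=> a x y; apply: (basis_act H); rewrite mulmxDl -scalemxAl.
- by rewrite !(up_e H) scaler0 addr0.
- rewrite !(up_W H) linearP /= mulmxDl -scalemxAl mulmxDr -scalemxAr.
  by rewrite scalerDr opprD !scalerN !scalerA [a * _]mulrC.
- by rewrite !(up_f H) mulmxDr -scalemxAr.
Qed.

Lemma psi_linear : linear psi.
Proof. by move=> a x y; rewrite /psi up_linear linearP. Qed.

Lemma psi_inj : injective psi.
Proof.
move=> x y /(congr1 (fun X : L => vsval X *m f)); rewrite /= !psi_val !(up_f H).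
by move/(W_inj H).
Qed.

Lemma psiE x : vsval (psi x) *m f = W *m x.
Proof. by rewrite psi_val (up_f H). Qed.

Lemma oq_graded : graded H0.
Proof.
apply: gradedP => // X; have XB := oq_skew X.
have [x [y [Z [XE ZB Zh]]]] := skew_decomposition F0 H H0e H0W H0f XB.
have inL (Y : 'M[F]_5) : Y^T *m B + B *m Y = 0 -> Y \in oq B by move=> YB; rewrite mem_oq YB.
exists (Subvs (inL _ (down_skew H x))), (Subvs (inL _ ZB)), (psi y); split; apply: oq_val_inj.
- by rewrite oq_valD psi_val.
- exact: (h_down H H0e H0W H0f).
- exact: Zh.
- by rewrite oq_val_lie oq_valZ psi_val; apply: (h_up H H0e H0W H0f).
Qed.

Lemma psi_grade x : psi x \in V.
Proof.
rewrite mem_grade; apply/eqP/oq_val_inj; rewrite oq_val_lie oq_valZ psi_val.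
exact: (h_up H H0e H0W H0f).
Qed.

Lemma oq_grade2 (X : L) : X \in V -> exists x, X = psi x.
Proof.
rewrite mem_grade => /eqP XE; have XB := oq_skew X.
have [|x xE] := skew_grade2 F0 H H0e H0W H0f XB.
  by rewrite -oq_valZ -XE.
by exists x; apply: oq_val_inj; rewrite xE psi_val.
Qed.

(** The projection [vsproj] makes this a total function of P; it is the conjugation when P is an
    isometry. *)
Definition isom_conj (P : 'M[F]_5) : 'End(L) :=
  linfun (vsproj (oq B) \o (fun X : L => P *m vsval X *m invmx P)).

Lemma isom_unit P : P^T *m B *m P = B -> P \in unitmx.
Proof. exact: isometry_unitmx. Qed.

Lemma isom_conjE P X : P^T *m B *m P = B -> vsval (isom_conj P X) = P *m vsval X *m invmx P.
Proof.
move=> PB; have uP := isom_unit PB.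
pose h (X : L) : L := vsproj (oq B) (P *m vsval X *m invmx P).
have lin : linear h.
  move=> a Y Z; rewrite /h oq_valD oq_valZ mulmxDr mulmxDl -scalemxAr -scalemxAl.
  by rewrite linearP.
pose l : {linear L -> L} := HB.pack h (GRing.isLinear.Build _ _ _ _ _ lin).
rewrite /isom_conj -[linfun _]/(linfun l) lfunE /= /h vsprojK // mem_oq; apply/eqP.
have uPT : P^T \in unitmx by rewrite unitmx_tr.
set Y := P *m _ *m _; have YP : Y *m P = P *m vsval X by rewrite /Y mulmxKV.
apply: (can_inj (mulmxK uP)); apply: (can_inj (mulKmx uPT)); rewrite mul0mx mulmx0.
rewrite mulmxDl mulmxDr -(mulmxA B) YP !mulmxA PB -trmx_mul YP trmx_mul.
by rewrite -!mulmxA (mulmxA P^T) PB oq_skew.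
Qed.

Lemma isom_conj_rel P X : P^T *m B *m P = B -> vsval (isom_conj P X) *m P = P *m vsval X.
Proof. by move=> PB; rewrite isom_conjE // mulmxKV // isom_unit. Qed.

Lemma isom_conj_eq P X Y : P^T *m B *m P = B -> P *m vsval X = vsval Y *m P -> isom_conj P X = Y.
Proof. by move=> PB E; apply: oq_val_inj; rewrite isom_conjE // E mulmxK // isom_unit. Qed.

Lemma isometryM (P Q : 'M[F]_5) : P^T *m B *m P = B -> Q^T *m B *m Q = B ->
  (P *m Q)^T *m B *m (P *m Q) = B.
Proof.
by move=> PB QB; rewrite trmx_mul -!mulmxA (mulmxA P^T) (mulmxA (_ *m B)) PB mulmxA.
Qed.

Lemma isom_conjM P Q : P^T *m B *m P = B -> Q^T *m B *m Q = B ->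
  isom_conj (P *m Q) = (isom_conj P \o isom_conj Q)%VF.
Proof.
move=> PB QB; apply/lfunP => X; apply: isom_conj_eq; first exact: isometryM.
by rewrite lfunE /= mulmxA isom_conj_rel // -!mulmxA isom_conj_rel // !mulmxA.
Qed.

Lemma isom_conj1 : isom_conj 1%:M = \1%VF.
Proof.
apply/lfunP => X; apply: isom_conj_eq; first by rewrite trmx1 mul1mx mulmx1.
by rewrite lfunE mul1mx mulmx1.
Qed.

Lemma isom_conj_lie_aut P : P^T *m B *m P = B -> is_lie_aut (isom_conj P).
Proof.
move=> PB; have uP := isom_unit PB.
have IB : (invmx P)^T *m B *m invmx P = B.
  by rewrite -{1}PB trmx_inv -!mulmxA mulmxV // mulmx1 mulKmx // unitmx_tr.
have I1 : (1%:M : 'M[F]_5)^T *m B *m 1%:M = B by rewrite trmx1 mul1mx mulmx1.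
split.
  exists (isom_conj (invmx P)) => X.
    by rewrite -comp_lfunE -isom_conjM // mulVmx // isom_conj1 lfunE.
  by rewrite -comp_lfunE -isom_conjM // mulmxV // isom_conj1 lfunE.
move=> X Y; apply: isom_conj_eq => //; rewrite !oq_val_lie mulmxBr mulmxBl.
by rewrite -!mulmxA !isom_conj_rel // !mulmxA !isom_conj_rel.
Qed.

(** The pair (g, a) acts by a on e, by 1/a on f and by g on W, hence by a g on V^+. *)
Definition levi_conj (s : 'M[F]_3 * F) : 'End(L) := isom_conj (levi s.2 s.2^-1 s.1).

Lemma levi_SO_isometry g a : SO BQ g -> a != 0 ->
  (levi a a^-1 g)^T *m B *m levi a a^-1 g = B.
Proof. by move=> [gB _] a0; apply: (levi_isometry H); rewrite ?mulfV. Qed.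

Lemma levi_conj_psi g a x : SO BQ g -> a != 0 -> levi_conj (g, a) (psi x) = psi (a *: (g *m x)).
Proof.
move=> gS a0; apply: isom_conj_eq; rewrite ?psi_val; first exact: levi_SO_isometry.
by have [gB _] := gS; apply: (levi_up H).
Qed.

Lemma levi_conjM g a g' a' : SO BQ g -> a != 0 -> SO BQ g' -> a' != 0 ->
  levi_conj (g *m g', a * a') = (levi_conj (g, a) \o levi_conj (g', a'))%VF.
Proof.
move=> gS a0 gS' a0'; rewrite /levi_conj /= invfM -(leviM H) isom_conjM //.
  exact: levi_SO_isometry.
exact: levi_SO_isometry.
Qed.

Lemma levi_conj_H g a : SO BQ g -> a != 0 -> levi_conj (g, a) H0 = H0.
Proof.
move=> gS a0; apply: isom_conj_eq; first exact: levi_SO_isometry.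
exact: (levi_h H H0e H0W H0f).
Qed.

Local Notation elconj := (@elementary_conj F K iota L 5 rho).

Lemma elementary_exp_wedge (y z : 'cV[K]_5) a :
  (a *: wedge B^K y z) ^+ 3 = 0 -> elconj (expmx 3 (a *: wedge B^K y z)).
Proof.
have [u <-] := rho_ext_wedge iota Bsym y z.
rewrite -rho_extZ => u0.
exact: (elementary_conj_exp K0 (@oq_rhoP F K iota B) (@oq_rho_lie F K iota B) (@oq_rho_free F K iota B) u0).
Qed.

Lemma elementary_weyl x : elconj (weyl_mx B^K BQ^K e^K f^K W^K (iota c) x).
Proof.
apply: elementary_conjM.
  by apply: elementary_exp_wedge; exact: (up_cube HK).
apply: elementary_conjM.
  by apply: elementary_exp_wedge; exact: (down_cube HK).
by apply: elementary_exp_wedge; exact: (up_cube HK).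
Qed.

Lemma map_levi a b g : (levi a b g)^K = levi_mx e^K f^K W^K (iota a) (iota b) g^K.
Proof.
have [le lW lf] := levi_act H a b g; have [le' lW' lf'] := levi_act HK (iota a) (iota b) g^K.
apply: (basis_act HK); rewrite ?le' ?lW' ?lf' -map_mxM ?le ?lW ?lf.
- by rewrite map_mxZ.
- by rewrite map_mxM.
- by rewrite map_mxZ.
Qed.

(* Over the closed field, a rotation s_x s_y with scale a is the product of the
   Weyl elements of x and of a multiple r y with q(x) = a r^2 q(y). *)
Lemma elementary_levi g a : SO BQ g -> a != 0 -> elconj (levi a a^-1 g)^K.
Proof.
move=> [gB dg] a0; have [x [y [x0 y0 gE]]] := cartan_dieudonne3 F0 BQsym Ban gB dg.
have qx : qform BQ x != 0 by apply: Ban.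
have qy : qform BQ y != 0 by apply: Ban.
pose t := qform BQ x / (a * qform BQ y).
have [r /rootP rE] : exists r, root ('X^2 - (iota t)%:P) r.
  by apply/closed_rootP; rewrite size_XnsubC.
have {}rE : r ^+ 2 = iota t by apply/eqP; move/eqP: rE; rewrite !hornerE subr_eq0.
have t0 : t != 0 by rewrite mulf_neq0 // invr_eq0 mulf_neq0.
have r0 : r != 0 by apply: contraNneq t0 => r0; rewrite -(fmorph_eq0 iota) -rE r0 expr0n.
have qx' : qform BQ^K x^K != 0 by rewrite map_qform fmorph_eq0.
have qy' : qform BQ^K (r *: y^K) != 0.
  by rewrite qformZ map_qform mulf_neq0 ?expf_neq0 // fmorph_eq0.
have := weyl_levi K0 HK qx' qy'.
rewrite reflectionZ // -!map_reflection -map_mxM -gE qformZ !map_qform rE -rmorphM -!fmorph_div.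
have -> : qform BQ x / (t * qform BQ y) = a by rewrite /t; field; rewrite qx qy a0.
have -> : t * qform BQ y / qform BQ x = a^-1 by rewrite /t; field; rewrite qx qy a0.
rewrite -map_levi => <-.
by apply: elementary_conjM; apply: elementary_weyl.
Qed.

Lemma levi_conj_grG g a : SO BQ g -> a != 0 -> G (levi_conj (g, a)).
Proof.
move=> gS a0; have PB := levi_SO_isometry gS a0; split; last exact: levi_conj_H.
split; first exact: isom_conj_lie_aut.
apply: (elementary_conj_ext (@oq_rhoP F K iota B) (@oq_rho_free F K iota B)
  (P := (levi a a^-1 g)^K)); last exact: elementary_levi.
  by rewrite map_unitmx (isom_unit PB).
by move=> X; rewrite /oq_rho -!map_mxM isom_conj_rel.
Qed.

End OrthogonalGroup.

Section OrthogonalGroupConverse.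
Variables (F : fieldType) (K : closedFieldType) (iota : {rmorphism F -> K}).
Hypothesis F0 : [pchar F] =i pred0.
Hypothesis K0 : [pchar K] =i pred0.
Variables (B : 'M[F]_5) (BQ : 'M[F]_3) (e f : 'cV[F]_5) (W : 'M[F]_(5, 3)) (c : F).
Hypothesis H : split_quadratic B BQ e f W c.
Hypothesis Ban : anisotropic BQ.

Local Notation L := (subvs_of (oq B)).
Local Notation up := (up_mx B e W c).
Local Notation levi := (levi_mx e f W).
Local Notation rho := (@oq_rho F K iota B).
Local Notation "M ^K" := (map_mx iota M) (at level 2, format "M ^K").
Local Notation psi := (psi B e W c).
Local Notation Phi := (levi_conj B e f W).
Let HK := map_split_quadratic iota H.
Let BQsym := sq_BQ_sym H.

Variable H0 : L.
Hypotheses (H0e : vsval H0 *m e = 2%:R *: e) (H0W : vsval H0 *m W = 0)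
  (H0f : vsval H0 *m f = - 2%:R *: f).
Local Notation G := (grG iota H0).
Local Notation V := (grade H0 2%:R).

Lemma grG_psi_matrix g : G g -> exists M : 'M[F]_3, forall x, g (psi x) = psi (M *m x).
Proof.
move=> Gg; have /choice[m mE] j : exists y, g (psi (delta_mx j 0)) = psi y.
  by apply: (oq_grade2 F0 H H0e H0W H0f); apply: grG_grade Gg (psi_grade H H0e H0W H0f _).
pose l : {linear 'cV[F]_3 -> L} := HB.pack psi (GRing.isLinear.Build _ _ _ _ _ (psi_linear H)).
exists (frame m) => x; rewrite frame_mul.
have xE : x = \sum_j x j 0 *: delta_mx j 0.
  by rewrite {1}[x]matrix_sum_delta; apply: eq_bigr => i _; rewrite big_ord1.
transitivity (g (l x)); first by [].
rewrite -[RHS]/(l _) {1}xE !linear_sum; apply: eq_bigr => j _.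
by rewrite !linearZ /= mE.
Qed.

(** The action on V^+ is la h over K and a matrix M over F. The Gram matrix of M is la^2 times that
    of Q and its determinant is la^3, so la^2, la^3 and their quotient la lie in F. *)
Lemma levi_conj_of_matrix (g : 'End(L)) (P : 'M[K]_5) la la' (h : 'M[K]_3) : G g ->
  P *m e^K = la *: e^K -> P *m W^K = W^K *m h -> P *m f^K = la' *: f^K ->
  P^T *m B^K *m P = B^K -> \det h = 1 -> (forall X, P *m rho X = rho (g X) *m P) ->
  exists g' a, [/\ SO BQ g', a != 0 & Phi (g', a) = g].
Proof.
move=> Gg Pe PW Pf PB dh PE; have [M ME] := grG_psi_matrix Gg.
have [la1 hB] := proj1 (isometry_basis HK Pe PW Pf) PB.
have hM (x : 'cV[F]_3) : h *m x^K = la' *: (M *m x)^K.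
  apply: (W_inj HK); have := congr1 (mulmx^~ f^K) (PE (psi x)); rewrite ME /oq_rho !(psi_val H).
  rewrite -!mulmxA Pf -!map_mxM (up_f H) -scalemxAr -map_mxM (up_f H) !map_mxM mulmxA PW.
  by rewrite -mulmxA -scalemxAr.
have MK : M^K = la *: h.
  apply/matrixP => i j; have /matrixP/(_ i 0) := hM (delta_mx j 0).
  rewrite -colE map_delta_mx -colE !mxE => ->.
  by rewrite mulrA la1 mul1r.
have [i [j BQij]] : exists i j, BQ i j != 0.
  by apply/matrix0Pn; apply: contraNneq (det_anisotropic BQsym Ban) => ->; rewrite det0.
pose mu := (M^T *m BQ *m M) i j / BQ i j.
have laE2 : la ^+ 2 = iota mu.
  have E1 : (M^T *m BQ *m M)^K = la ^+ 2 *: BQ^K.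
    rewrite !map_mxM -map_trmx MK [(_ *: _)^T]linearZ /= -!scalemxAl -scalemxAr scalerA hB.
    by rewrite -expr2.
  have /matrixP/(_ i j) := E1; rewrite [LHS]mxE [RHS]mxE [BQ^K i j]mxE /mu fmorph_div => ->.
  by rewrite mulfK // fmorph_eq0.
have laE3 : la ^+ 3 = iota (\det M) by rewrite -det_map_mx MK detZ dh mulr1.
have la0 : la != 0 by apply: contraTneq (oner_neq0 K) => z; rewrite negbK -la1 z mul0r.
have laE : la = iota (\det M / mu).
  by rewrite fmorph_div -laE2 -laE3 exprS mulfK // expf_neq0.
set a := \det M / mu in laE; have a0 : a != 0 by rewrite -(fmorph_eq0 iota) -laE.
have gK : (a^-1 *: M)^K = h by rewrite map_mxZ fmorphV -laE MK scalerK.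
have SOg : SO BQ (a^-1 *: M).
  split; first by apply: (@map_mx_inj _ _ iota); rewrite !map_mxM -map_trmx gK.
  by apply: (fmorph_inj iota); rewrite -det_map_mx gK rmorph1.
exists (a^-1 *: M), a; split=> //; apply/lfunP => X.
have lB := levi_SO_isometry H SOg a0.
rewrite /levi_conj; apply: (isom_conj_eq H lB); apply: (@map_mx_inj _ _ iota).
have PK : P = (levi a a^-1 (a^-1 *: M))^K.
  rewrite (map_levi iota H) gK -laE; have [le lW lf] := levi_act HK la (iota a^-1) h.
  apply: (basis_act HK); rewrite ?le ?lW ?lf // Pf fmorphV -laE.
  by congr (_ *: _); apply: (mulfI la0); rewrite la1 mulfV.
move: PK lB => /=; move: (levi _ _ _) => Q PK _.
by rewrite !map_mxM -PK; apply: PE.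
Qed.

Lemma grG_levi_conj g : G g -> exists g' a, [/\ SO BQ g', a != 0 & Phi (g', a) = g].
Proof.
move=> Gg; have [[_ eg] gH] := Gg.
have [P PB /(lfun_ext_rho (@oq_rhoP F K iota B)) PE] :=
  elementary_is_isometry K0 (sq_sym H) (sq_unit H) eg.
have PH := PE H0; rewrite gH in PH.
have he : rho H0 *m e^K = 2%:R *: e^K by rewrite -map_mxM H0e map_mxZ rmorph_nat.
have hW : rho H0 *m W^K = 0 by rewrite -map_mxM H0W map_mx0.
have hf : rho H0 *m f^K = - 2%:R *: f^K by rewrite -map_mxM H0f map_mxZ rmorphN rmorph_nat.
have [a1 Pe] : exists a, P *m e^K = e^K *m a.
  by apply: (h_eigen_e K0 HK he hW hf); rewrite mulmxA -PH -mulmxA he -scalemxAr.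
have [b1 Pf] : exists a, P *m f^K = f^K *m a.
  by apply: (h_eigen_f K0 HK he hW hf); rewrite mulmxA -PH -mulmxA hf -scalemxAr.
have [h PW] : exists h, P *m W^K = W^K *m h.
  by apply: (h_eigen_W K0 HK he hW hf); rewrite mulmxA -PH -mulmxA hW mulmx0.
rewrite scal1 in Pe; rewrite scal1 in Pf.
have [_ hB] := proj1 (isometry_basis HK Pe PW Pf) PB.
have /eqP : \det h ^+ 2 = 1.
  have := congr1 determinant hB; rewrite !det_mulmx det_tr mulrAC -expr2 => E1.
  apply: (mulIf (_ : \det BQ^K != 0)); last by rewrite E1 mul1r.
  by rewrite det_map_mx fmorph_eq0 (det_anisotropic BQsym Ban).
rewrite sqrf_eq1 => /orP[/eqP dh|/eqP dh].
  exact: levi_conj_of_matrix Gg Pe PW Pf PB dh PE.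
(* In odd dimension -P induces the same automorphism, and its block on W has determinant 1. *)
apply: (@levi_conj_of_matrix g (-1 *: P) (- a1 0 0) (- b1 0 0) (-1 *: h) Gg) => [||||| X].
- by rewrite -scalemxAl Pe scalerA mulN1r.
- by rewrite -scalemxAl PW scalemxAr.
- by rewrite -scalemxAl Pf scalerA mulN1r.
- by rewrite [(_ *: _)^T]linearZ /= -!scalemxAl -scalemxAr scalerA mulrNN mulr1 scale1r.
- by rewrite detZ dh -signr_odd /= expr1 mulrNN mulr1.
- by rewrite -scalemxAl PE scalemxAr.
Qed.

Lemma levi_conj_image :
  Phi @` (SO BQ `*` [set a : F | a != 0]) = G.
Proof.
rewrite predeqE => g; split=> [[[h a] [hS a0] <-]|/grG_levi_conj[h [a [hS a0 <-]]]].
  exact: (levi_conj_grG iota F0 K0 H Ban H0e H0W H0f).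
by exists (h, a).
Qed.

Lemma scaled_rotation_inj (g g' : 'M[F]_3) a a' : SO BQ g -> SO BQ g' -> a != 0 -> a' != 0 ->
  a *: g = a' *: g' -> g = g' /\ a = a'.
Proof.
move=> [gB dg] [gB' dg'] a0 a0' E.
have E3 : a ^+ 3 = a' ^+ 3.
  by have := congr1 determinant E; rewrite !detZ dg dg' !mulr1.
have E2 : a ^+ 2 = a' ^+ 2.
  have [i [j BQij]] : exists i j, BQ i j != 0.
    by apply/matrix0Pn; apply: contraNneq (det_anisotropic BQsym Ban) => ->; rewrite det0.
  have gram k (h : 'M[F]_3) : h^T *m BQ *m h = BQ -> (k *: h)^T *m BQ *m (k *: h) = k ^+ 2 *: BQ.
    by move=> hB; rewrite [(_ *: _)^T]linearZ /= -!scalemxAl -scalemxAr scalerA hB -expr2.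
  have /matrixP/(_ i j) : a ^+ 2 *: BQ = a' ^+ 2 *: BQ by rewrite -(gram _ _ gB) E gram.
  by rewrite !mxE => /(mulIf BQij).
have aa : a = a'.
  by apply: (mulIf (expf_neq0 2 a0')); rewrite -{1}E2 -!exprS.
by split=> //; move: E; rewrite aa => /(scalerI a0').
Qed.

Lemma levi_conj_inj g a g' a' : SO BQ g -> a != 0 -> SO BQ g' -> a' != 0 ->
  Phi (g, a) = Phi (g', a') -> g = g' /\ a = a'.
Proof.
move=> gS a0 gS' a0' E; apply: scaled_rotation_inj => //.
apply/matrixP => i j; have := congr1 (fun h : 'End(L) => h (psi (delta_mx j 0))) E.
rewrite !(levi_conj_psi H) // => /(psi_inj H)/matrixP/(_ i 0).
by rewrite -!colE !mxE.
Qed.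

Local Notation q := (qform BQ).

(** If q(y) = t^2 q(x), then y = t z with q(z) = q(x), and minus the reflection in x + z is a
    rotation taking x to z. When x + z = 0 there is no such reflection, and the identity with scale
    -t is used. *)
Lemma rotation_orbit x y : x != 0 -> (exists g a, [/\ SO BQ g, a != 0 & a *: (g *m x) = y]) <->
  sq_equiv (q y) (q x).
Proof.
have qg g u : SO BQ g -> q (g *m u) = q u.
  by move=> [gB _]; rewrite -!bilxx bil_isometry.
move=> x0; split=> [[g [a [gS a0 <-]]]|[t t0 qy]].
  by exists a; rewrite // qformZ qg // mulrC.
have SO1 : SO BQ 1%:M by split; rewrite ?det1 // trmx1 mul1mx mulmx1.
pose z := t^-1 *: y; have yE : y = t *: z by rewrite scalerA mulfV // scale1r.
have qz : q x = q z by rewrite /z qformZ qy exprVn mulrC mulfK // expf_neq0.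
have [xz|xz] := eqVneq x (- z).
  exists 1%:M, (- t); split; rewrite ?oppr_eq0 //.
  by rewrite mul1mx xz scalerN scaleNr opprK -yE.
exists (- reflection BQ (x - - z)), t; split=> //.
  by apply: neg_reflection_SO => //; rewrite subr_eq0.
rewrite mulNmx reflect_sub ?opprK //.
by rewrite -scaleN1r qformZ sqrrN expr1n mul1r.
Qed.

Lemma psi0 : psi 0 = 0.
Proof. by have := psi_linear H (-1) 0 0; rewrite scaler0 addr0 scaleN1r addNr. Qed.

Lemma oq_orbit_zero : lie_orbit G (psi 0) = [set 0].
Proof.
rewrite psi0 predeqE => X; split=> [[g Gg <-]|->]; first by rewrite linear0.
exists \1%VF; last by rewrite lfunE.
rewrite -levi_conj_image; exists (1%:M, 1).
  by split; [split; rewrite ?det1 // trmx1 mul1mx mulmx1 | rewrite /= oner_eq0].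
by rewrite /levi_conj /= invr1 (levi1 H) (isom_conj1 H).
Qed.

Lemma oq_orbit x : x != 0 ->
  lie_orbit G (psi x) = psi @` [set y | sqclass (q x) (q y)].
Proof.
move=> x0; rewrite predeqE => X; split.
  move=> [g /grG_levi_conj[h [a [hS a0 <-]]] <-]; rewrite (levi_conj_psi H) //.
  exists (a *: (h *m x)) => //=; apply/sqclassE/rotation_orbit => //.
  by exists h, a.
move=> [y /sqclassE/(rotation_orbit _ x0)[h [a [hS a0 <-]]] <-].
exists (Phi (h, a)); last by rewrite (levi_conj_psi H).
by rewrite -levi_conj_image; exists (h, a).
Qed.

Variables d1 d2 d3 : F.
Local Notation O d := (psi @` [set x | sqclass d (q x)]).
Hypothesis d_neq0 : [/\ d1 != 0, d2 != 0 & d3 != 0].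
Hypothesis d_distinct : [/\ ~ sq_equiv d1 d2, ~ sq_equiv d1 d3 & ~ sq_equiv d2 d3].
Hypothesis d_values : [/\ exists x, q x = d1, exists x, q x = d2 & exists x, q x = d3].
Hypothesis d_cover : forall x : 'cV[F]_3, x != 0 ->
  [\/ sq_equiv (q x) d1, sq_equiv (q x) d2 | sq_equiv (q x) d3].

Lemma oq_orbits : lie_orbits G V = [set [set 0]; O d1; O d2; O d3].
Proof.
have orb d x : x != 0 -> sq_equiv (q x) d -> lie_orbit G (psi x) = O d.
  by move=> x0 /eq_sqclass E; rewrite oq_orbit // E.
have val0 d x : d != 0 -> q x = d -> x != 0.
  by move=> d0 xd; apply: contraNneq d0 => x0; rewrite -xd (qform_eq0 Ban) x0.
rewrite predeqE => S; split=> [[X /(oq_grade2 F0 H H0e H0W H0f)[x ->] <-]|].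
  have [->|x0] := eqVneq x 0; first by rewrite oq_orbit_zero; do 3 left.
  by have [E|E|E] := d_cover x0; rewrite (orb _ _ x0 E); [left; left; right | left; right | right].
have [d10 d20 d30] := d_neq0; have [[x1 q1] [x2 q2] [x3 q3]] := d_values.
have PV x := psi_grade H H0e H0W H0f x.
case=> [[[->|->]|->]|->].
- by exists (psi 0); [exact: PV | exact: oq_orbit_zero].
- by exists (psi x1); [exact: PV | apply: orb (val0 _ _ d10 q1) _; rewrite q1; apply: sq_equiv_refl].
- by exists (psi x2); [exact: PV | apply: orb (val0 _ _ d20 q2) _; rewrite q2; apply: sq_equiv_refl].
- by exists (psi x3); [exact: PV | apply: orb (val0 _ _ d30 q3) _; rewrite q3; apply: sq_equiv_refl].
Qed.

Lemma oq_orbits_distinct :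
  [/\ [set 0] <> O d1, [set 0] <> O d2, [set 0] <> O d3 &
      [/\ O d1 <> O d2, O d1 <> O d3 & O d2 <> O d3]].
Proof.
have [d10 d20 d30] := d_neq0; have [v1 v2 v3] := d_values; have [n12 n13 n23] := d_distinct.
have mem d x : q x = d -> O d (psi x).
  by move=> xd; exists x => //=; rewrite xd; apply/sqclassE/sq_equiv_refl.
have nz d : d != 0 -> (exists x, q x = d) -> [set 0] <> O d.
  move=> d0 [x xd] E; have := mem d x xd; rewrite -E -psi0 => /(psi_inj H) x0.
  by move: d0; rewrite -xd x0 (qform_eq0 Ban) eqxx.
have ne d d' : (exists x, q x = d) -> ~ sq_equiv d d' -> O d <> O d'.
  move=> [x xd] dd E; have := mem d x xd; rewrite E => -[y /sqclassE yd /(psi_inj H) yx].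
  by apply: dd; rewrite -xd -yx.
by split; try split; [apply: nz | apply: nz | apply: nz | apply: ne | apply: ne | apply: ne].
Qed.

Lemma card_oq_orbits : lie_orbits G V #= `I_4.
Proof.
have [z1 z2 z3 [n12 n13 n23]] := oq_orbits_distinct.
pose o i := nth set0 [:: [set 0]; O d1; O d2; O d3] i.
have -> : lie_orbits G V = o @` `I_4.
  rewrite oq_orbits predeqE => S; split.
    by case=> [[[->|->]|->]|->]; [exists 0%N | exists 1%N | exists 2%N | exists 3%N].
  by case=> -[|[|[|[|]]]] //= _ <-; [do 3 left | left; left; right | left; right | right].
apply/inj_card_eq => i j; rewrite !inE /=.
by case: i j => [|[|[|[|i]]]] [|[|[|[|j]]]] //= _ _; rewrite /o /= => E;
  first [case: (z1 E) | case: (z2 E) | case: (z3 E) | case: (n12 E) | case: (n13 E) | case: (n23 E)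
    | case: (z1 (esym E)) | case: (z2 (esym E)) | case: (z3 (esym E)) | case: (n12 (esym E))
    | case: (n13 (esym E)) | case: (n23 (esym E))].
Qed.

End OrthogonalGroupConverse.

Section SquareClassesExcept.
Variables (R : realType) (K : fieldType) (v : K -> R).
Hypothesis vP : nonarch_abs v.
Hypothesis vcomplete : abs_complete v.
Hypothesis v2 : v 2%:R = 1.
Variables (J : finType) (cls : K -> J).
Hypothesis clsP : forall x y, v x <= 1 -> v y <= 1 -> (cls x == cls y) = (v (x - y) < 1).
Variable pi : K.
Hypotheses (pi0 : pi != 0) (pi1 : v pi < 1) (pimax : forall x, v x < 1 -> v x <= v pi).

(** Multiplication by [d] permutes the square classes, so the representatives are [d] times those of
    the three non-trivial classes. *)
Lemma square_classes_except d : d != 0 -> exists d1 d2 d3,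
  [/\ [/\ d1 != 0, d2 != 0 & d3 != 0],
      [/\ ~ sq_equiv d1 d, ~ sq_equiv d2 d & ~ sq_equiv d3 d],
      [/\ ~ sq_equiv d1 d2, ~ sq_equiv d1 d3 & ~ sq_equiv d2 d3] &
      forall x : K, x != 0 -> ~ sq_equiv x d -> [\/ sq_equiv x d1, sq_equiv x d2 | sq_equiv x d3]].
Proof.
move=> d0; have [eps [e0 eN piN epiN cover]] := local_square_classes vP vcomplete v2 clsP pi0 pi1 pimax.
have self (a x : K) : a != 0 -> ~ sq_equiv x 1 -> ~ sq_equiv (a * x) a.
  by move=> a0 xN; rewrite -{2}[a]mulr1 => /(sq_equiv_cancel a0).
exists (d * eps), (d * pi), (d * (eps * pi)); split.
- by rewrite !mulf_neq0.
- by split; apply: self.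
- split=> /(sq_equiv_cancel d0).
  + move=> E; apply: epiN; apply: sq_equiv_trans (sq_equivM eps (sq_equiv_sym E)) _.
    by exists eps; rewrite // mul1r expr2.
  + by move/sq_equiv_sym; apply: self.
  + by move/sq_equiv_sym; rewrite mulrC; apply: self.
move=> x x0 xN; have xd : x / d != 0 by rewrite mulf_neq0 ?invr_eq0.
have xE : x = d * (x / d) by rewrite mulrC divfK.
case: (cover _ xd) => E.
- by case: xN; have := sq_equivM d E; rewrite -xE mulr1.
- by apply: Or31; have := sq_equivM d E; rewrite -xE.
- by apply: Or32; have := sq_equivM d E; rewrite -xE.
- by apply: Or33; have := sq_equivM d E; rewrite -xE.
Qed.

End SquareClassesExcept.

(** * Openness of the orbits *)

Section OpenQuadraticCones.
Variables (R : realType) (K : fieldType) (v : K -> R).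
Hypothesis vP : nonarch_abs v.
Variable n : nat.
Implicit Type g h : 'cV[K]_n -> K.

Definition continuous_at g (x : 'cV[K]_n) := forall eps : R, 0 < eps -> exists2 d : R, 0 < d &
  forall y : 'cV[K]_n, (forall i, v (y i 0 - x i 0) < d) -> v (g y - g x) < eps.

Lemma continuous_cst a x : continuous_at (fun=> a) x.
Proof. by move=> eps e0; exists 1 => // y _; rewrite subrr (nonarch0 vP). Qed.

Lemma continuous_coord i x : continuous_at (fun y => y i 0) x.
Proof. by move=> eps e0; exists eps. Qed.

Lemma continuous_add g h x : continuous_at g x -> continuous_at h x ->
  continuous_at (fun y => g y + h y) x.
Proof.
move=> gx hx eps e0; have [d1 d10 D1] := gx eps e0; have [d2 d20 D2] := hx eps e0.
exists (Num.min d1 d2); first by rewrite lt_min d10.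
move=> y yx; rewrite opprD addrACA; apply: (nonarchD_lt vP); [apply: D1 | apply: D2] => i;
  by apply: lt_le_trans (yx i) _; rewrite ge_min lexx ?orbT.
Qed.

Lemma continuous_mul g h x : continuous_at g x -> continuous_at h x ->
  continuous_at (fun y => g y * h y) x.
Proof.
move=> gx hx eps e0; pose D := 1 + v (g x) + v (h x).
have g0 := nonarch_ge0 vP (g x); have h0 := nonarch_ge0 vP (h x).
have D0 : 0 < D by rewrite /D; lra.
(* Small against both linear terms of the expansion below, and at most 1, so that the product of the
   two increments is small as well. *)
pose e1 := Num.min 1 eps / D.
have m0 : 0 < Num.min 1 eps by rewrite lt_min ltr01.
have e10 : 0 < e1 by rewrite divr_gt0.
have De1 : D * e1 = Num.min 1 eps by rewrite mulrC divfK // gt_eqF.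
have De1' : D * e1 <= eps by rewrite De1 ge_min lexx orbT.
have e1_1 : e1 <= 1.
  rewrite /e1 ler_pdivrMr // mul1r (@le_trans _ _ 1) //; first by rewrite ge_min lexx.
  by rewrite /D; lra.
have [d1 d10 D1] := gx e1 e10; have [d2 d20 D2] := hx e1 e10.
exists (Num.min d1 d2); first by rewrite lt_min d10.
move=> y yx; have G : v (g y - g x) < e1.
  by apply: D1 => i; apply: lt_le_trans (yx i) _; rewrite ge_min lexx.
have Hy : v (h y - h x) < e1.
  by apply: D2 => i; apply: lt_le_trans (yx i) _; rewrite ge_min lexx orbT.
have -> : g y * h y - g x * h x =
    (g y - g x) * (h y - h x) + (g x * (h y - h x) + (g y - g x) * h x) by ring.
have G0 := nonarch_ge0 vP (g y - g x); have Hy0 := nonarch_ge0 vP (h y - h x).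
have D1' : 1 <= D by rewrite /D; lra.
have Dg : v (g x) <= D - 1 by rewrite /D; lra.
have Dh : v (h x) <= D - 1 by rewrite /D; lra.
by apply: (nonarchD_lt vP); last apply: (nonarchD_lt vP); rewrite (nonarchM vP); nra.
Qed.

Lemma continuous_sum (I : Type) (r : seq I) (g : I -> 'cV[K]_n -> K) x :
  (forall i, continuous_at (g i) x) -> continuous_at (fun y => \sum_(i <- r) g i y) x.
Proof.
move=> gx; elim: r => [|i r IH].
  by move=> eps e0; exists 1 => // y _; rewrite !big_nil subrr (nonarch0 vP).
have := continuous_add (gx i) IH => C eps e0; have [d d0 dP] := C eps e0.
by exists d => // y /dP; rewrite !big_cons.
Qed.

Lemma continuous_qform (M : 'M[K]_n) x : continuous_at (qform M) x.
Proof.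
have qE y : qform M y = \sum_j (\sum_i y i 0 * M i j) * y j 0.
  by rewrite /qform mxE; apply: eq_bigr => j _; rewrite mxE; under eq_bigr do rewrite mxE.
move=> eps e0; have [|d d0 dP] := @continuous_sum _ (index_enum 'I_n)
    (fun j y => (\sum_i y i 0 * M i j) * y j 0) x _ eps e0.
  move=> j; apply: continuous_mul; last exact: continuous_coord.
  apply: continuous_sum => i; apply: continuous_mul; last exact: continuous_cst.
  exact: continuous_coord.
by exists d => // y /dP; rewrite !qE.
Qed.

Hypothesis vcomplete : abs_complete v.
Hypothesis v2 : v 2%:R = 1.

(** b/a is 1 plus an element of absolute value below 1, hence a square by Hensel's lemma. *)
Lemma near_sq_equiv a b : v (b - a) < v a -> sq_equiv b a.
Proof.
move=> ba; have a0 : a != 0 by rewrite -(nonarch_gt0 vP) (le_lt_trans _ ba) // (nonarch_ge0 vP).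
have [|z zE] := hensel_sqrt vP vcomplete v2 (y := b / a - 1).
  have -> : b / a - 1 = (b - a) / a by field.
  by rewrite (nonarchM vP) (nonarchV vP) ltr_pdivrMr ?mul1r // (nonarch_gt0 vP).
have bE : b = a * (1 + z) ^+ 2 by rewrite zE; field.
exists (1 + z) => //; apply: contraTneq ba => z0.
by rewrite bE z0 expr0n mulr0 sub0r (nonarchN vP) ltxx.
Qed.

Lemma open_qform_class (M : 'M[K]_n) d : d != 0 -> abs_open v [set x | sqclass d (qform M x)].
Proof.
move=> d0 x /sqclassE xd; have qx0 : 0 < v (qform M x).
  by rewrite (nonarch_gt0 vP); have [t t0 ->] := xd; rewrite mulf_neq0 // expf_neq0.
have [eps e0 eP] := continuous_qform M x qx0.
by exists eps => // y /eP/near_sq_equiv yx; apply/sqclassE/(sq_equiv_trans yx).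
Qed.

End OpenQuadraticCones.

(** * The invariant of a ternary form *)

Lemma msize_affine (K : fieldType) n (p : {mpoly K[n]}) : (msize p <= 2)%N ->
  exists k : 'I_n -> K, forall t, p.@[t] = p.@[fun=> 0] + \sum_i k i * t i.
Proof.
move=> sp; have {sp} : forall m, m \in msupp p -> (mdeg m <= 1)%N.
  by move=> m /msize_mdeg_lt lt; rewrite -ltnS; apply: leq_trans lt sp.
rewrite {2 3}[p]mpolyE; elim: (msupp p) => [_|m s IH ms].
  exists (fun=> 0) => t; rewrite big_nil !meval0 add0r big1 // => i _.
  by rewrite mul0r.
have [|k kE] := IH; first by move=> m' m's; apply: ms; rewrite inE m's orbT.
have : (mdeg m <= 1)%N by apply: ms; rewrite inE eqxx.
rewrite leq_eqVlt ltnS leqn0 mdeg_eq0 => /orP[/mdeg1P[j /eqP mj]|/eqP m0].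
  exists (fun i => k i + (i == j)%:R * p@_m) => t.
  rewrite !big_cons !mevalD kE !mevalZ mj !mevalXU mulr0 add0r addrCA; congr (_ + _).
  under [RHS]eq_bigr do rewrite mulrDl.
  rewrite big_split addrC /=; congr (_ + _); rewrite (bigD1 j) //= eqxx mul1r big1 ?addr0 //.
  by move=> i /negPf ->; rewrite !mul0r.
by exists k => t; rewrite !big_cons !mevalD kE !mevalZ m0 mpolyX0 !meval1 addrA.
Qed.

Section TernaryInvariant.
Variables (F : fieldType) (K : closedFieldType) (iota : {rmorphism F -> K}).
Hypothesis F0 : [pchar F] =i pred0.
Hypothesis K0 : [pchar K] =i pred0.
Variable B : 'M[F]_3.
Hypotheses (Bsym : B^T = B) (Ban : anisotropic B).
Variables (n : nat) (C : 'M[F]_(n, 3)) (U : 'M[F]_(3, n)).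
Hypotheses (CU : C *m U = 1%:M) (UC : U *m C = 1%:M).
Local Notation "M ^K" := (map_mx iota M) (at level 2, format "M ^K").
Local Notation q := (qform B^K).
Local Notation b := (bil B^K).

(** For the invariant, [C] sends x to the coordinates of its image in [vbasis V], with inverse [U].
    The number n of coordinates is 3 only propositionally, so polynomials are evaluated through
    [C]. *)
Definition mxeval (E : fieldType) (D : 'M[E]_(n, 3)) (p : {mpoly E[n]}) (y : 'cV[E]_3) : E :=
  p.@[fun i => (D *m y) i 0].
Local Notation ev := (mxeval C^K).

Lemma mxeval_polyfun p : polyfun (ev p).
Proof.
apply: polyfun_meval => i; apply: polyfun_lin => a x y.
by rewrite mulmxDr -scalemxAr !mxE.
Qed.

Lemma mxeval_map p x : ev (map_mpoly iota p) x^K = iota (mxeval C p x).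
Proof.
rewrite /mxeval (meval_eq (v2 := iota \o (fun i => (C *m x) i 0))); last first.
  by move=> i; rewrite -map_mxM mxE.
elim/mpoly_closed_ind: p => [d|i|p r ep er|p r ep er].
- by rewrite map_mpolyC !mevalC.
- by rewrite map_mpolyX !mevalXU.
- by rewrite rmorphD !mevalD rmorphD ep er.
- by rewrite rmorphM !mevalM rmorphM ep er.
Qed.

Lemma mxeval_coord p t : p.@[t] = ev p (U^K *m \col_i t i).
Proof.
by apply: meval_eq => i; rewrite mulmxA -map_mxM CU map_mx1 mul1mx mxE.
Qed.

Lemma mxeval_inj p r : (forall y, ev p y = ev r y) -> p = r.
Proof.
move=> pr; apply/eqP; rewrite -subr_eq0; apply/eqP/(mpoly_fun_eq0 K0) => t.
by rewrite mevalB !mxeval_coord pr subrr.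
Qed.

Definition quadratic_mpoly : {mpoly F[n]} :=
  \sum_i \sum_j (U^T *m B *m U) i j *: ('X_i * 'X_j).
Local Notation P := quadratic_mpoly.

Lemma meval_quadratic (E : fieldType) (h : {rmorphism F -> E}) t :
  (map_mpoly h P).@[t] = qform (map_mx h B) (map_mx h U *m \col_i t i).
Proof.
transitivity (((\col_i t i)^T *m map_mx h (U^T *m B *m U) *m \col_i t i) 0 0); last first.
  by rewrite !map_mxM -map_trmx /qform trmx_mul !mulmxA.
rewrite mxE /quadratic_mpoly (raddf_sum (map_mpoly h)) (raddf_sum (meval t)).
under [RHS]eq_bigr do rewrite mxE mulr_suml.
rewrite exchange_big /=; apply: eq_bigr => i _; rewrite (raddf_sum (map_mpoly h)) (raddf_sum (meval t)).
apply: eq_bigr => j _; rewrite /= map_mpolyZ rmorphM /= !map_mpolyX mevalZ mevalM !mevalXU !mxE.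
by rewrite mulrA [t i * _]mulrC.
Qed.

Lemma mxeval_quadratic y : ev (map_mpoly iota P) y = q y.
Proof.
rewrite /mxeval meval_quadratic; congr (qform _ _).
have -> : (\col_i (C^K *m y) i 0) = C^K *m y by apply/matrixP => i j; rewrite ord1 mxE.
by rewrite mulmxA -map_mxM UC map_mx1 mul1mx.
Qed.

Lemma ternary_basis_span (y : 'cV[K]_3) : exists t : 'I_3 -> K, y = \sum_i t i *: delta_mx i 0.
Proof.
exists (fun i => y i 0); rewrite {1}[y]matrix_sum_delta.
by apply: eq_bigr => i _; rewrite big_ord1.
Qed.

Lemma ternary_natpt (k : 'I_3 -> nat) : exists2 x : 'cV[F]_3, x != 0 &
  \sum_i (k i).+1%:R *: (delta_mx i 0 : 'cV[K]_3) = x^K.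
Proof.
exists (\sum_i (k i).+1%:R *: delta_mx i 0).
  apply/eqP => /matrixP/(_ 0 0)/eqP; rewrite summxE (bigD1 0) //= big1 ?addr0 => [|i ne].
    by rewrite !mxE eqxx mulr1; have /pcharf0P -> := F0.
  by rewrite !mxE eq_sym (negPf ne) mulr0.
by rewrite map_mx_sum; apply: eq_bigr => i _; rewrite map_mxZ map_delta_mx rmorph_nat.
Qed.

Lemma ternary_dense (g : 'cV[K]_3 -> K) : polyfun g ->
  (forall x : 'cV[F]_3, x != 0 -> g x^K = 0) -> forall y, g y = 0.
Proof.
move=> gP g0; apply: (polyfun_dense K0 ternary_basis_span gP) => k.
by have [x x0 ->] := ternary_natpt k; apply: g0.
Qed.

Let BKsym : (B^K)^T = B^K. Proof. by rewrite map_trmx Bsym. Qed.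

Lemma map_bil x y : b x^K y^K = iota (bil B x y).
Proof. by rewrite /bil map_trmx -!map_mxM mxE. Qed.

Lemma quadratic_anisotropic_point : exists2 x : 'cV[F]_3, x != 0 & exists2 y : 'cV[F]_3,
  y != 0 & bil B x y = 0.
Proof.
have one0 : (const_mx 1 : 'cV[F]_3) != 0.
  by apply/eqP => /matrixP/(_ 0 0)/eqP; rewrite !mxE oner_eq0.
have [y [_ [y0 _ xy _ _]]] := orthogonal_extend B one0.
by exists (const_mx 1) => //; exists y.
Qed.

Lemma quadratic_mpoly_neq0 : map_mpoly iota P != 0.
Proof.
have [x x0 _] := quadratic_anisotropic_point.
apply: contraNneq (Ban x0) => E; rewrite -(fmorph_eq0 iota) -map_qform -mxeval_quadratic E.
by rewrite /mxeval meval0.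
Qed.

Lemma quadratic_mpoly_nonunit : map_mpoly iota P \isn't a GRing.unit.
Proof.
apply: (@meval0_nonunit _ _ _ (fun=> 0)); rewrite meval_quadratic.
have -> : (\col_(i < n) (0 : K)) = 0 by apply/matrixP => i j; rewrite !mxE.
by rewrite mulmx0 /qform mulmx0 mxE.
Qed.

Lemma msize_quadratic : msize (map_mpoly iota P) = 3%N.
Proof.
apply: (homogeneous_msize K0 quadratic_mpoly_neq0) => a t; rewrite !meval_quadratic -qformZ.
rewrite scalemxAr; congr (qform _ (_ *m _)).
by apply/matrixP => i j; rewrite !mxE.
Qed.

(* If q = l m with linear forms l and m, then q vanishes to second order at a
   common zero of l and m, which contradicts det B <> 0. *)
Lemma quadratic_not_product (l m : 'cV[K]_3 -> K) :
  (forall a x y, l (a *: x + y) = a * l x + l y) -> (forall a x y, m (a *: x + y) = a * m x + m y) ->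
  ~ (forall y, q y = l y * m y).
Proof.
move=> lP mP qlm; have two0 : 2%:R != 0 :> K by have /pcharf0P -> := K0.
pose lrow : 'rV[K]_3 := \row_j l (delta_mx j 0); pose mrow : 'rV[K]_3 := \row_j m (delta_mx j 0).
have rowE (k : 'cV[K]_3 -> K) y : (forall a x y, k (a *: x + y) = a * k x + k y) ->
    ((\row_j k (delta_mx j 0) : 'rV[K]_3) *m y) 0 0 = k y.
  move=> kP; have k0 : k 0 = 0 by have := kP (-1) 0 0; rewrite scaler0 addr0 mulN1r addNr.
  have kD : {morph k : x y / x + y} by move=> x z; rewrite -[x]scale1r kP mul1r scale1r.
  have [t tE] := ternary_basis_span y; rewrite {2}tE (big_morph k kD k0) mxE.
  apply: eq_bigr => i _; rewrite -[_ *: _]addr0 kP k0 addr0 mxE mulrC; congr (_ * _).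
  rewrite tE summxE (bigD1 i) //= big1 ?addr0 => [|j ji]; rewrite !mxE ?eqxx ?mulr1 //.
  by rewrite eq_sym (negPf ji) mulr0.
have [//|y y0 E] := @kernel_vector K (1 + 1) 3 (col_mx lrow mrow).
move/eqP: E; rewrite mul_col_mx col_mx_eq0 => /andP[/eqP ly /eqP my].
have {}ly : l y = 0 by rewrite -(rowE l y lP) ly mxE.
have {}my : m y = 0 by rewrite -(rowE m y mP) my mxE.
have by0 w : b y w = 0.
  have E1 : q (w + y) = l w * m w.
    by rewrite qlm -[w]scale1r lP mP !mul1r ly my !addr0 scale1r.
  have /eqP : 2%:R * b y w = 0.
    move: E1; rewrite (qformD BKsym) (bilC BKsym w y) -qlm => E1.
    have qy : q y = 0 by rewrite qlm ly mul0r.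
    by move: E1; rewrite qy addr0 -{2}[q w]addr0 => /addrI.
  by rewrite mulf_eq0 (negPf two0) => /eqP.
have : y^T *m B^K = 0.
  apply/rowP => j; rewrite [RHS]mxE.
  by have := by0 (delta_mx j 0); rewrite /bil -colE mxE.
move/(congr1 (mulmx^~ (invmx B^K))); rewrite mul0mx mulmxK => [/eqP|].
  by rewrite -(inj_eq trmx_inj) trmxK trmx0 (negPf y0).
by rewrite unitmxE unitfE det_map_mx fmorph_eq0 (det_anisotropic Bsym Ban).
Qed.

(** A proper factorisation has two factors of degree 1. Evaluated at s y for s = 0, 1, -1, it shows
    that the constant terms multiply to 0 and that q is the product of the linear parts. *)
Lemma quadratic_mpoly_irreducible : irreducible_elt (map_mpoly iota P).
Proof.
split; [exact: quadratic_mpoly_neq0 | exact: quadratic_mpoly_nonunit |] => p r pr.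
have p0 : p != 0 by apply: contraNneq quadratic_mpoly_neq0 => p0; rewrite pr p0 mul0r.
have r0 : r != 0 by apply: contraNneq quadratic_mpoly_neq0 => r0; rewrite pr r0 mulr0.
have unit1 (s : {mpoly K[n]}) : s != 0 -> (msize s <= 1)%N -> s \is a GRing.unit.
  by move=> s0 /msize1_polyC sE; rewrite sE mpolyC_unit // -(mpolyC_eq0 n) -sE.
have := msizeM p0 r0; rewrite -pr msize_quadratic => szE.
have [p1|p2] := leqP (msize p) 1; first by left; apply: unit1.
have [r1|r2] := leqP (msize r) 1; first by right; apply: unit1.
have [sp sr] : (msize p <= 2)%N /\ (msize r <= 2)%N.
  by move: szE p2 r2; move: (msize p) (msize r) => i j; lia.
have [k kE] := msize_affine sp; have [k' kE'] := msize_affine sr.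
have [] := @quadratic_not_product (fun y => \sum_i k i * (C^K *m y) i 0) (fun y => \sum_i k' i * (C^K *m y) i 0).
- move=> a x y; rewrite mulr_sumr -big_split; apply: eq_bigr => i _.
  by rewrite mulmxDr -scalemxAr !mxE /=; ring.
- move=> a x y; rewrite mulr_sumr -big_split; apply: eq_bigr => i _.
  by rewrite mulmxDr -scalemxAr !mxE /=; ring.
move=> y; set l := \sum_i _; set m := \sum_i _.
have lineE s : s ^+ 2 * q y = (p.@[fun=> 0] + s * l) * (r.@[fun=> 0] + s * m).
  rewrite -qformZ -mxeval_quadratic pr /mxeval mevalM kE kE' !mulr_sumr.
  by congr ((_ + _) * (_ + _)); apply: eq_bigr => i _; rewrite -scalemxAr mxE; ring.
have two0 : 2%:R != 0 :> K by have /pcharf0P -> := K0.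
have E0 := lineE 0; have E1 := lineE 1; have E2 := lineE (-1).
apply: (mulfI two0); move: E0 E1 E2; rewrite expr0n !mul0r !addr0.
move: (p.@[_]) (r.@[_]) => a a' E0 E1 E2.
transitivity (1 ^+ 2 * q y + (-1) ^+ 2 * q y - 2%:R * (a * a')); first by rewrite -E0; ring.
by rewrite E1 E2; ring.
Qed.

Lemma polyfun_coord i : polyfun (fun y : 'cV[K]_3 => y i 0).
Proof. by apply: polyfun_lin => a x y; rewrite !mxE. Qed.

Lemma polyfun_qform : polyfun q.
Proof.
have qE (y : 'cV[K]_3) : \sum_j (\sum_i y i 0 * B^K i j) * y j 0 = q y.
  by rewrite /qform mxE; apply: eq_bigr => j _; rewrite mxE; under [in RHS]eq_bigr do rewrite mxE.
apply: eq_polyfun qE _; apply: polyfun_sum => j; apply: polyfun_mul (polyfun_coord j).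
by apply: polyfun_sum => i; apply: polyfun_mul (polyfun_coord i) (polyfun_const _ _).
Qed.

(* q(a) times minus the reflection in a; unlike the reflection, it is polynomial in a. *)
Definition scaled_reflection (a x : 'cV[K]_3) : 'cV[K]_3 := (2%:R * b a x) *: a - q a *: x.
Local Notation N := scaled_reflection.

Lemma scaled_reflection_map (a x : 'cV[F]_3) : a != 0 ->
  N a^K x^K = (qform B a *: (- reflection B a *m x))^K.
Proof.
move=> a0; have qa : qform B a != 0 by apply: Ban.
rewrite /N mulNmx reflectE scalerN scalerBr opprB scalerA map_mxB !map_mxZ map_bil map_qform.
by rewrite !rmorphM fmorphV rmorph_nat mulrA [iota _ * (_ / _)]mulrC divfK ?fmorph_eq0.
Qed.

Lemma scaled_reflection_polyfun_l (g : 'cV[K]_3 -> K) x : polyfun g -> polyfun (fun a => g (N a x)).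
Proof.
apply: polyfun_comp => l lP.
have l0 : l 0 = 0 by have := lP (-1) 0 0; rewrite scaler0 addr0 mulN1r addNr.
have E (a : 'cV[K]_3) : 2%:R * b a x * l a - q a * l x = l (N a x).
  rewrite /N lP -scaleNr -[_ *: x]addr0 lP l0 addr0.
  by rewrite mulNr.
apply: eq_polyfun E _; apply: polyfun_sub.
  apply: polyfun_mul; last exact: polyfun_lin.
  apply: polyfun_mul (polyfun_const _ _) _; apply: polyfun_lin => c y z.
  by rewrite bilPl.
exact: polyfun_mul polyfun_qform (polyfun_const _ _).
Qed.

Lemma scaled_reflection_linear a : linear (N a).
Proof.
move=> c x y; rewrite /N bilPr; apply/matrixP => i j; rewrite !mxE.
by ring.
Qed.

Section Uniqueness.
Variable P' : {mpoly F[n]}.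
Hypothesis irr : irreducible_elt (map_mpoly iota P').
Hypothesis inv : forall g a, SO B g -> a != 0 ->
  exists k, forall x, mxeval C P' (a *: (g *m x)) = k * mxeval C P' x.
Local Notation f := (ev (map_mpoly iota P')).

Let fP : polyfun f := mxeval_polyfun _.

(** The multiplier [k] exists on F-points only. Once it is eliminated, density applies to x and then
    to y, with [h] the extension of the group element to K. *)
Let f_exchange (h : 'cV[K]_3 -> 'cV[K]_3) g a : linear h -> SO B g -> a != 0 ->
  (forall x : 'cV[F]_3, h x^K = (a *: (g *m x))^K) ->
  forall x y, f (h x) * f y = f (h y) * f x.
Proof.
move=> hL gS a0 hE x y; have [k kE] := inv gS a0.
apply/eqP; rewrite -subr_eq0; apply/eqP; move: x.
have hP : polyfun (fun z => f (h z)) := polyfun_comp_lin hL fP.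
apply: ternary_dense => [|x _].
  by apply: polyfun_sub; apply: polyfun_mul => //; apply: polyfun_const.
move: y; apply: ternary_dense => [|y _].
  by apply: polyfun_sub; apply: polyfun_mul => //; apply: polyfun_const.
by rewrite !hE !mxeval_map !kE !rmorphM /=; ring.
Qed.

Let SO1 : SO B 1%:M.
Proof. by split; rewrite ?det1 // trmx1 mul1mx mulmx1. Qed.

(** The scale is one more variable: the relation is polynomial in s and known when s is a positive
    integer. *)
Let f_scale_exchange s x y : f (s *: x) * f y = f (s *: y) * f x.
Proof.
have lineE z : exists p : {poly K}, forall s, f (s *: z) = p.[s].
  by have [p pE] := polyfun_line 0 z fP; exists p => t; rewrite -pE add0r.
have [p pE] := lineE x; have [r rE] := lineE y.
suff E : p * (f y)%:P - r * (f x)%:P = 0.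
  have := congr1 (fun u => u.[s]) E; rewrite /= !hornerE -pE -rE.
  by move/eqP; rewrite subr_eq0 => /eqP.
apply: (poly_nat_eq0 K0) => k; rewrite !hornerE -pE -rE; apply/eqP; rewrite subr_eq0; apply/eqP.
have k0 : k.+1%:R != 0 :> F by have /pcharf0P -> := F0.
apply: (f_exchange (h := *:%R k.+1%:R) _ SO1 k0) => [a u w|u].
  by rewrite scalerDr !scalerA mulrC.
by rewrite mul1mx map_mxZ rmorph_nat.
Qed.

Let f_neq0 : exists y, f y != 0.
Proof.
apply: contrapT => H; have [/eqP nz _ _] := irr; apply: nz; apply: mxeval_inj => y.
rewrite {2}/mxeval meval0; apply: contrapT => /eqP fy.
by apply: H; exists y.
Qed.

(** On the line through 0 and a point where f is non-zero, exchange with the inverse scale excludes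
    zeros other than s = 0, so the restriction is a monomial. *)
Let f_homogeneous : exists d, forall s x, f (s *: x) = s ^+ d * f x.
Proof.
have [y fy] := f_neq0; have [p pE] := polyfun_line 0 y fP.
have {}pE s : f (s *: y) = p.[s] by rewrite -pE add0r.
have [|d dE] := @poly_root0 K p.
  move=> s s0; have := f_scale_exchange s y (s^-1 *: y); rewrite scalerA mulfV // scale1r -pE => E.
  by apply: contraNneq fy => z; move: E; rewrite z mul0r => /esym/eqP; rewrite mulf_eq0 orbb.
exists d => s x; apply: (mulIf fy); rewrite f_scale_exchange pE dE -pE scale1r.
by ring.
Qed.

Let f_reflection_exchange a x y : f (N a x) * f y = f (N a y) * f x.
Proof.
apply/eqP; rewrite -subr_eq0; apply/eqP; move: a; apply: ternary_dense => [|a a0].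
  by apply: polyfun_sub; apply: polyfun_mul (polyfun_const _ _);
     apply: scaled_reflection_polyfun_l.
apply/eqP; rewrite subr_eq0; apply/eqP.
apply: (f_exchange (scaled_reflection_linear _) (neg_reflection_SO Bsym Ban a0) (Ban a0)).
by move=> z; apply: scaled_reflection_map.
Qed.

(** As N a a = q(a) a, the exchange relation determines the multiplier: f(N a y) = q(a)^d f(y). If
    q(x) = q(w), then N (x + w) x is a multiple of w, so f(x) = f(w) when q(x + w) is non-zero. Over
    K this compares x with r e0, where q(e0) = 1 and r^2 = q(x). *)
Lemma quadratic_invariant_unique : exists2 c, c != 0 & P' = c *: P.
Proof.
have [d dE] := f_homogeneous; have two0 : 2%:R != 0 :> K by have /pcharf0P -> := K0.
have [z fz] := f_neq0.
have fN a y : f (N a y) = q a ^+ d * f y.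
  apply/eqP; rewrite -subr_eq0; apply/eqP; move: a.
  (* The exchange relation with the vector [a] itself carries a factor f(a), which is cancelled by
     the domain property. *)
  have [||//|/(_ z) /eqP] := polyfun_domain K0 (f := fun a => f (N a y) - q a ^+ d * f y) _ fP.
  - apply: polyfun_sub; first exact: scaled_reflection_polyfun_l.
    by apply: polyfun_mul (polyfun_const _ _); apply: polyfun_exp polyfun_qform.
  - move=> a; have := f_reflection_exchange a a y.
    rewrite {1}/N bilxx -scalerBl mulr_natl mulr2n addrK dE => E.
    by rewrite mulrBl -E; ring.
  - by rewrite (negPf fz).
have same x w : q x = q w -> q (x + w) != 0 -> f x = f w.
  move=> xw a0; have NE : N (x + w) x = q (x + w) *: w.
    rewrite /N; have -> : q (x + w) = 2%:R * b (x + w) x.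
      by rewrite (qformD BKsym) bilDl bilxx -xw (bilC BKsym w x); ring.
    by rewrite scalerDr addrC addKr.
  have := fN (x + w) x; rewrite NE dE => /(mulfI (expf_neq0 d a0)) ->.
  by [].
have [x0 x00 [y0 y00 xy0]] := quadratic_anisotropic_point.
have sqrtE u : exists r : K, r ^+ 2 = u.
  have [|r /rootP] := @closed_rootP K ('X^2 - u%:P) _; first by rewrite size_XnsubC.
  by rewrite !hornerE => /eqP; rewrite subr_eq0 => /eqP rE; exists r.
have qx0 : q x0^K != 0 by rewrite map_qform fmorph_eq0; apply: Ban.
have qy0 : q y0^K != 0 by rewrite map_qform fmorph_eq0; apply: Ban.
have [r0 r0E] := sqrtE (q x0^K).
have r00 : r0 != 0 by apply: contraNneq qx0 => r0z; rewrite -r0E r0z expr0n.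
pose e0 := r0^-1 *: x0^K.
have qe0 : q e0 = 1 by rewrite qformZ -r0E exprVn mulVf // expf_neq0.
have ywe : b y0^K e0 = 0 by rewrite bilZr (bilC BKsym) map_bil xy0 rmorph0 mulr0.
have good x r : r ^+ 2 = q x -> r != 0 -> r + b x e0 != 0 -> f x = r ^+ d * f e0.
  move=> rx r00' rb; rewrite -dE; apply: same; first by rewrite qformZ qe0 mulr1 rx.
  rewrite (qformD BKsym) qformZ qe0 mulr1 bilZr -rx.
  have -> : r ^+ 2 + 2%:R * (r * b x e0) + r ^+ 2 = 2%:R * (r * (r + b x e0)) by ring.
  by rewrite !mulf_neq0.
(* One of the two square roots can be used: r + b(x, e0) and -r + b(x, e0) do not both vanish, as
   their difference is 2 r. *)
have one x : q x != 0 -> exists r, [/\ r ^+ 2 = q x, r != 0 & f x = r ^+ d * f e0].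
  move=> qx; have [r rE] := sqrtE (q x).
  have r0' : r != 0 by apply: contraNneq qx => rz; rewrite -rE rz expr0n.
  have [rb|rb] := eqVneq (r + b x e0) 0; last by exists r; split=> //; apply: good.
  exists (- r); split; rewrite ?oppr_eq0 ?sqrrN //; apply: good; rewrite ?oppr_eq0 ?sqrrN //.
  have -> : - r + b x e0 = (r + b x e0) - 2%:R * r by ring.
  by rewrite rb sub0r oppr_eq0 mulf_neq0.
have extend g : polyfun g -> (forall x, q x != 0 -> g x = 0) -> forall x, g x = 0.
  move=> gP g0; have [|/(_ x0^K)/eqP|//] := polyfun_domain K0 polyfun_qform gP.
    by move=> x; have [->|/g0 ->] := eqVneq (q x) 0; rewrite ?mul0r ?mulr0.
  by rewrite (negPf qx0).
have fe0 : f e0 != 0.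
  apply: contraNneq fz => fe0; rewrite (extend f fP) // => x /one[r [_ _ ->]].
  by rewrite fe0 mulr0.
(* For [y0], orthogonal to [e0], both square roots can be used, so (-r)^d = r^d and d is even. *)
have [k dk] : exists k, d = k.*2.
  exists d./2; have [r [rE r0' fr]] := one _ qy0.
  have : f y0^K = (- r) ^+ d * f e0.
    by apply: good; rewrite ?sqrrN ?ywe ?addr0 ?oppr_eq0.
  rewrite fr exprNn => E; rewrite -[LHS]odd_double_half.
  case od: (odd d) => //; move: E; rewrite -signr_odd od expr1 mulN1r mulNr => /eqP.
  by rewrite -addr_eq0 -mulr2n -mulr_natl !mulf_eq0 (negPf two0) (negPf fe0) expf_eq0 (negPf r0') andbF.
have fE x : f x = f e0 * q x ^+ k.
  apply/eqP; rewrite -subr_eq0; apply/eqP; move: x; apply: extend => [|x /one[r [rE _ ->]]].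
    apply: polyfun_sub fP _; apply: polyfun_mul (polyfun_const _ _) _.
    exact: polyfun_exp polyfun_qform.
  by rewrite -rE -exprM dk mul2n mulrC subrr.
have PE' : map_mpoly iota P' = f e0 *: map_mpoly iota P ^+ k.
  apply: mxeval_inj => x; rewrite fE [RHS]mevalZ (rmorphXn (meval _)) /= -/(mxeval C^K _ x).
  by rewrite mxeval_quadratic.
have k1 : k = 1%N by apply: (irreducible_power (c := f e0) quadratic_mpoly_nonunit); rewrite -PE'.
pose c := mxeval C P' x0 / qform B x0.
have cE : f e0 = iota c.
  rewrite fmorph_div -mxeval_map -map_qform [X in _ = X / _]fE k1 expr1 mulfK //.
exists c; first by rewrite -(fmorph_eq0 iota) -cE.
apply: (@map_mpoly_inj F K iota); by rewrite PE' k1 expr1 cE map_mpolyZ.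
Qed.

End Uniqueness.

End TernaryInvariant.

(** * The form Q as fundamental invariant of o(q, 5) *)

Section OrthogonalInvariant.
Variables (F : fieldType) (K : closedFieldType) (iota : {rmorphism F -> K}).
Hypothesis F0 : [pchar F] =i pred0.
Hypothesis K0 : [pchar K] =i pred0.
Variables (B : 'M[F]_5) (BQ : 'M[F]_3) (e f : 'cV[F]_5) (W : 'M[F]_(5, 3)) (c : F).
Hypothesis H : split_quadratic B BQ e f W c.
Hypothesis Ban : anisotropic BQ.
Local Notation L := (subvs_of (oq B)).
Local Notation psi := (psi B e W c).
Variable H0 : L.
Hypotheses (H0e : vsval H0 *m e = 2%:R *: e) (H0W : vsval H0 *m W = 0)
  (H0f : vsval H0 *m f = - 2%:R *: f).
Local Notation G := (grG iota H0).
Local Notation V := (grade H0 2%:R).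
Local Notation n := (\dim V).

Lemma psi_coordinates : exists (C : 'M[F]_(n, 3)) (U : 'M[F]_(3, n)),
  [/\ C *m U = 1%:M, U *m C = 1%:M &
      forall (p : {mpoly F[n]}) x, vpeval p (psi x) = mxeval C p x].
Proof.
have PV x : psi x \in V := psi_grade H H0e H0W H0f x.
have /choice[u uE] (i : 'I_n) : exists x, psi x = (vbasis V)`_i.
  have [|x ->] := oq_grade2 F0 H H0e H0W H0f (X := (vbasis V)`_i); last by exists x.
  by rewrite vbasis_mem // mem_nth // size_tuple.
pose C : 'M[F]_(n, 3) := \matrix_(i, j) coord (vbasis V) i (psi (delta_mx j 0)).
pose U : 'M[F]_(3, n) := \matrix_(j, i) u i j 0.
pose l : {linear 'cV[F]_3 -> L} := HB.pack psi (GRing.isLinear.Build _ _ _ _ _ (psi_linear H)).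
have xE (x : 'cV[F]_3) : x = \sum_j x j 0 *: delta_mx j 0.
  by rewrite {1}[x]matrix_sum_delta; apply: eq_bigr => i _; rewrite big_ord1.
have CE x i : (C *m x) i 0 = coord (vbasis V) i (psi x).
  rewrite -[psi x]/(l x) {2}(xE x) !linear_sum mxE; apply: eq_bigr => j _.
  by rewrite !linearZ /= mxE mulrC.
have Uu i : col i U = u i by apply/matrixP => j k; rewrite ord1 !mxE.
exists C, U; split.
- apply/matrixP => i j; have := CE (u j) i; rewrite uE coord_free ?(basis_free (vbasisP _)) //.
  rewrite eq_sym => E; rewrite [RHS]mxE -E -Uu !mxE; apply: eq_bigr => k _.
  by rewrite !mxE.
- have UCx (x : 'cV[F]_3) : U *m (C *m x) = x.
    apply: (psi_inj H); rewrite [RHS](coord_vbasis (PV x)).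
    have -> : U *m (C *m x) = \sum_i (C *m x) i 0 *: u i.
      apply/matrixP => j k; rewrite ord1 mxE summxE; apply: eq_bigr => i _.
      by rewrite [in LHS]mxE [in RHS]mxE mulrC.
    rewrite -[LHS]/(l _) linear_sum; apply: eq_bigr => i _.
    by rewrite linearZ /= uE CE.
  apply/matrixP => i j; have /matrixP/(_ i 0) := UCx (delta_mx j 0).
  by rewrite mulmxA -colE !mxE andbT.
- by move=> p x; apply: meval_eq => i; rewrite CE.
Qed.

Lemma oq_fundamental_invariant : exists P : {mpoly F[n]},
  fundamental_invariant iota P /\ forall x, vpeval P (psi x) = qform BQ x.
Proof.
have [C [U [CU UC evE]]] := psi_coordinates; have BQsym := sq_BQ_sym H.
have PV x : psi x \in V := psi_grade H H0e H0W H0f x.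
have PE x : vpeval (quadratic_mpoly BQ U) (psi x) = qform BQ x.
  rewrite evE; apply: (fmorph_inj iota); rewrite -mxeval_map mxeval_quadratic //.
  by rewrite map_qform.
have qg g a x : SO BQ g -> qform BQ (a *: (g *m x)) = a ^+ 2 * qform BQ x.
  by move=> [gB _]; rewrite qformZ -!bilxx bil_isometry.
exists (quadratic_mpoly BQ U); split=> //; split.
  split; first exact: (quadratic_mpoly_irreducible iota K0 BQsym Ban UC).
  have [x x0 _] := quadratic_anisotropic_point BQ.
  apply: (relative_invariantP (PV x)); first by rewrite PE; apply: Ban.
    by move=> g X Gg; apply: grG_grade Gg.
  move=> g /(grG_levi_conj F0 K0 H Ban H0e H0W H0f)[h [a [hS a0 <-]]].
  exists (a ^+ 2); first exact: expf_neq0.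
  move=> X /(oq_grade2 F0 H H0e H0W H0f)[y ->]; rewrite (levi_conj_psi H) // !PE.
  exact: qg.
move=> P' [irr [chi _ chiE]].
apply: (quadratic_invariant_unique F0 K0 BQsym Ban CU UC irr) => g a gS a0.
exists (chi (levi_conj B e f W (g, a))) => x; rewrite -!evE -(levi_conj_psi H) //.
apply: chiE => //.
exact: (levi_conj_grG iota F0 K0 H Ban H0e H0W H0f).
Qed.

End OrthogonalInvariant.

Theorem theorem1p12p4
  (R : realType) (p : nat) (Qp : fieldType) (absp : Qp -> R)
  (HQp : is_padic_numbers p absp)
  (F : fieldExtType Qp) (absF : F -> R) (HabsF : nonarch_abs absF)
  (HabsFp : forall c : Qp, absF c%:A = absp c)
  (Hres : 2%N \notin residue_pchar absF)
  (Fbar : closedFieldType) (iota : {rmorphism F -> Fbar})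
  (HFbar : forall z : Fbar, algebraicOver iota z) :
  (* (1) *)
  (forall (D : falgType F) (delta : nat) (phi : splitting iota D delta),
    (forall x : D, x != 0 -> x \is a GRing.unit) ->
    ('Z({:D}) = 1)%VS ->
    \dim {:D} = (delta ^ 2)%N ->
    let L := subvs_of (sl2 phi) in
    let H0 : L := sl2_H phi in
    let G := grG iota H0 in
    let Vplus := grade H0 2%:R in
    let Dunits := [set u : D | u \is a GRing.unit] in
    [/\ graded H0,
        (forall X : L, X \in Vplus <-> exists x : D, X = sl2_upper phi x),
        (exists Psi : D * D -> 'End(L),
          [/\ (forall u v : D, Dunits u -> Dunits v -> forall X : L,
                vsval (Psi (u, v) X) =
                  mx22 u 0 0 v * vsval X * mx22 u^-1 0 0 v^-1),
              Psi @` (Dunits `*` Dunits) = G,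
              (forall u v u' v' : D,
                Dunits u -> Dunits v -> Dunits u' -> Dunits v' ->
                Psi (u * u', v * v') = (Psi (u, v) \o Psi (u', v'))%VF),
              (forall u v : D, Dunits u -> Dunits v ->
                (Psi (u, v) = \1%VF <->
                 exists lambda : F, [/\ lambda != 0, u = lambda%:A & v = lambda%:A])) &
              (forall u v x : D, Dunits u -> Dunits v ->
                Psi (u, v) (sl2_upper phi x) = sl2_upper phi (u * x * v^-1))]),
        (lie_orbits G Vplus = [set [set 0]; sl2_upper phi @` Dunits] /\
         lie_orbits G Vplus #= `I_2) &
        exists P : {mpoly F[\dim Vplus]},
          [/\ fundamental_invariant iota P,
              (forall x : D, iota (vpeval P (sl2_upper phi x)) = rednorm phi x) &
              msize P = delta.+1]])
  /\
  (* (2) *)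
  (forall (B : 'M[F]_5) (BQ : 'M[F]_3)
      (e f : 'cV[F]_5) (W : 'M[F]_(5, 3)),
    B^T = B -> B \in unitmx ->
    (row_mx e (row_mx W f) : 'M[F]_5) \in unitmx ->
    qform B e = 0 -> qform B f = 0 -> e^T *m B *m f != 0 ->
    e^T *m B *m W = 0 -> f^T *m B *m W = 0 ->
    W^T *m B *m W = BQ -> anisotropic BQ ->
    forall H0 : subvs_of (oq B),
    vsval H0 *m e = 2%:R *: e -> vsval H0 *m W = 0 ->
    vsval H0 *m f = - 2%:R *: f ->
    let L := subvs_of (oq B) in
    let G := grG iota H0 in
    let Vplus := grade H0 2%:R in
    graded H0 /\
    exists psi : {linear 'cV[F]_3 -> L},
      [/\ ((forall x, vsval (psi x) *m f = W *m x) /\ injective psi /\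
           psi @` setT = [set X | X \in Vplus]),
          (exists Phi : 'M[F]_3 * F -> 'End(L),
            let S := SO BQ `*` [set lambda : F | lambda != 0] in
            [/\ Phi @` S = G,
                (forall s t, S s -> S t -> Phi s = Phi t -> s = t),
                (forall g lambda g' lambda', S (g, lambda) -> S (g', lambda') ->
                  Phi (g *m g', lambda * lambda') =
                    (Phi (g, lambda) \o Phi (g', lambda'))%VF) &
                (forall g lambda x, S (g, lambda) ->
                  Phi (g, lambda) (psi x) = psi (lambda *: (g *m x)))]),
          (exists P : {mpoly F[\dim Vplus]},
            fundamental_invariant iota P /\
            forall x, vpeval P (psi x) = qform BQ x) &
          exists u1 u2 u3 : set F,
            let O (u : set F) := [set x : 'cV[F]_3 | u (qform BQ x)] in
            [/\ [/\ u1 <> u2, u1 <> u3 & u2 <> u3],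
                [set u1; u2; u3] = @sqclasses F `\ sqclass (- \det BQ),
                lie_orbits G Vplus =
                  [set [set 0]; psi @` O u1; psi @` O u2; psi @` O u3],
                lie_orbits G Vplus #= `I_4 &
                [/\ abs_open absF (O u1), abs_open absF (O u2) &
                    abs_open absF (O u3)]]]).
Proof.
have F0 : [pchar F] =i pred0 := pchar_local HQp HabsF HabsFp.
have K0 : [pchar Fbar] =i pred0.
  by apply/pcharf0P => k; rewrite -(rmorph_nat iota) fmorph_eq0; have /pcharf0P -> := F0.
split=> [D delta phi Dunit Dcent Ddim L H0 G Vplus Dunits|B BQ e f W Bsym uB uT ee ff ef eW fW WW Ban H0 H0e H0W H0f L G Vplus].
  split.
  - exact: sl2_graded.
  - exact: sl2_grade2.
  - exists (@diag_conj F Fbar iota D delta phi); split.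
    + by move=> u v uu uv X; apply: diag_conjE.
    + rewrite predeqE => g; split=> [[[u v] [uu uv] <-]|Gg].
        exact: diag_conj_grG.
      have [u [v [uu uv <-]]] := grG_diag_conj F0 K0 Dunit Dcent Ddim Gg.
      by exists (u, v).
    + by move=> u v u' v' uu uv uu' uv'; apply: diag_conjM.
    + by move=> u v uu uv; apply: diag_conj_id.
    + by move=> u v x uu uv; apply: diag_conj_upper.
  - have orbE := sl2_orbits phi F0 K0 Dunit Dcent Ddim; split; first exact: orbE.
    have ne := @sl2_orbits_neq F Fbar iota D delta phi.
    pose o i := nth set0 [:: [set 0]; sl2_upper phi @` Dunits] i.
    have -> : lie_orbits G Vplus = o @` `I_2.
      rewrite orbE predeqE => S; split.
        by case=> ->; [exists 0%N | exists 1%N].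
      by case=> -[|[|]] //= _ <-; [left | right].
    apply/inj_card_eq => i j; rewrite !inE /=.
    by case: i j => [|[|i]] [|[|j]] //= _ _; rewrite /o /= => E; case: ne; rewrite E.
  - have [P PE] := rational_generic_det phi F0 K0 Dunit Dcent Ddim.
    exists P; split.
    + split; first split.
      * by rewrite PE; apply: generic_det_irreducible.
      * exact: rednorm_relative_invariant.
      * by move=> P'; apply: abs_irreducible_invariant_unique.
    + by move=> x; apply: vpeval_rednorm.
    + exact: msize_rednorm.
pose c := (e^T *m B *m f) 0 0.
have efc : e^T *m B *m f = c%:M by rewrite [LHS]mx11_scalar.
have c0 : c != 0 by apply: contraNneq ef => c0; rewrite efc c0 raddf0.
have isoE (x : 'cV[F]_5) : qform B x = 0 -> x^T *m B *m x = 0.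
  by rewrite /qform => x0; rewrite [LHS]mx11_scalar x0 raddf0.
have H : split_quadratic B BQ e f W c by split=> //; apply: isoE.
have BQsym := sq_BQ_sym H.
split; first exact: (oq_graded F0 H H0e H0W H0f).
pose psil : {linear 'cV[F]_3 -> L} := HB.pack (psi B e W c)
  (GRing.isLinear.Build _ _ _ _ _ (psi_linear H)).
exists psil; split.
- split; first exact: (psiE H).
  split; first exact: (psi_inj H).
  rewrite predeqE => X; split=> [[x _ <-]|/(oq_grade2 F0 H H0e H0W H0f)[x ->]].
    exact: (psi_grade H H0e H0W H0f).
  by exists x.
- exists (levi_conj B e f W) => S; split.
  + exact: (levi_conj_image iota F0 K0 H Ban H0e H0W H0f).
  + move=> [g a] [g' a'] [/= gS a0] [/= gS' a0'] E.
    by have [-> ->] : g = g' /\ a = a' by apply: (levi_conj_inj H Ban gS a0 gS' a0' E).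
  + by move=> g a g' a' [gS a0] [gS' a0']; apply: (levi_conjM H).
  + by move=> g a x [gS a0]; apply: (levi_conj_psi H).
- exact: (oq_fundamental_invariant iota F0 K0 H Ban H0e H0W H0f).
(* Residue characteristic different from 2 means that |2| is not below 1; integers have absolute
   value at most 1. *)
have v2 : absF 2%:R = 1.
  apply/eqP; rewrite eq_le (nonarch_nat HabsF) leNgt; apply/negP => lt1.
  by move/negP: Hres; apply; rewrite inE /= lt1.
have vcomplete := complete_finite_extension HQp HabsF HabsFp.
have [pi [pi0 pi1 pimax]] := uniformizer_exists HQp HabsF HabsFp.
have [J [cls clsP]] := residue_classes HQp HabsF HabsFp.
have d0 : - \det BQ != 0 by rewrite oppr_eq0 (det_anisotropic BQsym Ban).
have [d1 [d2 [d3 [[d10 d20 d30] [dN1 dN2 dN3] [n12 n13 n23] cover]]]] :=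
  square_classes_except HabsF vcomplete v2 clsP pi0 pi1 pimax d0.
have value d : d != 0 -> ~ sq_equiv d (- \det BQ) -> exists x, qform BQ x = d.
  exact: (ternary_value HabsF vcomplete v2 clsP pi0 pi1 pimax BQsym Ban).
have values : [/\ exists x, qform BQ x = d1, exists x, qform BQ x = d2 & exists x, qform BQ x = d3].
  by split; apply: value.
have dcover x : x != 0 -> [\/ sq_equiv (qform BQ x) d1, sq_equiv (qform BQ x) d2 | sq_equiv (qform BQ x) d3].
  move=> x0; apply: cover; first exact: Ban.
  exact: (represented_value BQsym Ban).
exists (sqclass d1), (sqclass d2), (sqclass d3) => O; split.
- by split=> /eq_sqclass.
- have ne (d d' : F) : ~ sq_equiv d d' -> sqclass d <> sqclass d' by move=> dd /eq_sqclass.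
  rewrite predeqE => u; split.
    by case=> [[->|->]|->]; split; [exists d1 | apply: ne | exists d2 | apply: ne | exists d3 | apply: ne].
  move=> [[d /= dn0 <-] dN].
  have [|E|E|E] := cover d dn0; last 3 first.
  + by left; left; apply/eq_sqclass.
  + by left; right; apply/eq_sqclass.
  + by right; apply/eq_sqclass.
  by move=> /eq_sqclass E; apply: dN.
- exact: (oq_orbits iota F0 K0 H Ban H0e H0W H0f (And3 d10 d20 d30) values dcover).
- exact: (card_oq_orbits iota F0 K0 H Ban H0e H0W H0f (And3 d10 d20 d30) (And3 n12 n13 n23) values dcover).
by split; apply: (open_qform_class HabsF vcomplete v2).
Qed.
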